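(* Assume $V,W$ satisfy assumptions (H) of the context, that $\nabla W$ is (globally) Lipschitz, and that $u_0$ satisfies a logarithmic Sobolev inequality with constant $c_0$. Then there exists a constant $\mathrm C_{\rm init}>0$, depending only on $V,W,d$ and the initial laws, independent of $t$ and $N$, such that for all $t\ge0$ and $N\ge1$, $$\frac{\mathbf{Ent}(u_t^{(N)},u_t^{\otimes N})}{N}\le\frac{\mathrm C_{\rm init}}{N}\left(e^{-\gamma t}\,\mathbf{Ent}(u_0^{(N)},u_0^{\otimes N})+1\right).$$
   Context: Let $V,W:\mathbb R^d\to\mathbb R$ be smooth potentials and $(B^i)_{i\ge1}$ independent Brownian motions on $\mathbb R^d$. Particle system: for each $N\ge1$, $(X^{1,N},\dots,X^{N,N})$ solves $$dX_t^{i,N}=\sqrt2\,dB_t^i-\nabla V(X_t^{i,N})\,dt-\frac1N\sum_{j=1}^N\nabla W(X_t^{i,N}-X_t^{j,N})\,dt,\quad 1\le i\le N,$$ with initial law $u_0^{(N)}$ on $\mathbb R^{dN}$ (not assumed exchangeable or product); $u_t^{(N)}$ denotes the law on $\mathbb R^{dN}$ of the solution at time $t$. Limit equation: $u_t$ is the law at time $t$ of the solution of the McKean-Vlasov equation $$d\bar X_t=\sqrt2\,dB_t-\nabla V(\bar X_t)\,dt-\nabla W\ast u_t(\bar X_t)\,dt,\qquad \mathcal L(\bar X_t)=u_t,$$ with initial law $u_0$ on $\mathbb R^d$. Assumptions (H): - $\nabla W$ is odd: $\nabla W(-x)=-\nabla W(x)$; - $(\nabla W(x)-\nabla W(y))\cdot(x-y)\ge\lambda_W|x-y|^2$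 for all $x,y$, with $\lambda_W\in\mathbb R$; - $(\nabla V(x)-\nabla V(y))\cdot(x-y)\ge\lambda_V|x-y|^2$ for all $x,y$, with $\lambda_V>0$; - $\lambda_V+2\lambda_W>0$; - $|\nabla W(x)-\nabla W(y)|\le M(|x-y|\wedge1)(1+|x|^m+|y|^m)$ for all $x,y$, with $m\in\mathbb N$, $M>0$; - $\nabla V$ is locally Lipschitz with polynomial growth. Relative entropy: $\mathbf{Ent}(\mu,\nu)=\int\frac{d\mu}{d\nu}\ln\frac{d\mu}{d\nu}\,d\nu$ if $\mu\ll\nu$, $+\infty$ otherwise. A probability measure $\mu$ satisfies a logarithmic Sobolev inequality with constant $c$ if for all suitable (smooth) positive $f$, $\int f\ln f\,d\mu-\int f\,d\mu\,\ln\int f\,d\mu\le c\int\frac{|\nabla f|^2}{f}\,d\mu$. Constants: $\beta=\lambda_V$ if $\lambda_W\ge0$, $\beta=\lambda_V+2\lambda_W$ otherwise; $\mathrm C_{\rm LSI}=\max\left(c_0,\frac{2}{\lambda_V+\lambda_W}\right)$; $\gamma=\min\left(2\beta,\frac1{2\mathrm C_{\rm LSI}}\right)$. *)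

(* Defs.v *)
From HB Require Import structures.
From mathcomp Require Export all_boot all_order all_algebra.
From mathcomp Require Export all_classical all_reals all_analysis.
Set Implicit Arguments.
Unset Strict Implicit.
Unset Printing Implicit Defensive.
Export Order.TTheory GRing.Theory Num.Theory.
Export numFieldNormedType.Exports.
Local Open Scope classical_set_scope.
Local Open Scope ring_scope.

Section rV_borel.
Variables (R : realType) (d : nat).

Let G : set (set 'rV[R]_d) := <<s open >>.

Let G0 : G set0. Proof. exact: sigma_algebra0. Qed.

Let GC A : G A -> G (~` A). Proof. exact: sigma_algebraC. Qed.

Let GU (F : (set 'rV[R]_d)^nat) : (forall i, G (F i)) -> G (\bigcup_i F i).
Proof. exact: sigma_algebra_bigcup. Qed.

Definition rV_borel_display : measure_display.
Proof. exact: default_measure_display. Qed.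

HB.instance Definition _ :=
  @isMeasurable.Build rV_borel_display 'rV[R]_d G G0 GC GU.

End rV_borel.

Section euclidean.
Variables (R : realType) (d : nat).
Implicit Types (x y : 'rV[R]_d) (f : 'rV[R]_d -> R).

Definition dotv x y : R := \sum_i x 0 i * y 0 i.

(* The library norm on ['rV_d] is the sup norm. *)
Definition enorm x : R := Num.sqrt (dotv x x).

Definition basis_vec (i : 'I_d) : 'rV[R]_d := delta_mx 0 i.

Definition grad f x : 'rV[R]_d := \row_i 'D_(basis_vec i) f x.

Fixpoint class_C (k : nat) f : Prop :=
  continuous f /\
  (if k is k'.+1 then
     forall i : 'I_d, (forall x, derivable f x (basis_vec i)) /\
                      class_C k' (fun x => 'D_(basis_vec i) f x)
   else True).

Definition smooth f : Prop := forall k, class_C k f.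

End euclidean.

Section product_power.
Context {dT : measure_display} {T : measurableType dT} {R : realType}.
Local Open Scope ereal_scope.

Definition tuple_cons n (p : T * n.-tuple T) : n.+1.-tuple T :=
  [the n.+1.-tuple T of p.1 :: p.2].

Lemma measurable_tuple_cons n : measurable_fun setT (@tuple_cons n).
Proof. exact: measurable_cons. Qed.

HB.instance Definition _ n :=
  isMeasurableFun.Build _ _ _ _ (@tuple_cons n) (@measurable_tuple_cons n).

Fixpoint prod_power (mu : probability T R) (N : nat)
    : probability (N.-tuple T) R :=
  match N with
  | 0%N => \d_([tuple] : 0.-tuple T)
  | n.+1 => distribution (mu \x prod_power mu n) (@tuple_cons n)
  end.

(* The density is finite everywhere when [mu `<< nu], hence the use of [fine].
   Since [ln 0 = 0] in the library, [f * ln f] vanishes where [f] does. *)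
Definition rel_entropy (mu nu : probability T R) : \bar R :=
  let f x := fine (Radon_Nikodym (charge_of_finite_measure mu) nu x) in
  if `[< mu `<< nu >] then \int[nu]_x (f x * ln (f x))%:E else +oo.

End product_power.

(* [f] and [f ln f] are required integrable, so that the left-hand side makes
   sense as a real number; the right-hand side may be [+oo]. *)
Definition log_sobolev (R : realType) (d : nat)
    (mu : probability 'rV[R]_d R) (c : R) : Prop :=
  forall f : 'rV[R]_d -> R, smooth f -> (forall x, 0 < f x) ->
    mu.-integrable setT (EFin \o f) ->
    mu.-integrable setT (fun x => (f x * ln (f x))%:E) ->
    ((\int[mu]_x (f x * ln (f x))
        - (\int[mu]_x f x) * ln (\int[mu]_x f x))%:E
      <= c%:E * \int[mu]_x ((enorm (grad f x)) ^+ 2 / f x)%:E)%E.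

Section processes.
Context {dO : measure_display} {Omega : measurableType dO} {R : realType}.
Variable P : probability Omega R.

Definition has_law {dT} {T : measurableType dT}
    (X : Omega -> T) (mu : probability T R) : Prop :=
  measurable_fun setT X /\
  forall A, measurable A -> P (X @^-1` A) = mu A.

Definition sigma_var {dT} {T : measurableType dT} (X : Omega -> T)
    : set (set Omega) := preimage_set_system setT X measurable.

Definition sigma_process {dT} {T : measurableType dT} (D : set R)
    (X : R -> Omega -> T) : set (set Omega) :=
  <<s \bigcup_(t in D) sigma_var (X t) >>.

Definition independent2 (G H : set (set Omega)) : Prop :=
  forall A B, G A -> H B -> P (A `&` B) = (P A * P B)%E.

(* For sigma-algebras this is mutual independence: choosing some of the [A i]
   equal to [setT] gives the product rule for all subfamilies. *)
Definition independent_family (I : finType) (G : I -> set (set Omega)) : Prop :=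
  forall A : I -> set Omega, (forall i, G i (A i)) ->
    P (\bigcap_i A i) = (\prod_i P (A i))%E.

(* Values at negative times are irrelevant. *)
Record brownian1 (b : R -> Omega -> R) : Prop := {
  brownian1_measurable : forall t, 0 <= t -> measurable_fun setT (b t) ;
  brownian1_start : {ae P, forall w, b 0 w = 0} ;
  brownian1_gauss : forall s t, 0 <= s -> s < t ->
    forall A, measurable A ->
      P ((fun w => b t w - b s w) @^-1` A) = normal_prob 0 (Num.sqrt (t - s)) A ;
  brownian1_indep : forall s t, 0 <= s -> s < t ->
    independent2 (sigma_process `[0, s] b)
                 (sigma_var (fun w => b t w - b s w)) ;
  brownian1_continuous :
    {ae P, forall w, {within `[0, +oo[, continuous (fun t => b t w)}} }.

Definition brownian (d : nat) (B : R -> Omega -> 'rV[R]_d) : Prop :=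
  (forall i, brownian1 (fun t w => B t w 0 i)) /\
  independent_family
    (fun i : 'I_d => sigma_process `[0, +oo[ (fun t w => B t w 0 i)).

(* dX_t = sqrt 2 dB_t + b_t dt: the noise being additive, the integrated equation
   is pathwise and involves no stochastic integral. *)
Record additive_sde (d : nat) (B : R -> Omega -> 'rV[R]_d)
    (b X : R -> Omega -> 'rV[R]_d) : Prop := {
  sde_measurable : forall t, 0 <= t -> measurable_fun setT (X t) ;
  sde_continuous :
    {ae P, forall w, {within `[0, +oo[, continuous (fun t => X t w)}} ;
  sde_integrable : {ae P, forall w, forall t (i : 'I_d), 0 <= t ->
    lebesgue_measure.-integrable `[0, t] (fun s => (b s w 0 i)%:E)} ;
  sde_equation : {ae P, forall w, forall t, 0 <= t ->
    X t w = X 0 w + Num.sqrt 2 *: B t w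
            + \row_i \int[lebesgue_measure]_(s in `[0, t]) b s w 0 i} }.

Section particles.
Variables (d N : nat) (V W : 'rV[R]_d -> R).

Definition configuration (X : 'I_N -> R -> Omega -> 'rV[R]_d)
    (t : R) (w : Omega) : N.-tuple 'rV[R]_d := [tuple X i t w | i < N].

Definition particle_drift (X : 'I_N -> R -> Omega -> 'rV[R]_d)
    (i : 'I_N) (t : R) (w : Omega) : 'rV[R]_d :=
  - grad V (X i t w)
  - N%:R^-1 *: \sum_(j < N) grad W (X i t w - X j t w).

(* The B^i are independent Brownian motions, jointly independent of the initial
   configuration (index [None]). *)
Record particle_system (B X : 'I_N -> R -> Omega -> 'rV[R]_d) : Prop := {
  particle_brownian : forall i, brownian (B i) ;
  particle_indep : independent_family (fun o : option 'I_N =>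
    if o is Some i then sigma_process `[0, +oo[ (B i)
    else sigma_var (configuration X 0)) ;
  particle_sde : forall i, additive_sde (B i) (particle_drift X i) (X i) }.

End particles.

Section mckean_vlasov.
Variables (d : nat) (V W : 'rV[R]_d -> R) (u : R -> probability 'rV[R]_d R).

Definition conv_grad (mu : probability 'rV[R]_d R) (x : 'rV[R]_d) : 'rV[R]_d :=
  \row_i \int[mu]_y grad W (x - y) 0 i.

Definition mv_drift (X : R -> Omega -> 'rV[R]_d) (t : R) (w : Omega)
    : 'rV[R]_d :=
  - grad V (X t w) - conv_grad (u t) (X t w).

Record mckean_vlasov (B X : R -> Omega -> 'rV[R]_d) : Prop := {
  mv_brownian : brownian B ;
  mv_indep : independent2 (sigma_var (X 0)) (sigma_process `[0, +oo[ B) ;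
  mv_integrable : forall t x (i : 'I_d), 0 <= t ->
    (u t).-integrable setT (fun y => (grad W (x - y) 0 i)%:E) ;
  mv_sde : additive_sde B (mv_drift X) X ;
  mv_law : forall t, 0 <= t -> has_law (X t) (u t) }.

End mckean_vlasov.

End processes.

(* Only laws are exposed: the probability space, the Brownian motions and the
   processes are existentially quantified. *)
Definition particle_flow (R : realType) (d N : nat) (V W : 'rV[R]_d -> R)
    (uN0 : probability (N.-tuple 'rV[R]_d) R)
    (uN : R -> probability (N.-tuple 'rV[R]_d) R) : Prop :=
  exists (dO : measure_display) (Omega : measurableType dO)
    (P : probability Omega R) (B X : 'I_N -> R -> Omega -> 'rV[R]_d),
    [/\ particle_system P V W B X,
        has_law P (configuration X 0) uN0 &
        forall t, 0 <= t -> has_law P (configuration X t) (uN t)].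

Definition mckean_vlasov_flow (R : realType) (d : nat) (V W : 'rV[R]_d -> R)
    (u0 : probability 'rV[R]_d R) (u : R -> probability 'rV[R]_d R) : Prop :=
  exists (dO : measure_display) (Omega : measurableType dO)
    (P : probability Omega R) (B X : R -> Omega -> 'rV[R]_d),
    mckean_vlasov P V W u B X /\ has_law P (X 0) u0.

Record potential_assumptions (R : realType) (d : nat) (V W : 'rV[R]_d -> R)
    (lamV lamW M : R) (m : nat) : Prop := {
  V_smooth : smooth V ;
  W_smooth : smooth W ;
  gradW_odd : forall x, grad W (- x) = - grad W x ;
  gradW_monotone : forall x y,
    lamW * enorm (x - y) ^+ 2 <= dotv (grad W x - grad W y) (x - y) ;
  lamV_gt0 : 0 < lamV ;
  gradV_monotone : forall x y,
    lamV * enorm (x - y) ^+ 2 <= dotv (grad V x - grad V y) (x - y) ;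
  lamVW_gt0 : 0 < lamV + 2 * lamW ;
  M_gt0 : 0 < M ;
  gradW_growth : forall x y,
    enorm (grad W x - grad W y) <=
      M * Num.min (enorm (x - y)) 1 * (1 + enorm x ^+ m + enorm y ^+ m) ;
  gradV_locally_lipschitz : forall x : 'rV[R]_d,
    exists2 U : set 'rV[R]_d, nbhs x U & [lipschitz (grad V z) | z in U] ;
  gradV_polynomial_growth : exists (K : R) (p : nat),
    forall x : 'rV[R]_d, enorm (grad V x) <= K * (1 + enorm x ^+ p) }.

Definition beta (R : realType) (lamV lamW : R) : R :=
  if 0 <= lamW then lamV else lamV + 2 * lamW.

Definition C_LSI (R : realType) (c0 lamV lamW : R) : R :=
  Num.max c0 (2 / (lamV + lamW)).

Definition gamma (R : realType) (c0 lamV lamW : R) : R :=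
  Num.min (2 * beta lamV lamW) (1 / (2 * C_LSI c0 lamV lamW)).

(* Main.v *)
(* Relative entropy is dual to exponential integrals, so it suffices to bound
   [int f du_t^N] by [ln (int e^f d(u_t)^(tensor N)) + C] for bounded, uniformly
   continuous test functions f. Both flows are replaced by implicit Euler schemes
   driven by the same Gaussian increments, whose step goes to 0 with t and N fixed.
   Let U be the particle semigroup applied to f and Ubar the nonlinear one applied
   to e^f. Coupling the two chains synchronously up to the last unit of time and
   then by a shift of the noise that makes them meet (Girsanov) gives the Harnack
   inequality U(x) <= ln Ubar(y) + C e^(-2 kap t) |x - y|^2 + S(y), with
   kap = lamV + min(lamW, 0). Here S(y) accumulates the fluctuations of the empirical
   interaction along the nonlinear chain; by independence and oddness of grad W its
   mean is bounded uniformly in t and N. The logarithmic Sobolev inequality of u_0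
   implies Talagrand's inequality, in a dual form that tensorizes, and the latter
   converts the quadratic cost into relative entropy at time 0. *)
From mathcomp Require Import fingroup perm.
Require Import Defs.
From mathcomp Require Import measurable_realfun ring lra.
Set Implicit Arguments.
Unset Strict Implicit.
Unset Printing Implicit Defensive.
Local Open Scope classical_set_scope.
Local Open Scope ring_scope.

(** * Bounded measurable functions, product laws and Euclidean geometry *)

Section pi_generation.
Context {R : realType}.

(** Discretising turns stochastic analysis into finite-dimensional Gaussian integrals: the change of
    measure is a translation of a Gaussian vector, and the laws at positive times enter only through
    integrals of test functions, which pass to the limit. The scheme is implicit in [V] because
    [grad V] is only locally Lipschitz: an explicit step need not contract, whereas the resolvent
    does so for every step size, by monotonicity. The Lipschitz interaction is explicit. The limit
    chain uses the exact fields [conv_grad W (u s)], so it is linear in its law and keeps product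
    laws; the price is a bias between these fields and those generated by the chain itself, which
    vanishes with the step at fixed [N]. Two obstacles shape the Harnack inequality. Comparing
    particles with independent nonlinear copies loses part of the rate to the fluctuations, so an
    intermediate particle system carries the initial distance at the full rate [2 * kap], which is
    at least [gamma]. And the shifted noise destroys the product law under which fluctuations can be
    averaged, so they are evaluated along a further, unshifted copy. *)

Definition pi_generates d (T : measurableType d) (G : set (set T)) :=
  [/\ setI_closed G, G setT & @measurable d T = <<s G >>].

Lemma pi_generates_measurable d (T : measurableType d) :
  pi_generates (@measurable d T).
Proof.
split; [exact: measurableI|exact: measurableT|].
by rewrite sigma_algebra_id//; exact: sigma_algebra_measurable.
Qed.

Lemma pi_generates_sub d (T : measurableType d) (G : set (set T)) A :
  pi_generates G -> G A -> measurable A.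
Proof. by case=> _ _ -> GA; exact: sub_sigma_algebra. Qed.

Lemma probability_unique d (T : measurableType d) (G : set (set T))
    (m1 m2 : probability T R) : pi_generates G ->
  (forall A, G A -> m1 A = m2 A) -> forall A, measurable A -> m1 A = m2 A.
Proof.
move=> pG m12 A mA; have [GI GT GE] := pG.
apply: (measure_unique G (fun=> setT)) => //.
- by rewrite bigcup_const//; exists 0%N.
- by move=> n; rewrite /= probability_setT ltry.
Qed.

Lemma pi_generates_prod d1 d2 (T1 : measurableType d1) (T2 : measurableType d2)
    (G1 : set (set T1)) (G2 : set (set T2)) :
  pi_generates G1 -> pi_generates G2 ->
  pi_generates [set A `*` B | A in G1 & B in G2].
Proof.
move=> p1 p2; have [I1 t1 E1] := p1; have [I2 t2 E2] := p2; split.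
- move=> _ _ [A GA [B GB <-]] [A' GA' [B' GB' <-]].
  by exists (A `&` A'); [exact: I1|exists (B `&` B'); [exact: I2|rewrite setXI]].
- by exists setT => //; exists setT => //; rewrite setXTT.
- set H := [set _ | _ in _ & _ in _].
  apply/seteqP; split; last first.
    apply: smallest_sub; first exact: sigma_algebra_measurable.
    move=> _ [A GA [B GB <-]]; apply: measurableX.
      exact: pi_generates_sub p1 GA.
    exact: pi_generates_sub p2 GB.
  rewrite measurable_prod_measurableType; apply: smallest_sub.
    exact: smallest_sigma_algebra.
  move=> _ [A mA [B mB <-]].
  have -> : A `*` B = (fst @^-1` A `&` snd @^-1` B : set (T1 * T2)).
    by apply/seteqP; split.
  (* The product is re-equipped with the sigma-algebra generated by the rectangles. Both projections
     are measurable for it, so it contains the product sigma-algebra. *)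
  have m1 : measurable_fun setT (fst : g_sigma_algebraType H -> T1).
    apply: (@measurability _ _ _ _ _ _ G1) => // _ [C GC <-].
    rewrite setTI; apply: sub_sigma_algebra; exists C => //; exists setT => //.
    by apply/seteqP; split => // -[? ?] /= [].
  have m2 : measurable_fun setT (snd : g_sigma_algebraType H -> T2).
    apply: (@measurability _ _ _ _ _ _ G2) => // _ [C GC <-].
    rewrite setTI; apply: sub_sigma_algebra; exists setT => //; exists C => //.
    by apply/seteqP; split => // -[? ?] /= [].
  have := @measurableI _ (g_sigma_algebraType H) (fst @^-1` A) (snd @^-1` B).
  by apply; rewrite -[X in measurable X]setTI; [exact: m1|exact: m2].
Qed.

Definition box T n (A : 'I_n -> set T) : set (n.-tuple T) :=
  [set x | forall i, A i (tnth x i)].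

Definition boxes T n (G : set (set T)) : set (set (n.-tuple T)) :=
  [set B | exists2 A, (forall i, G (A i)) & B = box A].

Lemma measurable_box d (T : measurableType d) n (A : 'I_n -> set T) :
  (forall i, measurable (A i)) -> measurable (box A).
Proof.
move=> mA; have -> : box A = \bigcap_(i in [set: 'I_n]) ((@tnth n T)^~ i @^-1` A i).
  by apply/seteqP; split => [x /= H i _|x /= H i]; [exact: H|exact: (H i I)].
apply: fin_bigcap_measurable => // i _.
by have := measurable_tnth i measurableT (mA i); rewrite setTI.
Qed.

Lemma pi_generates_tuple d (T : measurableType d) n (G : set (set T)) :
  pi_generates G -> pi_generates (@boxes T n G).
Proof.
move=> p; have [I t E] := p; split.
- move=> _ _ [A GA ->] [B GB ->]; exists (fun i => A i `&` B i).
    by move=> i; apply: I.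
  apply/seteqP; split => x /=; first by case=> a b i; split; [exact: a|exact: b].
  by move=> H; split => i; case: (H i).
- by exists (fun=> setT) => //; apply/seteqP; split.
- apply/seteqP; split; last first.
    apply: smallest_sub; first exact: sigma_algebra_measurable.
    by move=> _ [A GA ->]; apply: measurable_box => i; exact: pi_generates_sub p _.
  apply: smallest_sub; first exact: smallest_sigma_algebra.
  rewrite -bigcup_seq => _ [i _ [B mB <-]]; rewrite setTI.
  pose H := @boxes T n G.
  have mi : measurable_fun setT (fun x : g_sigma_algebraType H => tnth x i).
    apply: (@measurability _ _ _ _ _ _ G) => // _ [C GC <-].
    rewrite setTI; apply: sub_sigma_algebra.
    exists (fun j => if j == i then C else setT).
      by move=> j; case: ifP.
    apply/seteqP; split => x /=; first by move=> Cx j; case: eqP => // ->.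
    by move=> /(_ i); rewrite eqxx.
  by have := mi measurableT _ mB; rewrite setTI.
Qed.

End pi_generation.

Section bounded_measurable.
Context {R : realType} {d : measure_display} {T : measurableType d}.
Implicit Types (f g : T -> R) (mu : probability T R).

(** Against a probability measure such functions are integrable, so the real-valued integral is
    linear and monotone on them without side conditions. All test functions and value functions
    below are kept in this class. *)
Definition bmf f := measurable_fun setT f /\ exists B, forall x, `|f x| <= B.

Lemma bmf_meas f : bmf f -> measurable_fun setT f. Proof. by case. Qed.

Lemma bmf_bound f : bmf f -> exists2 B, 0 < B & forall x, `|f x| <= B.
Proof.
move=> [_ [B fB]]; exists (`|B| + 1).
  by rewrite ltr_pwDr.
by move=> x; rewrite (le_trans (fB x))// (le_trans (ler_norm _))// lerDl.
Qed.

Lemma bmf_integrable f mu : bmf f -> mu.-integrable setT (EFin \o f).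
Proof.
move=> [mf [B fB]]; apply: measurable_bounded_integrable => //.
  by rewrite (le_lt_trans (probability_le1 _ _))// ltry.
exists B; split; first exact: num_real.
by move=> M BM x _ /=; rewrite (le_trans (fB x))// ltW.
Qed.

Lemma bmf_cst c : bmf (fun=> c).
Proof. by split; [exact: measurable_cst|exists `|c|]. Qed.

Lemma bmfD f g : bmf f -> bmf g -> bmf (fun x => f x + g x).
Proof.
move=> [mf [B fB]] [mg [C gC]]; split; first exact: measurable_funD.
by exists (B + C) => x; rewrite (le_trans (ler_normD _ _))// lerD.
Qed.

Lemma bmfM f g : bmf f -> bmf g -> bmf (fun x => f x * g x).
Proof.
move=> [mf [B fB]] [mg [C gC]]; split; first exact: measurable_funM.
by exists (B * C) => x; rewrite normrM ler_pM.
Qed.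

Lemma bmfZ c f : bmf f -> bmf (fun x => c * f x).
Proof. by move=> bf; apply: bmfM => //; exact: bmf_cst. Qed.

Lemma bmfN f : bmf f -> bmf (fun x => - f x).
Proof.
move=> [mf [B fB]]; split; first exact: measurableT_comp.
by exists B => x; rewrite normrN.
Qed.

Lemma bmfB f g : bmf f -> bmf g -> bmf (fun x => f x - g x).
Proof. by move=> bf bg; apply: bmfD => //; exact: bmfN. Qed.

Lemma bmf_expR f : bmf f -> bmf (fun x => expR (f x)).
Proof.
move=> [mf [B fB]]; split; first exact: measurableT_comp.
exists (expR B) => x; rewrite ger0_norm ?expR_ge0// ler_expR.
by rewrite (le_trans (ler_norm _)).
Qed.

Lemma bmf_ln f a : 0 < a -> (forall x, a <= f x) -> bmf f ->
  bmf (fun x => ln (f x)).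
Proof.
move=> a0 af bf; have [B B0 fB] := bmf_bound bf; split.
  by apply: measurableT_comp; [exact: measurable_ln|exact: bmf_meas].
exists (`|ln a| + `|ln B|) => x.
have fx0 : 0 < f x by rewrite (lt_le_trans a0).
have h1 : ln a <= ln (f x) by rewrite ler_ln.
have h2 : ln (f x) <= ln B by rewrite ler_ln// (le_trans (ler_norm _)).
rewrite ler_norml; apply/andP; split.
  by have := ler_norm (- ln a); rewrite normrN; have := normr_ge0 (ln B); lra.
have := ler_norm (ln B); have := normr_ge0 (ln a); lra.
Qed.

Lemma bmf_min f g : bmf f -> bmf g -> bmf (fun x => Num.min (f x) (g x)).
Proof.
move=> [mf [B fB]] [mg [C gC]]; split; first exact: measurable_minr.
exists (Num.max B C) => x; rewrite le_max; case: (leP (f x) (g x)) => _.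
  by rewrite fB.
by rewrite gC orbT.
Qed.

Lemma bmf_minc f a : measurable_fun setT f -> (forall x, 0 <= f x) -> 0 <= a ->
  bmf (fun x => Num.min a (f x)).
Proof.
move=> mf f0 a0; split; first exact: measurable_minr.
by exists a => x; rewrite ger0_norm ?ge_min ?lexx// le_min a0 f0.
Qed.

Lemma bmf_ind A : measurable A -> bmf (\1_A).
Proof.
move=> mA; split; first exact: measurable_indic.
by exists 1 => x; rewrite indicE ger0_norm// lern1 leq_b1.
Qed.

Lemma Rint_le f g mu : bmf f -> bmf g -> (forall x, f x <= g x) ->
  \int[mu]_x f x <= \int[mu]_x g x.
Proof. by move=> bf bg fg; apply: le_Rintegral => //; exact: bmf_integrable. Qed.

Lemma RintD f g mu : bmf f -> bmf g ->
  \int[mu]_x (f x + g x) = \int[mu]_x f x + \int[mu]_x g x.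
Proof. by move=> bf bg; apply: RintegralD => //; exact: bmf_integrable. Qed.

Lemma RintB f g mu : bmf f -> bmf g ->
  \int[mu]_x (f x - g x) = \int[mu]_x f x - \int[mu]_x g x.
Proof. by move=> bf bg; apply: RintegralB => //; exact: bmf_integrable. Qed.

Lemma RintZ c f mu : bmf f -> \int[mu]_x (c * f x) = c * \int[mu]_x f x.
Proof. by move=> bf; apply: RintegralZl => //; exact: bmf_integrable. Qed.

Lemma Rint_cst c mu : \int[mu]_x c = c.
Proof.
have E := @probability_setT _ _ _ mu.
by rewrite Rintegral_cst//;  rewrite [X in fine X]E mulr1.
Qed.

Lemma EFin_Rint f mu : bmf f ->
  (\int[mu]_x f x)%:E = (\int[mu]_x (f x)%:E)%E.
Proof.
move=> bf; rewrite /Rintegral fineK//.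
exact: (integrable_fin_num measurableT (bmf_integrable mu bf)).
Qed.

Lemma Rint_bound f mu B : bmf f -> (forall x, `|f x| <= B) ->
  `|\int[mu]_x f x| <= B.
Proof.
move=> bf fB; rewrite ler_norml -[X in X <= _ <= _](Rint_cst _ mu).
rewrite -[X in _ <= _ <= X](Rint_cst _ mu); apply/andP.
by split; apply: Rint_le => // [|x]; try exact: bmf_cst;
  have := fB x; rewrite ler_norml => /andP[].
Qed.

Lemma Rint_expR_gt0 f mu : bmf f -> 0 < \int[mu]_x expR (f x).
Proof.
move=> bf; have [B B0 fB] := bmf_bound bf.
rewrite (lt_le_trans (expR_gt0 (- B)))//.
rewrite -[X in X <= _](Rint_cst _ mu); apply: Rint_le.
- exact: bmf_cst.
- exact: bmf_expR.
- by move=> x; rewrite ler_expR lerNl; have := fB x; rewrite ler_norml lerNl => /andP[].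
Qed.

(* Tangent line to the exponential at the mean. *)
Lemma expR_jensen f mu : bmf f ->
  expR (\int[mu]_x f x) <= \int[mu]_x expR (f x).
Proof.
move=> bf; set m := \int[mu]_x f x.
have -> : expR m = \int[mu]_x (expR m * (1 + (f x - m))).
  rewrite RintZ; last by apply: bmfD; [exact: bmf_cst|apply: bmfB => //; exact: bmf_cst].
  rewrite RintD; [|exact: bmf_cst|by apply: bmfB => //; exact: bmf_cst].
  by rewrite RintB ?Rint_cst//; [rewrite subrr addr0 mulr1|exact: bmf_cst].
apply: Rint_le.
- apply: bmfZ; apply: bmfD; [exact: bmf_cst|apply: bmfB => //; exact: bmf_cst].
- exact: bmf_expR.
- move=> x; have -> : f x = m + (f x - m) by lra.
  rewrite expRD addrAC subrr add0r ler_pM2l ?expR_gt0//.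
  exact: expR_ge1Dx.
Qed.

Lemma ln_jensen f mu : bmf f -> \int[mu]_x f x <= ln (\int[mu]_x expR (f x)).
Proof.
move=> bf; rewrite -[leLHS]expRK ler_ln ?posrE ?expR_gt0//; first exact: expR_jensen.
exact: Rint_expR_gt0.
Qed.

End bounded_measurable.

Section laws.
Context {R : realType}.

Lemma has_law_integral d (O : measurableType d) (P : probability O R)
    d' (T : measurableType d') (X : O -> T) (mu : probability T R)
    (f : T -> \bar R) : has_law P X mu ->
  measurable_fun setT f -> (forall x, (0 <= f x)%E) ->
  (\int[mu]_x f x = \int[P]_w f (X w))%E.
Proof.
move=> [mX PX] mf f0; pose Y := mfun_Sub (mem_set mX).
transitivity (\int[distribution P Y]_x f x)%E.
  by apply: eq_measure_integral => A mA _; first [exact: PX|exact/esym/PX].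
exact: ge0_integral_distribution.
Qed.

Lemma has_law_Rint d (O : measurableType d) (P : probability O R)
    d' (T : measurableType d') (X : O -> T) (mu : probability T R)
    (f : T -> R) : has_law P X mu -> bmf f ->
  \int[mu]_x f x = \int[P]_w f (X w).
Proof.
move=> [mX PX] bf; pose Y := mfun_Sub (mem_set mX).
have bfX : bmf (f \o Y).
  split; first by apply: measurableT_comp => //; exact: bmf_meas.
  by case: bf => _ [B fB]; exists B => w /=.
rewrite /Rintegral; congr fine.
transitivity (\int[distribution P Y]_x (f x)%:E)%E.
  by apply: eq_measure_integral => A mA _; first [exact: PX|exact/esym/PX].
apply: integral_distribution; last exact: (bmf_integrable P bfX).
exact/measurable_EFinP/bmf_meas.
Qed.

Lemma bmf_comp d (O : measurableType d) d' (T : measurableType d') (X : O -> T)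
    (f : T -> R) : bmf f -> measurable_fun setT X -> bmf (fun w => f (X w)).
Proof.
move=> [mf [B fB]] mX; split; first exact: measurableT_comp.
by exists B.
Qed.

Lemma has_law_comp d (O : measurableType d) (P : probability O R)
    d1 (T1 : measurableType d1) (X : O -> T1) (mu : probability T1 R)
    d2 (T2 : measurableType d2) (Y : T1 -> T2) (nu : probability T2 R) :
  has_law P X mu -> has_law mu Y nu -> has_law P (fun w => Y (X w)) nu.
Proof.
move=> [mX PX] [mY PY]; split; first exact: measurableT_comp.
move=> A mA; rewrite -PY// -PX// -[X in measurable X]setTI; exact: mY.
Qed.

Lemma has_law_pi d (O : measurableType d) (P : probability O R)
    d' (T : measurableType d') (X : O -> T) (mu : probability T R) G :
  measurable_fun setT X -> pi_generates G ->
  (forall A, G A -> P (X @^-1` A) = mu A) -> has_law P X mu.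
Proof.
move=> mX pG PX; split => // A mA; pose Y := mfun_Sub (mem_set mX).
exact: (probability_unique (m1 := distribution P Y) (m2 := mu) pG).
Qed.

Definition law d (O : measurableType d) (P : probability O R)
    d' (T : measurableType d') (X : O -> T) (mX : measurable_fun setT X) :
    probability T R := distribution P (mfun_Sub (mem_set mX)).

Lemma has_law_law d (O : measurableType d) (P : probability O R)
    d' (T : measurableType d') (X : O -> T) (mX : measurable_fun setT X) :
  has_law P X (law P mX).
Proof. by split. Qed.

End laws.

Lemma measurable_mktuple d1 (T1 : measurableType d1) d2 (T2 : measurableType d2)
    n (f : 'I_n -> T1 -> T2) : (forall i, measurable_fun setT (f i)) ->
  measurable_fun setT (fun w => [tuple f i w | i < n]).
Proof.
move=> mf; apply/measurable_fun_tnthP => i.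
rewrite (_ : _ \o _ = f i)//; apply/funext => w /=.
by rewrite tnth_mktuple.
Qed.

Section product_probability.
Context {R : realType} {d1 d2 : measure_display}.
Context {T1 : measurableType d1} {T2 : measurableType d2}.
Variables (mu : probability T1 R) (nu : probability T2 R).

Lemma prodE (A : set T1) (B : set T2) : measurable A -> measurable B ->
  (mu \x nu)%E (A `*` B) = (mu A * nu B)%E.
Proof. exact: product_measure1E. Qed.

Lemma bmf_int1 (F : T1 * T2 -> R) : bmf F -> bmf (fun x => \int[nu]_y F (x, y)).
Proof.
move=> bF; have bFx x : bmf (fun y => F (x, y)).
  by apply: bmf_comp bF _; exact: measurable_pair1.
split; last first.
  by have [B _ FB] := bmf_bound bF; exists B => x; exact: Rint_bound.
have := @measurable_fubini_F _ _ _ _ _ mu nu _ (bmf_integrable (mu \x nu)%E bF).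
move=> mF; apply/measurable_EFinP; apply: (eq_measurable_fun _ _ mF) => x _.
by rewrite /= EFin_Rint.
Qed.

Lemma bmf_int2 (F : T1 * T2 -> R) : bmf F -> bmf (fun y => \int[mu]_x F (x, y)).
Proof.
move=> bF; have bFx y : bmf (fun x => F (x, y)).
  by apply: bmf_comp bF _; exact: measurable_pair2.
split; last first.
  by have [B _ FB] := bmf_bound bF; exists B => x; exact: Rint_bound.
have := @measurable_fubini_G _ _ _ _ _ mu nu _ (bmf_integrable (mu \x nu)%E bF).
move=> mF; apply/measurable_EFinP; apply: (eq_measurable_fun _ _ mF) => x _.
by rewrite /= EFin_Rint.
Qed.

Lemma Rint_prod12 (F : T1 * T2 -> R) : bmf F ->
  \int[(mu \x nu)%E]_z F z = \int[mu]_x \int[nu]_y F (x, y).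
Proof.
move=> bF; have bFx x : bmf (fun y => F (x, y)).
  by apply: bmf_comp bF _; exact: measurable_pair1.
apply: EFin_inj; rewrite (EFin_Rint (mu \x nu)%E bF) (EFin_Rint mu (bmf_int1 bF)).
rewrite -[LHS](integral12_prod_meas1 (bmf_integrable (mu \x nu)%E bF)).
by apply: eq_integral => x _; rewrite EFin_Rint.
Qed.

Lemma Rint_prod21 (F : T1 * T2 -> R) : bmf F ->
  \int[(mu \x nu)%E]_z F z = \int[nu]_y \int[mu]_x F (x, y).
Proof.
move=> bF; have bFx y : bmf (fun x => F (x, y)).
  by apply: bmf_comp bF _; exact: measurable_pair2.
apply: EFin_inj; rewrite (EFin_Rint (mu \x nu)%E bF) (EFin_Rint nu (bmf_int2 bF)).
rewrite -[LHS](integral21_prod_meas1 (bmf_integrable (mu \x nu)%E bF)).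
by apply: eq_integral => x _; rewrite EFin_Rint.
Qed.

End product_probability.

Section prod_power_theory.
Context {R : realType} {d : measure_display} {T : measurableType d}.
Implicit Types (mu : probability T R).

Lemma has_law_cons mu n :
  has_law (mu \x prod_power mu n)%E (@tuple_cons d T n) (prod_power mu n.+1).
Proof. by split; [exact: measurable_tuple_cons|]. Qed.

Lemma tnth_consS n (x : T) (xs : n.-tuple T) (i : 'I_n) :
  tnth (tuple_cons (x, xs)) (lift ord0 i) = tnth xs i.
Proof. by rewrite /tuple_cons tnthS. Qed.

Lemma prod_power_box mu n (A : 'I_n -> set T) : (forall i, measurable (A i)) ->
  prod_power mu n (box A) = (\prod_i mu (A i))%E.
Proof.
elim: n A => [|n IH] A mA.
  by rewrite big_ord0 /= diracE mem_set// => -[].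
have [_ <-] := has_law_cons mu n; last exact: measurable_box.
have -> : @tuple_cons d T n @^-1` box A = A ord0 `*` box (fun i => A (lift ord0 i)).
  apply/seteqP; split => -[x xs] /=.
    by move=> H; split => [|i]; [exact: (H ord0)|rewrite -(tnth_consS x); exact: H].
  move=> [A0 AS] i; case: (unliftP ord0 i) => [j ->|->]; last exact: A0.
  by rewrite tnth_consS; exact: AS.
rewrite [LHS]prodE; [|exact: mA|by apply: measurable_box].
by rewrite big_ord_recl IH.
Qed.

Lemma has_law_prod_power d' (O : measurableType d') (P : probability O R) n
    (X : O -> n.-tuple T) mu G : pi_generates G -> measurable_fun setT X ->
  (forall A, (forall i, G (A i)) -> P (X @^-1` box A) = (\prod_i mu (A i))%E) ->
  has_law P X (prod_power mu n).
Proof.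
move=> pG mX PX; apply: (has_law_pi mX (pi_generates_tuple n pG)).
move=> _ [A GA ->]; rewrite PX// prod_power_box// => i.
exact: pi_generates_sub pG _.
Qed.

Lemma Rint_prod_powerS mu n (F : n.+1.-tuple T -> R) : bmf F ->
  \int[prod_power mu n.+1]_x F x =
  \int[mu]_x \int[prod_power mu n]_y F (tuple_cons (x, y)).
Proof.
move=> bF; rewrite (has_law_Rint (has_law_cons mu n) bF) Rint_prod12//.
apply: bmf_comp bF _; exact: measurable_tuple_cons.
Qed.

Lemma Rint_prod_powerSr mu n (F : n.+1.-tuple T -> R) : bmf F ->
  \int[prod_power mu n.+1]_x F x =
  \int[prod_power mu n]_y \int[mu]_x F (tuple_cons (x, y)).
Proof.
move=> bF; rewrite (has_law_Rint (has_law_cons mu n) bF) Rint_prod21//.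
apply: bmf_comp bF _; exact: measurable_tuple_cons.
Qed.

Lemma Rint_prod_power0 mu (F : 0.-tuple T -> R) :
  \int[prod_power mu 0]_x F x = F [tuple].
Proof.
have -> : F = (fun=> F [tuple]) by apply/funext => x; rewrite (tuple0 x).
by rewrite Rint_cst.
Qed.

Lemma bmf_cons1 n (F : n.+1.-tuple T -> R) (y : n.-tuple T) : bmf F ->
  bmf (fun x => F (tuple_cons (x, y))).
Proof.
move=> bF; apply: bmf_comp bF _.
apply: (measurableT_comp (@measurable_tuple_cons _ T n)); exact: measurable_pair2.
Qed.

Lemma bmf_cons_int mu n (F : n.+1.-tuple T -> R) : bmf F ->
  bmf (fun y => \int[mu]_x F (tuple_cons (x, y))).
Proof.
move=> bF; apply: (bmf_int2 (F := F \o @tuple_cons d T n) mu (prod_power mu n)).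
apply: bmf_comp bF _; exact: measurable_tuple_cons.
Qed.

Lemma integral_prod_powerS mu n (F : n.+1.-tuple T -> \bar R) :
  measurable_fun setT F -> (forall x, (0 <= F x)%E) ->
  (\int[prod_power mu n.+1]_x F x =
  \int[mu]_x \int[prod_power mu n]_y F (tuple_cons (x, y)))%E.
Proof.
move=> mF F0; rewrite (has_law_integral (has_law_cons mu n))//.
rewrite (fubini_tonelli1 (m1 := mu) (m2 := prod_power mu n))//.
apply: (measurableT_comp mF); exact: measurable_tuple_cons.
Qed.

(** Exchangeability of a product law. It reduces the fluctuation felt by an arbitrary particle to
    the one felt by particle [ord0]. *)
Lemma has_law_perm mu n (s : {perm 'I_n}) :
  has_law (prod_power mu n) (fun x => [tuple tnth x (s i) | i < n])
    (prod_power mu n).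
Proof.
have pm := pi_generates_measurable T.
apply: (has_law_prod_power pm).
  by apply: measurable_mktuple => i; exact: measurable_tnth.
move=> A mA; have -> : (fun x => [tuple tnth x (s i) | i < n]) @^-1` box A =
    box (fun i => A ((s^-1)%g i)).
  apply/seteqP; split => x /= H i.
    by have := H ((s^-1)%g i); rewrite tnth_mktuple permKV.
  by rewrite tnth_mktuple; have := H (s i); rewrite permK.
by rewrite prod_power_box// [RHS](reindex_inj (@perm_inj _ (s^-1)%g)).
Qed.

Lemma has_law_tnth mu n (i : 'I_n) :
  has_law (prod_power mu n) (fun x => tnth x i) mu.
Proof.
split; first exact: measurable_tnth.
move=> A mA; have -> : (fun x : n.-tuple T => tnth x i) @^-1` A =
    box (fun j => if j == i then A else setT).
  apply/seteqP; split => x /=; first by move=> Ax j; case: eqP => // ->.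
  by move=> /(_ i); rewrite eqxx.
rewrite prod_power_box => [|j]; last by case: ifP.
rewrite (bigD1 i)//= eqxx big1 ?mule1// => j /negbTE ->.
exact: probability_setT.
Qed.

End prod_power_theory.

Section prod_power_maps.
Context {R : realType} {d1 d2 : measure_display}.
Context {T1 : measurableType d1} {T2 : measurableType d2}.

Lemma measurable_map_tuple n (s : T1 -> T2) : measurable_fun setT s ->
  measurable_fun setT (fun x : n.-tuple T1 => [tuple s (tnth x i) | i < n]).
Proof.
move=> ms; apply: measurable_mktuple => i.
by apply: (measurableT_comp ms); exact: measurable_tnth.
Qed.

Lemma has_law_map (mu : probability T1 R) (nu : probability T2 R) n s :
  has_law mu s nu ->
  has_law (prod_power mu n) (fun x => [tuple s (tnth x i) | i < n])
    (prod_power nu n).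
Proof.
move=> [ms mus]; apply: (has_law_prod_power (pi_generates_measurable T2)).
  exact: measurable_map_tuple.
move=> A mA; have -> : (fun x => [tuple s (tnth x i) | i < n]) @^-1` box A =
    box (fun i => s @^-1` A i).
  apply/seteqP; split => x /= H i; first by have := H i; rewrite tnth_mktuple.
  by rewrite tnth_mktuple; exact: H.
rewrite prod_power_box => [|i]; first by apply: eq_bigr => i _; exact: mus.
by rewrite -[X in measurable X]setTI; exact: ms.
Qed.

(** Independent pairs (position, noise), one per particle, regroup into a configuration and an
    independent configuration of noises. This is why one nonlinear step maps a product law to a
    product law. *)
Lemma has_law_unzip (mu : probability T1 R) (nu : probability T2 R) n :
  has_law (prod_power (mu \x nu)%E n)
    (fun z => ([tuple (tnth z i).1 | i < n], [tuple (tnth z i).2 | i < n]))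
    (prod_power mu n \x prod_power nu n)%E.
Proof.
have p1 := pi_generates_tuple n (pi_generates_measurable T1).
have p2 := pi_generates_tuple n (pi_generates_measurable T2).
apply: (has_law_pi _ (pi_generates_prod p1 p2)).
  apply: measurable_fun_pair; apply: measurable_mktuple => i;
    by [apply: (measurableT_comp measurable_fst); exact: measurable_tnth
       |apply: (measurableT_comp measurable_snd); exact: measurable_tnth].
move=> _ [_ [A mA ->] [_ [B mB ->] <-]].
rewrite [RHS]prodE; [|exact: measurable_box..].
rewrite !prod_power_box//.
set E := _ @^-1` _; have -> : E = box (fun i => A i `*` B i).
  apply/seteqP; split => z /=; rewrite /E /=.
    by move=> [H1 H2] i; have := H1 i; have := H2 i; rewrite !tnth_mktuple; split.
  by move=> H; split=> i; rewrite tnth_mktuple; case: (H i).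
rewrite prod_power_box => [|i]; last exact: measurableX.
rewrite -[RHS]big_split /=; apply: eq_bigr => i _; exact: prodE.
Qed.

End prod_power_maps.

(** * Euclidean geometry of row vectors *)

Section dot_algebra.
Context {R : realType} {d : nat}.
Implicit Types x y z : 'rV[R]_d.

(** Coupling, Talagrand's inequality and Gaussian shifts all produce quadratic costs, so most
    estimates are carried out on squared norms. *)
Definition sq x : R := dotv x x.

Lemma sqE x : sq x = \sum_i x 0 i ^+ 2.
Proof. by apply: eq_bigr => i _; rewrite expr2. Qed.

Lemma sq_ge0 x : 0 <= sq x.
Proof. by rewrite sqE; apply: sumr_ge0 => i _; exact: sqr_ge0. Qed.

Lemma dotvC x y : dotv x y = dotv y x.
Proof. by apply: eq_bigr => i _; rewrite mulrC. Qed.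

Lemma dotvDl x y z : dotv (x + y) z = dotv x z + dotv y z.
Proof. by rewrite -big_split; apply: eq_bigr => i _ /=; rewrite mxE mulrDl. Qed.

Lemma dotvZl a x z : dotv (a *: x) z = a * dotv x z.
Proof. by rewrite mulr_sumr; apply: eq_bigr => i _ /=; rewrite mxE mulrA. Qed.

Lemma dotvNl x z : dotv (- x) z = - dotv x z.
Proof. by rewrite -scaleN1r dotvZl mulN1r. Qed.

Lemma dotvBl x y z : dotv (x - y) z = dotv x z - dotv y z.
Proof. by rewrite dotvDl dotvNl. Qed.

Lemma dotvDr x y z : dotv z (x + y) = dotv z x + dotv z y.
Proof. by rewrite dotvC dotvDl !(dotvC z). Qed.

Lemma dotvZr a x z : dotv z (a *: x) = a * dotv z x.
Proof. by rewrite dotvC dotvZl (dotvC z). Qed.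

Lemma dotvNr x z : dotv z (- x) = - dotv z x.
Proof. by rewrite dotvC dotvNl (dotvC z). Qed.

Lemma dotvBr x y z : dotv z (x - y) = dotv z x - dotv z y.
Proof. by rewrite dotvDr dotvNr. Qed.

Definition dotvE := (dotvDl, dotvDr, dotvBl, dotvBr, dotvZl, dotvZr, dotvNl, dotvNr).

Lemma sqN x : sq (- x) = sq x.
Proof. by rewrite /sq !dotvE opprK. Qed.

Lemma sqZ a x : sq (a *: x) = a ^+ 2 * sq x.
Proof. by rewrite /sq !dotvE mulrA expr2. Qed.

Lemma sqD x y : sq (x + y) = sq x + 2 * dotv x y + sq y.
Proof. by rewrite /sq !dotvE (dotvC y x); ring. Qed.

Lemma sqB x y : sq (x - y) = sq x - 2 * dotv x y + sq y.
Proof. by rewrite sqD sqN dotvNr; ring. Qed.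

Lemma sqBC x y : sq (x - y) = sq (y - x).
Proof. by rewrite -sqN opprB. Qed.

Lemma sq0 : sq 0 = 0.
Proof. by rewrite sqE big1// => i _; rewrite mxE expr0n. Qed.

Lemma dotv_young e x y : 0 < e -> 2 * dotv x y <= e * sq x + e^-1 * sq y.
Proof.
move=> e0; rewrite !sqE !mulr_sumr -big_split; apply: ler_sum => i _ /=.
have -> : e^-1 * y 0 i ^+ 2 = e * (e^-1 * y 0 i) ^+ 2 by field; rewrite gt_eqF.
have -> : 2 * (x 0 i * y 0 i) = 2 * e * (x 0 i * (e^-1 * y 0 i)).
  by field; rewrite gt_eqF.
have := sqr_ge0 (x 0 i - e^-1 * y 0 i).
move: (x 0 i) (e^-1 * y 0 i) => a b ab; nra.
Qed.

Lemma sqD_young e x y : 0 < e ->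
  sq (x + y) <= (1 + e) * sq x + (1 + e^-1) * sq y.
Proof. by move=> e0; rewrite sqD; have := dotv_young x y e0; lra. Qed.

Lemma sqD_le x y : sq (x + y) <= 2 * sq x + 2 * sq y.
Proof. by have := @sqD_young 1 x y ltr01; rewrite invr1; lra. Qed.

Lemma sqB_le x y : sq (x - y) <= 2 * sq x + 2 * sq y.
Proof. by rewrite -(sqN y) sqD_le. Qed.

Lemma sqD3_le x y z : sq (x + y + z) <= 3 * sq x + 3 * sq y + 3 * sq z.
Proof.
rewrite !sqD !dotvE.
have := sq_ge0 (x - y); have := sq_ge0 (x - z); have := sq_ge0 (y - z).
by rewrite !sqB; lra.
Qed.

Lemma sq_coord x i : x 0 i ^+ 2 <= sq x.
Proof.
by rewrite sqE (bigD1 i)//= lerDl; apply: sumr_ge0 => j _; exact: sqr_ge0.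
Qed.

Lemma sq_eq0 x : sq x = 0 -> x = 0.
Proof.
move=> x0; apply/rowP => i; rewrite mxE; apply/eqP.
by rewrite -sqrf_eq0 eq_le sqr_ge0 andbT -x0 sq_coord.
Qed.

Lemma dotv_sum (I : finType) (f : I -> 'rV[R]_d) z :
  dotv (\sum_i f i) z = \sum_i dotv (f i) z.
Proof.
rewrite (@big_morph _ _ (fun x => dotv x z) 0 +%R)//.
- by move=> x y; rewrite dotvDl.
- by rewrite -(scale0r z) dotvZl mul0r.
Qed.

(* Cauchy-Schwarz, in the form of the convexity of the square. *)
Lemma sq_sum_le (I : finType) (w : I -> R) (f : I -> 'rV[R]_d) :
  (forall i, 0 <= w i) -> \sum_i w i <= 1 ->
  sq (\sum_i w i *: f i) <= \sum_i w i * sq (f i).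
Proof.
move=> w0 w1; set m := \sum_i _.
have : 0 <= \sum_i w i * sq (f i - m).
  by apply: sumr_ge0 => i _; rewrite mulr_ge0// sq_ge0.
rewrite (eq_bigr (fun i => w i * sq (f i) - 2 * dotv (w i *: f i) m + w i * sq m)).
  rewrite big_split sumrB -mulr_suml -mulr_sumr -dotv_sum -/m /= -/(sq m).
  have := sq_ge0 m; nra.
by move=> i _; rewrite sqB !dotvE; ring.
Qed.

Lemma sq_enorm x : enorm x ^+ 2 = sq x.
Proof. by rewrite /enorm sqr_sqrtr// sq_ge0. Qed.

Lemma enorm_ge0 x : 0 <= enorm x. Proof. exact: sqrtr_ge0. Qed.

Lemma enorm_sqrt x : enorm x = Num.sqrt (sq x). Proof. by []. Qed.

Lemma sq_norm_le x : sq x <= d%:R * `|x| ^+ 2.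
Proof.
rewrite sqE -[d in d%:R]card_ord -sum1_card natr_sum mulr_suml.
apply: ler_sum => i _; rewrite mul1r -real_normK ?num_real//.
rewrite lerXn2r ?nnegrE//.
rewrite [leRHS]/Num.norm/= mx_normrE.
exact: (le_bigmax _ (fun ij : 'I_1 * 'I_d => `|x ij.1 ij.2|) (0, i)).
Qed.

Lemma norm_sq_le x : `|x| ^+ 2 <= sq x.
Proof.
have : `|x| <= Num.sqrt (sq x).
  rewrite /Num.norm/= mx_normrE; apply: bigmax_le => [|[i j] _ /=].
    exact: sqrtr_ge0.
  by rewrite (ord1 i) -sqrtr_sqr ler_wsqrtr// sq_coord.
move=> h; rewrite -(sqr_sqrtr (sq_ge0 x)) lerXn2r ?nnegrE//.
Qed.

End dot_algebra.

(** * Measurability of vector-valued maps *)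

Section borel_rV.
Context {R : realType} {d : nat}.

Lemma continuous_measurable_rV (f : 'rV[R]_d -> R) :
  continuous f -> measurable_fun setT f.
Proof.
move=> cf; apply: (measurability _ (RGenOpens.measurableE R)) => _ [_ [a [b ->]] <-].
rewrite setTI; apply: sub_sigma_algebra; exact: open_comp.
Qed.

Lemma measurable_coord (i : 'I_d) : measurable_fun setT (fun x : 'rV[R]_d => x 0 i).
Proof. apply: continuous_measurable_rV; exact: coord_continuous. Qed.

(** Cubes with rational centre and radius the inverse of a positive integer. They form a countable
    base of the topology, so that a vector map with measurable coordinates is Borel. *)
Let rbox (q : 'rV[rat]_d * nat) : set 'rV[R]_d :=
  [set x | forall i, `|x 0 i - ratr (q.1 0 i)| < q.2.+1%:R^-1].

Lemma open_rbox (U : set 'rV[R]_d) : open U ->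
  U = \bigcup_(q in [set q | rbox q `<=` U]) rbox q.
Proof.
move=> oU; apply/seteqP; split; last by move=> x [q qU qx]; exact: qU.
move=> x Ux; have : nbhs x U by exact: open_nbhs_nbhs.
move=> /nbhs_ballP [e /= e0 eU].
have [n ne] : exists n, n.+1%:R^-1 < e / 2.
  exists (Num.truncn (2 / e)).
  rewrite -[X in _ < X]invrK ltf_pV2 ?posrE ?invr_gt0 ?divr_gt0//.
  by rewrite invf_div; exact: truncnS_gt.
have n0 : 0 < n.+1%:R^-1 :> R by rewrite invr_gt0.
have qE i : exists q : rat, `|x 0 i - ratr q| < n.+1%:R^-1.
  move: n0; move: n.+1%:R^-1 => r r0.
  have : x 0 i - r < x 0 i + r by lra.
  move=> /rat_in_itvoo [q]; rewrite in_itv/= => /andP[q1 q2]; exists q.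
  by rewrite ltr_norml; apply/andP; split; lra.
pose q := (\row_i xget 0 [set q | `|x 0 i - ratr q| < n.+1%:R^-1] : 'rV[rat]_d).
have qP i : `|x 0 i - ratr (q 0 i)| < n.+1%:R^-1.
  rewrite mxE; case: xgetP => [y -> //|]; have [y yP] := qE i.
  by move=> /(_ y).
exists (q, n) => // y /= yq; apply: eU; split => // i j /=.
rewrite (ord1 i) /ball /=.
have := yq j; have := qP j => /= h1 h2.
have -> : x 0 j - y 0 j = (x 0 j - ratr (q 0 j)) - (y 0 j - ratr (q 0 j)) by ring.
rewrite (le_lt_trans (ler_normB _ _))//.
by move: ne h1 h2; move: n.+1%:R^-1 => r; lra.
Qed.

Lemma measurable_rV d' (T : measurableType d') (f : T -> 'rV[R]_d) :
  (forall i, measurable_fun setT (fun w => f w 0 i)) -> measurable_fun setT f.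
Proof.
move=> mf; apply: (measurability (open : set (set 'rV[R]_d)) erefl) => _ [U oU <-].
rewrite setTI (open_rbox oU) preimage_bigcup.
have mq q : measurable (f @^-1` rbox q).
  have -> : f @^-1` rbox q = \bigcap_(i in [set: 'I_d])
      ((fun w => f w 0 i) @^-1` ball (ratr (q.1 0 i) : R) q.2.+1%:R^-1).
    apply/seteqP; split => w /= H i; last first.
      by have := H i I; rewrite /ball /= distrC.
    by move=> _; rewrite /ball /= distrC; exact: H.
  apply: fin_bigcap_measurable => // i _; rewrite -[X in measurable X]setTI.
  apply: mf => //; exact: measurable_ball.
rewrite bigcup_mkcond; apply: countable_bigcupT_measurable => [|q].
  exact: countableP.
by case: ifP.
Qed.

Lemma continuous_measurable_map d' (f : 'rV[R]_d -> 'rV[R]_d') :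
  continuous f -> measurable_fun setT f.
Proof.
move=> cf; apply: (measurability (open : set (set 'rV[R]_d')) erefl) => _ [U oU <-].
rewrite setTI; apply: sub_sigma_algebra; exact: open_comp.
Qed.

Lemma measurable_rVD d' (T : measurableType d') (f g : T -> 'rV[R]_d) :
  measurable_fun setT f -> measurable_fun setT g ->
  measurable_fun setT (fun w => f w + g w).
Proof.
move=> mf mg; apply: measurable_rV => i; under eq_fun do rewrite mxE.
by apply: measurable_funD;
  [exact: (measurableT_comp (measurable_coord i) mf)
  |exact: (measurableT_comp (measurable_coord i) mg)].
Qed.

Lemma measurable_rVZ d' (T : measurableType d') (a : R) (f : T -> 'rV[R]_d) :
  measurable_fun setT f -> measurable_fun setT (fun w => a *: f w).
Proof.
move=> mf; apply: measurable_rV => i; under eq_fun do rewrite mxE.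
apply: measurable_funM; first exact: measurable_cst.
exact: (measurableT_comp (measurable_coord i) mf).
Qed.

Lemma measurable_rVN d' (T : measurableType d') (f : T -> 'rV[R]_d) :
  measurable_fun setT f -> measurable_fun setT (fun w => - f w).
Proof.
move=> mf; under eq_fun do rewrite -scaleN1r; exact: measurable_rVZ.
Qed.

Lemma measurable_rVB d' (T : measurableType d') (f g : T -> 'rV[R]_d) :
  measurable_fun setT f -> measurable_fun setT g ->
  measurable_fun setT (fun w => f w - g w).
Proof. by move=> mf mg; apply: measurable_rVD => //; exact: measurable_rVN. Qed.

Lemma measurable_rVsum d' (T : measurableType d') (I : finType)
    (f : I -> T -> 'rV[R]_d) : (forall i, measurable_fun setT (f i)) ->
  measurable_fun setT (fun w => \sum_i f i w).
Proof.
move=> mf; apply: measurable_rV => j; under eq_fun do rewrite summxE.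
apply: measurable_sum => i; exact: (measurableT_comp (measurable_coord j) (mf i)).
Qed.

Lemma measurable_sq d' (T : measurableType d') (f : T -> 'rV[R]_d) :
  measurable_fun setT f -> measurable_fun setT (fun w => sq (f w)).
Proof.
move=> mf; under eq_fun do rewrite sqE.
apply: measurable_sum => i; under eq_fun do rewrite expr2.
by apply: measurable_funM; exact: (measurableT_comp (measurable_coord i) mf).
Qed.

End borel_rV.

(** * Calculus of smooth functions of a row vector *)

Section smooth_functions.
Context {R : realType} {d : nat}.
Implicit Types (f g : 'rV[R]_d -> R).

(** Reduces a directional derivative to a derivative on the real line, where the chain rule is
    available. *)
Lemma is_derive_line f x v df :
  is_derive x v f df <-> is_derive (0 : R) 1 (fun h : R => f (h *: v + x)) df.
Proof.
have E : (fun h : R => h^-1 *: (((fun h : R => f (h *: v + x)) \o shift 0) (h *: 1)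
     - f (0 *: v + x))) = (fun h => h^-1 *: ((f \o shift x) (h *: v) - f x)).
  apply/funext => h /=.
  by rewrite addr0 scale0r add0r [h *: 1]mulr1.
split=> [[D1 D2]|[D1 D2]]; split.
- by rewrite /derivable E.
- by rewrite /derive E.
- by move: D1; rewrite /derivable E.
- by move: D2; rewrite /derive E.
Qed.

Lemma is_derive_comp_line (g : R -> R) f x v df dg :
  is_derive x v f df -> is_derive (f x) 1 g dg ->
  is_derive x v (fun y => g (f y)) (dg * df).
Proof.
move=> /is_derive_line Df Dg; apply/is_derive_line.
apply: (@is_derive1_comp R g (fun h : R => f (h *: v + x))) => //.
by rewrite scale0r add0r.
Qed.

Lemma is_derive_coord x (i j : 'I_d) :
  is_derive x (basis_vec R i) (fun y => y 0 j) (j == i)%:R.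
Proof.
apply/is_derive_line.
have -> : (fun h : R => (h *: basis_vec R i + x) 0 j) =
    (fun h : R => h * (j == i)%:R + x 0 j).
  by apply/funext => h; rewrite !mxE eqxx.
apply: is_derive_eq; rewrite ?scaler0 ?addr0 ?add0r.
rewrite /GRing.scale/=.
by rewrite mulr1.
Qed.

Lemma class_C_cont k f : class_C k f -> continuous f.
Proof. by case: k => [|k] []. Qed.

Arguments class_C_cont {k f} _.

Lemma class_CS k f : class_C k.+1 f -> class_C k f.
Proof.
elim: k f => [|k IH] f [cf df]; first by split.
split => // i; have [dfi Ci] := df i; split => //; exact: IH.
Qed.

(** Explicit candidates for the partial derivatives suffice. Closure of [class_C] under each
    operation then follows by induction on the order, since the candidates are built from the same
    operations one order below. *)
Lemma class_C_intro k f (g : 'I_d -> 'rV[R]_d -> R) : continuous f ->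
  (forall i x, is_derive x (basis_vec R i) f (g i x)) ->
  (forall i, class_C k (g i)) -> class_C k.+1 f.
Proof.
move=> cf df Cg; split => // i; split; first by move=> x; have [] := df i x.
rewrite (_ : (fun x => _) = g i)//; apply/funext => x.
by have [_ ->] := df i x.
Qed.

Lemma class_C_derive k f i x : class_C k.+1 f ->
  is_derive x (basis_vec R i) f ('D_(basis_vec R i) f x).
Proof. by case=> _ /(_ i)[df _]; split. Qed.

Lemma class_C_D k f i : class_C k.+1 f ->
  class_C k (fun x => 'D_(basis_vec R i) f x).
Proof. by case=> _ /(_ i)[]. Qed.

Lemma class_C_cst k c : class_C k (fun _ : 'rV[R]_d => c).
Proof.
elim: k c => [|k IH] c; first by split => //; exact: cst_continuous.
by apply: (@class_C_intro _ _ (fun _ _ => 0)) => //; exact: cst_continuous.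
Qed.

Lemma continuous_add f g : continuous f -> continuous g ->
  continuous (fun x => f x + g x).
Proof. by move=> cf cg x; exact: (cvgD (cf x) (cg x)). Qed.

Lemma continuous_mul f g : continuous f -> continuous g ->
  continuous (fun x => f x * g x).
Proof. by move=> cf cg x; exact: (cvgM (cf x) (cg x)). Qed.

Lemma class_C_add k f g : class_C k f -> class_C k g ->
  class_C k (fun x => f x + g x).
Proof.
elim: k f g => [|k IH] f g Cf Cg.
  by split => //; apply: continuous_add; [apply: (class_C_cont Cf)|apply: (class_C_cont Cg)].
apply: (@class_C_intro _ _ (fun i x => 'D_(basis_vec R i) f x + 'D_(basis_vec R i) g x)).
- by apply: continuous_add; [apply: (class_C_cont Cf)|apply: (class_C_cont Cg)].
- by move=> i x; exact: (is_deriveD (class_C_derive i x Cf) (class_C_derive i x Cg)).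
- by move=> i /=; apply: IH; exact: class_C_D.
Qed.

Lemma class_C_mul k f g : class_C k f -> class_C k g ->
  class_C k (fun x => f x * g x).
Proof.
elim: k f g => [|k IH] f g Cf Cg.
  by split => //; apply: continuous_mul; [apply: (class_C_cont Cf)|apply: (class_C_cont Cg)].
apply: (@class_C_intro _ _ (fun i x => f x * 'D_(basis_vec R i) g x +
    g x * 'D_(basis_vec R i) f x)).
- by apply: continuous_mul; [apply: (class_C_cont Cf)|apply: (class_C_cont Cg)].
- by move=> i x; exact: (is_deriveM (class_C_derive i x Cf) (class_C_derive i x Cg)).
- by move=> i /=; apply: class_C_add; apply: IH => //; by [exact: class_CS|exact: class_C_D].
Qed.

Lemma class_C_sum k (I : finType) (F : I -> 'rV[R]_d -> R) :
  (forall i, class_C k (F i)) -> class_C k (fun x => \sum_i F i x).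
Proof.
move=> CF; rewrite (_ : (fun x => _) = \sum_i F i); last first.
  by apply/funext => x; rewrite fct_sumE.
elim/big_ind: _ => //; first exact: class_C_cst.
by move=> f g Cf Cg; exact: class_C_add.
Qed.

Lemma class_C_coord k j : class_C k (fun x : 'rV[R]_d => x 0 j).
Proof.
case: k => [|k]; first by split => //; exact: coord_continuous.
apply: (@class_C_intro _ _ (fun i _ => (j == i)%:R)).
- exact: coord_continuous.
- by move=> i x; exact: is_derive_coord.
- by move=> i; exact: class_C_cst.
Qed.

Lemma class_C_expR k f : class_C k f -> class_C k (fun x => expR (f x)).
Proof.
have ce (h : 'rV[R]_d -> R) : class_C 0 h -> continuous (fun x : 'rV[R]_d => expR (h x)).
  move=> [ch _] x; apply: (@continuous_comp _ _ _ h expR); first exact: ch.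
  exact: continuous_expR.
have C0 j (h : 'rV[R]_d -> R) : class_C j h -> class_C 0 h by move=> Ch; split => //; exact: (class_C_cont Ch).
elim: k f => [|k IH] f Cf; first by split => //; exact: ce.
apply: (@class_C_intro _ _ (fun i x => expR (f x) * 'D_(basis_vec R i) f x)).
- exact/ce/(C0 _ _ Cf).
- by move=> i x; exact: (is_derive_comp_line (class_C_derive i x Cf) (is_derive_expR _)).
- by move=> i /=; apply: class_C_mul; [apply: IH; exact: class_CS|exact: class_C_D].
Qed.

Lemma class_C_inv k f : (forall x, 0 < f x) -> class_C k f ->
  class_C k (fun x => (f x)^-1).
Proof.
move=> f0; have ce : class_C k f -> continuous (fun x : 'rV[R]_d => (f x)^-1).
  move=> Cf x; apply: (@cvgV R 'rV[R]_d (nbhs x) _ f (f x)).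
    by rewrite gt_eqF.
  exact: (class_C_cont Cf).
elim: k ce => [|k IH] ce Cf; first by split => //; exact: ce.
have {}IH : class_C k (fun x => (f x)^-1).
  apply: IH; last exact: class_CS.
  by move=> _; exact: (ce Cf).
apply: (@class_C_intro _ _ (fun i x =>
   (-1 * ((f x)^-1 * (f x)^-1)) * 'D_(basis_vec R i) f x)).
- exact: ce.
- move=> i x; have fx : f x != 0 by rewrite gt_eqF.
  have D : is_derive (f x) 1 (fun r : R => r^-1) (- f x ^- 2 *: 1).
    exact: (@is_deriveV R id (f x) 1 1).
  apply: (is_derive_eq (is_derive_comp_line (class_C_derive i x Cf) D)).
  by rewrite /GRing.scale/= -exprVn expr2 mulN1r mulr1.
- move=> i /=; apply: class_C_mul; last exact: class_C_D.
  by apply: class_C_mul; [exact: class_C_cst|exact: class_C_mul].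
Qed.

Lemma class_C_ln k f : (forall x, 0 < f x) -> class_C k f ->
  class_C k (fun x => ln (f x)).
Proof.
move=> f0 Cf.
have ce : continuous (fun x : 'rV[R]_d => ln (f x)).
  move=> x; apply: (@continuous_comp _ _ _ f (@ln R)).
    exact: (class_C_cont Cf).
  exact: continuous_ln.
case: k Cf => [|k] Cf; first by split.
apply: (@class_C_intro _ _ (fun i x => (f x)^-1 * 'D_(basis_vec R i) f x)) => //.
- by move=> i x; exact: (is_derive_comp_line (class_C_derive i x Cf) (is_derive1_ln (f0 x))).
- by move=> i /=; apply: class_C_mul; [apply: class_C_inv => //; exact: class_CS|exact: class_C_D].
Qed.

Lemma class_C_sq k (y : 'rV[R]_d) : class_C k (fun x => sq (x - y)).
Proof.
rewrite (_ : (fun x => _) =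
  (fun x : 'rV[R]_d => \sum_i (x 0 i + (- y 0 i)) * (x 0 i + (- y 0 i)))).
  apply: class_C_sum => i; apply: class_C_mul; apply: class_C_add;
  by [exact: class_C_coord|exact: class_C_cst].
by apply/funext => x; apply: eq_bigr => i _; rewrite !mxE.
Qed.

Lemma grad_is_derive f x (g : 'rV[R]_d) :
  (forall i, is_derive x (basis_vec R i) f (g 0 i)) -> grad f x = g.
Proof. by move=> H; apply/rowP => i; rewrite mxE; have [_ ->] := H i. Qed.

Lemma smooth_grad_derive f x i : smooth f ->
  is_derive x (basis_vec R i) f (grad f x 0 i).
Proof. by move=> /(_ 1%N)/class_C_derive H; rewrite mxE. Qed.

Lemma smooth_continuous f : smooth f -> continuous f.
Proof. by move=> /(_ 0%N) []. Qed.

Lemma smooth_grad_continuous f i : smooth f -> continuous (fun x => grad f x 0 i).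
Proof.
move=> /(_ 1%N)/(@class_C_D 0 f i) [cf _].
by under eq_fun do rewrite mxE.
Qed.

End smooth_functions.

(** * Hypercontractivity along Hamilton-Jacobi subsolutions *)

Section lsi_monotone.
Context {R : realType} {d : nat}.
Variables (nu : probability 'rV[R]_d R) (c a B0 B1 : R).
Variables (L dL : R -> 'rV[R]_d -> R).
Hypotheses (c0 : 0 < c) (a0 : 0 < a) (B10 : 0 <= B1).
Hypothesis LSI : log_sobolev nu c.
Hypothesis sL : forall (t : R), 0 < t -> smooth (L t).
Hypothesis derL : forall (t : R) x, 0 < t -> is_derive t 1 (L^~ x) (dL t x).
Hypothesis gradL : forall (t : R) x, 0 < t -> c * a * sq (grad (L t) x) <= dL t x.
Hypothesis L_bd : forall (t : R) x, 0 < t -> `|L t x| <= B0.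
Hypothesis dL_bd : forall (t : R) x, 0 < t -> dL t x <= B1 / t.
Hypothesis dL_cont : forall (t : R), 0 < t -> continuous (dL t).

Let dL_ge0 (t : R) x : 0 < t -> 0 <= dL t x.
Proof. by move=> t0; rewrite (le_trans _ (gradL x t0))// mulr_ge0 ?sq_ge0// ltW// mulr_gt0. Qed.

Let bL (t : R) : 0 < t -> bmf (L t).
Proof.
move=> t0; split; last by exists B0 => x; exact: L_bd.
by apply: continuous_measurable_rV; apply: smooth_continuous; exact: sL.
Qed.

Let bdL (t : R) : 0 < t -> bmf (dL t).
Proof.
move=> t0; split; last by exists (B1 / t) => x; rewrite ger0_norm ?dL_ge0// dL_bd.
by apply: continuous_measurable_rV; exact: dL_cont.
Qed.

(** Put Q = [- a * L]. By [gradL], the time derivative of Q is at most [- c] times the squared norm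
    of its gradient, and [ln (H t) / t] is the logarithm of the norm of exp(Q) in L^t: the
    functional of Bobkov, Gentil and Ledoux. *)
Let f (t : R) x := expR (- a * t * L t x).

Let bf (t : R) : 0 < t -> bmf (f t).
Proof. by move=> t0; apply/bmf_expR/bmfZ/bL. Qed.

Let H (t : R) : R := \int[nu]_x f t x.
Let dH (t : R) := \int[nu]_x ((- a * L t x - a * t * dL t x) * f t x).

Let H_gt0 (t : R) : 0 < t -> 0 < H t.
Proof. by move=> t0; apply: Rint_expR_gt0; apply/bmfZ/bL. Qed.

Let bdH (t : R) : 0 < t -> bmf (fun x => (- a * L t x - a * t * dL t x) * f t x).
Proof. by move=> t0; apply: bmfM (bf t0); apply: bmfB; apply: bmfZ; [exact: bL|exact: bdL]. Qed.

Let derf (t : R) x : 0 < t ->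
  is_derive t 1 (f^~ x) ((- a * L t x - a * t * dL t x) * f t x).
Proof.
move=> t0; have D := derL x t0.
have D1 : is_derive t 1 (fun s : R => (- a * s) * L s x) (- a * L t x - a * t * dL t x).
  apply: (is_derive_eq (is_deriveM _ D)).
  by rewrite /GRing.scale/= /GRing.scale/=; ring.
apply: (is_derive_eq (is_derive1_comp _ D1)).
  by rewrite mulrC.
Qed.

Let derH (t : R) : 0 < t -> is_derive t 1 H (dH t).
Proof.
(* The bound [B1 / t] on [dL] degenerates at 0, so differentiation under the integral is done on the
   window from t/2 to 2t, where the constant [G * K] dominates. *)
move=> t0; pose u := t / 2; pose v := 2 * t.
have uv (s : R) : `]u, v[%classic s -> 0 < s /\ u < s /\ s < v.
  by rewrite /= in_itv/= => /andP[us sv]; split; [rewrite /u in us; lra|].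
have It : `]u, v[%classic t by rewrite /= in_itv/= /u /v; apply/andP; split; lra.
pose G := a * B0 + a * v * (B1 / u).
have u0 : 0 < u by rewrite /u; lra.
have B00 : 0 <= B0 by rewrite (le_trans _ (L_bd 0 t0)).
pose K := expR (a * v * B0).
have intf (s : R) : `]u, v[%classic s -> nu.-integrable setT (EFin \o f s).
  by move=> /uv[s0 _]; apply: bmf_integrable; exact: bf.
have derf1 (s : R) y : `]u, v[%classic s -> setT y -> derivable (f ^~ y) s 1.
  by move=> /uv[s0 _] _; have [] := derf y s0.
have G0 (y : 'rV[R]_d) : 0 <= (fun=> G * K) y.
  rewrite mulr_ge0 ?expR_ge0// addr_ge0// mulr_ge0//; try exact: ltW.
  - by rewrite mulr_ge0 ?ltW// /v; lra.
  - by rewrite divr_ge0// ltW.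
have iG : nu.-integrable setT (EFin \o (fun _ : 'rV[R]_d => G * K)).
  exact/bmf_integrable/bmf_cst.
have Gub (s : R) y : `]u, v[%classic s -> setT y -> `|partial1of2 f s y| <= (fun=> G * K) y.
  move=> /uv[s0 [us sv]] _; rewrite /partial1of2 derive1E.
  have [_ ->] := derf y s0.
  rewrite normrM ler_pM//; last first.
    rewrite ger0_norm ?expR_ge0// ler_expR.
    rewrite (le_trans (ler_norm _))// normrM mulNr normrN (gtr0_norm (mulr_gt0 a0 s0)).
    rewrite ler_pM ?L_bd// ?mulr_ge0 ?ltW//.
    by rewrite ltr_pM2l.
  rewrite (le_trans (ler_normB _ _))// lerD//.
    rewrite normrM normrN (gtr0_norm a0) ler_pM2l//; exact: L_bd.
  rewrite normrM (gtr0_norm (mulr_gt0 a0 s0)) (ger0_norm (dL_ge0 _ s0)).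
  apply: ler_pM.
  - by rewrite mulr_ge0 ?ltW.
  - exact: dL_ge0.
  - by rewrite ler_pM2l// ltW.
  - rewrite (le_trans (dL_bd _ s0))//; apply: ler_wpM2l => //.
    by rewrite lef_pV2 ?posrE// ltW.
split.
  exact: (@derivable_under_integral _ _ _ nu f setT measurableT t u v It intf derf1 _ G0 iG Gub).
have := @differentiation_under_integral _ _ _ nu f setT measurableT t u v It intf derf1 _ G0 iG Gub.
rewrite derive1E => ->; apply: eq_Rintegral => y _.
by rewrite /partial1of2 derive1E; have [_ ->] := derf y t0.
Qed.

(** [t * dH t] is the mean of f ln f minus [a * t ^+ 2] times the mean of [dL * f]. The logarithmic
    Sobolev inequality bounds the first mean by H ln H plus an energy, and [gradL] makes this energy
    at most the subtracted term. *)
Let lsi_dH (t : R) : 0 < t -> t * dH t <= H t * ln (H t).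
Proof.
move=> t0.
have sat : smooth (fun x => - a * t * L t x).
  by move=> k; apply: class_C_mul; [exact: class_C_cst|exact: sL].
have sf : smooth (f t) by move=> k; apply: class_C_expR; exact: sat.
have fp x : 0 < f t x by exact: expR_gt0.
have flnf x : f t x * ln (f t x) = (- a * t) * (L t x * f t x).
  by rewrite /f expRK; ring.
have b1 : bmf (fun x => L t x * f t x) by apply: bmfM; [exact: bL|exact: bf].
have b2 : bmf (fun x => f t x * ln (f t x)).
  by rewrite (_ : (fun x => _) = fun x => (- a * t) * (L t x * f t x));
    [exact: bmfZ|apply/funext => x; rewrite flnf].
have gE x : grad (f t) x = (- a * t * f t x) *: grad (L t) x.
  apply: grad_is_derive => i; rewrite mxE.
  have D : is_derive x (basis_vec R i) (fun x => - a * t * L t x)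
      (- a * t * grad (L t) x 0 i).
    apply: (is_derive_eq (is_deriveM (is_derive_cst _ _ _) (smooth_grad_derive x i (sL t0)))).
    by rewrite scaler0 addr0.
  apply: (is_derive_eq (is_derive_comp_line D (is_derive_expR _))).
  by rewrite /f; ring.
pose q x := enorm (grad (f t) x) ^+ 2 / f t x.
have qE x : q x = (a * t) ^+ 2 * (sq (grad (L t) x) * f t x).
  rewrite /q sq_enorm gE sqZ; field; rewrite gt_eqF//.
have bq : bmf q.
  rewrite (_ : q = fun x => (a * t) ^+ 2 * (sq (grad (L t) x) * f t x)); last first.
    exact/funext.
  apply: bmfZ; apply: bmfM; last exact: bf.
  split.
    apply: measurable_sq; apply: measurable_rV => i.
    by apply: continuous_measurable_rV; apply: smooth_grad_continuous; exact: sL.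
  exists (B1 / t / (c * a)) => x; rewrite ger0_norm ?sq_ge0//.
  rewrite ler_pdivlMr ?mulr_gt0// mulrC.
  by rewrite (le_trans (gradL _ t0))// dL_bd.
have := LSI sf fp (bmf_integrable nu (bf t0)) (bmf_integrable nu b2).
rewrite -/(q _) -[X in (_ <= _ * X)%E](EFin_Rint nu bq) -EFinM lee_fin => lsi.
have : t * dH t = \int[nu]_x (f t x * ln (f t x)) - a * t ^+ 2 * \int[nu]_x (dL t x * f t x).
  have bd : bmf (fun x => dL t x * f t x) by apply: bmfM; [exact: bdL|exact: bf].
  rewrite -RintZ// -RintB//; last exact: bmfZ.
  rewrite -RintZ; last exact: bdH.
  by apply: eq_Rintegral => x _; rewrite flnf; ring.
have : c * \int[nu]_x q x <= a * t ^+ 2 * \int[nu]_x (dL t x * f t x).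
  have bd : bmf (fun x => dL t x * f t x) by apply: bmfM; [exact: bdL|exact: bf].
  rewrite -!RintZ//; apply: Rint_le; [exact: bmfZ|exact: bmfZ|].
  move=> x; rewrite qE.
  have -> : c * ((a * t) ^+ 2 * (sq (grad (L t) x) * f t x)) =
    (a * t ^+ 2 * f t x) * (c * a * sq (grad (L t) x)) by ring.
  have -> : a * t ^+ 2 * (dL t x * f t x) = (a * t ^+ 2 * f t x) * dL t x by ring.
  apply: ler_wpM2l; last exact: gradL.
  by rewrite mulr_ge0 ?expR_ge0// mulr_ge0 ?sqr_ge0// ltW.
move: lsi; rewrite -/(H t); lra.
Qed.

Lemma lsi_monotone (s t : R) : 0 < s -> s <= t -> ln (H t) / t <= ln (H s) / s.
Proof.
move=> s0 st.
have D (u : R) : 0 < u -> is_derive u 1 (fun u => ln (H u) * u^-1)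
    ((u * dH u - H u * ln (H u)) / (H u * u ^+ 2)).
  move=> u0; have D1 := derH u0; have Hu := H_gt0 u0.
  have D2 := is_derive1_comp (is_derive1_ln Hu) D1.
  have D3 : is_derive u 1 (fun u : R => u^-1) (- u ^- 2 *: 1).
    by apply: is_deriveV => //; rewrite gt_eqF.
  apply: (is_derive_eq (is_deriveM D2 D3)).
  rewrite /GRing.scale/=; field.
  by rewrite !gt_eqF.
apply: (@ler0_derive1_nincr R (fun u => ln (H u) / u) s t) => //.
- move=> u; rewrite in_itv/= => /andP[su _].
  by have [] := D _ (lt_trans s0 su).
- move=> u; rewrite in_itv/= => /andP[su _]; have u0 := lt_trans s0 su.
  rewrite derive1E; have [_ ->] := D _ u0.
  rewrite mulr_le0_ge0 ?subr_le0 ?lsi_dH// invr_ge0 mulr_ge0 ?sqr_ge0//.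
  exact/ltW/H_gt0.
- apply: derivable_within_continuous => u; rewrite in_itv/= => /andP[su _].
  by have [] := D _ (lt_le_trans s0 su).
Qed.

End lsi_monotone.

(** * Talagrand's inequality from the logarithmic Sobolev inequality *)

Section limits.
Context {R : realType} {dT : measure_display} {T : measurableType dT}.
Variable mu : probability T R.

Lemma Rint_bounded_cvg (f_ : nat -> T -> R) (f : T -> R) B :
  (forall n, measurable_fun setT (f_ n)) -> bmf f ->
  (forall n x, `|f_ n x| <= B) ->
  {ae mu, forall x, f_ n x @[n --> \oo] --> f x} ->
  \int[mu]_x f_ n x @[n --> \oo] --> \int[mu]_x f x.
Proof.
move=> mf_ bf fB cf.
have bf_ n : bmf (f_ n) by split => //; exists B.
have [|||||_ _ +] := @dominated_convergence _ _ R mu setT measurableT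
  (fun n x => (f_ n x)%:E) (EFin \o f) (fun=> B%:E).
- by move=> n; exact/measurable_EFinP.
- exact/measurable_EFinP/bmf_meas.
- by apply: filterS cf => x fx _; apply: cvg_EFin => //; exact: nearW.
- by apply: bmf_integrable; exact: bmf_cst.
- by apply: aeW => x n _ /=; rewrite lee_fin.
- by rewrite -EFin_Rint//; under eq_fun do rewrite -EFin_Rint//; move/fine_cvg.
Qed.

Lemma integral_trunc (f : T -> R) K : measurable_fun setT f ->
  (forall x, 0 <= f x) ->
  (forall n : nat, \int[mu]_x Num.min n%:R (f x) <= K) ->
  (\int[mu]_x (f x)%:E <= K%:E)%E.
Proof.
move=> mf f0 H.
have bn (n : nat) : bmf (fun x => Num.min n%:R (f x)) by apply: bmf_minc.
have fE x : limn (fun n => (Num.min n%:R (f x))%:E) = (f x)%:E.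
  apply: cvg_lim => //; apply: cvg_EFin; first exact: nearW.
  apply: cvg_near_cst; near=> n.
  apply: min_r; near: n; exact: nbhs_infty_ger.
rewrite (_ : (\int[mu]_x _)%E =
    (\int[mu]_x (limn (fun n => (Num.min n%:R (f x))%:E)))%E); last first.
  by apply: eq_integral => x _; rewrite fE.
rewrite monotone_convergence//.
- apply: lime_le; last by apply: nearW => n; rewrite -EFin_Rint// lee_fin.
  apply: ereal_nondecreasing_is_cvgn => m n mn; apply: ge0_le_integral => //.
  + by move=> x _; rewrite lee_fin le_min ler0n f0.
  + exact/measurable_EFinP/bmf_meas.
  + exact/measurable_EFinP/bmf_meas.
  + by move=> x _; rewrite lee_fin le_min !ge_min lexx orbT ler_nat mn.
- by move=> n; exact/measurable_EFinP/bmf_meas.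
- by move=> n x _; rewrite lee_fin le_min ler0n f0.
- by move=> x _ m n mn; rewrite lee_fin le_min !ge_min lexx orbT ler_nat mn.
Unshelve. all: end_near. Qed.

Lemma Rint_markov (f : T -> R) a A : 0 < a -> bmf f -> (forall x, 0 <= f x) ->
  measurable A -> (forall x, A x -> a <= f x) ->
  a * fine (mu A) <= \int[mu]_x f x.
Proof.
move=> a0 bf f0 mA Af.
have -> : a * fine (mu A) = \int[mu]_x (a * \1_A x).
  rewrite RintZ; last exact: bmf_ind.
  by rewrite /Rintegral integral_indic// setIT.
apply: Rint_le => //; first exact/bmfZ/bmf_ind.
move=> x; rewrite indicE; case: (boolP (x \in A)) => /= [/set_mem/Af|_].
  by rewrite mulr1.
by rewrite mulr0.
Qed.

End limits.

Section t2_definitions.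
Context {R : realType} {d : nat}.

(** The dual form, due to Bobkov and Götze, of Talagrand's transport inequality. The infimal
    convolution of [g] is represented by an arbitrary minorant [U], which avoids measurability
    questions about infima. The premise quantified over [e] expresses uniform continuity of the
    bounded function [g]. *)
Definition T2dual (nu : probability 'rV[R]_d R) (k : R) :=
  forall U g : 'rV[R]_d -> R, bmf U -> bmf g ->
  (forall e, 0 < e -> exists C, forall x y, g y <= g x + e + C * sq (x - y)) ->
  (forall x y, U x <= g y + sq (x - y) / 2) ->
  \int[nu]_x expR (k * U x) <= expR (k * \int[nu]_x g x).

Definition dist2 N (x y : N.-tuple 'rV[R]_d) :=
  \sum_(i < N) sq (tnth x i - tnth y i).

(** For a bounded function this is equivalent to uniform continuity, the quadratic term absorbing
    the oscillation at large distances. The form is adapted to quadratic costs: a map that is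
    Lipschitz for [dist2] acts on [C] only. *)
Definition ucont N (f : N.-tuple 'rV[R]_d -> R) :=
  forall e, 0 < e -> exists C, forall x y, f y <= f x + e + C * dist2 x y.

Lemma dist2_ge0 N (x y : N.-tuple 'rV[R]_d) : 0 <= dist2 x y.
Proof. by apply: sumr_ge0 => i _; exact: sq_ge0. Qed.

Lemma dist2_cons N a b (x y : N.-tuple 'rV[R]_d) :
  dist2 (tuple_cons (a, x)) (tuple_cons (b, y)) = sq (a - b) + dist2 x y.
Proof.
rewrite /dist2 big_ord_recl; congr (_ + _).
by apply: eq_bigr => i _; rewrite !tnth_consS.
Qed.

Lemma dist2xx N (x : N.-tuple 'rV[R]_d) : dist2 x x = 0.
Proof. by rewrite /dist2 big1// => i _; rewrite subrr sq0. Qed.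

End t2_definitions.

Section lsi_t2.
Context {R : realType} {d : nat}.
Variables (nu : probability 'rV[R]_d R) (c : R).
Hypotheses (c0 : 0 < c) (LSI : log_sobolev nu c).
Variables (g : 'rV[R]_d -> R) (B : R).
Hypotheses (B0 : 0 < B) (gB : forall x, `|g x| <= B) (mg : measurable_fun setT g).
Variables (n : nat) (y : 'I_n -> 'rV[R]_d) (de : R).
Hypothesis de0 : 0 < de.

(** [- de * ln Z] is a smooth substitute for the Hopf-Lax function, the minimum of [B] and of g(y k)
    + |x - y k|^2 / 2t over finitely many base points: a log-sum-exp at temperature [de]. The
    constant term of [Z] caps it at [B] and keeps [Z] away from 0. *)
Let E (k : 'I_n) (t : R) x := expR (- (g (y k) / de) - sq (x - y k) / (2 * de) * t^-1).
Let Z (t : R) x := expR (- (B / de)) + \sum_k E k t x.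
Definition softmin_log t x := ln (Z t x).
Local Notation L := softmin_log.
Let dL (t : R) x := (\sum_k E k t x * (sq (x - y k) / (2 * de * t ^+ 2))) / Z t x.

Let E_ge0 k t x : 0 <= E k t x. Proof. exact: expR_ge0. Qed.

Let Z_ge t x : expR (- (B / de)) <= Z t x.
Proof. by rewrite lerDl; apply: sumr_ge0 => k _; exact: E_ge0. Qed.

Let Z_gt0 t x : 0 < Z t x.
Proof. by rewrite (lt_le_trans _ (Z_ge t x))// expR_gt0. Qed.

Let E_le k (t : R) x : 0 < t ->
  E k t x <= expR (B / de) * expR (- (sq (x - y k) / (2 * de) * t^-1)).
Proof.
move=> t0; rewrite -expRD ler_expR lerD2r -mulNr ler_pM2r ?invr_gt0//.
by have := gB (y k); rewrite ler_norml; lra.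
Qed.

Let Z_le (t : R) x : 0 < t -> Z t x <= n.+1%:R * expR (B / de).
Proof.
move=> t0; rewrite /Z -natr1 mulrDl mul1r addrC lerD//; last first.
  rewrite ler_expR -subr_ge0 opprK; have := divr_ge0 (ltW B0) (ltW de0); lra.
rewrite -[n in n%:R]card_ord -sum1_card natr_sum mulr_suml; apply: ler_sum => k _.
rewrite mul1r (le_trans (E_le _ _ t0))// -[leRHS]mulr1 ler_pM2l ?expR_gt0//.
rewrite -[leRHS]expR0 ler_expR oppr_le0 mulr_ge0 ?invr_ge0 ?(ltW t0)//.
by rewrite divr_ge0 ?sq_ge0// mulr_ge0// ltW.
Qed.

Let smE k (t : R) : smooth (E k t).
Proof.
move=> j; apply: class_C_expR; apply: class_C_add; first exact: class_C_cst.
rewrite (_ : (fun x => _) = fun x => (- (2 * de)^-1 * t^-1) * sq (x - y k)).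
  by apply: class_C_mul; [exact: class_C_cst|exact: class_C_sq].
by apply/funext => x; ring.
Qed.

Let smZ (t : R) : smooth (Z t).
Proof.
by move=> j; apply: class_C_add; [exact: class_C_cst|apply: class_C_sum => k; exact: smE].
Qed.

Let smL t : 0 < t -> smooth (L t).
Proof. by move=> t0 j; apply: class_C_ln => [x|]; [exact: Z_gt0|exact: smZ]. Qed.

Let derE k (t : R) x : 0 < t ->
  is_derive t 1 (fun t => E k t x) (E k t x * (sq (x - y k) / (2 * de * t ^+ 2))).
Proof.
move=> t0; have D : is_derive t 1 (fun r : R => r^-1) (- t ^- 2 *: 1).
  by apply: (@is_deriveV R id t 1 1); rewrite gt_eqF.
have D2 : is_derive t 1
   (fun t : R => - (g (y k) / de) - sq (x - y k) / (2 * de) * t^-1)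
   (0 - sq (x - y k) / (2 * de) * (- t ^- 2)).
  apply: is_deriveB; apply: (is_derive_eq (is_deriveM (is_derive_cst _ _ _) D)).
  by rewrite scaler0 addr0 /GRing.scale/= mulr1.
apply: (is_derive_eq (is_derive1_comp (is_derive_expR _) D2)).
by rewrite /E; field; rewrite !gt_eqF.
Qed.

Let derZ (t : R) x : 0 < t ->
  is_derive t 1 (fun t => Z t x) (\sum_k E k t x * (sq (x - y k) / (2 * de * t ^+ 2))).
Proof.
move=> t0; rewrite -[X in is_derive _ _ _ X]add0r.
apply: is_deriveD.
rewrite (_ : (fun t => _) = \sum_k (fun t => E k t x)); last first.
  by apply/funext => s; rewrite fct_sumE.
by apply: is_derive_sum => k; exact: derE.
Qed.

Let derL (t : R) x : 0 < t -> is_derive t 1 (L^~ x) (dL t x).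
Proof.
move=> t0; apply: (is_derive_eq (@is_derive1_comp R (@ln R) (fun t => Z t x) t _ _ (is_derive1_ln (Z_gt0 _ _)) (derZ x t0))).
by rewrite mulrC.
Qed.

Let gradE k (t : R) x i : is_derive x (basis_vec R i) (E k t)
  (E k t x * (- (de * t)^-1 * (x - y k) 0 i)).
Proof.
have Dj (j : 'I_d) : is_derive x (basis_vec R i)
    (fun x : 'rV[R]_d => (x 0 j - y k 0 j) ^+ 2) (2 * (x 0 j - y k 0 j) * (j == i)%:R).
  have D1 : is_derive x (basis_vec R i) (fun x : 'rV[R]_d => x 0 j - y k 0 j) (j == i)%:R.
    by apply: (is_derive_eq (is_deriveB (is_derive_coord x i j) (is_derive_cst _ _ _))); rewrite subr0.
  under eq_fun do rewrite expr2.
  apply: (is_derive_eq (is_deriveM D1 D1)); rewrite /GRing.scale/=; ring.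
have D2 : is_derive x (basis_vec R i) (fun x => sq (x - y k)) (2 * (x - y k) 0 i).
  rewrite (_ : (fun x => _) = \sum_j (fun x : 'rV[R]_d => (x 0 j - y k 0 j) ^+ 2)); last first.
    by apply/funext => z; rewrite fct_sumE sqE; apply: eq_bigr => j _; rewrite !mxE.
  apply: (is_derive_eq (is_derive_sum Dj)).
  rewrite (bigD1 i)//= eqxx big1 ?addr0 ?mulr1 ?mxE// => j /negbTE ->.
  by rewrite mulr0.
have D3 : is_derive x (basis_vec R i)
   (fun x => - (g (y k) / de) - sq (x - y k) / (2 * de) * t^-1)
   (0 - (2 * de)^-1 * t^-1 * (2 * (x - y k) 0 i)).
  apply: is_deriveB.
  rewrite (_ : (fun x => _) = fun x => ((2 * de)^-1 * t^-1) * sq (x - y k)); last first.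
    by apply/funext => z; ring.
  apply: (is_derive_eq (is_deriveM (is_derive_cst _ _ _) D2)).
  by rewrite scaler0 addr0.
apply: (is_derive_eq (is_derive_comp_line D3 (is_derive_expR _))).
rewrite /E [(de * t)^-1]invfM; congr (_ * _).
by move: t^-1 => u; field; rewrite !gt_eqF.
Qed.

Let gradL (t : R) x :
  grad (L t) x = \sum_k (E k t x / Z t x) *: ((- (de * t)^-1) *: (x - y k)).
Proof.
apply: grad_is_derive => i.
have DZ : is_derive x (basis_vec R i) (Z t)
   (\sum_k E k t x * (- (de * t)^-1 * (x - y k) 0 i)).
  rewrite -[X in is_derive _ _ _ X]add0r; apply: is_deriveD.
  rewrite (_ : (fun t => _) = \sum_k E k t); last first.
    by apply/funext => s; rewrite fct_sumE.
  by apply: is_derive_sum => k; exact: gradE.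
apply: (is_derive_eq (is_derive_comp_line DZ (is_derive1_ln (Z_gt0 t x)))).
rewrite summxE mulr_sumr; apply: eq_bigr => k _; rewrite !mxE.
by ring.
Qed.

(** The gradient averages multiples of the vectors [x - y k] with weights of sum at most 1.
    Convexity of the square therefore yields the Hamilton-Jacobi inequality needed for monotonicity,
    with [a = de / (2 * c)]. *)
Let gradL_le (t : R) x : 0 < t -> c * (de / (2 * c)) * sq (grad (L t) x) <= dL t x.
Proof.
move=> t0; rewrite gradL.
have w0 k : 0 <= E k t x / Z t x by rewrite divr_ge0// ltW.
have w1 : \sum_k E k t x / Z t x <= 1.
  by rewrite -mulr_suml ler_pdivrMr// mul1r lerDr expR_ge0.
have -> : c * (de / (2 * c)) = de / 2 by field; rewrite gt_eqF.
apply: (@le_trans _ _ (de / 2 * \sum_k (E k t x / Z t x) * sq ((- (de * t)^-1) *: (x - y k)))).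
  apply: ler_wpM2l; first by rewrite divr_ge0// ltW.
  exact: sq_sum_le.
rewrite /dL mulr_sumr mulr_suml; apply: ler_sum => k _; rewrite sqZ.
rewrite le_eqVlt; apply/orP; left; apply/eqP; field.
by rewrite !gt_eqF.
Qed.

Let L_bd (t : R) x : 0 < t -> `|L t x| <= B / de + ln n.+1%:R.
Proof.
move=> t0; have n0 : 0 <= ln n.+1%:R :> R by rewrite ln_ge0// ler1n.
have h1 : - (B / de) <= L t x by rewrite -[leLHS]expRK ler_ln ?posrE ?expR_gt0.
have h2 : L t x <= B / de + ln n.+1%:R.
  rewrite addrC -[B / de]expRK -lnM ?posrE ?expR_gt0// ler_ln ?posrE ?mulr_gt0 ?expR_gt0//.
  exact: Z_le.
rewrite ler_norml h2 andbT; lra.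
Qed.

(** With [s] the quadratic exponent, each summand is at most [expR (B / de)] times s exp(-s) / t,
    and s exp(-s) is at most 1. Dividing by the lower bound of [Z] costs the second factor
    [expR (B / de)]. *)
Let dL_bd (t : R) x : 0 < t -> dL t x <= (n%:R * expR (B / de) ^+ 2) / t.
Proof.
move=> t0; rewrite /dL ler_pdivrMr ?Z_gt0//.
apply: (@le_trans _ _ (\sum_(k < n) expR (B / de) / t)); last first.
  rewrite sumr_const card_ord -[X in X <= _]mulr_natl.
  have -> : n%:R * expR (B / de) ^+ 2 / t * Z t x =
    n%:R * (expR (B / de) / t) * (expR (B / de) * Z t x) by ring.
  rewrite -[leLHS]mulr1; apply: ler_wpM2l.
    by rewrite mulr_ge0// divr_ge0 ?expR_ge0// ltW.
  rewrite -(expRxMexpNx_1 (B / de)) ler_pM2l ?expR_gt0//.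
apply: ler_sum => k _.
set s := sq (x - y k) / (2 * de) * t^-1.
have -> : sq (x - y k) / (2 * de * t ^+ 2) = s / t.
  by rewrite /s; field; rewrite !gt_eqF.
rewrite mulrA ler_pM2r ?invr_gt0//.
apply: (@le_trans _ _ (expR (B / de) * expR (- s) * s)).
  apply: ler_wpM2r; last exact: E_le.
  by rewrite /s mulr_ge0 ?invr_ge0 ?(ltW t0)// divr_ge0 ?sq_ge0// mulr_ge0// ltW.
rewrite -[leRHS]mulr1 -mulrA ler_pM2l ?expR_gt0//.
rewrite -(expRxMexpNx_1 s) mulrC ler_pM2r ?expR_gt0//.
by rewrite (le_trans _ (expR_ge1Dx s))//; lra.
Qed.

Let dL_cont t : 0 < t -> continuous (dL t).
Proof.
move=> t0; apply: (@class_C_cont _ _ 0).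
apply: class_C_mul; last by apply: class_C_inv; [exact: Z_gt0|exact: smZ].
apply: class_C_sum => k; apply: class_C_mul; first exact: smE.
by apply: class_C_mul; [exact: class_C_sq|exact: class_C_cst].
Qed.

Lemma softmin_monotone s : 0 < s -> s <= 1 ->
  ln (\int[nu]_x expR (- (de / (2 * c)) * L 1 x)) <=
  s^-1 * ln (\int[nu]_x expR (- (de / (2 * c)) * s * L s x)).
Proof.
move=> s0 s1; have a0 : 0 < de / (2 * c) by rewrite divr_gt0// mulr_gt0.
have B1 : 0 <= n%:R * expR (B / de) ^+ 2 by rewrite mulr_ge0// sqr_ge0.
have h := lsi_monotone c0 a0 B1 LSI smL derL gradL_le L_bd dL_bd dL_cont s0 s1.
have gen (p q p' : R) : p' / 1 <= q / s -> p = p' -> p <= s^-1 * q.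
  by rewrite divr1 mulrC => ? ->.
apply: (gen _ _ _ h); congr (ln _); apply: eq_Rintegral => x _.
by rewrite mulr1.
Qed.

Lemma softmin_le_bound s x : - (de * L s x) <= B.
Proof.
have : - (B / de) <= L s x by rewrite -[leLHS]expRK ler_ln ?posrE ?expR_gt0.
by rewrite -mulNr ler_pdivrMr//; lra.
Qed.

Lemma softmin_le s x k : 0 < s -> - (de * L s x) <= g (y k) + sq (x - y k) / (2 * s).
Proof.
move=> s0; have : - (g (y k) / de) - sq (x - y k) / (2 * de) * s^-1 <= L s x.
  rewrite -[leLHS]expRK ler_ln ?posrE ?expR_gt0//.
  rewrite /Z (bigD1 k)//= addrCA lerDl addr_ge0 ?expR_ge0//.
  by apply: sumr_ge0 => j _; exact: E_ge0.
have -> : - (g (y k) / de) - sq (x - y k) / (2 * de) * s^-1 =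
  - (g (y k) + sq (x - y k) / (2 * s)) / de by field; rewrite !gt_eqF.
by rewrite ler_pdivrMr//; lra.
Qed.

(** [Z] has [n.+1] terms, each at most exp(- u / de). The price of log-sum-exp is thus
    [de * ln n.+1], which a fast decrease of the temperature makes vanish. *)
Lemma softmin_ge x u : u <= B -> (forall k, u <= g (y k) + sq (x - y k) / 2) ->
  u - de * ln n.+1%:R <= - (de * L 1 x).
Proof.
move=> uB ug; suff : L 1 x <= ln n.+1%:R - u / de.
  rewrite -(ler_pM2l de0) mulrBr [de * (u / de)]mulrC divfK ?gt_eqF//; lra.
rewrite -[u / de]expRK -ln_div ?posrE ?expR_gt0// ler_ln ?posrE ?divr_gt0 ?expR_gt0//.
rewrite -expRN /Z -natr1 mulrDl mul1r addrC lerD//; last first.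
  by rewrite ler_expR lerN2 ler_pM2r// invr_gt0.
rewrite -[n in n%:R]card_ord -sum1_card natr_sum mulr_suml; apply: ler_sum => k _.
rewrite mul1r ler_expR invr1 mulr1.
have -> : - (g (y k) / de) - sq (x - y k) / (2 * de) =
  - ((g (y k) + sq (x - y k) / 2) / de) by field; rewrite !gt_eqF.
by rewrite lerN2 ler_pM2r// invr_gt0.
Qed.

Lemma bmf_softmin s : 0 < s -> bmf (L s).
Proof.
move=> s0; split; last by exists (B / de + ln n.+1%:R) => x; exact: L_bd.
by apply: continuous_measurable_rV; apply: smooth_continuous; exact: smL.
Qed.

End lsi_t2.

Section dense_sequence.
Context {R : realType} {d : nat}.

(** An enumeration of the rational vectors; integers that code no vector are sent to 0. *)
Definition rat_rV (k : nat) : 'rV[R]_d :=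
  if (unpickle k : option 'rV[rat]_d) is Some q then map_mx ratr q else 0.

Lemma rat_rV_dense (x : 'rV[R]_d) e : 0 < e -> exists k, sq (x - rat_rV k) <= e.
Proof.
move=> e0; pose r := Num.min 1 (e / d.+1%:R).
have r0 : 0 < r by rewrite /r lt_min ltr01 divr_gt0.
have qE i : exists q : rat, `|x 0 i - ratr q| < r.
  have : x 0 i - r < x 0 i + r by lra.
  move=> /rat_in_itvoo [q]; rewrite in_itv/= => /andP[q1 q2]; exists q.
  by rewrite ltr_norml; apply/andP; split; lra.
have [q qP] : exists q : 'rV[rat]_d, forall i, `|x 0 i - ratr (q 0 i)| < r.
  have [f fP] := choice qE; exists (\row_i f i) => i; rewrite mxE; exact: fP.
exists (pickle q); rewrite /rat_rV pickleK sqE.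
apply: (@le_trans _ _ (\sum_(i < d) e / d.+1%:R)).
  apply: ler_sum => i _; rewrite !mxE -real_normK ?num_real//.
  have := qP i; move: `|_| (normr_ge0 (x 0 i - ratr (q 0 i))) => u u0 ur.
  have [r1 r2] : r <= 1 /\ r <= e / d.+1%:R by rewrite /r !ge_min !lexx orbT.
  rewrite expr2 (le_trans (ler_wpM2l u0 (le_trans (ltW ur) r1)))// mulr1; exact: (le_trans (ltW ur) r2).
rewrite sumr_const card_ord -[X in X <= _]mulr_natl mulrA ler_pdivrMr// mulrC ler_pM2l//.
by rewrite ler_nat.
Qed.

End dense_sequence.

Section lsi_t2.
Context {R : realType} {d : nat}.
Variables (nu : probability 'rV[R]_d R) (c : R).
Hypotheses (c0 : 0 < c) (LSI : log_sobolev nu c).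

(** The functional is compared at the times [s] and 1 while the base points fill the space and the
    temperature tends to 0. At time 1 the soft minimum dominates [U] up to a vanishing error. At
    time [s] it ends up below [g x] plus any margin, since base points come close to [x] itself. *)
Lemma lsi_T2dual_small (U g : 'rV[R]_d -> R) s : bmf U -> bmf g ->
  (forall e, 0 < e -> exists C, forall x y, g y <= g x + e + C * sq (x - y)) ->
  (forall x y, U x <= g y + sq (x - y) / 2) -> 0 < s -> s <= 1 ->
  ln (\int[nu]_x expR ((2 * c)^-1 * U x)) <=
  s^-1 * ln (\int[nu]_x expR ((2 * c)^-1 * s * g x)).
Proof.
move=> bU bg cg Ug s0 s1; set k := (2 * c)^-1.
have k0 : 0 < k by rewrite invr_gt0 mulr_gt0.
have [B B0 gB] := bmf_bound bg; have mg := bmf_meas bg.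
(* Squared, so that the log-sum-exp error [de n * ln n.+1] is at most [n.+1%:R^-1]. *)
pose de n : R := n.+1%:R^-1 ^+ 2.
have de0 n : 0 < de n by rewrite exprn_gt0 ?invr_gt0.
pose y n (i : 'I_n) := @rat_rV R d i.
pose L n t x := softmin_log g B (y n) (de n) t x.
pose v n x := - (de n * L n s x).
(* Only upper bounds on [v] hold in the limit. The maximum with [g] supplies the lower bound needed
   for convergence and still dominates [v]. *)
pose w n x := Num.max (v n x) (g x).
have bL n t : 0 < t -> bmf (L n t) by move=> t0; apply: bmf_softmin.
have bv n : bmf (v n) by apply: bmfN; apply: bmfZ; exact: bL.
have wB n x : `|w n x| <= B.
  have /andP[g1 g2] : - B <= g x <= B by have := gB x; rewrite ler_norml.
  rewrite ler_norml /w le_max g1 orbT ge_max g2 andbT.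
  exact: softmin_le_bound.
have mw n : measurable_fun setT (w n).
  by apply: measurable_maxr => //; exact: bmf_meas.
have cw x : w n x @[n --> \oo] --> g x.
  apply/cvgrPdist_le => e e0.
  have e2 : 0 < e / 2 by lra.
  have [C HC] := cg _ e2.
  pose C' := `|C| + (2 * s)^-1.
  have C'0 : 0 < C' by rewrite /C' ltr_wpDl// invr_gt0 mulr_gt0.
  have [m hm] := rat_rV_dense x (divr_gt0 e2 C'0).
  near=> n.
  have mn : (m < n)%N by near: n; exact: nbhs_infty_gt.
  have : v n x <= g (y n (Ordinal mn)) + sq (x - y n (Ordinal mn)) / (2 * s).
    exact: softmin_le.
  rewrite /y /= => h1; have h2 := HC x (@rat_rV R d m).
  have h3 : v n x <= g x + e.
    have q0 := sq_ge0 (x - @rat_rV R d m).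
    have : C' * sq (x - @rat_rV R d m) <= e / 2.
      by rewrite mulrC -ler_pdivlMr.
    rewrite /C' mulrDl => h4.
    have : C * sq (x - rat_rV m) <= `|C| * sq (x - @rat_rV R d m).
      by apply: ler_wpM2r => //; exact: ler_norm.
    rewrite [sq _ / _]mulrC in h1; lra.
  rewrite ler_norml /w; case: (leP (v n x) (g x)) => h4; lra.
pose I0 := \int[nu]_x expR (k * U x).
pose J n := \int[nu]_x expR (k * s * w n x).
have bw n : bmf (w n) by split => //; exists B.
have step n : ln I0 <= k * n.+1%:R^-1 + s^-1 * ln (J n).
  have aE : de n / (2 * c) = k * de n by rewrite mulrC.
  have h := softmin_monotone c0 LSI B0 gB (y n) (de0 n) s0 s1.
  have : ln I0 <= k * n.+1%:R^-1 + ln (\int[nu]_x expR (- (de n / (2 * c)) * L n 1 x)).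
    have bl : bmf (fun x => - (de n / (2 * c)) * L n 1 x) by apply: bmfZ; exact: bL.
    rewrite -[k * _]expRK -lnM ?posrE ?expR_gt0//; last exact: Rint_expR_gt0.
    rewrite ler_ln ?posrE ?mulr_gt0 ?expR_gt0//; [|by apply: Rint_expR_gt0; exact: bmfZ
       |exact: Rint_expR_gt0].
    rewrite -RintZ; last exact: bmf_expR.
    apply: Rint_le; [by apply: bmf_expR; exact: bmfZ|by apply: bmfZ; exact: bmf_expR|].
    move=> x; rewrite -expRD ler_expR.
    have UB : U x <= B.
      have := Ug x x; rewrite subrr sq0 mul0r addr0 => /le_trans; apply.
      by have := gB x; rewrite ler_norml => /andP[].
    have := softmin_ge (g := g) (B := B) (y := y n) (de0 n) UB (fun k => Ug x (y n k)).
    rewrite -/(L n 1 x) aE => h1.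
    have h2 : de n * ln n.+1%:R <= n.+1%:R^-1.
      rewrite /de expr2 -mulrA -[leRHS]mulr1 ler_pM2l ?invr_gt0//.
      rewrite mulrC ler_pdivrMr// mul1r.
      have := @le_ln1Dx R n%:R; rewrite nat1r => /(_ _)/le_trans; apply.
        by rewrite (lt_le_trans _ (ler0n _ _)).
      by rewrite ler_nat.
    have h3 : U x <= n.+1%:R^-1 - de n * L n 1 x.
      apply: (@le_trans _ _ (de n * ln n.+1%:R - de n * L n 1 x)).
        by rewrite -lerBlDl.
      by rewrite lerD2r.
    apply: (@le_trans _ _ (k * (n.+1%:R^-1 - de n * L n 1 x))).
      by rewrite ler_pM2l.
    by rewrite mulrBr lerD2l mulNr mulrA.
  move=> /le_trans; apply; rewrite lerD2l; apply: (le_trans h).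
  rewrite ler_pM2l ?invr_gt0// ler_ln ?posrE.
  - apply: Rint_le.
    + by apply: bmf_expR; apply: bmfZ; exact: bL.
    + by apply: bmf_expR; exact: bmfZ.
    + move=> x; rewrite ler_expR aE.
      have -> : - (k * de n) * s * softmin_log g B (y n) (de n) s x = k * s * v n x.
        by rewrite /v /L; ring.
      by rewrite ler_pM2l ?mulr_gt0// le_max lexx.
  - by apply: Rint_expR_gt0; apply: bmfZ; exact: bL.
  - by apply: Rint_expR_gt0; exact: bmfZ.
have cJ : J n @[n --> \oo] --> \int[nu]_x expR (k * s * g x).
  apply: (@Rint_bounded_cvg _ _ _ _ _ _ (expR (k * s * B))).
  - by move=> n; apply: bmf_meas; apply: bmf_expR; exact: bmfZ.
  - by apply: bmf_expR; exact: bmfZ.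
  - move=> n x; rewrite ger0_norm ?expR_ge0// ler_expR ler_pM2l ?mulr_gt0//.
    by rewrite (le_trans (ler_norm _)).
  - apply: aeW => x.
    apply: (@continuous_cvg _ _ _ _ _ _ (fun r : R => expR (k * s * r))); last exact: cw.
    apply: (@continuous_comp _ _ _ (fun r : R => k * s * r) expR).
      exact: mulrl_continuous.
    exact: continuous_expR.
have clim : k * n.+1%:R^-1 + s^-1 * ln (J n) @[n --> \oo] -->
    k * 0 + s^-1 * ln (\int[nu]_x expR (k * s * g x)).
  apply: cvgD; apply: cvgMr; first exact: cvg_harmonic.
  apply: (@continuous_cvg _ _ _ _ _ _ (@ln R)) => //.
  by apply: continuous_ln; apply: Rint_expR_gt0; exact: bmfZ.
rewrite mulr0 add0r in clim.
rewrite -(cvg_lim _ clim)//; apply: limr_ge; first by apply/cvg_ex; eexists; exact: clim.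
exact: nearW.
Unshelve. all: end_near. Qed.

(** The theorem of Otto and Villani. As [s] tends to 0, the right-hand side of [lsi_T2dual_small]
    tends to [k] times the mean of [g]; a second-order bound on the exponential makes this
    quantitative. *)
Theorem lsi_T2dual : T2dual nu (2 * c)^-1.
Proof.
move=> U g bU bg cg Ug; set k := (2 * c)^-1.
have k0 : 0 < k by rewrite invr_gt0 mulr_gt0.
have [B B0 gB] := bmf_bound bg.
rewrite -[leLHS]lnK ?posrE; last by apply: Rint_expR_gt0; exact: bmfZ.
rewrite ler_expR; apply/ler_addgt0Pr => e e0.
(* The second bound keeps [k * s * g] in [-1, 1], where [quad] applies; the third makes the
   remainder [2 * (k * s * B) ^+ 2] at most [s * e]. *)
pose s := Num.min 1 (Num.min (k * B)^-1 (e / (2 * (k * B) ^+ 2))).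
have kB : 0 < k * B by rewrite mulr_gt0.
have [s0 [s1 [s2 s3]]] : 0 < s /\ s <= 1 /\ s <= (k * B)^-1 /\ s <= e / (2 * (k * B) ^+ 2).
  rewrite /s !lt_min ltr01 invr_gt0 kB divr_gt0 ?mulr_gt0 ?exprn_gt0//= ge_min lexx; split => //.
  by split => //; rewrite !ge_min !lexx !orbT.
apply: (le_trans (lsi_T2dual_small bU bg cg Ug s0 s1)); rewrite -/k.
rewrite mulrC ler_pdivrMr//.
have ksB : k * s * B <= 1 by rewrite mulrAC mulrC -ler_pdivlMr// mul1r.
have quad (u : R) : `|u| <= 1 -> expR u <= 1 + u + 2 * u ^+ 2.
  rewrite ler_norml => /andP[u1 u2].
  have [u0|u0] := leP u 0.
    have h := expR_ge1Dx (- u); have h2 := expRxMexpNx_1 u; have h3 := expR_gt0 u.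
    nra.
  (* For [u > 0] the bound goes through the square root: exp(u/2) is at most 1/(1 - u/2), whose
     square is at most 1 + u + 2u^2 on (0, 1]. *)
  have h := expR_ge1Dx (- (u / 2)); have h2 := expRxMexpNx_1 (u / 2).
  have h3 := expR_gt0 (u / 2).
  have -> : expR u = expR (u / 2) ^+ 2 by rewrite expr2 -expRD; congr expR; lra.
  move: (expR (u / 2)) (expR (- (u / 2))) h h2 h3 => p r h h2 h3.
  have h4 : p * (1 - u / 2) <= 1 by nra.
  have h5 : (p * (1 - u / 2)) ^+ 2 <= 1.
    by rewrite expr_le1// mulr_ge0 ?(ltW h3)//; lra.
  have h6 : 1 <= (1 + u + 2 * u ^+ 2) * (1 - u / 2) ^+ 2.
    have -> : (1 + u + 2 * u ^+ 2) * (1 - u / 2) ^+ 2 =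
      1 + u ^+ 2 * ((1 - u) * (5 / 4 - u / 2)) by field.
    by rewrite lerDl mulr_ge0 ?sqr_ge0// mulr_ge0//; lra.
  have h7 : 0 < (1 - u / 2) ^+ 2 by rewrite exprn_gt0//; lra.
  by rewrite -(ler_pM2r h7) -exprMn (le_trans h5).
have hk : \int[nu]_x expR (k * s * g x) <= 1 + (k * s * \int[nu]_x g x + 2 * (k * s * B) ^+ 2).
  have bb : bmf (fun x => k * s * g x + 2 * (k * s * B) ^+ 2).
    by apply: bmfD; [exact: bmfZ|exact: bmf_cst].
  rewrite -[X in 1 + (_ + X)](Rint_cst _ nu) -[X in X + _](Rint_cst _ nu) -RintZ//.
  rewrite -RintD; [|exact: bmfZ|exact: bmf_cst].
  rewrite -RintD; [|exact: bmf_cst|exact: bb].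
  apply: Rint_le; [by apply: bmf_expR; exact: bmfZ|by apply: bmfD => //; exact: bmf_cst|].
  move=> x; have ks0 : 0 < k * s by rewrite mulr_gt0.
  have hx : `|k * s * g x| <= k * s * B by rewrite normrM gtr0_norm// ler_pM2l.
  apply: (le_trans (quad _ (le_trans hx ksB))).
  rewrite addrA lerD2l ler_pM2l// -real_normK ?num_real// lerXn2r ?nnegrE//.
  by rewrite mulr_ge0 ?ltW.
have I0 : 0 < \int[nu]_x expR (k * s * g x) by apply: Rint_expR_gt0; exact: bmfZ.
apply: (@le_trans _ _ (k * s * \int[nu]_x g x + 2 * (k * s * B) ^+ 2)).
  apply: (le_trans _ (le_ln1Dx _)).
    by rewrite ler_ln ?posrE// (lt_le_trans I0).
  by have := lt_le_trans I0 hk; rewrite -ltrBlDl sub0r.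
have : s * (s * (2 * (k * B) ^+ 2)) <= s * e by rewrite ler_pM2l// -ler_pdivlMr// mulr_gt0// exprn_gt0.
have -> : 2 * (k * s * B) ^+ 2 = s * (s * (2 * (k * B) ^+ 2)) by ring.
lra.
Qed.

End lsi_t2.

Section t2_tensor.
Context {R : realType} {d : nat}.
Variables (nu : probability 'rV[R]_d R) (k : R).
Hypotheses (k0 : 0 < k) (T2 : T2dual nu k).

Lemma ucont_cons_int N (g : N.+1.-tuple 'rV[R]_d -> R) : bmf g -> ucont g ->
  ucont (fun y => \int[nu]_x g (tuple_cons (x, y))).
Proof.
move=> bg cg e e0; have [C HC] := cg _ e0; exists C => x y.
rewrite -addrA -[X in _ <= _ + X](Rint_cst _ nu) -RintD; [|exact: bmf_cons1|exact: bmf_cst].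
apply: Rint_le; [exact: bmf_cons1|by apply: bmfD; [exact: bmf_cons1|exact: bmf_cst]|].
move=> a; rewrite addrA; apply: (le_trans (HC (tuple_cons (a, x)) _)).
by rewrite dist2_cons subrr sq0 add0r.
Qed.

(** [U'] is the log-Laplace transform of [U] in the first coordinate and [G] the mean of [g] in it.
    The one-coordinate inequality says precisely that [U'] lies below [G] plus half the remaining
    cost, so the induction hypothesis applies to this pair. *)
Theorem T2dual_tensor N (U g : N.-tuple 'rV[R]_d -> R) : bmf U -> bmf g ->
  ucont g -> (forall x y, U x <= g y + dist2 x y / 2) ->
  \int[prod_power nu N]_x expR (k * U x) <= expR (k * \int[prod_power nu N]_x g x).
Proof.
elim: N U g => [|N IH] U g bU bg cg Ug.
  rewrite !Rint_prod_power0 ler_expR ler_pM2l//.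
  by rewrite (le_trans (Ug [tuple] [tuple]))// dist2xx mul0r addr0.
have bkU : bmf (fun x => expR (k * U x)) by apply: bmf_expR; exact: bmfZ.
pose J x' := \int[nu]_x expR (k * U (tuple_cons (x, x'))).
have bUc x' : bmf (fun x => U (tuple_cons (x, x'))) by exact: bmf_cons1.
have bJ : bmf J by exact: bmf_cons_int bkU.
have [B B0 UB] := bmf_bound bU.
have JB x' : expR (- (k * B)) <= J x'.
  rewrite -[leLHS](Rint_cst _ nu); apply: Rint_le; first exact: bmf_cst.
    by apply: bmf_expR; exact: bmfZ.
  move=> x; rewrite ler_expR -mulrN ler_pM2l// lerNl.
  by rewrite (le_trans (ler_norm _))// normrN.
have J0 x' : 0 < J x' by rewrite (lt_le_trans _ (JB x'))// expR_gt0.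
pose U' x' := k^-1 * ln (J x').
pose G y' := \int[nu]_x g (tuple_cons (x, y')).
have bU' : bmf U' by apply: bmfZ; exact: (bmf_ln (expR_gt0 _) JB).
have bG : bmf G by exact: bmf_cons_int.
have U'G x' y' : U' x' <= G y' + dist2 x' y' / 2.
  rewrite /U' mulrC ler_pdivrMr//.
  rewrite -[leRHS]expRK ler_ln ?posrE ?expR_gt0// mulrC.
  have bg1 : bmf (fun x => g (tuple_cons (x, y'))) by exact: bmf_cons1.
  have -> : G y' + dist2 x' y' / 2 = \int[nu]_x (g (tuple_cons (x, y')) + dist2 x' y' / 2).
    by rewrite RintD ?Rint_cst//; exact: bmf_cst.
  apply: T2 => //.
  - by apply: bmfD => //; exact: bmf_cst.
  - move=> e e0; have [C HC] := cg e e0; exists C => x y.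
    have := HC (tuple_cons (x, y')) (tuple_cons (y, y')).
    by rewrite dist2_cons dist2xx addr0; lra.
  - move=> x y; have := Ug (tuple_cons (x, x')) (tuple_cons (y, y')).
    by rewrite dist2_cons; lra.
rewrite Rint_prod_powerSr// Rint_prod_powerSr//.
apply: (le_trans _ (IH U' G bU' bG (ucont_cons_int bg cg) U'G)).
rewrite le_eqVlt; apply/orP; left; apply/eqP.
apply: eq_Rintegral => x' _; rewrite /U' mulrA divff ?gt_eqF// mul1r lnK ?posrE//.
Qed.

(* Talagrand's argument: the cost vanishes on a ball of measure at least 1/2. *)
Theorem T2dual_moment : exists K : R, (\int[nu]_x (sq x)%:E <= K%:E)%E.
Proof.
have msq : measurable_fun setT (fun x : 'rV[R]_d => sq x).
  by apply: measurable_sq; exact: measurable_id.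
have mset r : measurable [set x : 'rV[R]_d | r < sq x].
  rewrite -[X in measurable X]setTI.
  have -> : [set x : 'rV[R]_d | r < sq x] = sq @^-1` `]r, +oo[%classic.
    by apply/seteqP; split => x /=; rewrite in_itv/= andbT.
  exact: msq.
have [r0 [r00 hr]] : exists r0 : R, 0 < r0 /\ fine (nu [set x | r0 < sq x]) <= 1 / 2.
  pose F (n : nat) := [set x : 'rV[R]_d | n%:R < sq x].
  have cF : nu (F n) @[n --> \oo] --> nu (\bigcap_n F n).
    have mF n : measurable (F n) by exact: mset.
    apply: nonincreasing_cvg_mu; [|exact: mF|exact: bigcap_measurableType|].
      apply: (@le_lt_trans _ _ 1%E); [exact: probability_le1|exact: ltey].
    move=> m n mn; apply/subsetPset => x /=; apply: le_lt_trans.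
    by rewrite ler_nat.
  have F0 : \bigcap_n F n = set0.
    apply/seteqP; split => x //= H.
    have : (Num.truncn (sq x)).+1%:R < sq x := H _ I.
    by rewrite ltNge ltW// truncnS_gt.
  rewrite F0 measure0 in cF.
  have cF' : fine (nu (F n)) @[n --> \oo] --> (0 : R) by apply: fine_cvg.
  have : \forall n \near \oo, fine (nu (F n)) <= 1 / 2.
    have half : 0 < 1 / 2 :> R by lra.
    move/cvgrPdist_lt: cF' => /(_ _ half); apply: filterS => n.
    by rewrite sub0r normrN => /ltW; apply: le_trans; exact: ler_norm.
  move=> [N _ HN]; exists N.+1%:R; split => //.
  exact: (HN N.+1 (leqnSn _)).
pose rr := r0 + 1.
pose tail A := [set x : 'rV[R]_d | 2 * rr + 4 * A < sq x].
have tail_le A : 0 < A -> fine (nu (tail A)) <= expR (- (k * A / 2)).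
  move=> A0.
  pose cl (u : R) := Num.min A (Num.max 0 u).
  have clb u : 0 <= cl u <= A.
    by rewrite /cl le_min ge_min lexx le_max lexx (ltW A0).
  have mcl (f : 'rV[R]_d -> R) : measurable_fun setT f -> bmf (fun x => cl (f x)).
    move=> mf; split; last by exists A => x; have /andP[h1 h2] := clb (f x); rewrite ger0_norm.
    by apply: measurable_minr => //; exact: measurable_maxr.
  (* [g] vanishes where [sq x <= r0], a set of measure at least 1/2, so its mean is at most A/2; it
     equals [A] once [sq x] reaches [rr]. [U] equals [A] on [tail A]. The dual inequality then gives
     exp(kA) nu(tail A) <= exp(kA/2). *)
  pose g (x : 'rV[R]_d) := cl (A * (sq x - r0)).
  pose U (x : 'rV[R]_d) := cl ((sq x - 2 * rr) / 4).
  have bg : bmf g by apply: mcl; apply: measurable_funM => //; exact: measurable_funB.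
  have bU : bmf U by apply: mcl; apply: measurable_funM => //; exact: measurable_funB.
  have gA x : g x < A -> sq x < rr.
    rewrite /g /cl gt_min ltxx/= gt_max => /andP[_].
    by rewrite -{2}[A]mulr1 ltr_pM2l// /rr; lra.
  have cg e : 0 < e -> exists C, forall x y, g y <= g x + e + C * sq (x - y).
    (* Where [g x < A], [sq x] is below [rr], so Young's weight [th] turns the quadratic growth of
       [sq] into an error of at most [e]. *)
    move=> e0; pose th := Num.min 1 (e / (A * rr)).
    have rr0 : 0 < rr by rewrite /rr; lra.
    have [th0 th1] : 0 < th /\ th * (A * rr) <= e.
      rewrite /th lt_min ltr01 divr_gt0 ?mulr_gt0//; split => //.
      by rewrite -ler_pdivlMr ?mulr_gt0// ge_min lexx orbT.
    exists (A * (1 + th^-1)) => x y.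
    have q0 := sq_ge0 (x - y).
    have C0 : 0 <= A * (1 + th^-1) * sq (x - y).
      by rewrite mulr_ge0// mulr_ge0 ?addr_ge0 ?invr_ge0 ?(ltW th0)// ltW.
    have /andP[gx0 gxA] := clb (A * (sq x - r0)).
    have /andP[gy0 gyA] := clb (A * (sq y - r0)).
    have [gA'|] := ltP (g x) A; last by rewrite /g /= => ?; rewrite /g in gyA *; lra.
    have sx := gA _ gA'.
    rewrite {1}/g /cl ge_min; apply/orP; right; rewrite ge_max.
    apply/andP; split; first by rewrite /g in gx0 *; lra.
    have : A * (sq x - r0) <= g x.
      rewrite /g /cl le_min le_max lexx orbT andbT.
      move: gA'; rewrite /g /cl gt_min ltxx/= gt_max => /andP[_ ]; exact: ltW.
    have := sqD_young x (y - x) th0; rewrite [x + (y - x)]addrC subrK (sqBC y x) => h1.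
    have h2 : A * sq y <= A * ((1 + th) * sq x + (1 + th^-1) * sq (x - y)).
      by rewrite ler_pM2l.
    have h3 : th * (A * sq x) <= th * (A * rr).
      by rewrite ler_pM2l// ler_pM2l// ltW.
    lra.
  have Ug x y : U x <= g y + sq (x - y) / 2.
    have q0 := sq_ge0 (x - y).
    have /andP[U0 UA] := clb ((sq x - 2 * rr) / 4).
    have /andP[gy0 gyA] := clb (A * (sq y - r0)).
    have [gA'|] := ltP (g y) A; last by rewrite /U /g => ?; lra.
    have sy := gA _ gA'.
    rewrite /U /cl ge_min; apply/orP; right; rewrite ge_max.
    rewrite addr_ge0 ?divr_ge0//=.
    have := sqD_le y (x - y); rewrite [y + (x - y)]addrC subrK => h1.
    by rewrite /g in gy0 *; lra.
  have := T2 bU bg cg Ug => h.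
  have gi : \int[nu]_x g x <= A / 2.
    apply: (@le_trans _ _ (\int[nu]_x (A * \1_([set x | r0 < sq x]) x))).
      apply: Rint_le => //; first by apply: bmfZ; exact: bmf_ind.
      move=> x; rewrite indicE; have /andP[gx0 gxA] := clb (A * (sq x - r0)).
      case: (boolP (x \in _)) => [_|/negP xr]; first by rewrite mulr1.
      rewrite mulr0 /g /cl ge_min ge_max lexx/=; apply/orP; right.
      have : sq x <= r0 by rewrite leNgt; apply/negP => hx; apply: xr; rewrite inE.
      by rewrite pmulr_rle0//; lra.
    rewrite RintZ; last exact: bmf_ind.
    rewrite ler_pM2l//; rewrite /Rintegral integral_indic// setIT.
    by move: hr; rewrite mul1r.
  have bE : bmf (fun x => expR (k * U x)) by apply: bmf_expR; exact: bmfZ.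
  have mt : measurable (tail A) by exact: mset.
  have := @Rint_markov R _ _ nu (fun x => expR (k * U x)) (expR (k * A)) (tail A)
    (expR_gt0 _) bE (fun x => expR_ge0 _) mt _.
  move=> /(_ _)/le_trans/(_ h) mk.
  have {}mk : expR (k * A) * fine (nu (tail A)) <= expR (k * \int[nu]_x g x).
    apply: mk => x; rewrite /tail /= => hx; rewrite ler_expR ler_pM2l// /U /cl.
    by rewrite le_min lexx/= le_max; apply/orP; right; lra.
  have e1 : expR (k * \int[nu]_x g x) <= expR (k * A) * expR (- (k * A / 2)).
    rewrite -expRD ler_expR.
    have : k * \int[nu]_x g x <= k * (A / 2) by rewrite ler_pM2l.
    lra.
  by have := le_trans mk e1; rewrite ler_pM2l ?expR_gt0.
pose q := expR (- (k / 2)).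
have q0 : 0 < q by exact: expR_gt0.
have q1 : q < 1 by rewrite /q -[ltRHS]expR0 ltr_expR oppr_lt0 divr_gt0.
have rr0 : 0 < rr by rewrite /rr; lra.
exists (2 * rr + 4 + 4 * (1 - q)^-1); apply: integral_trunc => //.
  by move=> x; exact: sq_ge0.
(* Raising the truncation level by 4 adds at most 4 times the measure of a tail, and the tails
   decrease geometrically with ratio [q]. *)
have key (n : nat) : \int[nu]_x Num.min (2 * rr + 4 + 4 * n%:R) (sq x) <=
    2 * rr + 4 + 4 * ((1 - q ^+ n) / (1 - q)).
  have bm (m : nat) : bmf (fun x : 'rV[R]_d => Num.min (2 * rr + 4 + 4 * m%:R) (sq x : R)).
    apply: bmf_minc => //; first by move=> x; exact: sq_ge0.
    by rewrite addr_ge0 ?mulr_ge0//; lra.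
  elim: n => [|n IH].
    rewrite (_ : 2 * rr + 4 + 4 * ((1 - q ^+ 0) / (1 - q)) = 2 * rr + 4); last first.
      by rewrite expr0 subrr mul0r mulr0 addr0.
    rewrite -[leRHS](Rint_cst _ nu).
    apply: Rint_le; [exact: bm|exact: bmf_cst|].
    by move=> x; rewrite ge_min; apply/orP; left; rewrite mulr0 addr0.
  apply: (@le_trans _ _ (\int[nu]_x (Num.min (2 * rr + 4 + 4 * n%:R) (sq x) +
      4 * \1_(tail n.+1%:R) x))).
    apply: Rint_le => //; first by apply: bmfD => //; apply: bmfZ; apply: bmf_ind; exact: mset.
    move=> x; rewrite indicE; case: (boolP (x \in tail n.+1%:R)) => [_|/negP xt].
      rewrite mulr1 -natr1 /Num.min; do 2 case: ifP => ?; lra.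
    have hx : sq x <= 2 * rr + 4 * n.+1%:R.
      by rewrite leNgt; apply/negP => hx; apply: xt; rewrite inE.
    rewrite mulr0 addr0 -natr1 /Num.min; rewrite -natr1 in hx; do 2 case: ifP => ?; lra.
  have bt : bmf (\1_(tail n.+1%:R) : _ -> R) by apply: bmf_ind; exact: mset.
  rewrite RintD//; last exact: bmfZ.
  rewrite RintZ// {2}/Rintegral integral_indic//; last exact: mset.
  rewrite setIT.
  have := @tail_le n.+1%:R (ltr0Sn _ _) => ht.
  have -> : (1 - q ^+ n.+1) / (1 - q) = (1 - q ^+ n) / (1 - q) + q ^+ n.
    by rewrite exprS; field; rewrite subr_eq0 gt_eqF.
  have : expR (- (k * n.+1%:R / 2)) <= q ^+ n.
    rewrite /q -expRM_natl ler_expR -[n.+1%:R]natr1.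
    have -> : - (k * (n%:R + 1) / 2) = n%:R * - (k / 2) - k / 2 by field.
    by rewrite gerBl divr_ge0// ltW.
  lra.
move=> n; apply: (@le_trans _ _ (\int[nu]_x Num.min (2 * rr + 4 + 4 * n%:R) (sq x))).
  apply: Rint_le.
  - by apply: bmf_minc => // x; exact: sq_ge0.
  - apply: bmf_minc => //; first by move=> x; exact: sq_ge0.
    by rewrite addr_ge0 ?mulr_ge0//; lra.
  - move=> x; rewrite le_min !ge_min lexx orbT andbT; apply/orP; left.
    have := ler0n R n; lra.
apply: (le_trans (key n)); rewrite lerD2l ler_pM2l// ler_pdivrMr ?subr_gt0//.
by rewrite mulVf ?subr_eq0 ?gt_eqF// lerBlDr lerDl exprn_ge0 ?(ltW q0).
Qed.

End t2_tensor.

(** * Gaussian shifts *)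

Section lebesgue_translation.
Context {R : realType}.

Lemma measurable_addr (a : R) : measurable_fun setT (fun x : R => x + a).
Proof. exact: measurable_funD. Qed.

Lemma lebesgue_translation (a : R) (A : set R) : measurable A ->
  pushforward lebesgue_measure (+%R^~ a : _ -> measurableTypeR R) A =
  lebesgue_measure A.
Proof.
move=> mA; have mh : measurable_fun setT (+%R^~ a : R -> measurableTypeR R).
  exact: measurable_addr.
apply/esym/lebesgue_measure_unique => //= _ [[u v]] _ <-.
rewrite /pushforward.
have -> : (fun x : R => x + a) @^-1` `]u, v] = `]u - a, v - a]%classic.
  by apply/seteqP; split => x /=; rewrite !in_itv/= => /andP[h1 h2]; apply/andP; split; lra.
rewrite !lebesgue_measure_itv /= !lte_fin ltrD2r; case: ifP => // _.
by rewrite -!EFinB; congr EFin; ring.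
Qed.

Lemma integral_lebesgue_translation (a : R) (f : R -> \bar R) :
  measurable_fun setT f -> (forall x, (0 <= f x)%E) ->
  (\int[lebesgue_measure]_x f (x + a)%R = \int[lebesgue_measure]_x f x)%E.
Proof.
move=> mf f0.
transitivity (\int[pushforward lebesgue_measure (+%R^~ a : R -> measurableTypeR R)]_x f x)%E.
  rewrite ge0_integral_pushforward//=; exact: measurable_addr.
apply: eq_measure_integral => [|? A mA _]; first exact: measurable_addr.
exact: lebesgue_translation.
Qed.

End lebesgue_translation.

(** An integrable [p] with these set integrals agrees almost everywhere with the Radon-Nikodym
    derivative, so the change of variables holds with the explicit density. *)
Lemma integral_density d (T : measurableType d) (R : realType)
    (nu : {finite_measure set T -> \bar R})
    (mu : {sigma_finite_measure set T -> \bar R}) (p f : T -> \bar R) :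
  nu `<< mu -> mu.-integrable setT p ->
  (forall A, measurable A -> nu A = (\int[mu]_(x in A) p x)%E) ->
  measurable_fun setT f -> (forall x, (0 <= f x)%E) ->
  (\int[nu]_x f x = \int[mu]_x (f x * p x))%E.
Proof.
move=> numu ip nuE mf f0.
rewrite -(Radon_Nikodym_SigmaFinite.change_of_variables numu f0 measurableT mf).
have iq := Radon_Nikodym_SigmaFinite.f_integrable numu.
apply: ae_eq_integral => //.
- by apply: emeasurable_funM => //; exact: measurable_int iq.
- by apply: emeasurable_funM => //; exact: measurable_int ip.
- apply: ae_eqe_mul2l; apply: integral_ae_eq => //.
    exact: measurable_int ip.
  by move=> A _ mA; rewrite -nuE// -Radon_Nikodym_SigmaFinite.f_integral.
Qed.

Section gaussian.
Context {R : realType}.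
Variable s : R.
Hypothesis s0 : 0 < s.
Local Notation gam := (normal_prob 0 s).
Local Notation p := (normal_pdf 0 s).

Let mp : measurable_fun setT p. Proof. exact: measurable_normal_pdf. Qed.
Let p0 x : 0 <= p x. Proof. exact: normal_pdf_ge0. Qed.

Lemma integral_normal_prob (f : R -> \bar R) : measurable_fun setT f ->
  (forall x, (0 <= f x)%E) ->
  (\int[gam]_x f x = \int[lebesgue_measure]_x (f x * (p x)%:E))%E.
Proof.
move=> mf f0; apply: integral_density => //; first exact: normal_prob_dominates.
exact: integrable_normal_pdf.
Qed.

Let tilt (a z : R) := - (2 * a * z + a ^+ 2) / (2 * s ^+ 2).

Let measurable_mull (b : R) : measurable_fun setT (fun x : R => b * x).
Proof. exact: measurable_funM. Qed.

Let measurable_tilt a : measurable_fun setT (tilt a).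
Proof.
apply: measurable_funM => //; apply: measurableT_comp => //.
by apply: measurable_funD.
Qed.

Let measurable_expM (b : R) : measurable_fun setT (fun x : R => (expR (b * x))%:E).
Proof. by apply/measurable_EFinP; apply: measurableT_comp. Qed.

Let integrable_cst (c : R) : gam.-integrable setT (EFin \o (fun _ : R => c)).
Proof. exact/bmf_integrable/bmf_cst. Qed.

(** The Cameron-Martin formula on the line: Lebesgue measure is translation invariant, and [tilt a]
    is the logarithm of the ratio of the two Gaussian densities. *)
Lemma integral_normal_shift (a : R) (f : R -> R) : measurable_fun setT f ->
  (forall x, 0 <= f x) ->
  (\int[gam]_x (f x)%:E = \int[gam]_x (f (x + a) * expR (tilt a x))%:E)%E.
Proof.
move=> mf f0.
have mt : measurable_fun setT (fun x => expR (tilt a x)).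
  by apply: measurableT_comp.
have mfa : measurable_fun setT (fun x : R => f (x + a)).
  by apply: measurableT_comp => //; exact: measurable_addr.
rewrite integral_normal_prob//; last exact/measurable_EFinP.
rewrite integral_normal_prob; last 2 first.
- exact/measurable_EFinP/measurable_funM.
- by move=> x; rewrite lee_fin mulr_ge0 ?expR_ge0.
rewrite -(integral_lebesgue_translation a); last 2 first.
- apply: emeasurable_funM; exact/measurable_EFinP.
- by move=> x; rewrite mule_ge0// lee_fin.
apply: eq_integral => x _; rewrite -!EFinM; congr EFin.
rewrite -mulrA; congr (_ * _); rewrite /normal_pdf (gt_eqF s0) /normal_fun mulrCA.
congr (_ * _); rewrite -expRD; congr expR; rewrite /tilt.
by field; rewrite gt_eqF.
Qed.

(** The shift formula applied to the constant 1: the total mass of the tilted measure is the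
    generating function up to an explicit factor. *)
Lemma normal_mgf b : (\int[gam]_x (expR (b * x))%:E = (expR (b ^+ 2 * s ^+ 2 / 2))%:E)%E.
Proof.
have := @integral_normal_shift (- b * s ^+ 2) (fun=> 1) (measurable_cst _) (fun=> ler01).
rewrite integral_cst// mul1e [X in X = _](_ : _ = 1%:E); last exact: probability_setT.
move=> H.
have : (1%:E = (expR (- (b ^+ 2 * s ^+ 2 / 2)))%:E * \int[gam]_x (expR (b * x))%:E)%E.
  rewrite H -ge0_integralZl//.
  - apply: eq_integral => x _; rewrite -EFinM mul1r -expRD; congr (expR _)%:E.
    by rewrite /tilt; field; rewrite gt_eqF.
  - exact: measurable_expM.
move=> /(congr1 (mule (expR (b ^+ 2 * s ^+ 2 / 2))%:E)).
by rewrite mule1 muleA -EFinM expRxMexpNx_1 mul1e => <-.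
Qed.

Lemma integrable_normal_exp b : gam.-integrable setT (fun x => (expR (b * x))%:E).
Proof.
apply/integrableP; split.
  exact: measurable_expM.
under eq_integral => x _ do rewrite gee0_abs ?lee_fin ?expR_ge0//.
by rewrite normal_mgf ltry.
Qed.

Lemma pow_le_expR (q : nat) (u : R) : 0 <= u -> u ^+ q <= q%:R ^+ q * expR u.
Proof.
move=> u0; case: q => [|q]; first by rewrite !expr0 mul1r -expR0 ler_expR.
have -> : expR u = expR (u / q.+1%:R) ^+ q.+1.
  by rewrite -expRM_natl; congr expR; field.
rewrite -exprMn lerXn2r ?nnegrE ?mulr_ge0 ?expR_ge0//.
apply: (@le_trans _ _ (q.+1%:R * (u / q.+1%:R))); first by rewrite mulrC divfK.
by rewrite ler_pM2l// (le_trans _ (expR_ge1Dx _))// lerDr.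
Qed.

Lemma normal_moment (q : nat) :
  (\int[gam]_x (`|x| ^+ q)%:E <= (4 * q%:R ^+ q * s ^+ q)%:E)%E.
Proof.
pose C := q%:R ^+ q * s ^+ q.
have C0 : 0 <= C by rewrite mulr_ge0// exprn_ge0// ltW.
apply: (@le_trans _ _ (\int[gam]_x (C%:E * ((expR (s^-1 * x))%:E + (expR (- s^-1 * x))%:E)))%E).
  apply: ge0_le_integral => //.
  - by apply/measurable_EFinP; apply: measurable_funX.
  - apply: emeasurable_funM; first exact: measurable_cst.
    by apply: emeasurable_funD; exact: measurable_expM.
  - move=> x _; rewrite -EFinD -EFinM lee_fin.
    have h := @pow_le_expR q (`|x| / s) (divr_ge0 (normr_ge0 _) (ltW s0)).
    have -> : `|x| ^+ q = s ^+ q * (`|x| / s) ^+ q.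
      by rewrite -exprMn mulrC divfK// gt_eqF.
    apply: (@le_trans _ _ (s ^+ q * (q%:R ^+ q * expR (`|x| / s)))).
      by rewrite ler_pM2l// exprn_gt0.
    rewrite mulrA [s ^+ q * _]mulrC -/C ler_wpM2l//.
    have e1 := expR_ge0 (s^-1 * x); have e2 := expR_ge0 (- s^-1 * x).
    case: (ler0P x) => _; rewrite [_ / s]mulrC; last by lra.
    by rewrite mulrN -mulNr; lra.
rewrite ge0_integralZl//; last 2 first.
- by apply: emeasurable_funD; exact: measurable_expM.
- by move=> x _; rewrite adde_ge0// lee_fin expR_ge0.
rewrite ge0_integralD//; try exact: measurable_expM; try by move=> x _; rewrite lee_fin expR_ge0.
rewrite !normal_mgf -EFinD -EFinM lee_fin.
have -> : 4 * q%:R ^+ q * s ^+ q = C * 4 by rewrite /C; ring.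
have -> : s^-1 ^+ 2 * s ^+ 2 / 2 = 1 / 2 by field; rewrite gt_eqF.
have -> : (- s^-1) ^+ 2 * s ^+ 2 / 2 = 1 / 2 by field; rewrite gt_eqF.
apply: ler_wpM2l => //.
have : expR (1 / 2) <= 2 :> R.
  have := expR_ge1Dx (- (1 / 2) : R); have := expRxMexpNx_1 (1 / 2 : R).
  have := expR_gt0 (1 / 2 : R); nra.
lra.
Qed.

Lemma integrable_normal_pow (q : nat) : gam.-integrable setT (fun x => (x ^+ q)%:E).
Proof.
apply/integrableP; split; first by apply/measurable_EFinP; exact: measurable_funX.
under eq_integral => x _ do rewrite abse_EFin normrX.
by rewrite (le_lt_trans (normal_moment q))// ltry.
Qed.

(** Since 1 + b x <= exp(b x), the generating function gives b times the mean at most b^2 s^2 for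
    small [b] of either sign. Dividing by [b] and letting it tend to 0 from each side gives both
    inequalities. *)
Lemma normal_mean : \int[gam]_x x = 0.
Proof.
have i1 := integrable_normal_pow 1.
have iZ b : gam.-integrable setT (fun x => (b * x)%:E).
  by under eq_fun do rewrite EFinM; exact: integrableZl.
have key b : `|b| * s <= 1 -> b * \int[gam]_x x <= b ^+ 2 * s ^+ 2.
  move=> bs.
  have e1 : \int[gam]_x expR (b * x) = expR (b ^+ 2 * s ^+ 2 / 2).
    by rewrite /Rintegral normal_mgf.
  have : \int[gam]_x (1 + b * x) <= \int[gam]_x expR (b * x).
    apply: le_Rintegral => //.
    - rewrite /comp; under eq_fun do rewrite EFinD.
      by apply: integrableD => //; exact: integrable_cst.
    - exact: integrable_normal_exp.
    - by move=> x _; exact: expR_ge1Dx.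
  have -> : \int[gam]_x (1 + b * x) = 1 + b * \int[gam]_x x.
    rewrite -[X in _ = X + _](Rint_cst 1 gam) -RintegralZl//.
    by apply: RintegralD => //; first [exact: integrable_cst|exact: iZ].
  rewrite e1.
  have u1 : b ^+ 2 * s ^+ 2 <= 1.
    rewrite -real_normK ?num_real// -exprMn expr_le1// mulr_ge0//; exact: ltW.
  have u0 : 0 <= b ^+ 2 * s ^+ 2 by rewrite mulr_ge0 ?sqr_ge0.
  move: (b ^+ 2 * s ^+ 2) u0 u1 => u u0 u1.
  have h1 := expR_ge1Dx (- (u / 2)); have h2 := expRxMexpNx_1 (u / 2).
  have h3 := expR_gt0 (u / 2).
  have : expR (u / 2) <= 1 + u.
    have : expR (u / 2) * (1 - u / 2) <= 1 by nra.
    nra.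
  by move=> h4 h5; lra.
apply/eqP; rewrite eq_le; apply/andP; split.
  apply/ler_addgt0Pr => e e0; rewrite add0r.
  pose b := Num.min s^-1 (e / s ^+ 2).
  have b0 : 0 < b by rewrite lt_min invr_gt0 s0 divr_gt0// exprn_gt0.
  have b1 : `|b| * s <= 1 by rewrite gtr0_norm// -ler_pdivlMr// mul1r ge_min lexx.
  have := key _ b1; rewrite expr2 -mulrA ler_pM2l// => /le_trans; apply.
  by rewrite -ler_pdivlMr ?exprn_gt0// ge_min lexx orbT.
rewrite -oppr_le0; apply/ler_addgt0Pr => e e0; rewrite add0r.
pose b := Num.min s^-1 (e / s ^+ 2).
have b0 : 0 < b by rewrite lt_min invr_gt0 s0 divr_gt0// exprn_gt0.
have b1 : `|- b| * s <= 1 by rewrite normrN gtr0_norm// -ler_pdivlMr// mul1r ge_min lexx.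
have := key _ b1; rewrite sqrrN mulNr -mulrN expr2 -mulrA ler_pM2l// => /le_trans; apply.
by rewrite -ler_pdivlMr ?exprn_gt0// ge_min lexx orbT.
Qed.

(** The one-dimensional change of measure. The relative entropy between a Gaussian and its translate
    by [a] is a^2 / 2s^2, which appears here as minus the mean of [tilt a]; Jensen's inequality does
    the rest. *)
Lemma normal_shift_entropy (a : R) (f : R -> R) : bmf f ->
  \int[gam]_x f (x + a) <= ln (\int[gam]_x expR (f x)) + a ^+ 2 / (2 * s ^+ 2).
Proof.
move=> bf; have bfa : bmf (fun x : R => f (x + a)) by apply: bmf_comp bf _; exact: measurable_addr.
pose g x := f (x + a) + tilt a x.
have mg : measurable_fun setT g by apply: measurable_funD => //; exact: bmf_meas.
have E : \int[gam]_x expR (f x) = \int[gam]_x expR (g x).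
  rewrite /Rintegral (integral_normal_shift a (f := fun x => expR (f x))).
  - by congr fine; apply: eq_integral => x _; rewrite -expRD.
  - exact: (bmf_meas (bmf_expR bf)).
  - by move=> x; exact: expR_ge0.
have it : gam.-integrable setT (EFin \o tilt a).
  rewrite (_ : _ \o _ = (fun x => (- (a / s ^+ 2) * x)%:E - (a ^+ 2 / (2 * s ^+ 2))%:E)%E).
    apply: integrableB => //; last exact: integrable_cst.
    by under eq_fun do rewrite EFinM; apply: integrableZl => //; exact: (integrable_normal_pow 1).
  apply/funext => x /=; rewrite -EFinB; congr EFin; rewrite /tilt; field.
  by rewrite gt_eqF.
have tE : \int[gam]_x tilt a x = - (a ^+ 2 / (2 * s ^+ 2)).
  transitivity (\int[gam]_x (- (a / s ^+ 2) * x - (a ^+ 2 / (2 * s ^+ 2)))).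
    by apply: eq_Rintegral => x _; rewrite /tilt; field; rewrite gt_eqF.
  have ix := integrable_normal_pow 1.
  rewrite RintegralB//; last first.
    by rewrite /comp; under eq_fun do rewrite EFinM; exact: integrableZl.
  by rewrite Rint_cst RintegralZl// normal_mean mulr0 sub0r.
have ig : gam.-integrable setT (EFin \o g).
  rewrite /comp /g; under eq_fun do rewrite EFinD.
  by apply: integrableD => //; exact: bmf_integrable.
have ieg : gam.-integrable setT (fun x => (expR (g x))%:E).
  apply/integrableP; split.
    by apply/measurable_EFinP; exact: measurableT_comp.
  under eq_integral => x _ do rewrite gee0_abs ?lee_fin ?expR_ge0//.
  under eq_integral => x _ do rewrite expRD.
  rewrite -(integral_normal_shift a (f := fun x => expR (f x))).
  - by rewrite -EFin_Rint ?ltry//; exact: bmf_expR.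
  - exact: (bmf_meas (bmf_expR bf)).
  - by move=> x; exact: expR_ge0.
set m := \int[gam]_x g x.
have mE : m = \int[gam]_x f (x + a) - a ^+ 2 / (2 * s ^+ 2).
  rewrite /m RintegralD//; last exact: bmf_integrable.
  by rewrite tE.
rewrite -lerBlDr -mE -[leLHS]expRK ler_ln ?posrE ?expR_gt0//; last exact: Rint_expR_gt0.
rewrite E.
(* Jensen's inequality through the tangent line at [m], carried out by hand because [tilt a] makes
   [g] unbounded. *)
have -> : expR m = \int[gam]_x (expR m * (g x + (1 - m))).
  rewrite RintegralZl//; last first.
    rewrite /comp; under eq_fun do rewrite EFinD.
    by apply: integrableD => //; exact: integrable_cst.
  rewrite RintegralD//.
  by rewrite Rint_cst -/m addrC subrK mulr1.
apply: le_Rintegral => //.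
  rewrite /comp; under eq_fun do rewrite EFinM; apply: integrableZl => //.
  rewrite /comp; under eq_fun do rewrite EFinD.
  by apply: integrableD => //; exact: integrable_cst.
move=> x _; rewrite -[g x in leRHS](subrK m) [_ + m]addrC expRD ler_pM2l ?expR_gt0//.
by rewrite (le_trans _ (expR_ge1Dx _))//; lra.
Qed.

End gaussian.

Section shift_tensor.
Context {R : realType} {d : measure_display} {T : measurableType d}.
Variables (A : Type) (sh : A -> T -> T) (co : A -> R) (g : probability T R).
Hypothesis msh : forall a, measurable_fun setT (sh a).
Hypothesis shift : forall (f : T -> R) a, bmf f ->
  \int[g]_z f (sh a z) <= ln (\int[g]_z expR (f z)) + co a.

Definition tuple_shift n (a : 'I_n -> A) (z : n.-tuple T) : n.-tuple T :=
  [tuple sh (a i) (tnth z i) | i < n].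

Lemma measurable_tuple_shift n (a : 'I_n -> A) : measurable_fun setT (tuple_shift a).
Proof.
apply: measurable_mktuple => i; apply: (measurableT_comp (msh (a i))).
exact: measurable_tnth.
Qed.

(** The log-Laplace transform in the first coordinate becomes the test function for the remaining
    ones, so the costs add. It is used twice: over the coordinates of one noise vector, then over
    the particles. *)
Lemma shift_tensor n (f : n.-tuple T -> R) a : bmf f ->
  \int[prod_power g n]_z f (tuple_shift a z) <=
  ln (\int[prod_power g n]_z expR (f z)) + \sum_i co (a i).
Proof.
elim: n f a => [|n IH] f a bf.
  rewrite !Rint_prod_power0 big_ord0 addr0 expRK.
  by rewrite (_ : tuple_shift _ _ = [tuple])//; exact: tuple0.
have bfa : bmf (fun z => f (tuple_shift a z)) by apply: bmf_comp bf _; exact: measurable_tuple_shift.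
have be := bmf_expR bf.
pose h y := ln (\int[g]_x expR (f (tuple_cons (x, y)))).
have [B B0 fB] := bmf_bound bf.
have JB y : expR (- B) <= \int[g]_x expR (f (tuple_cons (x, y))).
  rewrite -[leLHS](Rint_cst _ g); apply: Rint_le; first exact: bmf_cst.
    by apply: bmf_expR; exact: bmf_cons1.
  by move=> x; rewrite ler_expR lerNl (le_trans (ler_norm _))// normrN.
have bh : bmf h by apply: (bmf_ln (expR_gt0 _) JB); exact: bmf_cons_int be.
pose a' (i : 'I_n) := a (lift ord0 i).
have shE x y : tuple_shift a (tuple_cons (x, y)) =
    tuple_cons (sh (a ord0) x, tuple_shift a' y).
  apply: eq_from_tnth => i; rewrite tnth_mktuple.
  case: (unliftP ord0 i) => [j ->|->]; last by rewrite /tuple_cons !tnth0.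
  by rewrite !tnth_consS tnth_mktuple.
rewrite Rint_prod_powerSr// Rint_prod_powerSr// big_ord_recl.
apply: (@le_trans _ _ (\int[prod_power g n]_y (h (tuple_shift a' y) + co (a ord0)))).
  have bh' : bmf (fun y => h (tuple_shift a' y)).
    by apply: bmf_comp bh _; exact: measurable_tuple_shift.
  apply: Rint_le.
  - exact: bmf_cons_int bfa.
  - by apply: bmfD => //; exact: bmf_cst.
  - move=> y; rewrite /h.
    under eq_Rintegral do rewrite shE.
    by apply: (shift (f := fun x => f (tuple_cons (x, tuple_shift a' y)))); exact: bmf_cons1.
rewrite RintD ?Rint_cst; [|by apply: bmf_comp bh _; exact: measurable_tuple_shift|exact: bmf_cst].
rewrite addrA addrAC lerD2r; apply: (le_trans (IH h a' bh)).
rewrite le_eqVlt; apply/orP; left; apply/eqP; congr (ln _ + _).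
by apply: eq_Rintegral => y _; rewrite /h lnK// posrE (lt_le_trans _ (JB y))// expR_gt0.
Qed.

End shift_tensor.

(** * Implicit Euler steps *)

Section one_sided_minimum.
Context {R : realType}.

Lemma derive_ge0_right_min (f : R -> R) p e : 0 < e -> is_derive (0 : R) 1 f p ->
  (forall t, 0 < t -> t < e -> f 0 <= f t) -> 0 <= p.
Proof.
move=> e0 [df <-] fmin; rewrite leNgt; apply/negP => D0.
have : h^-1 *: ((f \o shift 0) (h *: 1) - f 0) @[h --> (0 : R)^'] --> 'D_1 f 0 by exact: df.
move=> /cvgrPdist_lt /(_ (- 'D_1 f 0)); rewrite oppr_gt0 => /(_ D0).
rewrite /dnbhs /within /= => /nbhs_ballP[r /= r0 hr].
pose t := Num.min e r / 2.
have t0 : 0 < t by rewrite divr_gt0// lt_min e0.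
have [te tr] : t < e /\ t < r.
  have : Num.min e r <= e by rewrite ge_min lexx.
  have : Num.min e r <= r by rewrite ge_min lexx orbT.
  have : 0 < Num.min e r by rewrite lt_min e0.
  by rewrite /t; move: (Num.min e r) => u; lra.
have := hr t; rewrite /ball /= sub0r normrN gtr0_norm// => /(_ tr).
rewrite gt_eqF// => /(_ isT); rewrite addr0 [t *: 1]mulr1.
have : 0 <= t^-1 *: (f t - f 0).
  by rewrite mulr_ge0 ?invr_ge0 ?(ltW t0)// subr_ge0 fmin.
move: (_ *: _) => u u0; rewrite ltr_norml => /andP[]; lra.
Qed.

Lemma derive_le0_left_min (f : R -> R) p e : 0 < e -> is_derive (0 : R) 1 f p ->
  (forall t, - e < t -> t < 0 -> f 0 <= f t) -> p <= 0.
Proof.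
move=> e0 df fmin; rewrite -oppr_ge0.
have D : is_derive (0 : R) 1 (fun t => f (- t)) (- p).
  have D1 : is_derive (0 : R) 1 (fun t : R => - t) (- 1) by exact: is_deriveN.
  rewrite -mulrN1; apply: (@is_derive1_comp _ f (fun t => - t)) => //.
  by rewrite oppr0.
apply: (derive_ge0_right_min e0 D) => t t0 te; rewrite oppr0.
by apply: fmin; lra.
Qed.

End one_sided_minimum.

Section resolvent.
Context {R : realType} {d : nat}.
Variables (V : 'rV[R]_d -> R) (lam : R).
Hypotheses (sV : smooth V) (lam0 : 0 <= lam).
Hypothesis monV : forall x y,
  lam * sq (x - y) <= dotv (grad V x - grad V y) (x - y).

(* The minimizer of [V + |. - z|^2 / 2h] over a large cube satisfies
   [p_i y_i <= 0] for each partial derivative [p_i]; by monotonicity it is then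
   interior. *)
Lemma resolvent_exists h (z : 'rV[R]_d) : 0 < h ->
  exists y, y + h *: grad V y = z.
Proof.
move=> h0; pose w := z - h *: grad V 0.
pose r := sq w + 1.
have r0 : 0 < r by rewrite ltr_wpDl ?sq_ge0.
pose K := [set y : 'rV[R]_d | forall i, `[- r, r]%classic (y ord0 i)].
have cK : compact K.
  by apply: (@rV_compact R d (fun=> `[- r, r]%classic)) => i; exact: segment_compact.
have K0 : K !=set0.
  by exists 0 => i; rewrite /= mxE in_itv/=; apply/andP; split; lra.
pose Psi y := V y + (2 * h)^-1 * sq (y - z).
have sPsi : smooth Psi.
  move=> k; apply: class_C_add; first exact: sV.
  by apply: class_C_mul; [exact: class_C_cst|exact: class_C_sq].
have cPsi : {within K, continuous Psi}.
  by apply: continuous_subspaceT; exact: smooth_continuous.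
have [y /set_mem Ky ymin] := EVT_min_rV K0 cK cPsi.
have gPsi i : is_derive y (basis_vec R i) Psi (grad V y 0 i + h^-1 * (y - z) 0 i).
  have D1 := smooth_grad_derive y i sV.
  have Dj (j : 'I_d) : is_derive y (basis_vec R i)
      (fun x : 'rV[R]_d => (x 0 j - z 0 j) ^+ 2) (2 * (y 0 j - z 0 j) * (j == i)%:R).
    have D2 : is_derive y (basis_vec R i) (fun x : 'rV[R]_d => x 0 j - z 0 j) (j == i)%:R.
      by apply: (is_derive_eq (is_deriveB (is_derive_coord y i j) (is_derive_cst _ _ _))); rewrite subr0.
    under eq_fun do rewrite expr2.
    apply: (is_derive_eq (is_deriveM D2 D2)); rewrite /GRing.scale/=; ring.
  have D2 : is_derive y (basis_vec R i) (fun x => sq (x - z)) (2 * (y - z) 0 i).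
    rewrite (_ : (fun x => _) = \sum_j (fun x : 'rV[R]_d => (x 0 j - z 0 j) ^+ 2)); last first.
      by apply/funext => u; rewrite fct_sumE sqE; apply: eq_bigr => j _; rewrite !mxE.
    apply: (is_derive_eq (is_derive_sum Dj)).
    rewrite (bigD1 i)//= eqxx big1 ?addr0 ?mulr1 ?mxE// => j /negbTE ->.
    by rewrite mulr0.
  apply: is_deriveD.
  apply: (is_derive_eq (is_deriveM (is_derive_cst _ _ _) D2)).
  transitivity ((2 * h)^-1 * (2 * (y - z) 0 i) + sq (y - z) * 0); first by [].
  by rewrite mulr0 addr0; field; rewrite gt_eqF.
pose p i := grad V y 0 i + h^-1 * (y - z) 0 i.
pose line i (t : R) := Psi (t *: basis_vec R i + y).
have dline i : is_derive (0 : R) 1 (line i) (p i).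
  by have := gPsi i; rewrite is_derive_line.
have line0 i : line i 0 = Psi y by rewrite /line scale0r add0r.
have Kline i t : - r <= y 0 i + t -> y 0 i + t <= r -> Psi y <= line i t.
  move=> t1 t2; apply: ymin; apply/mem_set => j /=; rewrite in_itv/= !mxE eqxx/=.
  have := Ky j; rewrite /= in_itv/=.
  case: (eqVneq j i) => [->|_] /= kj; first by rewrite mulr1 addrC t1.
  by rewrite mulr0 add0r.
have p_le i : - r < y 0 i -> p i <= 0.
  move=> yi; have e0 : 0 < y 0 i + r by lra.
  apply: (derive_le0_left_min e0 (dline i)) => t t1 t2; rewrite line0.
  have := Ky i; rewrite /= in_itv/= => /andP[k1 k2].
  by apply: Kline; lra.
have p_ge i : y 0 i < r -> 0 <= p i.
  move=> yi; have e0 : 0 < r - y 0 i by lra.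
  apply: (derive_ge0_right_min e0 (dline i)) => t t1 t2; rewrite line0.
  have := Ky i; rewrite /= in_itv/= => /andP[k1 k2].
  by apply: Kline; lra.
(* A positive coordinate is away from the face at [- r] and can be decreased, which forces
   [p i <= 0]; symmetrically for a negative one. So the sign holds even on the faces. *)
have py i : p i * y 0 i <= 0.
  have [yi|yi|->] := ltrgtP (y 0 i) 0; last by rewrite mulr0.
    by rewrite mulr_ge0_le0 ?(ltW yi)// p_ge//; lra.
  by rewrite mulr_le0_ge0 ?(ltW yi)// p_le//; lra.
have dpy : dotv (grad V y) y + h^-1 * dotv (y - z) y <= 0.
  rewrite /dotv mulr_sumr -big_split/=; apply: sumr_le0 => i _.
  by have := py i; rewrite /p mulrDl mulrA.
have yw : sq y <= sq w.
  have := monV y 0; rewrite subr0 dotvBl => hm.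
  have hs := sq_ge0 y; have ls : 0 <= lam * sq y by rewrite mulr_ge0.
  have : dotv (y - z) y <= - h * dotv (grad V 0) y.
    have : h * (dotv (grad V y) y + h^-1 * dotv (y - z) y) <= 0 by rewrite pmulr_rle0.
    rewrite mulrDr mulrA divff ?gt_eqF// mul1r.
    have : h * dotv (grad V 0) y <= h * dotv (grad V y) y by rewrite ler_pM2l//; lra.
    by lra.
  rewrite dotvBl -/(sq y) => h3.
  have := @dotv_young _ _ 1 w y ltr01; rewrite /w dotvBl dotvZl invr1 -/w; lra.
have yr i : `|y 0 i| < r.
  have := sq_coord y i; have := sq_ge0 w; rewrite -(real_normK (num_real (y 0 i))) /r.
  move: yw; move: `|y 0 i| (normr_ge0 (y 0 i)) (sq y) (sq w) => a a0 b c; nra.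
exists y; apply/rowP => i; rewrite !mxE.
have := yr i; rewrite ltr_norml => /andP[y1 y2].
have : p i = 0 by apply/eqP; rewrite eq_le p_le// p_ge.
rewrite /p !mxE => pi0.
have : h * ('D_(basis_vec R i) V y + h^-1 * (y 0 i - z 0 i)) = 0 by rewrite pi0 mulr0.
rewrite mulrDr mulrA divff ?gt_eqF// mul1r; lra.
Qed.

(** The inverse of the identity plus [h] times the monotone operator [grad V]. For [0 < h] a
    solution exists and the default 0 is never returned in its place. *)
Definition resolvent h (z : 'rV[R]_d) : 'rV[R]_d := xget 0 [set y | y + h *: grad V y = z].

Lemma resolventE h z : 0 < h -> resolvent h z + h *: grad V (resolvent h z) = z.
Proof.
move=> h0; have [y hy] := resolvent_exists z h0.
by rewrite /resolvent; case: xgetP => [u ->//|/(_ y)]; rewrite /= hy.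
Qed.

(** Expanding the square of [u - v] leaves a cross term, bounded below by monotonicity, and a
    nonnegative square. The estimate is insensitive to the size of [grad V] and to that of the step:
    this is why [V] is treated implicitly. *)
Lemma resolvent_contract h u v : 0 < h ->
  (1 + 2 * h * lam) * sq (resolvent h u - resolvent h v) <= sq (u - v).
Proof.
move=> h0; rewrite -[X in _ <= sq (X - _)](resolventE u h0) -[X in _ <= sq (_ - X)](resolventE v h0).
move: (resolvent h u) (resolvent h v) => x y.
have -> : x + h *: grad V x - (y + h *: grad V y) =
    (x - y) + h *: (grad V x - grad V y).
  by rewrite scalerBr opprD addrACA.
rewrite [X in _ <= X]sqD sqZ !dotvZr dotvC.
have := monV x y; have := sq_ge0 (grad V x - grad V y); move=> g0 m.
have : h * (lam * sq (x - y)) <= h * dotv (grad V x - grad V y) (x - y).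
  by rewrite ler_pM2l.
have : 0 <= h ^+ 2 * sq (grad V x - grad V y) by rewrite mulr_ge0 ?sqr_ge0.
lra.
Qed.

(** Uniqueness, by monotonicity. It presents an arbitrary point as a value of the resolvent, so that
    exact solutions and reference points can be compared with the scheme through
    [resolvent_contract]. *)
Lemma resolvent_fix h y : 0 < h -> resolvent h (y + h *: grad V y) = y.
Proof.
move=> h0; apply/eqP; rewrite -subr_eq0; apply/eqP; apply: sq_eq0.
have := resolventE (y + h *: grad V y) h0; set x := resolvent _ _ => e.
have := monV x y; have hs := sq_ge0 (x - y); have ls : 0 <= lam * sq (x - y) by rewrite mulr_ge0.
have : x - y = - h *: (grad V x - grad V y).
  apply/rowP => i; have := congr1 (fun w : 'rV[R]_d => w 0 i) e; rewrite !mxE; lra.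
move=> e2 m; have : sq (x - y) = - h * dotv (grad V x - grad V y) (x - y).
  by rewrite {1}/sq {1}e2 dotvZl.
have : 0 <= h * dotv (grad V x - grad V y) (x - y) by rewrite mulr_ge0 ?(ltW h0)// (le_trans ls).
by move=> h5 h6; lra.
Qed.

End resolvent.

Section noise.
Context {R : realType} {d : nat}.
Variable s : R.
Hypothesis s0 : 0 < s.

Let measurable_idR : measurable_fun setT (id : measurableTypeR R -> R).
Proof. by move=> _ A mA; rewrite setTI. Qed.

(** The normal law carried by the identity from [measurableTypeR R] to [R], so that its product
    powers can be formed. *)
Definition gauss1 : probability R R := law (normal_prob 0 s) measurable_idR.

Lemma Rint_gauss1 f : bmf f -> \int[gauss1]_x f x = \int[normal_prob 0 s]_x f x.
Proof. exact: (has_law_Rint (has_law_law (normal_prob 0 s) measurable_idR)). Qed.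

Definition noise1 : probability (d.-tuple R) R := prod_power gauss1 d.
Definition noise N : probability (N.-tuple (d.-tuple R)) R := prod_power noise1 N.

Definition row_of (z : d.-tuple R) : 'rV[R]_d := \row_j tnth z j.

Lemma measurable_row_of : measurable_fun setT row_of.
Proof.
apply: measurable_rV => i; under eq_fun do rewrite mxE.
exact: measurable_tnth.
Qed.

Definition noise_shift N (a : 'I_N -> 'rV[R]_d) (z : N.-tuple (d.-tuple R)) :
    N.-tuple (d.-tuple R) :=
  tuple_shift (fun (b : 'rV[R]_d) (u : d.-tuple R) =>
    tuple_shift (fun c x : R => x + c) (fun j => b 0 j) u) a z.

Let measurable_shift1 (b : 'rV[R]_d) :
  measurable_fun setT (fun u : d.-tuple R =>
    tuple_shift (fun c x : R => x + c) (fun j => b 0 j) u).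
Proof. apply: measurable_tuple_shift => c; exact: measurable_addr. Qed.

Lemma measurable_noise_shift N (a : 'I_N -> 'rV[R]_d) :
  measurable_fun setT (noise_shift a).
Proof. exact: measurable_tuple_shift. Qed.

Lemma noise_shiftE N (a : 'I_N -> 'rV[R]_d) z i :
  row_of (tnth (noise_shift a z) i) = row_of (tnth z i) + a i.
Proof. by apply/rowP => j; rewrite !mxE !tnth_mktuple. Qed.

Lemma noise_shift_entropy N (a : 'I_N -> 'rV[R]_d) (f : N.-tuple (d.-tuple R) -> R) :
  bmf f -> \int[noise N]_z f (noise_shift a z) <=
    ln (\int[noise N]_z expR (f z)) + (\sum_i sq (a i)) / (2 * s ^+ 2).
Proof.
move=> bf; apply: (le_trans (shift_tensor
  (co := fun b : 'rV[R]_d => \sum_j b 0 j ^+ 2 / (2 * s ^+ 2)) _ _ a bf)) => //.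
- move=> h b bh.
  apply: (shift_tensor (co := fun c : R => c ^+ 2 / (2 * s ^+ 2))) => //.
    by move=> c; exact: measurable_addr.
  move=> k c bk; rewrite !Rint_gauss1; [exact: normal_shift_entropy|exact: bmf_expR|].
  apply: bmf_comp bk _; exact: measurable_addr.
- rewrite lerD2l mulr_suml; apply: ler_sum => i _.
  by rewrite sqE mulr_suml.
Qed.

End noise.

Section scheme.
Context {R : realType} {d N : nat}.
Local Notation rV := 'rV[R]_d.
Local Notation E := (N.-tuple rV).
Variables (gW J : rV -> rV) (L lamV lamW h : R).
Hypotheses (h0 : 0 < h) (L0 : 0 <= L) (lamV0 : 0 <= lamV).
Hypothesis cW : continuous gW.
Hypothesis oddW : forall x, gW (- x) = - gW x.
Hypothesis lipW : forall x y, sq (gW x - gW y) <= L * sq (x - y).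
Hypothesis monW : forall x y, lamW * sq (x - y) <= dotv (gW x - gW y) (x - y).
Hypothesis J_contract : forall u v,
  (1 + 2 * h * lamV) * sq (J u - J v) <= sq (u - v).
Hypothesis mJ : measurable_fun setT J.

Definition KN (x : E) (i : 'I_N) : rV :=
  N%:R^-1 *: \sum_j gW (tnth x i - tnth x j).

(** The constants are those of the interaction: an average of translates of [gW] inherits both,
    which makes every field of the limit equation admissible. *)
Definition field_ok (K : rV -> rV) := [/\ measurable_fun setT K,
  (forall x y, sq (K x - K y) <= L * sq (x - y)) &
  (forall x y, lamW * sq (x - y) <= dotv (K x - K y) (x - y))].

(** The squared distance between the empirical interaction and a mean field: the only discrepancy
    between the two drifts at a common configuration. *)
Definition fluct (K : rV -> rV) (y : E) : R :=
  \sum_i sq (KN y i - K (tnth y i)).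

(** Implicit in the confinement through [J], explicit in the Lipschitz interaction. *)
Definition step (x : E) (z : N.-tuple (d.-tuple R)) : E :=
  [tuple J (tnth x i - h *: KN x i + Num.sqrt 2 *: row_of (tnth z i)) | i < N].

Definition step1 (K : rV -> rV) (y : rV) (z : d.-tuple R) : rV :=
  J (y - h *: K y + Num.sqrt 2 *: row_of z).

Definition bstep K (y : E) (z : N.-tuple (d.-tuple R)) : E :=
  [tuple step1 K (tnth y i) (tnth z i) | i < N].

Local Notation Gam := (@noise R d (Num.sqrt h) N).

Definition Top (f : E -> R) x : R := \int[Gam]_z f (step x z).
Definition Tbar K (f : E -> R) y : R := \int[Gam]_z f (bstep K y z).

(** The field changes from one step to the next with the law of the limit process; the head of the
    list is the field of the first step. *)
Fixpoint Ubar (ks : seq (rV -> rV)) (f : E -> R) : E -> R :=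
  if ks is K :: ks' then Tbar K (Ubar ks' f) else f.

Let lamM := Num.min lamW 0.

Lemma fluct_ge0 K y : 0 <= fluct K y.
Proof. by apply: sumr_ge0 => i _; exact: sq_ge0. Qed.

Let sum_sq_weight (x : 'I_N -> rV) (i : 'I_N) :
  sq (N%:R^-1 *: \sum_j x j) <= N%:R^-1 * \sum_j sq (x j).
Proof.
rewrite scaler_sumr mulr_sumr; apply: sq_sum_le => [j|].
  by rewrite invr_ge0.
rewrite sumr_const card_ord -[X in X <= _]mulr_natl divff//.
by rewrite pnatr_eq0 -lt0n (leq_ltn_trans _ (ltn_ord i)).
Qed.

Let double_sumD (c : R) (a : 'I_N -> R) :
  \sum_i \sum_j c * (a i + a j) = 2 * c * N%:R * \sum_i a i.
Proof.
transitivity (\sum_i (N%:R * (c * a i) + c * \sum_j a j)).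
  apply: eq_bigr => i _; rewrite -mulr_sumr big_split /= sumr_const card_ord.
  by rewrite -[a i *+ N]mulr_natl; move: (N%:R : R) (\sum_j a j) => n s; ring.
rewrite big_split /= sumr_const card_ord -[(c * _) *+ N]mulr_natl -!mulr_sumr.
by move: (N%:R : R) (\sum_j a j) => n s; ring.
Qed.

(** Convexity bounds the square of an empirical average by an average over pairs. The factor 4 comes
    from sq(a - b) <= 2 sq a + 2 sq b, summed over both indices. *)
Lemma KN_lip (x y : E) : \sum_i sq (KN x i - KN y i) <= 4 * L * dist2 x y.
Proof.
pose z i := tnth x i - tnth y i.
have h1 i : sq (KN x i - KN y i) <= N%:R^-1 * \sum_j (2 * L * (sq (z i) + sq (z j))).
  rewrite /KN -scalerBr -sumrB; apply: (le_trans (sum_sq_weight _ i)).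
  rewrite ler_wpM2l ?invr_ge0//; apply: ler_sum => j _.
  apply: (le_trans (lipW _ _)).
  have -> : tnth x i - tnth x j - (tnth y i - tnth y j) = z i - z j.
    by rewrite /z; apply/rowP => k; rewrite !mxE; ring.
  rewrite -mulrA mulrCA; apply: ler_wpM2l => //.
  by have := sqB_le (z i) (z j); lra.
apply: (@le_trans _ _ (\sum_i N%:R^-1 * \sum_j (2 * L * (sq (z i) + sq (z j))))).
  by apply: ler_sum => i _; exact: h1.
have -> : dist2 x y = \sum_i sq (z i) by [].
rewrite -mulr_sumr double_sumD.
set S := \sum_i sq (z i).
have S0 : 0 <= S by apply: sumr_ge0 => i _; exact: sq_ge0.
case: (posnP N) => [N0|N0].
  rewrite [in N%:R^-1]N0 invr0 mul0r mulr_ge0 ?mulr_ge0//.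
have : N%:R != 0 :> R by rewrite pnatr_eq0 -lt0n.
move: (N%:R : R) => n n0.
by rewrite le_eqVlt; apply/orP; left; apply/eqP; field.
Qed.

(** Oddness symmetrises the double sum into half the sum of the products with [z i - z j], where
    monotonicity applies. The squares of these differences miss the translations common to all
    particles, so a positive constant would be lost: hence the minimum of [lamW] with 0. *)
Lemma KN_mon (x y : E) :
  lamM * dist2 x y <= \sum_i dotv (KN x i - KN y i) (tnth x i - tnth y i).
Proof.
pose z i := tnth x i - tnth y i.
pose a i j := gW (tnth x i - tnth x j) - gW (tnth y i - tnth y j).
have aN i j : a j i = - a i j.
  rewrite /a -(opprB (tnth x i)) -(opprB (tnth y i)) !oddW.
  by rewrite opprB addrC opprK.
have E1 i : dotv (KN x i - KN y i) (z i) = N%:R^-1 * \sum_j dotv (a i j) (z i).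
  by rewrite /KN -scalerBr -sumrB dotvZl dotv_sum.
have -> : \sum_i dotv (KN x i - KN y i) (tnth x i - tnth y i) =
    N%:R^-1 * \sum_i \sum_j dotv (a i j) (z i).
  by rewrite mulr_sumr; apply: eq_bigr => i _; exact: E1.
have S2 : \sum_i \sum_j dotv (a i j) (z i) =
    2^-1 * \sum_i \sum_j dotv (a i j) (z i - z j).
  have S3 : \sum_i \sum_j dotv (a i j) (z i) = \sum_i \sum_j dotv (a i j) (- z j).
    rewrite exchange_big; apply: eq_bigr => i _; apply: eq_bigr => j _.
    by rewrite aN dotvNl dotvNr.
  have -> : \sum_i \sum_j dotv (a i j) (z i - z j) =
     \sum_i \sum_j dotv (a i j) (z i) + \sum_i \sum_j dotv (a i j) (- z j).
    rewrite -big_split; apply: eq_bigr => i _; rewrite -big_split; apply: eq_bigr => j _.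
    by rewrite /= dotvDr.
  by rewrite -S3; lra.
rewrite S2.
have l1 i j : lamM * sq (z i - z j) <= dotv (a i j) (z i - z j).
  have -> : z i - z j = (tnth x i - tnth x j) - (tnth y i - tnth y j).
    by rewrite /z; apply/rowP => k; rewrite !mxE; ring.
  apply: le_trans (monW _ _); apply: ler_wpM2r; first exact: sq_ge0.
  by rewrite /lamM ge_min lexx.
have l2 : \sum_i \sum_j sq (z i - z j) <= 2 * N%:R * \sum_i sq (z i).
  have -> : \sum_i \sum_j sq (z i - z j) =
     2 * N%:R * (\sum_i sq (z i)) - 2 * sq (\sum_i z i).
    have -> : sq (\sum_i z i) = \sum_i \sum_j dotv (z i) (z j).
      rewrite /sq dotv_sum; apply: eq_bigr => i _; rewrite dotvC dotv_sum.
      by apply: eq_bigr => j _; rewrite dotvC.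
    transitivity (\sum_i \sum_j (1 * (sq (z i) + sq (z j)) - 2 * dotv (z i) (z j))).
      by apply: eq_bigr => i _; apply: eq_bigr => j _; rewrite [LHS]sqB mul1r; ring.
    transitivity (\sum_i \sum_j (1 * (sq (z i) + sq (z j))) -
       2 * \sum_i \sum_j dotv (z i) (z j)).
      rewrite mulr_sumr -sumrB; apply: eq_bigr => i _.
      by rewrite mulr_sumr -sumrB.
    by rewrite double_sumD mulr1.
  by have := sq_ge0 (\sum_i z i); lra.
have lM : lamM <= 0 by rewrite /lamM ge_min lexx orbT.
apply: (@le_trans _ _ (N%:R^-1 * (2^-1 * \sum_i \sum_j lamM * sq (z i - z j)))); last first.
  apply: ler_wpM2l; first by rewrite invr_ge0.
  apply: ler_wpM2l; first by rewrite invr_ge0.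
  by apply: ler_sum => i _; apply: ler_sum => j _; exact: l1.
rewrite (_ : \sum_i \sum_j lamM * _ = lamM * \sum_i \sum_j sq (z i - z j)); last first.
  by rewrite mulr_sumr; apply: eq_bigr => i _; rewrite mulr_sumr.
have -> : dist2 x y = \sum_i sq (z i) by [].
have s0 : 0 <= \sum_i sq (z i) by apply: sumr_ge0 => i _; exact: sq_ge0.
case: (posnP N) => [N0|N0].
  by rewrite [in N%:R^-1]N0 invr0 mul0r mulr_le0_ge0.
have Nn : N%:R != 0 :> R by rewrite pnatr_eq0 -lt0n.
have -> : lamM * \sum_i sq (z i) = N%:R^-1 * (2^-1 * (lamM * (2 * N%:R * \sum_i sq (z i)))).
  by field.
apply: ler_wpM2l; first by rewrite invr_ge0.
apply: ler_wpM2l; first by rewrite invr_ge0.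
exact: ler_wnM2l.
Qed.

Lemma particle_contract (x y : E) :
  \sum_i sq ((tnth x i - h *: KN x i) - (tnth y i - h *: KN y i)) <=
  (1 - 2 * h * lamM + 4 * h ^+ 2 * L) * dist2 x y.
Proof.
have -> : \sum_i sq ((tnth x i - h *: KN x i) - (tnth y i - h *: KN y i)) =
   dist2 x y - 2 * h * (\sum_i dotv (KN x i - KN y i) (tnth x i - tnth y i)) +
   h ^+ 2 * \sum_i sq (KN x i - KN y i).
  rewrite !mulr_sumr -sumrB -big_split; apply: eq_bigr => i _ /=.
  have -> : tnth x i - h *: KN x i - (tnth y i - h *: KN y i) =
    (tnth x i - tnth y i) - h *: (KN x i - KN y i).
    by apply/rowP => k; rewrite !mxE; ring.
  by rewrite [LHS]sqB sqZ dotvZr dotvC; ring.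
have := KN_lip x y; have := KN_mon x y => m l.
have : 2 * h * (lamM * dist2 x y) <=
   2 * h * \sum_i dotv (KN x i - KN y i) (tnth x i - tnth y i).
  by rewrite ler_wpM2l// mulr_ge0// ltW.
have : h ^+ 2 * (\sum_i sq (KN x i - KN y i)) <= h ^+ 2 * (4 * L * dist2 x y).
  by rewrite ler_wpM2l// sqr_ge0.
lra.
Qed.

Lemma J_contract_tuple (u v : 'I_N -> rV) :
  (1 + 2 * h * lamV) * dist2 [tuple J (u i) | i < N] [tuple J (v i) | i < N] <=
  \sum_i sq (u i - v i).
Proof.
rewrite /dist2 mulr_sumr; apply: ler_sum => i _.
by rewrite !tnth_mktuple; exact: J_contract.
Qed.

Let den1 : 1 <= 1 + 2 * h * lamV.
Proof. by rewrite lerDl !mulr_ge0// ltW. Qed.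

Lemma J_nonexp_tuple (u v : 'I_N -> rV) :
  dist2 [tuple J (u i) | i < N] [tuple J (v i) | i < N] <= \sum_i sq (u i - v i).
Proof.
apply: le_trans (J_contract_tuple u v).
by rewrite -[leLHS]mul1r ler_wpM2r ?dist2_ge0.
Qed.

Lemma step_sync (x y : E) z : (1 + 2 * h * lamV) * dist2 (step x z) (step y z) <=
  (1 - 2 * h * lamM + 4 * h ^+ 2 * L) * dist2 x y.
Proof.
apply: le_trans (J_contract_tuple _ _) _; apply: le_trans (particle_contract x y).
by apply: ler_sum => i _; rewrite opprD addrACA subrr addr0.
Qed.

(** The shared noise cancels. The drifts differ by the contracting particle part and by [h] times
    the fluctuation; Young's inequality separates them, with a weight [e] to be taken proportional
    to [h]. *)
Lemma step_bstep_sync (x y : E) K z e : 0 < e ->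
  (1 + 2 * h * lamV) * dist2 (step x z) (bstep K y z) <=
  (1 + e) * (1 - 2 * h * lamM + 4 * h ^+ 2 * L) * dist2 x y +
  (1 + e^-1) * h ^+ 2 * fluct K y.
Proof.
move=> e0; apply: le_trans (J_contract_tuple _ _) _.
apply: (@le_trans _ _ (\sum_i ((1 + e) *
    sq ((tnth x i - h *: KN x i) - (tnth y i - h *: KN y i)) +
    (1 + e^-1) * (h ^+ 2 * sq (KN y i - K (tnth y i)))))).
  apply: ler_sum => i _; rewrite -sqZ.
  have -> : tnth x i - h *: KN x i + Num.sqrt 2 *: row_of (tnth z i) -
      (tnth y i - h *: K (tnth y i) + Num.sqrt 2 *: row_of (tnth z i)) =
      (tnth x i - h *: KN x i) - (tnth y i - h *: KN y i) - h *: (KN y i - K (tnth y i)).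
    rewrite [- (_ + Num.sqrt 2 *: _)]opprD addrACA subrr addr0.
    rewrite scalerBr; apply/rowP => j; rewrite !mxE; ring.
  by apply: (le_trans (sqD_young _ _ e0)); rewrite sqN.
rewrite big_split -!mulr_sumr /= lerD//; last by rewrite mulrA.
by rewrite -mulrA ler_wpM2l ?particle_contract// addr_ge0// ltW.
Qed.

Lemma bstep_lip K (x y : E) z : field_ok K ->
  dist2 (bstep K x z) (bstep K y z) <= (2 + 2 * h ^+ 2 * L) * dist2 x y.
Proof.
move=> [_ Klip _]; apply: le_trans (J_nonexp_tuple _ _) _.
rewrite /dist2 mulr_sumr; apply: ler_sum => i _.
rewrite opprD addrACA subrr addr0.
have -> : tnth x i - h *: K (tnth x i) - (tnth y i - h *: K (tnth y i)) =
   (tnth x i - tnth y i) - h *: (K (tnth x i) - K (tnth y i)).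
  by rewrite scalerBr; apply/rowP => j; rewrite !mxE; ring.
apply: (le_trans (sqB_le _ _)); rewrite sqZ.
have : h ^+ 2 * sq (K (tnth x i) - K (tnth y i)) <= h ^+ 2 * (L * sq (tnth x i - tnth y i)).
  by rewrite ler_wpM2l ?sqr_ge0.
lra.
Qed.

Lemma measurable_KN (i : 'I_N) : measurable_fun setT (fun x : E => KN x i).
Proof.
apply: measurable_rVZ; apply: measurable_rVsum => j.
apply: (measurableT_comp (continuous_measurable_map cW)).
by apply: measurable_rVB; exact: measurable_tnth.
Qed.

Lemma measurable_fluct K : measurable_fun setT K -> measurable_fun setT (fluct K).
Proof.
move=> mK; apply: measurable_sum => i; apply: measurable_sq; apply: measurable_rVB.
  exact: measurable_KN.
by apply: (measurableT_comp mK); exact: measurable_tnth.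
Qed.

Lemma measurable_step1 K : measurable_fun setT K ->
  measurable_fun setT (fun p : rV * d.-tuple R => step1 K p.1 p.2).
Proof.
move=> mK; apply: (measurableT_comp mJ); apply: measurable_rVD.
  apply: measurable_rVB => //; apply: measurable_rVZ.
  exact: measurableT_comp.
apply: measurable_rVZ; apply: (measurableT_comp measurable_row_of).
exact: measurable_snd.
Qed.

Lemma measurable_step : measurable_fun setT (fun p : E * N.-tuple (d.-tuple R) => step p.1 p.2).
Proof.
apply: measurable_mktuple => i; apply: (measurableT_comp mJ); apply: measurable_rVD.
  apply: measurable_rVB; first exact: (measurableT_comp (measurable_tnth i) measurable_fst).
  apply: measurable_rVZ; exact: (measurableT_comp (measurable_KN i) measurable_fst).
apply: measurable_rVZ; apply: (measurableT_comp measurable_row_of).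
exact: (measurableT_comp (measurable_tnth i) measurable_snd).
Qed.

Lemma measurable_bstep K : measurable_fun setT K ->
  measurable_fun setT (fun p : E * N.-tuple (d.-tuple R) => bstep K p.1 p.2).
Proof.
move=> mK; apply: measurable_mktuple => i.
apply: (measurableT_comp (measurable_step1 mK)) (_ : measurable_fun setT
  (fun p : E * N.-tuple (d.-tuple R) => (tnth p.1 i, tnth p.2 i))).
apply: measurable_fun_pair.
  exact: (measurableT_comp (measurable_tnth i) measurable_fst).
exact: (measurableT_comp (measurable_tnth i) measurable_snd).
Qed.

Lemma bmf_step_z (f : E -> R) (x : E) : bmf f -> bmf (fun z => f (step x z)).
Proof.
move=> bf; apply: bmf_comp bf _.
exact: (measurableT_comp measurable_step (measurable_pair1 x)).
Qed.

Lemma bmf_bstep_z K (f : E -> R) (x : E) : measurable_fun setT K -> bmf f -> bmf (fun z => f (bstep K x z)).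
Proof.
move=> mK bf; apply: bmf_comp bf _.
exact: (measurableT_comp (measurable_bstep mK) (measurable_pair1 x)).
Qed.

Lemma bmf_Top (f : E -> R) : bmf f -> bmf (Top f).
Proof.
(* The Dirac mass is an arbitrary first factor, since [bmf_int1] speaks of a product of two
   probabilities. *)
by move=> bf; apply: (bmf_int1 (F := fun p => f (step p.1 p.2)) (\d_(nseq_tuple N (0 : rV))) Gam);
  apply: bmf_comp bf _; exact: measurable_step.
Qed.

Lemma bmf_Tbar K (f : E -> R) : measurable_fun setT K -> bmf f -> bmf (Tbar K f).
Proof.
by move=> mK bf; apply: (bmf_int1 (F := fun p => f (bstep K p.1 p.2)) (\d_(nseq_tuple N (0 : rV))) Gam);
  apply: bmf_comp bf _; exact: measurable_bstep.
Qed.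

Lemma ucont_Tbar K (f : E -> R) : field_ok K -> bmf f -> ucont f -> ucont (Tbar K f).
Proof.
move=> Kok bf cf e e0; have [mK _ _] := Kok.
have [C HC] := cf _ e0; exists (`|C| * (2 + 2 * h ^+ 2 * L)) => x y.
rewrite -addrA -[X in _ <= _ + X](Rint_cst _ Gam) -RintD; [|exact: bmf_bstep_z|exact: bmf_cst].
apply: Rint_le; [exact: bmf_bstep_z|by apply: bmfD; [exact: bmf_bstep_z|exact: bmf_cst]|].
move=> z; rewrite addrA; apply: (le_trans (HC (bstep K x z) (bstep K y z))).
rewrite lerD2l -[X in _ <= X]mulrA.
apply: (@le_trans _ _ (`|C| * dist2 (bstep K x z) (bstep K y z))).
  by rewrite ler_wpM2r ?dist2_ge0// ler_norm.
by rewrite ler_wpM2l// bstep_lip.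
Qed.

End scheme.

(** * The entropic Harnack inequality *)

Section ucont_ops.
Context {R : realType} {d N : nat}.
Local Notation E := (N.-tuple 'rV[R]_d).

Lemma ucont_pos (f : E -> R) : ucont f -> forall e, 0 < e ->
  exists2 C, 0 <= C & forall x y, f y <= f x + e + C * dist2 x y.
Proof.
move=> uf e e0; have [C HC] := uf e e0; exists `|C| => // x y.
by apply: (le_trans (HC x y)); rewrite lerD2l ler_wpM2r ?dist2_ge0// ler_norm.
Qed.

Lemma ucont_expR (f : E -> R) : bmf f -> ucont f -> ucont (fun x => expR (f x)).
Proof.
move=> bf uf e e0; have [B B0 fB] := bmf_bound bf.
have eB := expR_gt0 B.
have [|C C0 HC] := ucont_pos uf (e := e / expR B); first exact: divr_gt0.
exists (expR B * C) => x y; have := HC x y.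
have D0 := dist2_ge0 x y.
have rhs0 : 0 <= e / expR B + C * dist2 x y.
  by rewrite addr_ge0 ?mulr_ge0// ltW// divr_gt0.
have key : expR (f y) - expR (f x) <= expR B * Num.max (f y - f x) 0.
  have := expR_ge1Dx (f x - f y); rewrite expRB => h1.
  have h2 : expR (f y) * (1 + (f x - f y)) <= expR (f x).
    rewrite -[leRHS](divfK (lt0r_neq0 (expR_gt0 (f y)))) mulrC.
    by rewrite ler_wpM2r// expR_ge0.
  have h3 : expR (f y) * (f y - f x) <= expR B * Num.max (f y - f x) 0.
    apply: (@le_trans _ _ (expR (f y) * Num.max (f y - f x) 0)).
      by rewrite ler_wpM2l ?expR_ge0// le_max lexx.
    rewrite ler_wpM2r ?le_max ?lexx ?orbT// ler_expR.
    exact: le_trans (ler_norm _) (fB y).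
  by move: h2 h3; lra.
move=> h; rewrite -addrA -lerBlDl; apply: (le_trans key).
have -> : e + expR B * C * dist2 x y = expR B * (e / expR B + C * dist2 x y).
  by rewrite mulrDr mulrCA divff ?mulr1 ?mulrA// lt0r_neq0.
rewrite ler_wpM2l ?expR_ge0// ge_max rhs0 andbT; lra.
Qed.

Lemma ucont_ln (f : E -> R) a : 0 < a -> (forall x, a <= f x) -> ucont f ->
  ucont (fun x => ln (f x)).
Proof.
move=> a0 fa uf e e0.
have [|C C0 HC] := ucont_pos uf (e := e * a); first exact: mulr_gt0.
exists (C / a) => x y; have := HC x y.
have D0 := dist2_ge0 x y.
have fx0 : 0 < f x by exact: lt_le_trans (fa x).
have fy0 : 0 < f y by exact: lt_le_trans (fa y).
move=> h; rewrite -addrA -lerBlDl -ln_div ?posrE//.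
have q0 : 0 < f y / f x by rewrite divr_gt0.
apply: (@le_trans _ _ (f y / f x - 1)).
  by rewrite -[X in ln X](addrNK 1) addrC; apply: le_ln1Dx; rewrite ltrBrDl addrN.
have -> : f y / f x - 1 = (f y - f x) / f x by rewrite mulrBl divff// lt0r_neq0.
rewrite ler_pdivrMr//.
apply: (@le_trans _ _ ((e + C / a * dist2 x y) * a)); last first.
  by rewrite ler_wpM2l ?fa// addr_ge0 ?(ltW e0)// mulr_ge0// divr_ge0// ltW.
have -> : (e + C / a * dist2 x y) * a = e * a + C * dist2 x y.
  by field; rewrite lt0r_neq0.
lra.
Qed.

Lemma ucontD (f g : E -> R) : ucont f -> ucont g -> ucont (fun x => f x + g x).
Proof.
move=> uf ug e e0; have e2 : 0 < e / 2 by rewrite divr_gt0.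
have [C HC] := uf _ e2; have [D HD] := ug _ e2; exists (C + D) => x y.
by have := HC x y; have := HD x y; lra.
Qed.

Lemma dist2_eq (x y : E) : dist2 x y = 0 -> x = y.
Proof.
move=> /eqP; rewrite psumr_eq0 => [/allP xy|i _]; last exact: sq_ge0.
apply: eq_from_tnth => i; apply/eqP; rewrite -subr_eq0; apply/eqP/sq_eq0/eqP.
by have := xy i (mem_index_enum _).
Qed.

End ucont_ops.

Section harnack.
Context {R : realType} {d N : nat}.
Local Notation rV := 'rV[R]_d.
Local Notation E := (N.-tuple rV).
Variables (gW J : rV -> rV) (L lamV lamW h th C1 q2 : R).
Hypotheses (h0 : 0 < h) (L0 : 0 <= L) (lamV0 : 0 <= lamV).
Hypothesis cW : continuous gW.
Hypothesis lipW : forall x y, sq (gW x - gW y) <= L * sq (x - y).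
Hypothesis J_contract : forall u v,
  (1 + 2 * h * lamV) * sq (J u - J v) <= sq (u - v).
Hypothesis mJ : measurable_fun setT J.
Hypotheses (th0 : 0 <= th) (th1 : th <= 1) (C10 : 0 <= C1) (q20 : 0 <= q2).
Hypothesis sync : forall (x y : E) K z,
  dist2 (step gW J h x z) (bstep J h K y z) <= th * dist2 x y + C1 * h * fluct gW K y.
Hypothesis syncN : forall (x y : E) z,
  dist2 (step gW J h x z) (step gW J h y z) <= q2 * dist2 x y.

Local Notation Gam := (@noise R d (Num.sqrt h) N).
Local Notation Top := (@Top R d N gW J h).
Local Notation Tbar := (@Tbar R d N J h).
Local Notation Ubar := (@Ubar R d N J h).
Local Notation F := (@fluct R d N gW).
Local Notation ok := (field_ok L lamW).

(** The expected fluctuation cost along the nonlinear chain, weighted according to the number of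
    steps left. The cap at [2 * B] keeps it a bounded function and loses nothing, since the two
    sides of the Harnack inequality differ by at most [2 * B] anyway. *)
Fixpoint Sacc (B : R) (w : nat -> R) (ks : seq (rV -> rV)) (S0 : E -> R) : E -> R :=
  if ks is K :: ks' then
    fun y => Num.min (2 * B) (w (size ks') * F K y + Tbar K (Sacc B w ks' S0) y)
  else S0.

Definition oks (ks : seq (rV -> rV)) := forall K, List.In K ks -> ok K.

Lemma oks_head K ks : oks (K :: ks) -> ok K. Proof. by move=> k; apply: k; left. Qed.

Lemma oks_tail K ks : oks (K :: ks) -> oks ks.
Proof. by move=> k K' i; apply: k; right. Qed.

Lemma oks_cat ks1 ks2 : oks ks1 -> oks ks2 -> oks (ks1 ++ ks2).
Proof.
move=> k1 k2 K /List.in_app_iff[|]; [exact: k1|exact: k2].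
Qed.

Lemma ok_meas (K : rV -> rV) : ok K -> measurable_fun setT K.
Proof. by case. Qed.

(** [fluct] grows quadratically and is in general not in [ucont]. This relative version suffices as
    soon as a cap bounds the values that matter. *)
Lemma fluct_growth K y y' e : 0 < e -> ok K ->
  F K y' <= (1 + e) * F K y + (1 + e^-1) * (10 * L) * dist2 y y'.
Proof.
move=> e0 [_ Klip _].
apply: (@le_trans _ _ (\sum_i ((1 + e) * sq (KN gW y i - K (tnth y i)) + (1 + e^-1) *
   (2 * sq (KN gW y i - KN gW y' i) + 2 * (L * sq (tnth y i - tnth y' i)))))).
  apply: ler_sum => i _.
  have -> : KN gW y' i - K (tnth y' i) = (KN gW y i - K (tnth y i)) -
    ((KN gW y i - KN gW y' i) - (K (tnth y i) - K (tnth y' i))).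
    by apply/rowP => k; rewrite !mxE; ring.
  apply: (le_trans (sqD_young _ _ e0)); rewrite sqN lerD2l ler_wpM2l//.
    by rewrite addr_ge0// invr_ge0 ltW.
  by apply: (le_trans (sqB_le _ _)); rewrite lerD2l ler_wpM2l.
rewrite big_split -!mulr_sumr big_split -!mulr_sumr /= lerD2l -[X in _ <= X]mulrA ler_wpM2l//.
  by rewrite addr_ge0// invr_ge0 ltW.
have := KN_lip L0 lipW y y'; rewrite /dist2; lra.
Qed.

Lemma Rint_ge0b d' (T : measurableType d') (f : T -> R) (mu : probability T R) :
  bmf f -> (forall x, 0 <= f x) -> 0 <= \int[mu]_x f x.
Proof.
move=> bf f0; rewrite -[leLHS](Rint_cst 0 mu); apply: Rint_le => //; exact: bmf_cst.
Qed.

Section acc.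
Variables (B : R) (w : nat -> R) (S0 : E -> R).
Hypotheses (B0 : 0 < B) (w0 : forall n, 0 <= w n).
Hypotheses (bS0 : bmf S0) (S00 : forall y, 0 <= S0 y) (uS0 : ucont S0).

Lemma Sacc_ok ks : oks ks ->
  [/\ bmf (Sacc B w ks S0), forall y, 0 <= Sacc B w ks S0 y & ucont (Sacc B w ks S0)].
Proof.
elim: ks => [|K ks IH] oK; first by split.
have [bS Sge uS] := IH (oks_tail oK); have okK := oks_head oK.
have mK := ok_meas okK.
have T0 y : 0 <= Tbar K (Sacc B w ks S0) y.
  by apply: Rint_ge0b => //; exact: bmf_bstep_z.
have bT := bmf_Tbar h mJ mK bS.
have uT := ucont_Tbar h0 lamV0 J_contract mJ okK bS uS.
have F0 y : 0 <= w (size ks) * F K y by rewrite mulr_ge0// fluct_ge0.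
have B20 : 0 <= 2 * B by rewrite mulr_ge0// ltW.
rewrite [Sacc _ _ (K :: ks) _]/=.
move: (Tbar K (Sacc B w ks S0)) bT uT T0 => T bT uT T0.
split => [|y|]; first 1 last.
- by rewrite /= le_min B20 addr_ge0.
- move=> e e0 /=; have e2 : 0 < e / 2 by rewrite divr_gt0.
  have [C C0 HC] := ucont_pos uT e2.
  (* Below the cap the weighted fluctuation is at most [2 * B], so a relative error [de] costs at
     most [e / 2]. *)
  pose de := e / 2 / (2 * B).
  have de0 : 0 < de by rewrite divr_gt0// mulr_gt0.
  exists (w (size ks) * ((1 + de^-1) * (10 * L)) + C) => x y.
  have D0 := dist2_ge0 x y.
  have c0 : 0 <= w (size ks) * ((1 + de^-1) * (10 * L)).
    by rewrite !mulr_ge0// addr_ge0// invr_ge0 ltW.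
  set m := Num.min (2 * B) (w (size ks) * F K x + _).
  case: (leP (2 * B) (w (size ks) * F K x + T x)) => hB.
    have -> : m = 2 * B by rewrite /m min_l.
    apply: (@le_trans _ _ (2 * B)); first by rewrite ge_min lexx.
    by rewrite -addrA lerDl addr_ge0 ?(ltW e0)// mulr_ge0// addr_ge0.
  have -> : m = w (size ks) * F K x + T x by rewrite /m min_r// ltW.
  rewrite ge_min; apply/orP; right.
  have := ler_wpM2l (w0 (size ks)) (fluct_growth x y de0 okK).
  have := HC x y; have T0x := T0 x.
  have : de * (w (size ks) * F K x) <= de * (2 * B) by rewrite ler_wpM2l ?(ltW de0)//; lra.
  have -> : de * (2 * B) = e / 2 by rewrite /de divfK// lt0r_neq0// mulr_gt0.
  lra.
- apply: (bmf_minc _ _ B20) => [|y]; last by rewrite addr_ge0.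
  apply: measurable_funD; last exact: bmf_meas bT.
  by apply: measurable_funM => //; exact: measurable_fluct.
Qed.

End acc.

Section bounds.
Variables (phi : E -> R) (B : R).
Hypotheses (bphi : bmf phi) (B0 : 0 < B) (phiB : forall x, `|phi x| <= B).

Lemma Ubar_ok ks : oks ks -> [/\ bmf (Ubar ks (fun x => expR (phi x))) ,
   forall y, expR (- B) <= Ubar ks (fun x => expR (phi x)) y &
   ucont phi -> ucont (Ubar ks (fun x => expR (phi x)))].
Proof.
elim: ks => [|K ks IH] oK.
  split; [exact: bmf_expR| |by move=> uphi; exact: ucont_expR].
  by move=> y /=; rewrite ler_expR lerNl; have := phiB y; rewrite ler_norml => /andP[]; lra.
have [bU gU uU] := IH (oks_tail oK); have okK := oks_head oK; have mK := ok_meas okK.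
split => [|y|uphi].
- exact: bmf_Tbar.
- rewrite -[leLHS](Rint_cst _ Gam); apply: Rint_le => [||z]; last exact: gU.
    exact: bmf_cst.
  exact: bmf_bstep_z.
- apply: (ucont_Tbar h0 lamV0 J_contract mJ okK bU); exact: uU.
Qed.

Lemma bmf_lnUbar ks : oks ks -> bmf (fun y => ln (Ubar ks (fun x => expR (phi x)) y)).
Proof. by move=> /Ubar_ok[b1 b2 _]; exact: bmf_ln (expR_gt0 (- B)) b2 b1. Qed.

Lemma lnUbar_ge ks y : oks ks -> - B <= ln (Ubar ks (fun x => expR (phi x)) y).
Proof.
move=> /Ubar_ok[_ b2 _]; rewrite -[leLHS]expRK ler_ln ?posrE ?expR_gt0//.
exact: lt_le_trans (expR_gt0 _) (b2 y).
Qed.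

Lemma ucont_lnUbar ks : oks ks -> ucont phi ->
  ucont (fun y => ln (Ubar ks (fun x => expR (phi x)) y)).
Proof.
by move=> /Ubar_ok[_ b2 b3] uphi; apply: ucont_ln (expR_gt0 (- B)) b2 _; exact: b3.
Qed.

Lemma iter_Top_ok n : bmf (iter n Top phi) /\ forall x, iter n Top phi x <= B.
Proof.
elim: n => [|n [bn ln]] /=.
  by split => // x; exact: le_trans (ler_norm _) (phiB x).
split; first exact: bmf_Top.
move=> x; rewrite -[leRHS](Rint_cst B Gam); apply: Rint_le => //.
  exact: bmf_step_z.
exact: bmf_cst.
Qed.

(** Constants of the meeting phase: [cA] goes with the squared gap divided by the remaining time,
    [cb] with the squared distance to the auxiliary chain times the remaining time. In [cC], the 2
    is the direct cost of a fluctuation and [cb * C1] its effect on the later distances to the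
    auxiliary chain. *)
Definition cA := 1 + 2 * L.
Definition cb := 10 * L.
Definition cC := cb * C1 + 2.

Definition S2 ks := Sacc B (fun=> cC * h) ks (fun=> 0).

Lemma cC_ge0 : 0 <= cC. Proof. by rewrite /cC /cb addr_ge0// !mulr_ge0. Qed.

Lemma S2_ok ks : oks ks -> [/\ bmf (S2 ks), forall y, 0 <= S2 ks y & ucont (S2 ks)].
Proof.
apply: Sacc_ok => //; last 2 first.
- exact: bmf_cst.
- by move=> e e0; exists 0 => x y; rewrite mul0r addr0 add0r ltW.
- by move=> n; rewrite mulr_ge0 ?cC_ge0// ltW.
Qed.

(* Girsanov in discrete form: the noise driving the second system is shifted by
   [a], which makes the two systems meet at the end of the remaining steps. *)
Lemma control_cost K (x y xb : E) (t : R) (a : 'I_N -> rV) : ok K -> h <= t ->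
  (forall i, Num.sqrt 2 *: a i = (tnth x i - h *: KN gW x i) -
     (tnth y i - h *: K (tnth y i)) - (1 - t) *: (tnth x i - tnth y i)) ->
  (\sum_i sq (a i)) / (2 * h) <=
    cA * (t ^+ 2 / h) * dist2 x y + cb * h * dist2 x xb + 2 * h * F K xb.
Proof.
move=> [_ Klip _] ht aE.
have h2 i : sq (a i) <= t ^+ 2 * sq (tnth x i - tnth y i) + 4 * h ^+ 2 *
   (sq (KN gW x i - KN gW xb i) + sq (KN gW xb i - K (tnth xb i)) +
    L * sq (tnth x i - tnth xb i) + L * sq (tnth x i - tnth y i)).
  have e1 : 2 * sq (a i) = sq (Num.sqrt 2 *: a i) by rewrite sqZ sqr_sqrtr.
  (* The gap between the drifts at [x] and [y] is routed through [xb], where the fluctuation is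
     evaluated, and through [K] at [x]. The last two terms cancel. *)
  have e2 : Num.sqrt 2 *: a i = t *: (tnth x i - tnth y i) - h *:
    ((KN gW x i - KN gW xb i) + (KN gW xb i - K (tnth xb i)) -
     ((K (tnth x i) - K (tnth xb i)) - (K (tnth x i) - K (tnth y i)))) - 
    (2 * h) *: (K (tnth x i) - K (tnth y i)) + (2 * h) *: (K (tnth x i) - K (tnth y i)).
    by rewrite aE; apply/rowP => k; rewrite !mxE; ring.
  rewrite -subr_ge0.
  suff : 2 * sq (a i) <= 2 * (t ^+ 2 * sq (tnth x i - tnth y i) + 4 * h ^+ 2 *
   (sq (KN gW x i - KN gW xb i) + sq (KN gW xb i - K (tnth xb i)) +
    L * sq (tnth x i - tnth xb i) + L * sq (tnth x i - tnth y i))) by lra.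
  rewrite e1 e2 subrK; apply: (le_trans (sqB_le _ _)); rewrite !sqZ.
  have := sqB_le ((KN gW x i - KN gW xb i) + (KN gW xb i - K (tnth xb i)))
     ((K (tnth x i) - K (tnth xb i)) - (K (tnth x i) - K (tnth y i))).
  have := sqD_le (KN gW x i - KN gW xb i) (KN gW xb i - K (tnth xb i)).
  have := sqB_le (K (tnth x i) - K (tnth xb i)) (K (tnth x i) - K (tnth y i)).
  have := Klip (tnth x i) (tnth xb i); have := Klip (tnth x i) (tnth y i).
  move=> k1 k2 k3 k4 k5.
  set Z := sq (_ + _ - _) in k5 *.
  suff : h ^+ 2 * Z <= h ^+ 2 * (4 * (sq (KN gW x i - KN gW xb i) +
     sq (KN gW xb i - K (tnth xb i)) + L * sq (tnth x i - tnth xb i) +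
     L * sq (tnth x i - tnth y i))) by lra.
  by rewrite ler_wpM2l ?sqr_ge0//; lra.
have h3 : \sum_i sq (a i) <= t ^+ 2 * dist2 x y + 4 * h ^+ 2 *
   (4 * L * dist2 x xb + F K xb + L * dist2 x xb + L * dist2 x y).
  apply: (@le_trans _ _ (t ^+ 2 * dist2 x y + 4 * h ^+ 2 *
   (\sum_i sq (KN gW x i - KN gW xb i) + F K xb + L * dist2 x xb + L * dist2 x y))).
    rewrite /dist2 /fluct !mulr_sumr -!big_split mulr_sumr -big_split.
    by apply: ler_sum => i _; exact: h2.
  rewrite lerD2l; apply: ler_wpM2l; first by rewrite mulr_ge0 ?sqr_ge0.
  rewrite !lerD2r; exact: KN_lip.
rewrite ler_pdivrMr ?mulr_gt0//; apply: (le_trans h3).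
have D1 := dist2_ge0 x y; have D2 := dist2_ge0 x xb; have D3 := fluct_ge0 gW K xb.
have -> : (cA * (t ^+ 2 / h) * dist2 x y + cb * h * dist2 x xb + 2 * h * F K xb) * (2 * h) =
   cA * 2 * t ^+ 2 * dist2 x y + 2 * cb * h ^+ 2 * dist2 x xb + 4 * h ^+ 2 * F K xb.
  by field; rewrite lt0r_neq0.
have ht2 : h ^+ 2 * (L * dist2 x y) <= t ^+ 2 * (L * dist2 x y).
  rewrite ler_wpM2r ?mulr_ge0// lerXn2r ?nnegrE ?(ltW h0)//.
  exact: le_trans (ltW h0) ht.
have t2 : 0 <= t ^+ 2 * dist2 x y by rewrite mulr_ge0 ?sqr_ge0.
rewrite /cA /cb; lra.
Qed.

(** Three systems: the particles [x], a nonlinear chain from [y] whose shifted noise drives it onto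
    the particles, and a nonlinear chain from [xb] with the original noise. Fluctuations are charged
    to the last one, whose law remains a product when it starts from a product law. The last premise
    covers the absence of steps, where the divisor is 0. *)
Lemma harnack_meet ks x y xb : oks ks -> (size ks)%:R * h <= 1 ->
  (size ks = 0%N -> x = y) ->
  iter (size ks) Top phi x <= ln (Ubar ks (fun x => expR (phi x)) y) +
    cA / ((size ks)%:R * h) * dist2 x y + cb * ((size ks)%:R * h) * dist2 x xb + S2 ks xb.
Proof.
have AL : 0 <= cA by rewrite /cA addr_ge0// mulr_ge0.
have bL : 0 <= cb by rewrite /cb mulr_ge0.
elim: ks x y xb => [|K ks IH] x y xb oK rh xy.
  by rewrite /= /S2 /= !mul0r invr0 !mulr0 !mul0r !addr0 expRK -xy.
have [okK oks'] := (oks_head oK, oks_tail oK); have mK := ok_meas okK.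
have [bS Sge _] := S2_ok oks'.
move: rh; rewrite [size _]/= => rh.
set r := size ks in IH rh *.
have D1 := dist2_ge0 x y; have D2 := dist2_ge0 x xb; have D3 := fluct_ge0 gW K xb.
have r1 : 0 < (r.+1%:R : R) by [].
have lB := lnUbar_ge y oK; have [_ iB] := iter_Top_ok r.+1.
set lU := ln _ in lB *; set RR := (X in lU + X + _); set P := (X in lU + _ + X).
set S := S2 _ _.
have rest0 : 0 <= RR + P.
  by rewrite /RR /P addr_ge0// !mulr_ge0// ?invr_ge0 ?mulr_ge0// ltW.
have -> : S = Num.min (2 * B) (cC * h * F K xb + Tbar K (S2 ks) xb) by [].
(* The branch of the cap: the left-hand side is at most [B] and [lU] is at least [- B]. *)
have triv : iter r.+1 Top phi x <= lU + RR + P + 2 * B.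
  by have := iB x; move: rest0; lra.
suff main : iter r.+1 Top phi x <=
    lU + RR + P + (cC * h * F K xb + Tbar K (S2 ks) xb).
  by rewrite -lerBlDl le_min !lerBlDl; apply/andP; split.
(* The gap is closed linearly: with [r.+1] steps left, the fraction [t] of it is removed, and all of
   it at the last step. *)
pose t : R := r.+1%:R^-1.
have t0 : 0 < t by rewrite invr_gt0.
have ht : h <= t by rewrite -[t]mul1r ler_pdivlMr// mulrC.
pose a i := (Num.sqrt 2)^-1 *: ((tnth x i - h *: KN gW x i) -
     (tnth y i - h *: K (tnth y i)) - (1 - t) *: (tnth x i - tnth y i)).
have s2 : Num.sqrt 2 != 0 :> R by rewrite lt0r_neq0// sqrtr_gt0.
have aE i : Num.sqrt 2 *: a i = (tnth x i - h *: KN gW x i) -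
     (tnth y i - h *: K (tnth y i)) - (1 - t) *: (tnth x i - tnth y i).
  by rewrite /a scalerA divff// scale1r.
have cost := control_cost xb okK ht aE.
have meet z : dist2 (step gW J h x z) (bstep J h K y (noise_shift a z)) <=
    (1 - t) ^+ 2 * dist2 x y.
  have -> : bstep J h K y (noise_shift a z) = [tuple J (tnth x i - h *: KN gW x i +
      Num.sqrt 2 *: row_of (tnth z i) - (1 - t) *: (tnth x i - tnth y i)) | i < N].
    apply: eq_from_tnth => i; rewrite [LHS]tnth_mktuple [RHS]tnth_mktuple /step1; congr (J _).
    by rewrite noise_shiftE scalerDr aE; apply/rowP => k; rewrite !mxE; ring.
  apply: (le_trans (J_nonexp_tuple h0 lamV0 J_contract _ _)).
  rewrite /dist2 mulr_sumr; apply: ler_sum => i _.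
  by rewrite opprB addrCA subrr addr0 sqZ.
have step_le z : iter r Top phi (step gW J h x z) <=
    ln (Ubar ks (fun x => expR (phi x)) (bstep J h K y (noise_shift a z))) +
    (cA / (r%:R * h) * ((1 - t) ^+ 2 * dist2 x y) +
     cb * (r%:R * h) * (th * dist2 x xb + C1 * h * F K xb)) +
    S2 ks (bstep J h K xb z).
  have rh' : r%:R * h <= 1.
    by apply: le_trans rh; rewrite ler_wpM2r ?(ltW h0)// ler_nat.
  apply: (le_trans (IH _ (bstep J h K y (noise_shift a z)) (bstep J h K xb z) oks' rh' _)).
    move=> r0; apply: dist2_eq; apply/eqP; rewrite eq_le dist2_ge0 andbT.
    by apply: (le_trans (meet z)); rewrite /t r0 invr1 subrr expr0n mul0r.
  rewrite lerD2r -addrA lerD2l lerD// ler_wpM2l//.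
  - by rewrite mulr_ge0// invr_ge0 mulr_ge0// ltW.
  - by rewrite !mulr_ge0// ltW.
have bU := bmf_lnUbar oks'.
have bU' := bmf_bstep_z h mJ y mK bU.
have bUs : bmf (fun z => ln (Ubar ks (fun x => expR (phi x)) (bstep J h K y (noise_shift a z)))).
  by apply: (bmf_comp bU'); exact: measurable_noise_shift.
have bSz := bmf_bstep_z h mJ xb mK bS.
have [biT _] := iter_Top_ok r.
set c := cA / (r%:R * h) * _ + _ in step_le.
apply: (@le_trans _ _ (\int[Gam]_z (ln (Ubar ks (fun x => expR (phi x))
    (bstep J h K y (noise_shift a z))) + c + S2 ks (bstep J h K xb z)))).
  apply: Rint_le => //; first exact: bmf_step_z.
  by apply: bmfD => //; apply: bmfD => //; exact: bmf_cst.
rewrite RintD//; last by apply: bmfD => //; exact: bmf_cst.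
rewrite RintD//; last exact: bmf_cst.
rewrite Rint_cst.
have sh : 0 < Num.sqrt h by rewrite sqrtr_gt0.
have nse := noise_shift_entropy sh a bU'.
rewrite sqr_sqrtr ?(ltW h0)// in nse.
have lUE : ln (\int[Gam]_z expR (ln (Ubar ks (fun x => expR (phi x)) (bstep J h K y z)))) = lU.
  congr ln; apply: eq_Rintegral => z _; rewrite lnK// posrE.
  by have [_ b2 _] := Ubar_ok oks'; exact: lt_le_trans (expR_gt0 _) (b2 _).
rewrite lUE in nse.
have TE : \int[Gam]_z S2 ks (bstep J h K xb z) = Tbar K (S2 ks) xb by [].
rewrite TE.
have c1 : c + (\sum_i sq (a i)) / (2 * h) <= RR + P + cC * h * F K xb; last first.
  by move: nse c1; set u := \int[_]_z _; set v := Tbar _ _ _; set q := _ / _; lra.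
apply: (@le_trans _ _ (c + (cA * (t ^+ 2 / h) * dist2 x y + cb * h * dist2 x xb +
    2 * h * F K xb))); first by rewrite lerD2l.
(* An equality, because closing the gap linearly is optimal for a quadratic cost. For [r = 0] the
   first term is 0, the gap being entirely closed. *)
have e1 : cA / (r%:R * h) * ((1 - t) ^+ 2 * dist2 x y) + cA * (t ^+ 2 / h) * dist2 x y = RR.
  rewrite /RR /t -[r.+1%:R]natr1; case: (posnP r) => [->|r0].
    by rewrite !mul0r invr0 !mulr0 !mul0r !add0r invr1 mul1r expr1n mul1r.
  have rn : r%:R != 0 :> R by rewrite pnatr_eq0 -lt0n.
  have rn1 : r%:R + 1 != 0 :> R by rewrite natr1.
  by field; rewrite rn rn1 lt0r_neq0.
have e2 : cb * (r%:R * h) * (th * dist2 x xb) + cb * h * dist2 x xb <= P.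
  rewrite /P -[r.+1%:R]natr1.
  have : cb * (r%:R * h) * (th * dist2 x xb) <= cb * (r%:R * h) * (1 * dist2 x xb).
    rewrite ler_wpM2l//; first by rewrite !mulr_ge0// ltW.
    by rewrite ler_wpM2r.
  by move: (r%:R : R) => q; lra.
have e3 : cb * (r%:R * h) * (C1 * h * F K xb) + 2 * h * F K xb <= cC * h * F K xb.
  have : (r%:R * h) * (cb * (C1 * h * F K xb)) <= 1 * (cb * (C1 * h * F K xb)).
    rewrite ler_wpM2r//; first by rewrite !mulr_ge0// ltW.
    by apply: le_trans rh; rewrite ler_wpM2r ?(ltW h0)// ler_nat.
  by rewrite /cC; move: (r%:R : R) => q; lra.
rewrite /c mulrDr; lra.
Qed.

(** When the meeting phase lasts between 1/2 and 1, its distance cost is at most 2 cA + cb times the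
    squared distance; the outer 2 comes from inserting the intermediate configuration [xt]. *)
Definition cal := 2 * (2 * cA + cb).

Definition S1 ks1 ks2 := Sacc B (fun j => cal * C1 * h * th ^+ j) ks1 (S2 ks2).

Lemma cal_ge0 : 0 <= cal.
Proof. by rewrite /cal /cA /cb; move: L0; lra. Qed.

Lemma S1_ok ks1 ks2 : oks ks1 -> oks ks2 ->
  [/\ bmf (S1 ks1 ks2), forall y, 0 <= S1 ks1 ks2 y & ucont (S1 ks1 ks2)].
Proof.
move=> o1 o2; have [b g u] := S2_ok o2.
have w0 j : 0 <= cal * C1 * h * th ^+ j.
  exact: mulr_ge0 (mulr_ge0 (mulr_ge0 cal_ge0 C10) (ltW h0)) (exprn_ge0 _ th0).
exact: (Sacc_ok B0 w0 b g u o1).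
Qed.

(** Synchronous phase, then the meeting phase as base case. A particle system started at [xt] is
    inserted between [x] and [y]: two particle systems contract by the full factor [q2], while only
    the passage from [xt] to the nonlinear chain suffers the weaker factor [th] and the
    fluctuations. At [xt = y] the initial distance meets [q2] alone. *)
Lemma harnack ks1 ks2 x xt y : oks ks1 -> oks ks2 ->
  (size ks2)%:R * h <= 1 -> 1 <= 2 * ((size ks2)%:R * h) ->
  iter (size (ks1 ++ ks2)) Top phi x <=
    ln (Ubar (ks1 ++ ks2) (fun x => expR (phi x)) y) +
    cal * q2 ^+ size ks1 * dist2 x xt + cal * th ^+ size ks1 * dist2 xt y + S1 ks1 ks2 y.
Proof.
move=> + o2 rh rh2; elim: ks1 x xt y => [|K ks IH] x xt y o1.
  rewrite !cat0s !expr0 !mulr1.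
  have r0 : size ks2 <> 0%N by move=> r0; move: rh2; rewrite r0 mul0r mulr0 ler10.
  have := harnack_meet (x := x) (y := y) y o2 rh (fun e => False_ind _ (r0 e)).
  have D := dist2_ge0 x y.
  have Dt : dist2 x y <= 2 * dist2 x xt + 2 * dist2 xt y.
    rewrite /dist2 !mulr_sumr -big_split; apply: ler_sum => i _.
    rewrite (_ : tnth x i - tnth y i = (tnth x i - tnth xt i) + (tnth xt i - tnth y i)).
      exact: sqD_le.
    by rewrite addrA subrK.
  have q0 : 0 < (size ks2)%:R * h by lra.
  move: q0 rh rh2; move: (_ * h) => q q0 rh rh2 hm.
  have k1 : cA / q * dist2 x y <= cA * 2 * dist2 x y.
    rewrite ler_wpM2r// ler_wpM2l//; first by rewrite /cA addr_ge0// mulr_ge0.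
    by rewrite -[q^-1]mul1r ler_pdivrMr.
  have k2 : cb * q * dist2 x y <= cb * 1 * dist2 x y.
    by rewrite ler_wpM2r// ler_wpM2l// /cb mulr_ge0.
  have k3 : (2 * cA + cb) * dist2 x y <= (2 * cA + cb) * (2 * dist2 x xt + 2 * dist2 xt y).
    by rewrite ler_wpM2l// /cA /cb; have := L0; lra.
  rewrite (_ : S1 [::] ks2 y = S2 ks2 y)// /cal; move: hm k1 k2 k3; lra.
have [okK oks'] := (oks_head o1, oks_tail o1); have mK := ok_meas okK.
have [bS Sge _] := S1_ok oks' o2.
have oc := oks_cat oks' o2; have ocK := oks_cat o1 o2.
rewrite !cat_cons ![size (_ :: _)]/=.
set r := size (ks ++ ks2) in IH *; set j := size ks in IH *.
have D1 := dist2_ge0 x xt; have D2 := dist2_ge0 xt y; have D3 := fluct_ge0 gW K y.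
have lB := lnUbar_ge y ocK; have [_ iB] := iter_Top_ok r.+1.
rewrite cat_cons in lB.
set lU := ln _ in lB *; set RR := (X in lU + X + _); set P := (X in lU + _ + X).
set S := S1 _ _ _.
have al0 := cal_ge0.
have rest0 : 0 <= RR + P.
  apply: addr_ge0; apply: mulr_ge0 => //; apply: mulr_ge0 => //; exact: exprn_ge0.
have -> : S = Num.min (2 * B) (cal * C1 * h * th ^+ j * F K y + Tbar K (S1 ks ks2) y) by [].
have triv : iter r.+1 Top phi x <= lU + RR + P + 2 * B.
  by have := iB x; move: rest0; lra.
suff main : iter r.+1 Top phi x <=
    lU + RR + P + (cal * C1 * h * th ^+ j * F K y + Tbar K (S1 ks ks2) y).
  by rewrite -lerBlDl le_min !lerBlDl; apply/andP; split.
have step_le z : iter r Top phi (step gW J h x z) <=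
    ln (Ubar (ks ++ ks2) (fun x => expR (phi x)) (bstep J h K y z)) +
    (RR + P + cal * C1 * h * th ^+ j * F K y) + S1 ks ks2 (bstep J h K y z).
  apply: (le_trans (IH _ (step gW J h xt z) (bstep J h K y z) oks')).
  rewrite lerD2r -addrA lerD2l.
  have k1 : cal * q2 ^+ j * dist2 (step gW J h x z) (step gW J h xt z) <= RR.
    rewrite /RR exprSr [cal * (_ * q2)]mulrA -[X in _ <= X]mulrA.
    by rewrite ler_wpM2l// mulr_ge0// exprn_ge0.
  have k2 : cal * th ^+ j * dist2 (step gW J h xt z) (bstep J h K y z) <=
     cal * th ^+ j * (th * dist2 xt y + C1 * h * F K y).
    by rewrite ler_wpM2l// mulr_ge0// exprn_ge0.
  have -> : P = cal * th ^+ j * (th * dist2 xt y) by rewrite /P exprSr; ring.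
  by move: k2; rewrite mulrDr; lra.
have bU := bmf_lnUbar oc.
have bU' := bmf_bstep_z h mJ y mK bU.
have bSz := bmf_bstep_z h mJ y mK bS.
have [biT _] := iter_Top_ok r.
set c := RR + P + _ in step_le.
apply: (@le_trans _ _ (\int[Gam]_z (ln (Ubar (ks ++ ks2) (fun x => expR (phi x))
    (bstep J h K y z)) + c + S1 ks ks2 (bstep J h K y z)))).
  apply: Rint_le => //; first exact: bmf_step_z.
  by apply: bmfD => //; apply: bmfD => //; exact: bmf_cst.
rewrite RintD//; last by apply: bmfD => //; exact: bmf_cst.
rewrite RintD//; last exact: bmf_cst.
rewrite Rint_cst.
have nse := ln_jensen Gam bU'.
have lUE : ln (\int[Gam]_z expR (ln (Ubar (ks ++ ks2) (fun x => expR (phi x)) (bstep J h K y z)))) = lU.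
  congr ln; apply: eq_Rintegral => z _; rewrite lnK// posrE.
  by have [_ b2 _] := Ubar_ok oc; exact: lt_le_trans (expR_gt0 _) (b2 _).
rewrite lUE in nse.
have TE : \int[Gam]_z S1 ks ks2 (bstep J h K y z) = Tbar K (S1 ks ks2) y by [].
by rewrite TE /c; move: nse; set u := \int[_]_z _; lra.
Qed.

End bounds.
End harnack.

(** * Fluctuations under product laws *)

Section nonneg.
Context {R : realType} {d : measure_display} {T : measurableType d}.
Implicit Types (mu : probability T R) (f g : T -> R).

(** The companion of [bmf] for quantities without a bound known in advance: their integrals are
    taken in the extended reals, where additivity, monotonicity and Tonelli's theorem hold without
    integrability. *)
Definition nnm f := measurable_fun setT f /\ forall x, 0 <= f x.

Lemma nnm_meas f : nnm f -> measurable_fun setT f. Proof. by case. Qed.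
Lemma nnm_ge0 f : nnm f -> forall x, 0 <= f x. Proof. by case. Qed.
Lemma nnm_EFin f : nnm f -> measurable_fun setT (EFin \o f).
Proof. by move=> [mf _]; exact/measurable_EFinP. Qed.

Lemma nnmD f g : nnm f -> nnm g -> nnm (fun x => f x + g x).
Proof.
by move=> [mf f0] [mg g0]; split; [exact: measurable_funD|move=> x; exact: addr_ge0].
Qed.

Lemma nnmZ c f : 0 <= c -> nnm f -> nnm (fun x => c * f x).
Proof.
by move=> c0 [mf f0]; split; [exact: measurable_funM|move=> x; exact: mulr_ge0].
Qed.

Lemma nnm_cst c : 0 <= c -> nnm (fun=> c).
Proof. by move=> c0; split. Qed.

Lemma nnm_sum (I : finType) (F : I -> T -> R) : (forall i, nnm (F i)) ->
  nnm (fun x => \sum_i F i x).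
Proof.
move=> nF; split; first by apply: measurable_sum => i; have [] := nF i.
by move=> x; apply: sumr_ge0 => i _; have [] := nF i.
Qed.

Lemma nnm_sqr f : measurable_fun setT f -> nnm (fun x => f x ^+ 2).
Proof. by move=> mf; split; [exact: measurable_funX|move=> x; exact: sqr_ge0]. Qed.

Lemma nnm_sq d' (f : T -> 'rV[R]_d') : measurable_fun setT f -> nnm (fun x => sq (f x)).
Proof. by move=> mf; split; [exact: measurable_sq|move=> x; exact: sq_ge0]. Qed.

Local Open Scope ereal_scope.

Lemma nnI_ge0 mu f : nnm f -> 0 <= \int[mu]_x (f x)%:E.
Proof. by move=> [_ f0]; apply: integral_ge0 => x _; rewrite lee_fin. Qed.

Lemma nnID mu f g : nnm f -> nnm g ->
  \int[mu]_x (f x + g x)%:E = \int[mu]_x (f x)%:E + \int[mu]_x (g x)%:E.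
Proof.
move=> nf ng; under eq_integral do rewrite EFinD.
by rewrite ge0_integralD//; [move=> x _; rewrite lee_fin; exact: nnm_ge0|exact: nnm_EFin
  |move=> x _; rewrite lee_fin; exact: nnm_ge0|exact: nnm_EFin].
Qed.

Lemma nnIZ mu f c : (0 <= c)%R -> nnm f ->
  \int[mu]_x (c * f x)%:E = c%:E * \int[mu]_x (f x)%:E.
Proof.
move=> c0 nf; under eq_integral do rewrite EFinM.
by rewrite ge0_integralZl_EFin//; [move=> x _; rewrite lee_fin; exact: nnm_ge0|exact: nnm_EFin].
Qed.

Lemma nnIcst mu c : \int[mu]_x c%:E = c%:E.
Proof.
have E := @probability_setT _ _ _ mu.
by have := integral_cst mu measurableT c%:E; rewrite [X in _ = (_ * X)%E]E mule1.
Qed.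

Lemma nnIsum mu (I : finType) (F : I -> T -> R) : (forall i, nnm (F i)) ->
  \int[mu]_x (\sum_i F i x)%:E = \sum_i \int[mu]_x (F i x)%:E.
Proof.
move=> nF; under eq_integral do rewrite -sumEFin.
by rewrite ge0_integral_sum//; [move=> i; exact: nnm_EFin|
  move=> i x _; rewrite lee_fin; exact: nnm_ge0].
Qed.

Lemma nnI_le mu f g : nnm f -> nnm g -> (forall x, f x <= g x)%R ->
  \int[mu]_x (f x)%:E <= \int[mu]_x (g x)%:E.
Proof.
move=> nf ng fg; apply: ge0_le_integral => //; first by move=> x _; rewrite lee_fin; exact: nnm_ge0.
- exact: nnm_EFin.
- exact: nnm_EFin.
- by move=> x _; rewrite lee_fin.
Qed.

Lemma nnI_int mu f : nnm f -> \int[mu]_x (f x)%:E < +oo -> mu.-integrable setT (EFin \o f).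
Proof.
move=> nf fi; apply/integrableP; split; first exact: nnm_EFin.
rewrite (_ : (\int[mu]_x _) = \int[mu]_x (f x)%:E)//.
by apply: eq_integral => x _ /=; rewrite ger0_norm ?(nnm_ge0 nf).
Qed.

End nonneg.

Section variance.
Context {R : realType} {d : measure_display} {T : measurableType d}.
Variable (nu : probability T R).

Section scalar.
Variables (g : T -> R).
Hypotheses (mg : measurable_fun setT g).
Hypothesis g2 : (\int[nu]_x (g x ^+ 2)%:E < +oo)%E.

Lemma L2_integrable : nu.-integrable setT (EFin \o g).
Proof.
have n2 : nnm (fun x => 1 + g x ^+ 2) by apply: nnmD; [exact: nnm_cst|exact: nnm_sqr].
apply: (@le_integrable _ _ _ _ _ _ _ (EFin \o (fun x => 1 + g x ^+ 2))) => //.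
- exact/measurable_EFinP.
- move=> x _ /=; rewrite lee_fin [X in _ <= X]ger0_norm ?(nnm_ge0 n2)//.
  rewrite -[X in _ <= 1 + X]real_normK ?num_real//.
  move: `|g x| (normr_ge0 (g x)) => u u0; have := sqr_ge0 (u - 2^-1); rewrite sqrrB expr2; nra.
- apply: nnI_int => //; rewrite (nnID nu (nnm_cst ler01) (nnm_sqr mg)).
  by rewrite nnIcst lte_add_pinfty// ltry.
Qed.

Let m := \int[nu]_x g x.
Let v := \int[nu]_x (g x ^+ 2) - m ^+ 2.

Lemma var_shift c : (\int[nu]_x ((c + g x) ^+ 2)%:E = ((c + m) ^+ 2 + v)%:E)%E.
Proof.
have i1 := L2_integrable.
have i2 : nu.-integrable setT (EFin \o (fun x => g x ^+ 2)).
  by apply: nnI_int => //; exact: nnm_sqr.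
have iZ : nu.-integrable setT (EFin \o (fun x => 2 * c * g x)).
  rewrite /comp; under eq_fun do rewrite EFinM; exact: integrableZl.
have ic : nu.-integrable setT (EFin \o (fun=> c ^+ 2 : R)).
  exact: finite_measure_integrable_cst.
have i3 : nu.-integrable setT (EFin \o (fun x => 2 * c * g x + g x ^+ 2)).
  rewrite /comp; under eq_fun do rewrite EFinD; exact: integrableD.
have i4 : nu.-integrable setT (EFin \o (fun x => c ^+ 2 + (2 * c * g x + g x ^+ 2))).
  rewrite /comp; under eq_fun do rewrite EFinD; exact: integrableD.
transitivity (\int[nu]_x (c ^+ 2 + (2 * c * g x + g x ^+ 2))%:E)%E.
  by apply: eq_integral => x _; congr EFin; ring.
rewrite -[LHS]fineK; last exact: (integrable_fin_num measurableT i4).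
congr EFin; rewrite -[fine _]/(\int[nu]_x (c ^+ 2 + (2 * c * g x + g x ^+ 2))).
rewrite RintegralD// RintegralD// RintegralZl// Rint_cst /v /m.
ring.
Qed.

Lemma var_ge0 : 0 <= v.
Proof.
have := var_shift (- m); rewrite addNr expr0n add0r => e.
by rewrite -lee_fin -e; apply: nnI_ge0; apply: nnm_sqr; exact: measurable_funD.
Qed.

(** The offset [s] is left free so that the induction can absorb the first summand into it;
    integrating that summand then adds one variance. *)
Lemma var_sum n (s : R) : (\int[prod_power nu n]_x
   ((s + \sum_i (g (tnth x i) - m)) ^+ 2)%:E = (s ^+ 2 + n%:R * v)%:E)%E.
Proof.
elim: n s => [|n IH] s.
  under eq_integral => x _ do rewrite big_ord0 addr0.
  by rewrite nnIcst mul0r addr0.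
rewrite (integral_prod_powerS nu (F := fun x => ((s + \sum_i (g (tnth x i) - m)) ^+ 2)%:E)); last 2 first.
- apply/measurable_EFinP; apply: measurable_funX; apply: measurable_funD => //.
  apply: measurable_sum => i; apply: measurable_funB => //.
  by apply: (measurableT_comp mg); exact: measurable_tnth.
- by move=> x; rewrite lee_fin sqr_ge0.
transitivity (\int[nu]_x (((s - m) + g x) ^+ 2 + n%:R * v)%:E)%E.
  apply: eq_integral => x _.
  under eq_integral => y _.
    rewrite big_ord_recl/= (_ : \sum_(i < n) _ = \sum_i (g (tnth y i) - m)); last first.
      by apply: eq_bigr => i _; rewrite tnth_consS.
    rewrite (_ : tnth _ _ = x)// addrA.
    over.
  by rewrite IH; congr ((_ ^+ 2 + _)%:E); ring.
rewrite nnID; last 2 first.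
- by apply: nnm_sqr; exact: measurable_funD.
- by apply: nnm_cst; rewrite mulr_ge0 ?var_ge0.
rewrite nnIcst var_shift -EFinD; congr EFin.
by rewrite subrK -[n.+1%:R]natr1; ring.
Qed.

End scalar.

Section vector.
Variables (d' : nat) (f : T -> 'rV[R]_d').
Hypotheses (mf : measurable_fun setT f).
Hypothesis f2 : (\int[nu]_x (sq (f x))%:E < +oo)%E.

Definition vmean : 'rV[R]_d' := \row_i \int[nu]_x f x 0 i.
Definition vvar : R := \sum_i (\int[nu]_x (f x 0 i ^+ 2) - vmean 0 i ^+ 2).

Let mfi i : measurable_fun setT (fun x => f x 0 i).
Proof. exact: (measurableT_comp (measurable_coord i) mf). Qed.

Let f2i i : (\int[nu]_x (f x 0 i ^+ 2)%:E < +oo)%E.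
Proof.
apply: le_lt_trans f2; apply: nnI_le => [||x]; [exact: nnm_sqr|exact: nnm_sq|exact: sq_coord].
Qed.

Lemma vvar_ge0 : 0 <= vvar.
Proof. by apply: sumr_ge0 => i _; rewrite mxE; exact: (var_ge0 (mfi i) (f2i i)). Qed.

Lemma vvar_shift c : (\int[nu]_x (sq (c + f x))%:E = (sq (c + vmean) + vvar)%:E)%E.
Proof.
transitivity (\int[nu]_x (\sum_i (c 0 i + f x 0 i) ^+ 2)%:E)%E.
  by apply: eq_integral => x _; rewrite sqE; congr EFin; apply: eq_bigr => i _; rewrite mxE.
rewrite nnIsum; last by move=> i; apply: nnm_sqr; exact: measurable_funD.
rewrite /vvar sqE -big_split -sumEFin; apply: eq_bigr => i _.
by rewrite (var_shift (mfi i) (f2i i)) !mxE.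
Qed.

Lemma vvar_sum n s : (\int[prod_power nu n]_x
   (sq (s + \sum_i (f (tnth x i) - vmean)))%:E = (sq s + n%:R * vvar)%:E)%E.
Proof.
transitivity (\int[prod_power nu n]_x (\sum_j (s 0 j +
    \sum_i (f (tnth x i) 0 j - \int[nu]_x f x 0 j)) ^+ 2)%:E)%E.
  apply: eq_integral => x _; rewrite sqE; congr EFin; apply: eq_bigr => j _.
  by rewrite !mxE summxE; congr ((_ + _) ^+ 2); apply: eq_bigr => i _; rewrite !mxE.
rewrite nnIsum; last first.
  move=> j; apply: nnm_sqr; apply: measurable_funD => //; apply: measurable_sum => i.
  by apply: measurable_funB => //; apply: (measurableT_comp (mfi j)); exact: measurable_tnth.
rewrite /vvar sqE mulr_sumr -big_split -sumEFin; apply: eq_bigr => j _.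
by rewrite (var_sum (mfi j) (f2i j)) !mxE.
Qed.

(** At fixed [x] the inner integral is the variance plus the squared distance of [f x] to the mean.
    The bound by two copies makes a Lipschitz estimate on [f] applicable. *)
Lemma vvar_two_copies : (vvar%:E <= \int[nu]_x \int[nu]_y (sq (f x - f y))%:E)%E.
Proof.
rewrite -(nnIcst nu vvar); apply: ge0_le_integral => //.
- by move=> x _; rewrite lee_fin vvar_ge0.
- apply: (measurable_fun_fubini_tonelli_F (fun p : T * T => (sq (f p.1 - f p.2))%:E)); last first.
    by move=> p; rewrite lee_fin sq_ge0.
  apply/measurable_EFinP; apply: measurable_sq; apply: measurable_rVB; exact: measurableT_comp.
- move=> x _; under eq_integral => y _ do rewrite sqBC addrC.
  by rewrite vvar_shift lee_fin lerDr sq_ge0.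
Qed.

End vector.
End variance.

Section fluctuation.
Context {R : realType} {d : nat}.
Local Notation rV := 'rV[R]_d.
Variables (gW : rV -> rV) (L : R).
Hypothesis L0 : 0 <= L.
Hypothesis cW : continuous gW.
Hypothesis oddW : forall x, gW (- x) = - gW x.
Hypothesis lipW : forall x y, sq (gW x - gW y) <= L * sq (x - y).

(** Twice the variance, written with two independent copies instead of a mean. Being translation
    invariant, it contracts under a nonlinear step wherever the law is located, which gives a bound
    uniform in time. *)
Definition twocopy (nu : probability rV R) : \bar R :=
  (\int[nu]_x \int[nu]_y (sq (x - y))%:E)%E.

Definition selfconv (nu : probability rV R) x : rV := vmean nu (fun y => gW (x - y)).

Variable nu : probability rV R.
Variable D : R.
Hypothesis nuD : (twocopy nu <= D%:E)%E.

Let mW : measurable_fun setT gW := continuous_measurable_map cW.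

Let msub (x : rV) : measurable_fun setT (fun y : rV => gW (x - y)).
Proof. by apply: (measurableT_comp mW); apply: measurable_rVB. Qed.

Lemma gW0 : gW 0 = 0.
Proof.
have := oddW 0; rewrite oppr0 => e; apply/rowP => i.
have := congr1 (fun w : rV => w 0 i) e; rewrite !mxE; lra.
Qed.

Lemma gW_growth x : sq (gW x) <= L * sq x.
Proof. by have := lipW x 0; rewrite gW0 !subr0. Qed.

Lemma nnm_inner (f : rV * rV -> R) : nnm f ->
  measurable_fun setT (fun x => \int[nu]_y (f (x, y))%:E)%E.
Proof.
move=> nf; apply: (measurable_fun_fubini_tonelli_F (EFin \o f)); first exact: nnm_EFin.
by move=> p; rewrite /= lee_fin nnm_ge0.
Qed.

Lemma nnm_sqB2 (f g : rV * rV -> rV) : measurable_fun setT f -> measurable_fun setT g ->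
  nnm (fun p => sq (f p - g p)).
Proof. by move=> mf mg; apply: nnm_sq; exact: measurable_rVB. Qed.

(** A finite double integral has a finite inner integral at some point, and the triangle inequality
    moves it to any other. *)
Lemma twocopy_moment x : (\int[nu]_y (sq (x - y))%:E < +oo)%E.
Proof.
have [x0 hx0] : exists x0, (\int[nu]_y (sq (x0 - y))%:E < +oo)%E.
  apply/not_existsP => H.
  have : twocopy nu = +oo%E.
    rewrite /twocopy (_ : (fun x => _) = cst +oo%E).
      have E := @probability_setT _ _ _ nu.
      by have := integral_cst nu measurableT +oo%E; rewrite [X in _ = (_ * X)%E]E mule1.
    by apply/funext => z; have /negP := H z; rewrite -leNgt leye_eq => /eqP.
  by move=> e; move: nuD; rewrite e leye_eq.
apply: (@le_lt_trans _ _ (\int[nu]_y (2 * sq (x - x0) + 2 * sq (x0 - y))%:E)%E).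
  apply: nnI_le => [||y].
  - by apply: nnm_sq; apply: measurable_rVB.
  - apply: nnmD; first by apply: nnm_cst; rewrite mulr_ge0 ?sq_ge0.
    by apply: nnmZ => //; apply: nnm_sq; apply: measurable_rVB.
  - rewrite (_ : x - y = (x - x0) + (x0 - y)); first exact: sqD_le.
    by rewrite addrA subrK.
rewrite nnID; last 2 first.
- by apply: nnm_cst; rewrite mulr_ge0 ?sq_ge0.
- by apply: nnmZ => //; apply: nnm_sq; apply: measurable_rVB.
rewrite nnIcst nnIZ//; last by apply: nnm_sq; apply: measurable_rVB.
by rewrite lte_add_pinfty ?ltry// lte_mul_pinfty.
Qed.

Lemma gW_moment x : (\int[nu]_y (sq (gW (x - y)))%:E < +oo)%E.
Proof.
apply: (@le_lt_trans _ _ (\int[nu]_y (L * sq (x - y))%:E)%E).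
  apply: nnI_le => [||y]; [apply: nnm_sq; exact: msub| |exact: gW_growth].
  by apply: nnmZ => //; apply: nnm_sq; apply: measurable_rVB.
rewrite nnIZ//; last by apply: nnm_sq; apply: measurable_rVB.
by rewrite lte_mul_pinfty// twocopy_moment.
Qed.

(** Given particle [ord0] at [x], the others are independent, so the empirical interaction has
    variance of order 1/N around [selfconv nu x]. The target [k] may be off by a bias, whose square
    [b] adds up separately. *)
Lemma particle_variance n (x : rV) (k : rV) b : sq (selfconv nu x - k) <= b ->
  (\int[prod_power nu n]_y (sq (KN gW (tuple_cons (x, y)) ord0 - k))%:E <=
   (2 / n.+1%:R)%:E * (L%:E * (\int[nu]_y (sq (x - y))%:E + twocopy nu)) + (2 * b)%:E)%E.
Proof.
move=> hb; have f2 := gW_moment x.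
set m := selfconv nu x in hb *.
(* All [n.+1] terms are centred at [m]; the self-interaction is 0 and leaves the term [- m]. *)
pose S (y : n.-tuple rV) := - m + \sum_i (gW (x - tnth y i) - m).
have KNE y : KN gW (tuple_cons (x, y)) ord0 - m = n.+1%:R^-1 *: S y.
  rewrite /KN big_ord_recl (_ : tnth _ ord0 = x)// subrr gW0 add0r /S.
  rewrite (_ : \sum_(i < n) _ = \sum_i gW (x - tnth y i)); last first.
    by apply: eq_bigr => i _; rewrite tnth_consS.
  have n0 : n.+1%:R != 0 :> R by [].
  rewrite sumrB sumr_const card_ord; set G := \sum_i _.
  move: (m) G n0 => a c; rewrite -[n.+1%:R]natr1 => n0.
  by apply/rowP => j; rewrite !mxE mulmxnE -[a 0 j *+ n]mulr_natl; field.

have mS : measurable_fun setT S.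
  apply: measurable_rVD; first by [].
  apply: measurable_rVsum => i; apply: measurable_rVB => //.
  by apply: (measurableT_comp (msub x)); exact: measurable_tnth.
have nS : nnm (fun y => sq (S y)) by exact: nnm_sq.
have c0 : 0 <= 2 / n.+1%:R ^+ 2 :> R by rewrite divr_ge0 ?sqr_ge0.
have b0 : 0 <= b by exact: le_trans (sq_ge0 _) hb.
apply: (@le_trans _ _ (\int[prod_power nu n]_y (2 / n.+1%:R ^+ 2 * sq (S y) + 2 * b)%:E)%E).
  apply: nnI_le => [||y].
  - apply: nnm_sq; apply: measurable_rVB => //.
    rewrite (_ : (fun y => _) = (fun y => n.+1%:R^-1 *: S y + m)).
      by apply: measurable_rVD => //; exact: measurable_rVZ.
    by apply/funext => y; rewrite -KNE subrK.
  - by apply: nnmD; [exact: nnmZ|apply: nnm_cst; rewrite mulr_ge0].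
  - rewrite (_ : KN _ _ _ - k = n.+1%:R^-1 *: S y + (m - k)).
      apply: (le_trans (sqD_le _ _)); rewrite sqZ exprVn mulrA lerD2l ler_wpM2l//.
    by rewrite -KNE addrA subrK.
rewrite nnID; last 2 first.
- exact: nnmZ.
- by apply: nnm_cst; rewrite mulr_ge0.
rewrite nnIcst leeD2r// nnIZ// (vvar_sum (msub x) f2) sqN.
have [P0 P1] : (\int[nu]_y (sq (gW (x - y)))%:E = (sq m + vvar nu (fun y => gW (x - y)))%:E /\
    (vvar nu (fun y => gW (x - y)))%:E <= L%:E * twocopy nu)%E.
  split.
    transitivity (\int[nu]_y (sq (0 + gW (x - y)))%:E)%E.
      by apply: eq_integral => y _; rewrite add0r.
    by rewrite (vvar_shift (msub x) f2) add0r.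
  apply: (le_trans (vvar_two_copies (msub x) f2)).
  rewrite /twocopy -ge0_integralZl_EFin//; first last.
  - by apply: (nnm_inner (f := fun p : rV * rV => sq (p.1 - p.2))); apply: nnm_sqB2.
  - by move=> y _; apply: nnI_ge0; apply: nnm_sq; apply: measurable_rVB.
  apply: ge0_le_integral => //.
  - by move=> y _; apply: nnI_ge0; apply: nnm_sq; apply: measurable_rVB.
  - apply: (nnm_inner (f := fun p : rV * rV => sq (gW (x - p.1) - gW (x - p.2)))); apply: nnm_sqB2;
      by apply: (measurableT_comp (msub x)).
  - apply: measurable_funeM.
    by apply: (nnm_inner (f := fun p : rV * rV => sq (p.1 - p.2))); apply: nnm_sqB2.
  - move=> y _; rewrite -nnIZ//; last by apply: nnm_sq; apply: measurable_rVB.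
    apply: nnI_le => [||z].
    + by apply: nnm_sq; apply: measurable_rVB.
    + by apply: nnmZ => //; apply: nnm_sq; apply: measurable_rVB.
    + apply: (le_trans (lipW _ _)); rewrite ler_wpM2l//.
      by rewrite opprB addrC addrA subrK sqBC.
set vv := vvar _ _ in P0 P1 *.
have vv0 : 0 <= vv by exact: vvar_ge0 (msub x) f2.
have P2 : ((sq m + vv)%:E <= L%:E * \int[nu]_y (sq (x - y))%:E)%E.
  rewrite -P0 -nnIZ//; last by apply: nnm_sq; apply: measurable_rVB.
  apply: nnI_le => [||y]; [apply: nnm_sq; exact: msub| |exact: gW_growth].
  by apply: nnmZ => //; apply: nnm_sq; apply: measurable_rVB.
have tc0 : (0 <= twocopy nu)%E.
  apply: integral_ge0 => y _; apply: nnI_ge0; apply: nnm_sq; apply: measurable_rVB => //.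
apply: (@le_trans _ _ ((2 / n.+1%:R)%:E * ((sq m + vv)%:E + vv%:E))%E); last first.
  apply: lee_wpmul2l; first by rewrite lee_fin divr_ge0.
  rewrite ge0_muleDr//; last by apply: nnI_ge0; apply: nnm_sq; apply: measurable_rVB.
  exact: leeD.
rewrite -EFinD -!EFinM lee_fin.
have n1 : 1 <= n.+1%:R :> R by rewrite ler1n.
have -> : 2 / n.+1%:R * (sq m + vv + vv) = 2 / n.+1%:R ^+ 2 * (n.+1%:R * (sq m + vv + vv)) :> R.
  by field.
apply: ler_wpM2l => //.
have := sq_ge0 m; move: n1; rewrite -[n.+1%:R]natr1; move: (n%:R : R) (ler0n R n) => q q0 n1 m0; nra.
Qed.

(** Exchangeability leaves particle [ord0], whose contribution is of order 1/N; summed over the [N]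
    particles it is bounded independently of [N]. The bias enters as [2 * b * N] and is harmless
    once [b] is of order 1/N. *)
Lemma fluct_mean N (K : rV -> rV) b : measurable_fun setT K ->
  (forall x, sq (selfconv nu x - K x) <= b) ->
  (\int[prod_power nu N]_y (fluct gW K y)%:E <= (4 * L * D + 2 * b * N%:R)%:E)%E.
Proof.
move=> mK hb.
have nn i : nnm (fun y : N.-tuple rV => sq (KN gW y i - K (tnth y i))).
  apply: nnm_sq; apply: measurable_rVB; first exact: measurable_KN.
  by apply: (measurableT_comp mK); exact: measurable_tnth.
have D0 : 0 <= D.
  rewrite -lee_fin; apply: le_trans nuD; apply: integral_ge0 => y _; apply: nnI_ge0.
  by apply: nnm_sq; apply: measurable_rVB.
rewrite nnIsum//.
case: N nn => [|n] nn.
  by rewrite big_ord0 lee_fin mulr0 addr0 !mulr_ge0.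
apply: (@le_trans _ _ (\sum_(i < n.+1) (4 / n.+1%:R * (L * D) + 2 * b)%:E)%E); last first.
  rewrite sumEFin sumr_const card_ord lee_fin -[X in X <= _]mulr_natl.
  by rewrite le_eqVlt; apply/orP; left; apply/eqP; field.
apply: lee_sum => i _.
have -> : (\int[prod_power nu n.+1]_y (sq (KN gW y i - K (tnth y i)))%:E =
   \int[prod_power nu n.+1]_y (sq (KN gW y ord0 - K (tnth y ord0)))%:E)%E.
  rewrite (has_law_integral (has_law_perm nu (tperm ord0 i))
      (f := fun y => (sq (KN gW y ord0 - K (tnth y ord0)))%:E) (nnm_EFin (nn _))
      (fun y => sq_ge0 _)).
  apply: eq_integral => y _ /=; rewrite tnth_mktuple tpermL; congr ((sq (_ - _))%:E).
  rewrite /KN tnth_mktuple tpermL; congr (_ *: _).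
  rewrite (reindex_inj (@perm_inj _ (tperm ord0 i))) /=.
  by apply: eq_bigr => j _; rewrite tnth_mktuple.
rewrite (integral_prod_powerS nu (F := fun y => (sq (KN gW y ord0 - K (tnth y ord0)))%:E)); last 2 first.
- exact: nnm_EFin (nn _).
- by move=> y; rewrite lee_fin sq_ge0.
have b0 : 0 <= b by exact: le_trans (sq_ge0 _) (hb 0).
have n0 : 0 <= 2 / n.+1%:R :> R by rewrite divr_ge0.
have nB (x : rV) : nnm (fun y : rV => sq (x - y)) by apply: nnm_sq; apply: measurable_rVB.
have inner0 (x : rV) : (0 <= \int[nu]_y (sq (x - y))%:E)%E by apply: nnI_ge0.
have mi : measurable_fun setT (fun x : rV => \int[nu]_y (sq (x - y))%:E)%E.
  by apply: (nnm_inner (f := fun p : rV * rV => sq (p.1 - p.2))); apply: nnm_sqB2.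
have tc0 : (0 <= twocopy nu)%E by apply: integral_ge0 => y _; exact: inner0.
apply: (@le_trans _ _ (\int[nu]_x ((2 / n.+1%:R)%:E * (L%:E *
    (\int[nu]_y (sq (x - y))%:E + twocopy nu)) + (2 * b)%:E))%E).
  apply: ge0_le_integral => //.
  - by move=> x _; apply: integral_ge0 => y _; rewrite lee_fin sq_ge0.
  - apply: (measurable_fun_fubini_tonelli_F (fun p : rV * n.-tuple rV =>
      (sq (KN gW (tuple_cons p) ord0 - K (tnth (tuple_cons p) ord0)))%:E)); last first.
      by move=> p; rewrite lee_fin sq_ge0.
    apply: (measurableT_comp (nnm_EFin (nn ord0))); exact: measurable_tuple_cons.
  - apply: emeasurable_funD => //; apply: measurable_funeM; apply: measurable_funeM.
    exact: emeasurable_funD.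
  - by move=> x _; exact: (particle_variance n (hb x)).
rewrite ge0_integralD//; last 3 first.
- by move=> x _; rewrite mule_ge0// mule_ge0// adde_ge0.
- by apply: measurable_funeM; apply: measurable_funeM; exact: emeasurable_funD.
- by move=> x _; rewrite lee_fin mulr_ge0.
rewrite nnIcst ge0_integralZl_EFin//; last 2 first.
- by move=> x _; rewrite mule_ge0// adde_ge0.
- apply: measurable_funeM; exact: emeasurable_funD.
rewrite ge0_integralZl_EFin//; last 2 first.
- by move=> x _; rewrite adde_ge0.
- exact: emeasurable_funD.
have E1 := @probability_setT _ _ _ nu.
have E2 := integral_cst nu measurableT (twocopy nu).
rewrite [X in _ = (_ * X)%E]E1 mule1 in E2.
rewrite ge0_integralD// E2 EFinD leeD2r//.
have -> : 4 / n.+1%:R * (L * D) = 2 / n.+1%:R * (L * (D + D)) by field.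
rewrite [X in (_ <= X)%E]EFinM; apply: lee_wpmul2l; first by rewrite lee_fin.
rewrite EFinM; apply: lee_wpmul2l; first by rewrite lee_fin.
by rewrite EFinD; apply: leeD.
Qed.

End fluctuation.

Section noise_variance.
Context {R : realType} {d : nat}.
Variable s : R.
Hypothesis s0 : 0 < s.

Lemma nnI_gauss1 (f : R -> R) : nnm f ->
  (\int[gauss1 s]_x (f x)%:E = \int[normal_prob 0 s]_x (f x)%:E)%E.
Proof.
move=> nf; rewrite (has_law_integral (has_law_law (normal_prob 0 s) _))//.
  exact: nnm_EFin.
by move=> x; rewrite lee_fin nnm_ge0.
Qed.

Lemma noise1_moment :
  (\int[@noise1 R d s]_z (sq (row_of z))%:E <= (16 * d%:R * s ^+ 2)%:E)%E.
Proof.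
apply: (@le_trans _ _ (\int[@noise1 R d s]_z (\sum_i tnth z i ^+ 2)%:E)%E).
  rewrite le_eqVlt; apply/orP; left; apply/eqP.
  by apply: eq_integral => z _; rewrite sqE; congr EFin; apply: eq_bigr => i _; rewrite mxE.
rewrite nnIsum; last by move=> i; apply: nnm_sqr; exact: measurable_tnth.
apply: (@le_trans _ _ (\sum_(i < d) (16 * s ^+ 2)%:E)%E); last first.
  by rewrite sumEFin sumr_const card_ord lee_fin -[X in X <= _]mulr_natl; lra.
apply: lee_sum => i _.
have n2 : nnm (fun x : R => x ^+ 2) by apply: nnm_sqr; exact: measurable_id.
rewrite -(has_law_integral (has_law_tnth (gauss1 s) i) (f := fun x : R => (x ^+ 2)%:E)
  (nnm_EFin n2) (fun x : R => sqr_ge0 x)) nnI_gauss1//.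
have := normal_moment s0 2.
rewrite (_ : (fun x => _) = (fun x : R => (x ^+ 2)%:E)); last first.
  by apply/funext => x; rewrite real_normK ?num_real.
by move=> h; apply: (le_trans h); rewrite lee_fin; lra.
Qed.

End noise_variance.

Lemma nnm_fubini (R : realType) d1 d2 (T1 : measurableType d1) (T2 : measurableType d2)
    (mu : probability T2 R) (f : T1 * T2 -> R) : nnm f ->
  measurable_fun setT (fun x => \int[mu]_y (f (x, y))%:E)%E.
Proof.
move=> nf; apply: (measurable_fun_fubini_tonelli_F (EFin \o f)); first exact: nnm_EFin.
by move=> p; rewrite /= lee_fin nnm_ge0.
Qed.

Section chain.
Context {R : realType} {d : nat}.
Local Notation rV := 'rV[R]_d.
Variables (gW J : rV -> rV) (L lamV lamW h th : R).
Hypotheses (h0 : 0 < h) (L0 : 0 <= L) (lamV0 : 0 <= lamV).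
Hypothesis cW : continuous gW.
Hypothesis oddW : forall x, gW (- x) = - gW x.
Hypothesis lipW : forall x y, sq (gW x - gW y) <= L * sq (x - y).
Hypothesis J_contract : forall u v,
  (1 + 2 * h * lamV) * sq (J u - J v) <= sq (u - v).
Hypothesis mJ : measurable_fun setT J.

Local Notation n1 := (@noise1 R d (Num.sqrt h)).
Local Notation Gam := (@noise R d (Num.sqrt h)).

Definition next_law (K : rV -> rV) (nu nu' : probability rV R) :=
  has_law (nu \x n1)%E (fun p => step1 J h K p.1 p.2) nu'.

Let f (z : d.-tuple R) : rV := Num.sqrt 2 *: row_of z.

Let mf : measurable_fun setT f.
Proof. by apply: measurable_rVZ; exact: measurable_row_of. Qed.

Let f2 : (\int[n1]_z (sq (f z))%:E <= (32 * d%:R * h)%:E)%E.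
Proof.
have sh : 0 < Num.sqrt h by rewrite sqrtr_gt0.
under eq_integral do rewrite /f sqZ sqr_sqrtr//.
rewrite nnIZ//; last by apply: nnm_sq; exact: measurable_row_of.
apply: (@le_trans _ _ (2%:E * (16 * d%:R * Num.sqrt h ^+ 2)%:E)%E).
  by apply: lee_wpmul2l; [rewrite lee_fin|exact: noise1_moment].
by rewrite sqr_sqrtr ?(ltW h0)// -EFinM lee_fin; lra.
Qed.

Let f2fin : (\int[n1]_z (sq (f z))%:E < +oo)%E := le_lt_trans f2 (ltry _).

Let vv := vvar n1 f.

Let vv_le : vv <= 32 * d%:R * h.
Proof.
rewrite -lee_fin; apply: le_trans f2.
have -> : (\int[n1]_z (sq (f z))%:E = \int[n1]_z (sq (0 + f z))%:E)%E.
  by apply: eq_integral => z _; rewrite add0r.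
by rewrite (vvar_shift mf f2fin) lee_fin lerDr sq_ge0.
Qed.

Let noise_pair (A : rV) :
  (\int[n1]_z (sq (A + f z - vmean n1 f) + vv)%:E = (sq A + 2 * vv)%:E)%E.
Proof.
have v0 : 0 <= vv by exact: vvar_ge0 mf f2fin.
rewrite nnID; last 2 first.
- by apply: nnm_sq; apply: measurable_rVB => //; exact: measurable_rVD.
- exact: nnm_cst.
rewrite nnIcst (_ : (\int[n1]_z _ = \int[n1]_z (sq (A - vmean n1 f + f z))%:E)%E); last first.
  by apply: eq_integral => z _; rewrite addrAC.
by rewrite (vvar_shift mf f2fin) subrK -EFinD -/vv; congr EFin; lra.
Qed.

(** Two independent copies of the step. The drift and the resolvent contract the squared distance by
    [th], and the two independent noises add at most twice the variance of one. *)
Lemma twocopy_next K nu nu' D : field_ok L lamW K -> next_law K nu nu' ->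
  1 - 2 * h * lamW + h ^+ 2 * L <= th * (1 + 2 * h * lamV) -> 0 <= th ->
  (twocopy nu <= D%:E)%E ->
  (twocopy nu' <= (th * D + 64 * d%:R * h)%:E)%E.
Proof.
move=> [mK Klip Kmon] hl hth th0 nuD.
have den1 : 1 <= 1 + 2 * h * lamV by rewrite lerDl !mulr_ge0// ltW.
set rho := 1 + 2 * h * lamV in hth den1.
have rho0 : 0 < rho by exact: lt_le_trans den1.
have v0 : 0 <= vv by exact: vvar_ge0 mf f2fin.
pose A (x y : rV) := (x - h *: K x) - (y - h *: K y).
have mdrift : measurable_fun setT (fun x : rV => x - h *: K x).
  by apply: measurable_rVB => //; exact: measurable_rVZ.
have mS := measurable_step1 h mJ mK.
pose S (p : rV * d.-tuple R) := step1 J h K p.1 p.2.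
have S_le p q : sq (S p - S q) <= rho^-1 * sq (A p.1 q.1 + f p.2 - f q.2).
  rewrite ler_pdivlMl//; apply: (le_trans (J_contract _ _)).
  by rewrite opprD addrACA addrA.
have nS p : nnm (fun q => sq (S p - S q)) by apply: nnm_sq; exact: measurable_rVB.
have mA x : measurable_fun setT (A x) by exact: measurable_rVB.
have mA1 : measurable_fun setT (fun p : rV * rV => A p.1 p.2).
  by apply: measurable_rVB; apply: (measurableT_comp mdrift).
have E1 : twocopy nu' = (\int[nu \x n1]_p \int[nu \x n1]_q (sq (S p - S q))%:E)%E.
  have mi : measurable_fun setT (fun x : rV => \int[nu']_y (sq (x - y))%:E)%E.
    apply: (nnm_inner nu' (f := fun p : rV * rV => sq (p.1 - p.2))).
    by apply: nnm_sqB2.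
  rewrite /twocopy (has_law_integral hl (f := fun x : rV => \int[nu']_y (sq (x - y))%:E)%E)//; last first.
    by move=> x; apply: integral_ge0 => y _; rewrite lee_fin sq_ge0.
  apply: eq_integral => p _.
  rewrite (has_law_integral hl (f := fun y : rV => (sq (step1 J h K p.1 p.2 - y))%:E))//.
    by apply/measurable_EFinP; apply: measurable_sq; exact: measurable_rVB.
  by move=> y; rewrite lee_fin sq_ge0.
have inner p : (\int[nu \x n1]_q (sq (S p - S q))%:E <=
    rho^-1%:E * \int[nu]_y (sq (A p.1 y + f p.2 - vmean n1 f) + vv)%:E)%E.
  have mAf : measurable_fun setT (fun q : rV * d.-tuple R => A p.1 q.1 + f p.2 - f q.2).
    apply: measurable_rVB; last exact: (measurableT_comp mf).
    by apply: measurable_rVD => //; exact: (measurableT_comp (mA p.1)).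
  apply: (@le_trans _ _ (\int[nu \x n1]_q (rho^-1 * sq (A p.1 q.1 + f p.2 - f q.2))%:E)%E).
    apply: nnI_le => //; first by apply: nnmZ; [rewrite invr_ge0 ltW|exact: nnm_sq].
  rewrite nnIZ ?invr_ge0 ?(ltW rho0)//; last exact: nnm_sq.
  apply: lee_wpmul2l; first by rewrite lee_fin invr_ge0 ltW.
  rewrite (fubini_tonelli1 (m1 := nu) (m2 := n1)
    (fun q => (sq (A p.1 q.1 + f p.2 - f q.2))%:E)); last 2 first.
  - by apply/measurable_EFinP; exact: measurable_sq.
  - by move=> q; rewrite lee_fin sq_ge0.
  rewrite le_eqVlt; apply/orP; left; apply/eqP; apply: eq_integral => y _.
  rewrite /fubini_F /=.
  transitivity (\int[n1]_z (sq (- (A p.1 y + f p.2) + f z))%:E)%E.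
    by apply: eq_integral => z _; rewrite -sqN opprB [- _ + _]addrC.
  by rewrite (vvar_shift mf f2fin) -sqN opprD opprK.
have mB : measurable_fun setT (fun t : (rV * d.-tuple R) * rV =>
    A t.1.1 t.2 + f t.1.2 - vmean n1 f).
  apply: measurable_rVB => //; apply: measurable_rVD.
    apply: (measurableT_comp mA1) (_ : measurable_fun setT (fun t => (t.1.1, t.2))).
    apply: measurable_fun_pair => //; exact: (measurableT_comp measurable_fst measurable_fst).
  apply: (measurableT_comp mf); exact: (measurableT_comp measurable_snd measurable_fst).
have nB : nnm (fun t : (rV * d.-tuple R) * rV => sq (A t.1.1 t.2 + f t.1.2 - vmean n1 f) + vv).
  by apply: nnmD; [exact: nnm_sq|exact: nnm_cst].
have mIB : measurable_fun setT (fun p : rV * d.-tuple R =>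
    \int[nu]_y (sq (A p.1 y + f p.2 - vmean n1 f) + vv)%:E)%E.
  exact: (nnm_fubini nu nB).
have IB0 p : (0 <= \int[nu]_y (sq (A p.1 y + f p.2 - vmean n1 f) + vv)%:E)%E.
  by apply: integral_ge0 => y _; rewrite lee_fin addr_ge0 ?sq_ge0.
apply: (@le_trans _ _ (\int[nu \x n1]_p (rho^-1%:E *
    \int[nu]_y (sq (A p.1 y + f p.2 - vmean n1 f) + vv)%:E))%E).
  rewrite E1; apply: ge0_le_integral => //.
  - by move=> p _; apply: integral_ge0 => q _; rewrite lee_fin; exact: sq_ge0.
  - apply: (nnm_fubini (nu \x n1)%E
      (f := fun t : (rV * d.-tuple R) * (rV * d.-tuple R) => sq (S t.1 - S t.2))).
    by apply: nnm_sq; apply: measurable_rVB; exact: (measurableT_comp mS).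
  - exact: measurable_funeM.
rewrite ge0_integralZl_EFin//; last by rewrite invr_ge0 ltW.
rewrite (fubini_tonelli1 (m1 := nu) (m2 := n1) (fun p : rV * d.-tuple R =>
    \int[nu]_y (sq (A p.1 y + f p.2 - vmean n1 f) + vv)%:E)%E)//.
have E2 x : (\int[n1]_z \int[nu]_y (sq (A x y + f z - vmean n1 f) + vv)%:E =
    \int[nu]_y (sq (A x y) + 2 * vv)%:E)%E.
  rewrite (fubini_tonelli (m1 := n1) (m2 := nu) (fun t : d.-tuple R * rV =>
    (sq (A x t.2 + f t.1 - vmean n1 f) + vv)%:E)).
  - by apply: eq_integral => y _; exact: (noise_pair (A x y)).
  - apply: nnm_EFin; apply: nnmD; last exact: nnm_cst.
    apply: nnm_sq; apply: measurable_rVB => //; apply: measurable_rVD.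
      exact: (measurableT_comp (mA x)).
    exact: (measurableT_comp mf).
  - by move=> t; rewrite lee_fin addr_ge0 ?sq_ge0.
have A_le x y : sq (A x y) <= (th * rho) * sq (x - y).
  have -> : A x y = (x - y) - h *: (K x - K y).
    by rewrite /A; apply/rowP => k; rewrite !mxE; ring.
  rewrite [X in X <= _]sqB sqZ dotvZr dotvC.
  have : h ^+ 2 * sq (K x - K y) <= h ^+ 2 * (L * sq (x - y)) by rewrite ler_wpM2l ?sqr_ge0.
  have : 2 * h * (lamW * sq (x - y)) <= 2 * h * dotv (K x - K y) (x - y).
    by rewrite ler_wpM2l// mulr_ge0// ltW.
  have := ler_wpM2r (sq_ge0 (x - y)) hth; lra.
have c0 : 0 <= th * rho by rewrite mulr_ge0// ltW.
have nxy (x : rV) : nnm (fun y : rV => sq (x - y)) by apply: nnm_sq; exact: measurable_rVB.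
have mxy : measurable_fun setT (fun x : rV => \int[nu]_y (sq (x - y))%:E)%E.
  by apply: (nnm_inner nu (f := fun p : rV * rV => sq (p.1 - p.2))); apply: nnm_sqB2.
have x0 (x : rV) : (0 <= \int[nu]_y (sq (x - y))%:E)%E by apply: nnI_ge0.
have v2 : 0 <= 2 * vv by rewrite mulr_ge0.
have E3 x : (\int[nu]_y (sq (A x y) + 2 * vv)%:E <=
    (th * rho)%:E * \int[nu]_y (sq (x - y))%:E + (2 * vv)%:E)%E.
  rewrite -nnIZ// -[X in (_ + X)%E](nnIcst nu (2 * vv)) -nnID; last 2 first.
  - exact: nnmZ.
  - exact: nnm_cst.
  apply: nnI_le => [||y].
  - by apply: nnmD; [exact: nnm_sq|exact: nnm_cst].
  - by apply: nnmD; [exact: nnmZ|exact: nnm_cst].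
  - by rewrite lerD2r.
apply: (@le_trans _ _ (rho^-1%:E * \int[nu]_x ((th * rho)%:E * \int[nu]_y (sq (x - y))%:E +
    (2 * vv)%:E))%E).
  apply: lee_wpmul2l; first by rewrite lee_fin invr_ge0 ltW.
  apply: ge0_le_integral => //.
  - by move=> x _; apply: integral_ge0 => z _; exact: IB0 (x, z).
  - apply: (measurable_fun_fubini_tonelli_F (fun p : rV * d.-tuple R =>
      \int[nu]_y (sq (A p.1 y + f p.2 - vmean n1 f) + vv)%:E)%E) => //.
  - by apply: emeasurable_funD => //; exact: measurable_funeM.
  - by move=> x _; rewrite /fubini_F /= E2; exact: E3.
have E4 := nnIcst nu (2 * vv).
rewrite (ge0_integralD nu measurableT (f1 := fun x => ((th * rho)%:E *
   \int[nu]_y (sq (x - y))%:E)%E) (f2 := fun=> (2 * vv)%:E)); last 4 first.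
- by move=> x _; rewrite mule_ge0.
- exact: measurable_funeM.
- by move=> x _; rewrite lee_fin.
- by [].
rewrite E4 ge0_integralZl_EFin//.
apply: (@le_trans _ _ (rho^-1%:E * ((th * rho)%:E * D%:E + (2 * vv)%:E))%E).
  apply: lee_wpmul2l; first by rewrite lee_fin invr_ge0 ltW.
  by rewrite leeD2r//; apply: lee_wpmul2l.
rewrite -[((th * rho)%:E * D%:E)%E]EFinM -EFinD -EFinM lee_fin.
have -> : rho^-1 * (th * rho * D + 2 * vv) = th * D + rho^-1 * (2 * vv).
  by field; rewrite lt0r_neq0.
rewrite lerD2l; apply: (@le_trans _ _ (2 * vv)); last by have := vv_le; lra.
by rewrite -[leRHS]mul1r ler_wpM2r// invf_le1.
Qed.

Section tuples.
Variable N : nat.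
Local Notation E := (N.-tuple rV).

Lemma Rint_Tbar K nu nu' (g : E -> R) : measurable_fun setT K -> next_law K nu nu' ->
  bmf g -> \int[prod_power nu N]_y Tbar J h K g y = \int[prod_power nu' N]_y g y.
Proof.
move=> mK hl bg.
have bG : bmf (fun p : E * N.-tuple (d.-tuple R) => g (bstep J h K p.1 p.2)).
  by apply: (bmf_comp bg); exact: measurable_bstep.
rewrite -(Rint_prod12 (prod_power nu N) (Gam N) bG).
rewrite (has_law_Rint (has_law_unzip nu n1 N) bG).
rewrite (has_law_Rint (has_law_map N hl) bg).
apply: eq_Rintegral => p _; congr g; apply: eq_from_tnth => i.
by rewrite !tnth_mktuple.
Qed.

Variables (Ks : nat -> rV -> rV) (nus : nat -> probability rV R).
Hypothesis Kok : forall k, field_ok L lamW (Ks k).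
Hypothesis nus_next : forall k, next_law (Ks k) (nus k) (nus k.+1).

Let mKs k : measurable_fun setT (Ks k). Proof. by case: (Kok k). Qed.

Definition field_seq a n := [seq Ks k | k <- iota a n].

Lemma field_seq_ok a n : oks L lamW (field_seq a n).
Proof.
elim: n a => [|n IH] a K //=; case=> [<-|]; [exact: Kok|exact: (IH a.+1 K)].
Qed.

Lemma size_field_seq a n : size (field_seq a n) = n.
Proof. by rewrite size_map size_iota. Qed.

Lemma field_seq_cat a n1 n2 : field_seq a (n1 + n2) = field_seq a n1 ++ field_seq (a + n1) n2.
Proof. by rewrite /field_seq iotaD map_cat. Qed.

Lemma Rint_Ubar a n (g : E -> R) : bmf g ->
  \int[prod_power (nus a) N]_y Ubar J h (field_seq a n) g y =
  \int[prod_power (nus (a + n)%N) N]_y g y.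
Proof.
move=> bg; elim: n a => [|n IH] a; first by rewrite addn0.
have bU m b : bmf (Ubar J h (field_seq b m) g).
  by elim: m b => [|m IHm] b //=; apply: bmf_Tbar => //; exact: IHm.
rewrite [LHS](Rint_Tbar (mKs a) (nus_next a)); last exact: bU.
by rewrite IH addSnnS.
Qed.

(** Starting from a product law, the chain keeps a product law at each step, so every fluctuation is
    averaged under the law assumed in [fluct_mean]. Removing the caps only increases the
    integral. *)
Lemma Rint_Sacc a n B w (S0 : E -> R) c c0 : 0 < B -> (forall k, 0 <= w k) ->
  bmf S0 -> (forall y, 0 <= S0 y) -> ucont S0 ->
  (forall k, (k < n)%N -> (\int[prod_power (nus (a + k)%N) N]_y (fluct gW (Ks (a + k)%N) y)%:E <= c%:E)%E) ->
  \int[prod_power (nus (a + n)%N) N]_y S0 y <= c0 ->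
  \int[prod_power (nus a) N]_y Sacc gW J h B w (field_seq a n) S0 y <=
  (\sum_(k < n) w k) * c + c0.
Proof.
move=> B0 w0 bS S00 uS; elim: n a => [|n IH] a hc h0'.
  by rewrite big_ord0 mul0r add0r /= -[a in nus a]addn0.
have [bSa Sa0 _] := Sacc_ok h0 L0 lamV0 cW lipW J_contract mJ B0 w0 bS S00 uS (@field_seq_ok a.+1 n).
set Sa := Sacc _ _ _ _ _ _ _ in bSa Sa0.
have bT := bmf_Tbar h mJ (mKs a) bSa.
have T0 y : 0 <= Tbar J h (Ks a) Sa y.
  by apply: Rint_ge0b => //; exact: bmf_bstep_z.
have nF : nnm (fluct gW (N := N) (Ks a)).
  by split; [exact: measurable_fluct|move=> y; exact: fluct_ge0].
have nw : nnm (fun y : E => w n * fluct gW (Ks a) y) by exact: nnmZ.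
have nT : nnm (Tbar J h (Ks a) Sa) by split => //; exact: bmf_meas.
rewrite /= size_map size_iota -/Sa.
have B20 : 0 <= 2 * B by rewrite mulr_ge0// ltW.
have bm : bmf (fun y => Num.min (2 * B) (w n * fluct gW (Ks a) y + Tbar J h (Ks a) Sa y)).
  by apply: bmf_minc => //; have [] := nnmD nw nT.
rewrite -lee_fin EFin_Rint//.
apply: (@le_trans _ _ (\int[prod_power (nus a) N]_y
    (w n * fluct gW (Ks a) y + Tbar J h (Ks a) Sa y)%:E)%E).
  apply: nnI_le => [||y]; last by rewrite ge_min lexx orbT.
  - split; first exact: bmf_meas.
    by move=> y; rewrite le_min B20 (nnm_ge0 (nnmD nw nT)).
  - exact: nnmD.
rewrite nnID// nnIZ//.
have eT := Rint_Tbar (mKs a) (nus_next a) bSa.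
have eT' := EFin_Rint (prod_power (nus a) N) bT; rewrite eT in eT'; rewrite -eT'.
have IHa := IH a.+1.
apply: (@le_trans _ _ ((w n)%:E * c%:E + ((\sum_(k < n) w k) * c + c0)%:E)%E).
  apply: leeD; last first.
    rewrite lee_fin; apply: IHa => [k kn|]; last by rewrite addSnnS.
    by rewrite addSnnS; exact: hc.
  apply: lee_wpmul2l; first by rewrite lee_fin.
  by have := hc 0%N isT; rewrite addn0.
by rewrite -EFinM -EFinD lee_fin big_ord_recr /=; lra.
Qed.

End tuples.
End chain.

(** * Convergence of the Euler scheme *)

Section euclidean_norm.
Context {R : realType} {d : nat}.
Implicit Types x y : 'rV[R]_d.

Lemma cauchy_schwarz x y : dotv x y <= enorm x * enorm y.
Proof.
have nx := enorm_ge0 x; have ny := enorm_ge0 y.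
have ex := sq_enorm x; have ey := sq_enorm y.
have [x0|x0] := eqVneq (enorm x) 0.
  have : sq x = 0 by rewrite -ex x0 expr0n.
  by move=> /sq_eq0 xe; rewrite x0 mul0r xe /dotv big1// => i _; rewrite mxE mul0r.
have [y0|y0] := eqVneq (enorm y) 0.
  have : sq y = 0 by rewrite -ey y0 expr0n.
  by move=> /sq_eq0 ye; rewrite y0 mulr0 ye /dotv big1// => i _; rewrite mxE mulr0.
have e0 : 0 < enorm y / enorm x by rewrite divr_gt0// lt_neqAle eq_sym ?x0 ?y0.
have := dotv_young x y e0; rewrite -ex -ey invf_div.
have -> : enorm y / enorm x * enorm x ^+ 2 = enorm x * enorm y by field.
have -> : enorm x / enorm y * enorm y ^+ 2 = enorm x * enorm y by field.
lra.
Qed.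

Lemma enormD x y : enorm (x + y) <= enorm x + enorm y.
Proof.
rewrite -(ler_pXn2r (n := 2))// ?nnegrE ?addr_ge0 ?enorm_ge0//.
rewrite sq_enorm sqD sqrrD !sq_enorm mulr2n.
by have := cauchy_schwarz x y; lra.
Qed.

Lemma enormN x : enorm (- x) = enorm x.
Proof. by rewrite !enorm_sqrt sqN. Qed.

Lemma enormB x y : enorm (x - y) <= enorm x + enorm y.
Proof. by rewrite -[enorm y]enormN; exact: enormD. Qed.

Lemma enormZ a x : enorm (a *: x) = `|a| * enorm x.
Proof. by rewrite !enorm_sqrt sqZ sqrtrM ?sqr_ge0// sqrtr_sqr. Qed.

Lemma enorm_le_sum x : enorm x <= \sum_i `|x 0 i|.
Proof.
have s0 : 0 <= \sum_i `|x 0 i| by apply: sumr_ge0 => i _.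
rewrite -(ler_pXn2r (n := 2))// ?nnegrE ?enorm_ge0//.
rewrite sq_enorm sqE expr2 mulr_suml; apply: ler_sum => i _.
rewrite -real_normK ?num_real// expr2 ler_wpM2l// (bigD1 i)//= lerDl.
exact: sumr_ge0.
Qed.

Lemma coord_le_enorm x i : `|x 0 i| <= enorm x.
Proof.
rewrite -(ler_pXn2r (n := 2))// ?nnegrE ?enorm_ge0//.
by rewrite sq_enorm real_normK ?num_real// sq_coord.
Qed.

Lemma enorm_le_sq x y a : 0 <= a -> sq x <= a ^+ 2 * sq y -> enorm x <= a * enorm y.
Proof.
move=> a0 h; rewrite -(ler_pXn2r (n := 2))// ?nnegrE ?mulr_ge0 ?enorm_ge0//.
by rewrite exprMn !sq_enorm.
Qed.

End euclidean_norm.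

Section half_line.
Context {R : realType}.

(** Continuity relative to the half-line, as available for paths whose values at negative times are
    arbitrary. *)
Definition cont0 (f : R -> R) := forall x, 0 <= x -> forall e, 0 < e ->
  exists2 de, 0 < de & forall r, 0 <= r -> `|r - x| < de -> `|f r - f x| < e.

Lemma cont0_within (T : normedModType R) (X : R -> T) (F : T -> R) :
  {within `[0, +oo[, continuous X} -> continuous F -> cont0 (F \o X).
Proof.
move=> /subspace_continuousP cX cF x x0 e e0.
have xin : `[0, +oo[%classic x by rewrite /= in_itv /= x0.
have : (F \o X) y @[y --> within `[0, +oo[ (nbhs x)] --> (F \o X) x.
  by apply: (cvg_comp _ _ (cX x xin)); exact: cF.
move=> /cvgrPdist_lt /(_ e e0); rewrite near_withinE => /nbhs_ballP[de /= de0 H].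
exists de => // r r0 rx; rewrite distrC; apply: (H r); last by rewrite /= in_itv /= r0.
by rewrite /ball /= distrC.
Qed.

Lemma cont0D f g : cont0 f -> cont0 g -> cont0 (fun s => f s + g s).
Proof.
move=> cf cg x x0 e e0; have e2 : 0 < e / 2 by rewrite divr_gt0.
have [a a0 ha] := cf x x0 _ e2; have [b b0 hb] := cg x x0 _ e2.
exists (Num.min a b) => [|r r0]; first by rewrite lt_min a0.
rewrite lt_min => /andP[ra rb].
have -> : f r + g r - (f x + g x) = (f r - f x) + (g r - g x) by ring.
apply: (le_lt_trans (ler_normD _ _)).
by have := ha r r0 ra; have := hb r r0 rb; lra.
Qed.

Lemma cont0_within_itv (f : R -> R) t : cont0 f -> {within `[0, t], continuous f}.
Proof.
move=> cf; apply/subspace_continuousP => x /=; rewrite in_itv /= => /andP[x0 xt].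
apply/cvgrPdist_lt => e e0; rewrite near_withinE.
have [de de0 H] := cf x x0 e e0.
near=> r => /=; rewrite in_itv /= => /andP[r0 rt].
have rx : `|x - r| < de by near: r; apply/nbhs_ballP; exists de.
by rewrite distrC; apply: H => //; rewrite distrC.
Unshelve. all: by end_near. Qed.

Lemma cont0_integrable (f : R -> R) t : cont0 f ->
  lebesgue_measure.-integrable `[0, t] (EFin \o f).
Proof.
move=> cf; apply: continuous_compact_integrable; first exact: segment_compact.
exact: cont0_within_itv.
Qed.

Lemma cont0_unif (f : R -> R) t : cont0 f -> forall e, 0 < e ->
  exists2 de, 0 < de & forall r s, 0 <= r <= t -> 0 <= s <= t ->
    `|r - s| < de -> `|f r - f s| < e.
Proof.
move=> cf e e0.
have /compact_near_coveringP cover : compact `[0, t] by exact: segment_compact.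
pose Q (de s : R) := forall r, 0 <= r -> 0 <= s -> `|r - s| < de -> `|f r - f s| < e.
have : \forall de \near 0^'+, `[0, t]%classic `<=` Q de.
  apply: cover => x; rewrite /= in_itv /= => /andP[x0 _].
  have e2 : 0 < e / 2 by rewrite divr_gt0.
  have [de de0 H] := cf x x0 _ e2.
  have d2 : 0 < de / 2 by rewrite divr_gt0.
  near=> s c => r r0 s0 rs.
  have sx : `|s - x| < de / 2.
    by rewrite distrC; near: s; apply/nbhs_ballP; exists (de / 2).
  have c2 : c < de / 2 by near: c; exact: nbhs_right_lt.
  have rx : `|r - x| < de.
    have -> : r - x = (r - s) + (s - x) by ring.
    by apply: (le_lt_trans (ler_normD _ _)); rewrite (splitr de) ltrD// (lt_trans rs).
  have sx' : `|s - x| < de by apply: (lt_trans sx); rewrite ltr_pdivrMr// ltr_pMr// ltr1n.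
  have -> : f r - f s = (f r - f x) - (f s - f x) by ring.
  apply: (le_lt_trans (ler_normB _ _)).
  by rewrite (splitr e) ltrD// H.
move=> h; have [de [de0 de1]] := filter_ex (filterI (nbhs_right_gt (0 : R)) h).
exists de => // r s /andP[r0 rt] /andP[s0 st] rs.
by apply: (de1 s) => //; rewrite /= in_itv /= s0 st.
Unshelve. all: by end_near. Qed.

Lemma increment_le (f g : R -> R) a b : 0 <= a -> a <= b ->
  lebesgue_measure.-integrable `[0, b] (EFin \o f) ->
  lebesgue_measure.-integrable `[0, b] (EFin \o g) ->
  (forall s, a <= s -> s <= b -> f s <= g s) ->
  \int[lebesgue_measure]_(s in `[0, b]) f s - \int[lebesgue_measure]_(s in `[0, a]) f s <=
  \int[lebesgue_measure]_(s in `[0, b]) g s - \int[lebesgue_measure]_(s in `[0, a]) g s.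
Proof.
move=> a0 ab fi gi fg.
have sub : [set` Interval (BRight a) (BRight b)] `<=` `[0, b]%classic.
  move=> s /=; rewrite !in_itv /= => /andP[s1 ->]; rewrite andbT.
  exact: le_trans a0 (ltW s1).
rewrite !Rintegral_itvB//; try by rewrite bnd_simp.
apply: le_Rintegral => //.
- by apply: integrableS fi.
- by apply: integrableS gi.
- move=> s /=; rewrite in_itv /= => /andP[s1 s2]; apply: fg => //; exact: ltW.
Qed.

Lemma Rint_itv_cst (c a : R) : 0 <= a -> \int[lebesgue_measure]_(s in `[0, a]) c = c * a.
Proof.
move=> a0; rewrite Rintegral_cst//= lebesgue_measure_itv /= lte_fin.
case: ltgtP a0 => // [a1 _|<- _]; last by rewrite mulr0.
by rewrite oppr0 adde0.
Qed.

Lemma increment_near (f : R -> R) a b c om : 0 <= a -> a <= b ->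
  lebesgue_measure.-integrable `[0, b] (EFin \o f) ->
  (forall s, a <= s -> s <= b -> `|f s - c| <= om) ->
  `|\int[lebesgue_measure]_(s in `[0, b]) f s - \int[lebesgue_measure]_(s in `[0, a]) f s
    - (b - a) * c| <= (b - a) * om.
Proof.
move=> a0 ab fi H; have b0 := le_trans a0 ab.
have ic (e : R) : lebesgue_measure.-integrable `[0, b] (EFin \o (fun=> e)).
  by apply: cont0_integrable => x _ eps eps0; exists 1 => // r _ _; rewrite subrr normr0.
have := increment_le (g := fun=> c + om) a0 ab fi (ic _) _.
have := increment_le (f := fun=> c - om) a0 ab (ic _) fi _.
rewrite !Rint_itv_cst// => h1 h2; rewrite ler_norml.
have k1 s : a <= s -> s <= b -> c - om <= f s.
  by move=> s1 s2; have := H s s1 s2; rewrite ler_norml => /andP[]; lra.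
have k2 s : a <= s -> s <= b -> f s <= c + om.
  by move=> s1 s2; have := H s s1 s2; rewrite ler_norml => /andP[]; lra.
by have := h1 k1; have := h2 k2; move=> *; apply/andP; split; lra.
Qed.

Lemma gronwall (a : nat -> R) c (b : nat -> R) n : 0 <= c -> (forall k, 0 <= b k) ->
  (forall k, (k < n)%N -> a k.+1 <= expR c * a k + b k) -> 0 <= a 0%N ->
  a n <= expR (c * n%:R) * (a 0%N + \sum_(k < n) b k).
Proof.
move=> c0 b0; elim: n => [|n IH] H a0; first by rewrite big_ord0 mulr0 expR0 mul1r addr0.
apply: (le_trans (H n (ltnSn n))).
have := IH (fun k kn => H k (ltnW kn)) a0 => h.
have -> : expR (c * n.+1%:R) = expR c * expR (c * n%:R).
  by rewrite -expRD -[n.+1%:R]natr1; congr expR; ring.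
have e1 : 1 <= expR c * expR (c * n%:R).
  by rewrite -expRD -[leLHS]expR0 ler_expR addr_ge0// mulr_ge0.
rewrite big_ord_recr /=.
have h1 : expR c * a n <= expR c * (expR (c * n%:R) * (a 0%N + \sum_(k < n) b k)).
  by rewrite ler_wpM2l// expR_ge0.
have h2 : 1 * b n <= expR c * expR (c * n%:R) * b n by rewrite ler_wpM2r.
move: h1 h2; set u := \sum_(k < n) b k; set w := expR c; set v := expR (_ * _); lra.
Qed.

End half_line.

Section grids.
Context {R : realType}.
Variable t : R.
Hypothesis t0 : 0 < t.

Definition mesh (n : nat) : R := t / n%:R.
Definition grid (n k : nat) : R := k%:R * mesh n.

Lemma mesh_gt0 n : (0 < n)%N -> 0 < mesh n.
Proof. by move=> n0; rewrite divr_gt0// ltr0n. Qed.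

Lemma mesh_le n : mesh n <= t.
Proof.
case: n => [|n]; first by rewrite /mesh invr0 mulr0 ltW.
by rewrite ler_pdivrMr// ler_peMr ?(ltW t0)// ler1n.
Qed.

Lemma meshM n : (0 < n)%N -> n%:R * mesh n = t.
Proof. by move=> n0; rewrite /mesh mulrC divfK// pnatr_eq0 -lt0n. Qed.

Lemma grid_itv n k : (k <= n)%N -> 0 <= grid n k <= t.
Proof.
case: n => [|n] kn.
  by move: kn; rewrite leqn0 => /eqP ->; rewrite /grid mul0r lexx ltW.
have m0 := mesh_gt0 (ltn0Sn n).
rewrite mulr_ge0 ?(ltW m0)//= -[X in _ <= X](meshM (ltn0Sn n)).
by rewrite ler_wpM2r ?(ltW m0)// ler_nat.
Qed.

Lemma gridS n k : grid n k.+1 = grid n k + mesh n.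
Proof. by rewrite /grid -[k.+1%:R]natr1; ring. Qed.

Lemma cont0_near (f : R -> R) : cont0 f -> forall e, 0 < e ->
  \forall n \near \oo, forall r s, 0 <= r <= t -> 0 <= s <= t -> `|r - s| <= mesh n ->
    `|f r - f s| < e.
Proof.
move=> cf e e0; have [de de0 H] := cont0_unif t cf e0.
have /cvgr0_norm_lt /(_ _ de0) : (fun n => n.+1%:R^-1 * t : R) @ \oo --> 0.
  rewrite -[0](mul0r t); apply: cvgM; last exact: cvg_cst.
  exact: cvg_harmonic.
move=> [m _ Hm]; exists m.+1 => // n /= mn r s rt st rs; apply: H => //.
apply: (le_lt_trans rs); case: n mn rs => // n mn _.
have := Hm n mn; rewrite ger0_norm; last by rewrite mulr_ge0 ?invr_ge0 ?(ltW t0).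
by rewrite mulrC.
Qed.

End grids.

Section scheme_path.
Context {R : realType} {d N : nat}.
Local Notation rV := 'rV[R]_d.
Local Notation E := (N.-tuple rV).
Variables (V : rV -> R) (lam LG : R).
Hypotheses (sV : smooth V) (lam0 : 0 <= lam) (LG0 : 0 <= LG).
Hypothesis monV : forall x y,
  lam * sq (x - y) <= dotv (grad V x - grad V y) (x - y).
Variables (x B : 'I_N -> R -> rV) (G : R -> E -> 'I_N -> rV).

Definition tup (s : R) : E := [tuple x i s | i < N].

Hypothesis cg1 : forall i j, cont0 (fun s => grad V (x i s) 0 j).
Hypothesis cg2 : forall i j, cont0 (fun s => G s (tup s) i 0 j).
Hypothesis eqx : forall i s, 0 <= s -> x i s = x i 0 + Num.sqrt 2 *: B i s +
  \row_j \int[lebesgue_measure]_(r in `[0, s]) (- grad V (x i r) - G r (tup r) i) 0 j.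
Hypothesis lipG : forall s a b, 0 <= s ->
  \sum_i sq (G s a i - G s b i) <= LG * dist2 a b.

Variable t : R.
Hypothesis t0 : 0 < t.

Local Notation h n := (mesh t n).
Local Notation tk := (grid t).

(** One scheme for both systems: [N] components with the empirical field for the particles, and a
    single component with the field of the time-dependent law for the limit process. The noise
    enters through the increments of the given path. *)
Fixpoint euler (n k : nat) : E :=
  if k is k'.+1 then
    [tuple resolvent V (h n) (tnth (euler n k') i - h n *: G (tk n k') (euler n k') i +
      Num.sqrt 2 *: (B i (tk n k'.+1) - B i (tk n k'))) | i < N]
  else tup 0.

Let cdrift i j : cont0 (fun s => (- grad V (x i s) - G s (tup s) i) 0 j).
Proof.
have H (f : R -> R) : cont0 f -> cont0 (fun s => - f s).
  move=> cf y y0 e e0; have [de de0 H] := cf y y0 e e0; exists de => // r r0 ry.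
  by rewrite -opprD normrN; exact: H.
rewrite (_ : (fun s => _) = (fun s => - grad V (x i s) 0 j + - G s (tup s) i 0 j)); last first.
  by apply/funext => s; rewrite !mxE.
by apply: cont0D; apply: H.
Qed.

(** The residual of the exact path in one step of the scheme, with [grad V] taken at the right
    endpoint and [G] at the left one. *)
Definition defect n k i : rV := x i (tk n k.+1) - x i (tk n k) -
  Num.sqrt 2 *: (B i (tk n k.+1) - B i (tk n k)) +
  h n *: grad V (x i (tk n k.+1)) + h n *: G (tk n k) (tup (tk n k)) i.

Lemma defect_small om : 0 < om -> \forall n \near \oo, forall k i, (k < n)%N ->
  sq (defect n k i) <= d%:R * (2 * h n * om) ^+ 2.
Proof.
move=> om0.
have N1 : \forall n \near \oo, forall p : 'I_N * 'I_d, forall r s, 0 <= r <= t -> 0 <= s <= t ->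
    `|r - s| <= h n -> `|grad V (x p.1 r) 0 p.2 - grad V (x p.1 s) 0 p.2| < om.
  by apply: filter_forall => p; exact: (cont0_near t0 (cg1 p.1 p.2)).
have N2 : \forall n \near \oo, forall p : 'I_N * 'I_d, forall r s, 0 <= r <= t -> 0 <= s <= t ->
    `|r - s| <= h n -> `|G r (tup r) p.1 0 p.2 - G s (tup s) p.1 0 p.2| < om.
  by apply: filter_forall => p; exact: (cont0_near t0 (cg2 p.1 p.2)).
near=> n => k i kn.
have n0 : (0 < n)%N by exact: leq_ltn_trans kn.
have h0 := mesh_gt0 t0 n0.
have /andP[a0 at_] := grid_itv t0 (ltnW kn); have /andP[b0 bt] := grid_itv t0 kn.
have ab : tk n k <= tk n k.+1 by rewrite gridS lerDl ltW.
have bd j : `|defect n k i 0 j| <= 2 * h n * om.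
  pose f s := (- grad V (x i s) - G s (tup s) i) 0 j.
  pose c := - grad V (x i (tk n k.+1)) 0 j - G (tk n k) (tup (tk n k)) i 0 j.
  have := increment_near (f := f) (c := c) (om := 2 * om) a0 ab
    (cont0_integrable _ (cdrift i j)).
  have -> : tk n k.+1 - tk n k = h n by rewrite gridS; ring.
  have -> : defect n k i 0 j = \int[lebesgue_measure]_(s in `[0, tk n k.+1]) f s -
      \int[lebesgue_measure]_(s in `[0, tk n k]) f s - h n * c.
    have eb := congr1 (fun w : rV => w 0 j) (eqx i b0); rewrite !mxE -/f in eb.
    have ea := congr1 (fun w : rV => w 0 j) (eqx i a0); rewrite !mxE -/f in ea.
    by rewrite /defect /c !mxE eb ea; ring.
  have -> : 2 * h n * om = h n * (2 * om) by ring.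
  apply=> s sa sb.
  have fE : f s = - grad V (x i s) 0 j - G s (tup s) i 0 j by rewrite /f !mxE.
  rewrite fE /c.
  have st : 0 <= s <= t by rewrite (le_trans a0 sa) (le_trans sb bt).
  have hs1 : `|tk n k.+1 - s| <= h n by rewrite ger0_norm ?subr_ge0//; move: sa; rewrite gridS; lra.
  have hs2 : `|tk n k - s| <= h n by rewrite ler0_norm ?subr_le0//; move: sb; rewrite gridS; lra.
  have k1 := near N1 n; have := k1 _ (i, j) (tk n k.+1) s _ st hs1.
  have k2 := near N2 n; have := k2 _ (i, j) (tk n k) s _ st hs2.
  rewrite b0 bt a0 at_ => /(_ _ isT) h2 /(_ _ isT) h1.
  have -> : - grad V (x i s) 0 j - G s (tup s) i 0 j -
    (- grad V (x i (tk n k.+1)) 0 j - G (tk n k) (tup (tk n k)) i 0 j) =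
    (grad V (x i (tk n k.+1)) 0 j - grad V (x i s) 0 j) +
    (G (tk n k) (tup (tk n k)) i 0 j - G s (tup s) i 0 j) by ring.
  rewrite (_ : 2 * om = om + om); last by ring.
  apply: (le_trans (ler_normD _ _)); apply: lerD; apply: ltW.
  - exact: h1.
  - exact: h2.
rewrite sqE; apply: (@le_trans _ _ (\sum_(j < d) (2 * h n * om) ^+ 2)).
  apply: ler_sum => j _; rewrite -real_normK ?num_real// lerXn2r ?nnegrE//.
  by rewrite !mulr_ge0// ltW.
by rewrite sumr_const card_ord -[X in X <= _]mulr_natl.
Unshelve. all: by end_near. Qed.

(** The exact path is a perturbed run of the scheme: by [resolvent_fix] each of its grid points is a
    resolvent, with the defect added to the argument. Stability is Gronwall's inequality; the
    argument is pathwise and gives no rate. *)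
Lemma euler_cvg eps : 0 < eps -> \forall n \near \oo, forall k, (k <= n)%N ->
  dist2 (tup (tk n k)) (euler n k) <= eps.
Proof.
move=> eps0.
(* Gronwall's factor times the accumulated defects. In [2 + LG], the 2 comes from two applications
   of Young's inequality with weight [h n], and [LG] from the Lipschitz field. *)
pose C := expR ((2 + LG) * t) * (t * (1 + t) * (4 * N%:R * d%:R)) + 1.
have C0 : 0 < C.
  by rewrite ltr_wpDl// !mulr_ge0 ?expR_ge0 ?addr_ge0 ?(ltW t0).
pose om := Num.min 1 (eps / C).
have om0 : 0 < om by rewrite lt_min ltr01 divr_gt0.
have omE : om ^+ 2 <= eps / C.
  apply: (@le_trans _ _ (om * 1)).
    by rewrite expr2 ler_wpM2l ?(ltW om0)// ge_min lexx.
  by rewrite mulr1 ge_min lexx orbT.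
have := defect_small om0; apply: filter_app; near=> n => sm k kn.
case: (posnP n) => [n0|n0].
  by move: kn; rewrite n0 leqn0 => /eqP -> /=; rewrite /grid mul0r dist2xx ltW.
have h0 := mesh_gt0 t0 n0; have ht := mesh_le t0 n.
pose a l := dist2 (tup (tk n l)) (euler n l).
pose b := (1 + h n) * h n * (4 * N%:R * d%:R * om ^+ 2).
have b0 : 0 <= b.
  apply: mulr_ge0; last by rewrite mulr_ge0 ?sqr_ge0// !mulr_ge0.
  by apply: mulr_ge0; rewrite ?addr_ge0// ltW.
have rec l : (l < k)%N -> a l.+1 <= expR ((2 + LG) * h n) * a l + b.
  move=> lk; have ln : (l < n)%N by exact: leq_trans kn.
  pose u i := tnth (tup (tk n l)) i - tnth (euler n l) i.
  pose v i := G (tk n l) (tup (tk n l)) i - G (tk n l) (euler n l) i.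
  have s1 i : sq (x i (tk n l.+1) - tnth (euler n l.+1) i) <=
      sq ((u i - h n *: v i) + defect n l i).
    pose z1 := x i (tk n l.+1) + h n *: grad V (x i (tk n l.+1)).
    pose z2 := tnth (euler n l) i - h n *: G (tk n l) (euler n l) i +
      Num.sqrt 2 *: (B i (tk n l.+1) - B i (tk n l)).
    have e1 : resolvent V (h n) z1 = x i (tk n l.+1) := resolvent_fix sV lam0 monV _ h0.
    have e2 : tnth (euler n l.+1) i = resolvent V (h n) z2 by rewrite tnth_mktuple.
    have hc := resolvent_contract sV lam0 monV z1 z2 h0.
    rewrite e1 -e2 in hc.
    apply: (@le_trans _ _ (sq (z1 - z2))).
      apply: le_trans hc.
      by rewrite -[X in X <= _]mul1r ler_wpM2r ?sq_ge0// lerDl !mulr_ge0// ltW.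
    rewrite le_eqVlt; apply/orP; left; apply/eqP; congr sq.
    by rewrite /z1 /z2 /defect /u /v tnth_mktuple; apply/rowP => j; rewrite !mxE; ring.
  have s2 : \sum_i sq (u i - h n *: v i) <= (1 + h n) * (1 + h n * LG) * a l.
    apply: (@le_trans _ _ (\sum_i ((1 + h n) * sq (u i) + (1 + (h n)^-1) * (h n ^+ 2 * sq (v i))))).
      apply: ler_sum => i _; apply: (le_trans (sqD_young _ _ h0)).
      by rewrite sqN sqZ.
    rewrite big_split -!mulr_sumr /= mulrA.
    have -> : (1 + (h n)^-1) * h n ^+ 2 = (1 + h n) * h n by field; rewrite lt0r_neq0.
    have tl : 0 <= tk n l by rewrite mulr_ge0// ltW.
    have := lipG (tup (tk n l)) (euler n l) tl => lg.
    have -> : (1 + h n) * (1 + h n * LG) * a l = (1 + h n) * a l + (1 + h n) * h n * (LG * a l) by ring.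
    by rewrite lerD// ler_wpM2l// mulr_ge0 ?addr_ge0 ?(ltW h0).
  have s3 : a l.+1 <= (1 + h n) * ((1 + h n) * (1 + h n * LG) * a l) + b.
    apply: (@le_trans _ _ (\sum_i ((1 + h n) * sq (u i - h n *: v i) +
       (1 + (h n)^-1) * (d%:R * (2 * h n * om) ^+ 2)))).
      apply: ler_sum => i _; rewrite [X in X - _]tnth_mktuple.
      apply: (le_trans (s1 i)); apply: (le_trans (sqD_young _ _ h0)).
      rewrite lerD2l ler_wpM2l ?addr_ge0 ?invr_ge0 ?(ltW h0)//; exact: sm.
    rewrite big_split -mulr_sumr /= sumr_const card_ord -[X in _ + X <= _]mulr_natl.
    apply: lerD; first by rewrite ler_wpM2l// addr_ge0// ltW.
    rewrite le_eqVlt; apply/orP; left; apply/eqP; rewrite /b; field.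
    by rewrite lt0r_neq0.
  apply: (le_trans s3); rewrite lerD2r.
  have -> : (1 + h n) * ((1 + h n) * (1 + h n * LG) * a l) =
    (1 + h n) * (1 + h n) * (1 + h n * LG) * a l by ring.
  rewrite ler_wpM2r ?dist2_ge0//.
  have -> : expR ((2 + LG) * h n) = expR (h n) * expR (h n) * expR (h n * LG).
    by rewrite -!expRD; congr expR; ring.
  have e1 := expR_ge1Dx (h n); have e2 := expR_ge1Dx (h n * LG).
  have hL : 0 <= h n * LG by rewrite mulr_ge0// ltW.
  have h1 : 0 <= 1 + h n by rewrite addr_ge0// ltW.
  have f1 : (1 + h n) * (1 + h n) <= expR (h n) * expR (h n) by exact: ler_pM.
  by apply: ler_pM f1 e2; rewrite ?mulr_ge0// addr_ge0.
have c0 : 0 <= (2 + LG) * h n by rewrite mulr_ge0 ?addr_ge0// ltW.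
have a0 : a 0%N = 0 by rewrite /a /grid mul0r dist2xx.
have := gronwall c0 (fun=> b0) rec; rewrite a0 add0r => /(_ (lexx 0)) g.
apply: (le_trans g); rewrite sumr_const card_ord -[b *+ k]mulr_natl.
have kn' : k%:R * h n <= t by have /andP[] := grid_itv t0 kn.
apply: (@le_trans _ _ (expR ((2 + LG) * t) * (t * (1 + t) * (4 * N%:R * d%:R * om ^+ 2)))).
  have l1 : expR ((2 + LG) * h n * k%:R) <= expR ((2 + LG) * t).
    by rewrite ler_expR -mulrA ler_wpM2l ?addr_ge0// mulrC.
  have l2 : k%:R * b <= t * (1 + t) * (4 * N%:R * d%:R * om ^+ 2).
    have -> : k%:R * b = k%:R * h n * (1 + h n) * (4 * N%:R * d%:R * om ^+ 2) by rewrite /b; ring.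
    have h1 : 0 <= 1 + h n by rewrite addr_ge0// ltW.
    have kh : 0 <= k%:R * h n by rewrite mulr_ge0// ltW.
    have f1 : k%:R * h n * (1 + h n) <= t * (1 + t) by apply: ler_pM; rewrite // lerD2l.
    by apply: ler_wpM2r f1; rewrite mulr_ge0 ?sqr_ge0// !mulr_ge0.
  by apply: ler_pM l1 l2; rewrite ?expR_ge0// mulr_ge0.
apply: (@le_trans _ _ (C * om ^+ 2)).
  rewrite /C mulrDl; have := sqr_ge0 om; lra.
apply: (@le_trans _ _ (C * (eps / C))); first by rewrite ler_wpM2l// ltW.
by rewrite mulrC divfK// lt0r_neq0.
Unshelve. all: by end_near. Qed.

End scheme_path.

Lemma integrableDR (R : realType) d (T : measurableType d) (mu : {measure set T -> \bar R})
    (D : set T) (f g : T -> R) : measurable D ->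
  mu.-integrable D (EFin \o f) -> mu.-integrable D (EFin \o g) ->
  mu.-integrable D (EFin \o (fun x => f x + g x)).
Proof.
move=> mD fi gi; rewrite (_ : EFin \o (fun x => f x + g x)%R = (EFin \o f) \+ (EFin \o g))%E; last first.
  by apply/funext => x; rewrite /= EFinD.
exact: integrableD.
Qed.

Lemma integrableBR (R : realType) d (T : measurableType d) (mu : {measure set T -> \bar R})
    (D : set T) (f g : T -> R) : measurable D ->
  mu.-integrable D (EFin \o f) -> mu.-integrable D (EFin \o g) ->
  mu.-integrable D (EFin \o (fun x => f x - g x)).
Proof.
move=> mD fi gi; rewrite (_ : EFin \o (fun x => f x - g x)%R = (EFin \o f) \- (EFin \o g))%E; last first.
  by apply/funext => x; rewrite /= EFinB.
exact: integrableB.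
Qed.

Lemma integrableZR (R : realType) d (T : measurableType d) (mu : {measure set T -> \bar R})
    (D : set T) (c : R) (f : T -> R) : measurable D ->
  mu.-integrable D (EFin \o f) -> mu.-integrable D (EFin \o (fun x => c * f x)).
Proof.
move=> mD fi; rewrite (_ : EFin \o _ = fun x => (c%:E * (EFin \o f) x)%E).
  exact: integrableZl.
by apply/funext => x; rewrite /= EFinM.
Qed.

Lemma norm_add_le (R : realType) (a b g c : R) : `|a + b| <= g + c ->
  a <= g + (c - b) /\ - c - b - g <= a.
Proof. by rewrite ler_norml => /andP[h1 h2]; split; lra. Qed.

(** * A priori bound on a single path *)

Section path_bound.
Context {R : realType} {d : nat}.
Local Notation rV := 'rV[R]_d.
Variables (V : rV -> R) (lam l : R).
Hypotheses (sV : smooth V) (lam0 : 0 <= lam) (l0 : 0 <= l).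
Hypothesis monV : forall x y,
  lam * sq (x - y) <= dotv (grad V x - grad V y) (x - y).
Variables (x B k : R -> rV) (g : R -> R).
Hypothesis cx : forall j, cont0 (fun s => x s 0 j).
Hypothesis cB : forall j, cont0 (fun s => B s 0 j).
Hypothesis cg : forall j, cont0 (fun s => grad V (x s) 0 j).
Let F j s := (- grad V (x s) - k s) 0 j.
Hypothesis iF : forall j s, 0 <= s -> lebesgue_measure.-integrable `[0, s] (EFin \o F j).
Hypothesis eqx : forall s, 0 <= s -> x s = x 0 + Num.sqrt 2 *: B s +
  \row_j \int[lebesgue_measure]_(r in `[0, s]) F j r.
Hypothesis ig : forall s, 0 <= s -> lebesgue_measure.-integrable `[0, s] (EFin \o g).
Hypothesis g0 : forall s, 0 <= s -> 0 <= g s.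
Hypothesis kg : forall s j, 0 <= s -> `|k s 0 j| <= g s + l * enorm (x s).

(** What the path minus its noise pays per unit of time: [grad V] along the noise, and the growth of
    the interaction due to the noise. With [grad V] of polynomial growth it has Gaussian moments. *)
Definition noise_cost (b : rV) : R :=
  enorm (grad V (Num.sqrt 2 *: b)) + d%:R * l * (Num.sqrt 2 * enorm b).

Lemma noise_cost_ge0 b : 0 <= noise_cost b.
Proof. by rewrite addr_ge0 ?mulr_ge0 ?enorm_ge0 ?sqrtr_ge0. Qed.

Lemma sqrt2_le2 : Num.sqrt 2 <= 2 :> R.
Proof.
rewrite -(ler_pXn2r (n := 2))// ?nnegrE ?sqrtr_ge0//.
by rewrite sqr_sqrtr// expr2; lra.
Qed.

Lemma enorm_close (u v : rV) om : (forall j, `|u 0 j - v 0 j| <= om) ->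
  enorm u <= enorm v + d%:R * om.
Proof.
move=> h; rewrite -{1}(subrK v u) addrC; apply: (le_trans (enormD _ _)).
rewrite lerD2l; apply: (le_trans (enorm_le_sum _)).
apply: (@le_trans _ _ (\sum_(j < d) om)).
  by apply: ler_sum => j _; have := h j; rewrite !mxE.
by rewrite sumr_const card_ord -[X in X <= _]mulr_natl.
Qed.

Variable t : R.
Hypothesis t0 : 0 < t.
Local Notation h n := (mesh t n).
Local Notation tk := (grid t).
Let S n := h n * \sum_(k < n) noise_cost (B (tk n k.+1)).

Let Rx s := x s - Num.sqrt 2 *: B s.

(** By monotonicity the path is compared with its own noise rather than with the origin, so [grad V]
    is evaluated only along the noise. The comparison is made over the steps of a grid, where the
    resolvent expresses it; hence a Riemann sum and a slack [eps]. *)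
Lemma path_bound_eventually eps : 0 < eps -> \forall n \near \oo,
  enorm (x t - Num.sqrt 2 *: B t) <= expR (d%:R * l * t) *
    (enorm (x 0) + d%:R * \int[lebesgue_measure]_(s in `[0, t]) g s + S n + eps).
Proof.
move=> eps0.
pose C := t * d%:R * (3 * d%:R * l + 1) + 1.
have C0 : 0 < C.
  by rewrite ltr_wpDl// !mulr_ge0 ?(ltW t0)// addr_ge0// !mulr_ge0.
pose om := eps / C; have om0 : 0 < om by rewrite divr_gt0.
have N1 : \forall n \near \oo, forall j r s, 0 <= r <= t -> 0 <= s <= t ->
    `|r - s| <= h n -> `|x r 0 j - x s 0 j| < om.
  by apply: filter_forall => j; exact: (cont0_near t0 (cx j)).
have N2 : \forall n \near \oo, forall j r s, 0 <= r <= t -> 0 <= s <= t ->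
    `|r - s| <= h n -> `|B r 0 j - B s 0 j| < om.
  by apply: filter_forall => j; exact: (cont0_near t0 (cB j)).
have N3 : \forall n \near \oo, forall j r s, 0 <= r <= t -> 0 <= s <= t ->
    `|r - s| <= h n -> `|grad V (x r) 0 j - grad V (x s) 0 j| < om.
  by apply: filter_forall => j; exact: (cont0_near t0 (cg j)).
have N4 : \forall n \near \oo, (0 < n)%N by exact: nbhs_infty_gt.
near=> n.
have H1 : forall j r s, 0 <= r <= t -> 0 <= s <= t ->
    `|r - s| <= h n -> `|x r 0 j - x s 0 j| < om by near: n; exact: N1.
have H2 : forall j r s, 0 <= r <= t -> 0 <= s <= t ->
    `|r - s| <= h n -> `|B r 0 j - B s 0 j| < om by near: n; exact: N2.
have H3 : forall j r s, 0 <= r <= t -> 0 <= s <= t ->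
    `|r - s| <= h n -> `|grad V (x r) 0 j - grad V (x s) 0 j| < om by near: n; exact: N3.
have n0 : (0 < n)%N by near: n.
have h0 := mesh_gt0 t0 n0.
pose Ig s := \int[lebesgue_measure]_(r in `[0, s]) g r.
pose b m := d%:R * (Ig (tk n m.+1) - Ig (tk n m)) + h n * noise_cost (B (tk n m.+1)) +
  h n * d%:R * (3 * d%:R * l + 1) * om.
have cst_int (c s : R) : lebesgue_measure.-integrable `[0, s] (EFin \o (fun=> c)).
  by apply: cont0_integrable => y _ e e0; exists 1 => // r _ _; rewrite subrr normr0.
have dl0 : 0 <= d%:R * l by rewrite mulr_ge0.
have Rint_eq s j : 0 <= s -> Rx s 0 j = x 0 0 j + \int[lebesgue_measure]_(r in `[0, s]) F j r.
  by move=> s0; have := congr1 (fun w : rV => w 0 j) (eqx s0); rewrite /Rx !mxE; lra.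
have R0 : Rx 0 = x 0.
  apply/rowP => j; rewrite Rint_eq// (_ : \int[lebesgue_measure]_(r in `[0, 0]) F j r = 0) ?addr0//.
  by rewrite set_itv1 Rintegral_set1.
have step m : (m < n)%N -> enorm (Rx (tk n m.+1)) <= expR (d%:R * l * h n) * enorm (Rx (tk n m)) + b m.
  move=> mn; set p := tk n m; set q := tk n m.+1.
  have /andP[p0 pt] := grid_itv t0 (ltnW mn : (m <= n)%N).
  have /andP[q0 qt] := grid_itv t0 mn.
  rewrite -/p in p0 pt; rewrite -/q in q0 qt.
  have qE : q = p + h n by rewrite /q gridS.
  have pq : p <= q by rewrite qE lerDl ltW.
  have pin : 0 <= p <= t by rewrite p0.
  have qin : 0 <= q <= t by rewrite q0.
  pose c := l * (enorm (Rx p) + Num.sqrt 2 * enorm (B q) + 3 * d%:R * om) + om.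
  have xs s : p <= s -> s <= q -> enorm (x s) <= enorm (Rx p) + Num.sqrt 2 * enorm (B q) + 3 * d%:R * om.
    move=> ps sq_.
    have sin : 0 <= s <= t by rewrite (le_trans p0 ps) (le_trans sq_ qt).
    have e1 : enorm (x s) <= enorm (x p) + d%:R * om.
      apply: enorm_close => j; apply: ltW; apply: H1 => //.
      by rewrite ger0_norm ?subr_ge0//; move: sq_; rewrite qE; lra.
    have e2 : enorm (x p) <= enorm (Rx p) + Num.sqrt 2 * enorm (B p).
      rewrite -[X in enorm X <= _](subrK (Num.sqrt 2 *: B p)); apply: (le_trans (enormD _ _)).
      by rewrite enormZ ger0_norm ?sqrtr_ge0.
    have e3 : enorm (B p) <= enorm (B q) + d%:R * om.
      apply: enorm_close => j; apply: ltW; apply: H2 => //.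
      by rewrite ler0_norm ?subr_le0// qE; lra.
    have e4 : Num.sqrt 2 * enorm (B p) <= Num.sqrt 2 * enorm (B q) + 2 * (d%:R * om).
      apply: (@le_trans _ _ (Num.sqrt 2 * (enorm (B q) + d%:R * om))).
        by rewrite ler_wpM2l ?sqrtr_ge0.
      rewrite mulrDr lerD2l ler_wpM2r ?sqrt2_le2// mulr_ge0//; exact: ltW.
    by move: e1 e2 e4; lra.
  pose Q : rV := Rx q - Rx p + h n *: grad V (x q).
  have Qj j : `|Q 0 j| <= (Ig q - Ig p) + h n * c.
    have -> : Q 0 j = \int[lebesgue_measure]_(r in `[0, q]) F j r -
        \int[lebesgue_measure]_(r in `[0, p]) F j r + h n * grad V (x q) 0 j.
      have e1 := Rint_eq q j q0; have e2 := Rint_eq p j p0.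
      transitivity (Rx q 0 j - Rx p 0 j + h n * grad V (x q) 0 j); first by rewrite /Q !mxE.
      by rewrite e1 e2; ring.
    have Fb s : p <= s -> s <= q -> `|F j s + grad V (x q) 0 j| <= g s + c.
      move=> ps sq_.
      have sin : 0 <= s <= t by rewrite (le_trans p0 ps) (le_trans sq_ qt).
      have s0 : 0 <= s by case/andP: sin.
      have -> : F j s + grad V (x q) 0 j = - k s 0 j + (grad V (x q) 0 j - grad V (x s) 0 j).
        by rewrite /F !mxE; ring.
      apply: (le_trans (ler_normD _ _)); rewrite normrN /c addrA.
      apply: lerD; last first.
        by apply: ltW; apply: H3 => //; rewrite ger0_norm ?subr_ge0//; move: ps; rewrite qE; lra.
      by apply: (le_trans (kg j s0)); rewrite lerD2l ler_wpM2l// xs.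
    have igc (a : R) : lebesgue_measure.-integrable `[0, q] (EFin \o (fun s => g s + a)).
      by apply: integrableDR; [exact: measurable_itv|exact: ig|exact: cst_int].
    have Igc s (a : R) : 0 <= s -> \int[lebesgue_measure]_(r in `[0, s]) (g r + a) = Ig s + a * s.
      by move=> s0; rewrite RintegralD//; [rewrite Rint_itv_cst|exact: ig].
    have igN (a : R) : lebesgue_measure.-integrable `[0, q] (EFin \o (fun s => a - g s)).
      by apply: integrableBR; [exact: measurable_itv|exact: cst_int|exact: ig].
    have IgN s (a : R) : 0 <= s -> \int[lebesgue_measure]_(r in `[0, s]) (a - g r) = a * s - Ig s.
      by move=> s0; rewrite RintegralB//; [rewrite Rint_itv_cst|exact: ig].
    have up := increment_le (f := F j) (g := fun s => g s + (c - grad V (x q) 0 j)) p0 pq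
      (iF j q0) (igc _).
    have lo := increment_le (f := fun s => (- c - grad V (x q) 0 j) - g s) (g := F j) p0 pq
      (igN _) (iF j q0).
    rewrite !Igc// in up; rewrite !IgN// in lo.
    have u1 : forall s, p <= s -> s <= q -> F j s <= g s + (c - grad V (x q) 0 j).
      by move=> s ps sq_; have [] := norm_add_le (Fb s ps sq_).
    have l1 : forall s, p <= s -> s <= q -> - c - grad V (x q) 0 j - g s <= F j s.
      by move=> s ps sq_; have [] := norm_add_le (Fb s ps sq_).
    move: (up u1) (lo l1); rewrite ler_norml.
    move: (\int[lebesgue_measure]_(r in `[0, q]) F j r) (\int[lebesgue_measure]_(r in `[0, p]) F j r).
    move: (Ig q) (Ig p) (grad V (x q) 0 j) => i3 i4 i5 i1 i2; rewrite qE => h1 h2.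
    by apply/andP; split; lra.
  have Qn : enorm Q <= d%:R * ((Ig q - Ig p) + h n * c).
    apply: (le_trans (enorm_le_sum _)).
    apply: (@le_trans _ _ (\sum_(j < d) ((Ig q - Ig p) + h n * c))).
      by apply: ler_sum => j _; exact: Qj.
    by rewrite sumr_const card_ord -[X in X <= _]mulr_natl.
  (* [x q] and the noise at [q] are both resolvents by [resolvent_fix]; nonexpansiveness bounds
     their difference by that of the arguments, and [Q] collects the increment of the path without
     its confining force. *)
  have key : enorm (Rx q) <= enorm (Rx p) + enorm Q + h n * enorm (grad V (Num.sqrt 2 *: B q)).
    pose z1 := x q + h n *: grad V (x q).
    pose z2 := Num.sqrt 2 *: B q + h n *: grad V (Num.sqrt 2 *: B q).
    have hc := resolvent_contract sV lam0 monV z1 z2 h0.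
    rewrite !(resolvent_fix sV lam0 monV)// in hc.
    apply: (@le_trans _ _ (enorm (z1 - z2))).
      rewrite -[X in _ <= X]mul1r; apply: enorm_le_sq => //.
      rewrite expr1n mul1r; apply: le_trans hc.
      by rewrite -[X in X <= _]mul1r ler_wpM2r ?sq_ge0// lerDl !mulr_ge0// ltW.
    have -> : z1 - z2 = (Rx p + Q) - h n *: grad V (Num.sqrt 2 *: B q).
      by rewrite /z1 /z2 /Q /Rx; move: (grad V _) (grad V _) => w1 w2; apply/rowP => j; rewrite !mxE; ring.
    apply: (le_trans (enormB _ _)); rewrite enormZ ger0_norm ?(ltW h0)// lerD2r.
    exact: enormD.
  apply: (le_trans key).
  have e1 := expR_ge1Dx (d%:R * l * h n).
  have : (1 + d%:R * l * h n) * enorm (Rx p) <= expR (d%:R * l * h n) * enorm (Rx p).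
    by rewrite ler_wpM2r ?enorm_ge0.
  move: Qn; rewrite /b -/p -/q /c /noise_cost.
  move: (enorm Q) (enorm (Rx p)) (expR _) (enorm (grad V _)) (enorm (B q)) => u1 u2 u3 u4 u5.
  lra.
have c0 : 0 <= d%:R * l * h n by rewrite mulr_ge0// ltW.
have a0 : 0 <= enorm (Rx (tk n 0)) by exact: enorm_ge0.
have Imono m : (m < n)%N -> 0 <= Ig (tk n m.+1) - Ig (tk n m).
  move=> mn; have /andP[p0 pt] := grid_itv t0 (ltnW mn : (m <= n)%N).
  have /andP[q0 qt] := grid_itv t0 mn.
  have pq : tk n m <= tk n m.+1 by rewrite gridS lerDl ltW.
  have := increment_le (f := fun=> 0) (g := g) p0 pq (cst_int 0 _) (ig q0).
  rewrite !Rint_itv_cst// !mul0r subrr; apply=> s ps _.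
  exact: g0 (le_trans p0 ps).
pose b' m := if (m < n)%N then b m else 0.
have b'0 m : 0 <= b' m.
  rewrite /b'; case: ifP => // mn; rewrite /b !addr_ge0//.
  - by rewrite mulr_ge0// Imono.
  - by rewrite mulr_ge0 ?noise_cost_ge0// ltW.
  - have c1 : 0 <= 3 * d%:R * l + 1 by rewrite addr_ge0// !mulr_ge0.
    by apply: mulr_ge0 (ltW om0); apply: mulr_ge0 c1; rewrite mulr_ge0// ltW.
have step' m : (m < n)%N -> enorm (Rx (tk n m.+1)) <= expR (d%:R * l * h n) * enorm (Rx (tk n m)) + b' m.
  by move=> mn; rewrite /b' mn; exact: step.
have := gronwall (a := fun m => enorm (Rx (tk n m))) c0 b'0 step' a0.
rewrite -[_ * h n * _]mulrA [h n * _]mulrC meshM//.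
have -> : tk n n = t by rewrite /grid meshM.
have t00 : tk n 0 = 0 by rewrite /grid mul0r.
rewrite t00 R0 => /le_trans; apply; rewrite ler_wpM2l ?expR_ge0// -!addrA lerD2l.
have -> : \sum_(m < n) b' m = d%:R * (Ig t) + (S n + (n%:R * h n) * d%:R * (3 * d%:R * l + 1) * om).
  transitivity (\sum_(m < n) (d%:R * (Ig (tk n m.+1) - Ig (tk n m)) +
     (h n * noise_cost (B (tk n m.+1)) + h n * d%:R * (3 * d%:R * l + 1) * om))).
    by apply: eq_bigr => m _; rewrite /b' ltn_ord /b addrA.
  pose cc := h n * d%:R * (3 * d%:R * l + 1) * om; rewrite -/cc; move: (erefl cc); rewrite {1}/cc; move: cc => cc ccE.
  rewrite !big_split /= -!mulr_sumr sumr_const card_ord -[cc *+ n]mulr_natl.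
  rewrite -(big_mkord xpredT (fun m => Ig (tk n m.+1) - Ig (tk n m))) telescope_sumr//.
  have -> : tk n n = t by rewrite /grid meshM.
  rewrite t00 (_ : Ig 0 = 0) ?subr0; last by rewrite /Ig set_itv1 Rintegral_set1.
  by rewrite /S -ccE; ring.
rewrite meshM// !lerD2l.
have -> : eps = C * om by rewrite /om mulrC divfK// lt0r_neq0.
by rewrite /C; move: om0; lra.
Unshelve. all: by end_near. Qed.

End path_bound.

(** * Brownian increments and laws of the chains *)

Section sigma_process_facts.
Context {dO : measure_display} {Omega : measurableType dO} {R : realType}.
Context {dT : measure_display} {T : measurableType dT}.
Variables (D : set R) (X : R -> Omega -> T).

Definition sp_gen : set (set Omega) := \bigcup_(t in D) sigma_var (X t).

Lemma sp_measurable t : D t -> measurable_fun setT (X t : g_sigma_algebraType sp_gen -> T).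
Proof. by move=> Dt _ A mA; apply: sub_sigma_algebra; exists t => //; exists A. Qed.

Lemma sp_event dU (U : measurableType dU) (f : Omega -> U) A :
  measurable_fun setT (f : g_sigma_algebraType sp_gen -> U) -> measurable A ->
  sigma_process D X (f @^-1` A).
Proof. by move=> mf mA; have := mf measurableT A mA; rewrite setTI. Qed.

Lemma sp_I A B : sigma_process D X A -> sigma_process D X B -> sigma_process D X (A `&` B).
Proof. exact: (@measurableI _ (g_sigma_algebraType sp_gen)). Qed.

Lemma sp_T : sigma_process D X setT.
Proof. exact: (@measurableT _ (g_sigma_algebraType sp_gen)). Qed.

Lemma sp_fin (I : finType) (A : I -> set Omega) :
  (forall i, sigma_process D X (A i)) -> sigma_process D X [set w | forall i, A i w].
Proof.
move=> H; have -> : [set w | forall i, A i w] = \bigcap_(i in [set: I]) A i.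
  by apply/seteqP; split => [w Hw i _|w Hw i]; [exact: Hw|exact: (Hw i)].
by apply: (@fin_bigcap_measurable _ (g_sigma_algebraType sp_gen)) => // i _; exact: H.
Qed.

End sigma_process_facts.

Section increments.
Context {dO : measure_display} {Omega : measurableType dO} {R : realType}.
Variable P : probability Omega R.
Variable h : R.
Hypothesis h0 : 0 < h.
Let tau (k : nat) : R := k%:R * h.

Let tau_ge0 k : 0 <= tau k.
Proof. by rewrite mulr_ge0// ltW. Qed.

Let tau_lt k : tau k < tau k.+1.
Proof. by rewrite ltr_pM2r// ltr_nat. Qed.

Let tau_le k n : (k <= n)%N -> tau k <= tau n.
Proof. by move=> kn; rewrite ler_wpM2r ?(ltW h0)// ler_nat. Qed.

Definition incr_ev (b : R -> Omega -> R) n (A : nat -> set R) : set Omega :=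
  [set w | forall k, (k < n)%N -> A k (b (tau k.+1) w - b (tau k) w)].

Lemma incr_evS b n A : incr_ev b n.+1 A =
  incr_ev b n A `&` (fun w => b (tau n.+1) w - b (tau n) w) @^-1` A n.
Proof.
apply/seteqP; split => w /=.
  by move=> H; split => [k kn|]; apply: H => //; exact: ltnW.
by move=> [H1 H2] k; rewrite ltnS leq_eqVlt => /orP[/eqP ->//|]; exact: H1.
Qed.

Lemma incr_ev_sp dT (T : measurableType dT) (D : set R) (X : R -> Omega -> T)
    (b : R -> Omega -> R) n A :
  (forall k, measurable (A k)) ->
  (forall k, (k <= n)%N -> measurable_fun setT (b (tau k) : g_sigma_algebraType (sp_gen D X) -> R)) ->
  sigma_process D X (incr_ev b n A).
Proof.
move=> mA; elim: n => [|n IH] mb.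
  by rewrite (_ : incr_ev _ _ _ = setT); [exact: sp_T|apply/seteqP; split].
rewrite incr_evS; apply: sp_I; first by apply: IH => k kn; apply: mb; exact: leqW.
apply: sp_event; last exact: mA.
by apply: measurable_funB; apply: mb.
Qed.

(** Induction on [n]: the earlier increments belong to the past of the last grid point, of which the
    next increment is independent. *)
Lemma brownian1_increments b n (A : nat -> set R) : brownian1 P b ->
  (forall k, measurable (A k)) ->
  P (incr_ev b n A) = (\prod_(k < n) gauss1 (Num.sqrt h) (A k))%E.
Proof.
move=> Bb mA; elim: n => [|n IH].
  rewrite big_ord0 (_ : incr_ev _ _ _ = setT); first exact: probability_setT.
  by apply/seteqP; split.
rewrite incr_evS (brownian1_indep Bb (tau_ge0 n) (tau_lt n)).
- rewrite big_ord_recr /= -IH; congr (_ * _)%E.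
  rewrite (brownian1_gauss Bb (tau_ge0 n) (tau_lt n) (mA n)).
  by rewrite (_ : tau n.+1 - tau n = h)// /tau -[n.+1%:R]natr1; ring.
- apply: incr_ev_sp => // k kn; apply: sp_measurable.
  by rewrite /= in_itv /= tau_ge0 tau_le.
- by exists (A n) => //; rewrite setTI.
Qed.

Section vector.
Variable d : nat.
Local Notation rV := 'rV[R]_d.

Definition incr (B : R -> Omega -> rV) (k : nat) (w : Omega) : d.-tuple R :=
  [tuple B (tau k.+1) w 0 j - B (tau k) w 0 j | j < d].

Definition vincr_ev (B : R -> Omega -> rV) n (A : nat -> 'I_d -> set R) : set Omega :=
  [set w | forall j, incr_ev (fun t w => B t w 0 j) n (A^~ j) w].

Lemma vincr_ev_sp B n A : (forall k j, measurable (A k j)) ->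
  sigma_process `[0, +oo[ B (vincr_ev B n A).
Proof.
move=> mA; apply: sp_fin => j; apply: incr_ev_sp => // k kn.
have := @sp_measurable _ Omega R _ _ `[0, +oo[%classic B (tau k).
move=> /(_ _) m; apply: (measurableT_comp (measurable_coord j) (m _)).
by rewrite /= in_itv /= tau_ge0.
Qed.

Lemma vincr_ev_prob B n A : brownian P B -> (forall k j, measurable (A k j)) ->
  P (vincr_ev B n A) = (\prod_(j < d) \prod_(k < n) gauss1 (Num.sqrt h) (A k j))%E.
Proof.
move=> [B1 Bi] mA.
have -> : vincr_ev B n A = \bigcap_j incr_ev (fun t w => B t w 0 j) n (A^~ j).
  by apply/seteqP; split => [w Hw i _|w Hw i]; [exact: Hw|exact: (Hw i)].
rewrite Bi; first by apply: eq_bigr => j _; exact: brownian1_increments.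
move=> j; apply: incr_ev_sp => // k kn; apply: sp_measurable.
by rewrite /= in_itv /= tau_ge0.
Qed.

Lemma measurable_incr B k : (forall t, 0 <= t -> measurable_fun setT (B t)) ->
  measurable_fun setT (incr B k).
Proof.
move=> mB; apply: measurable_mktuple => j.
apply: measurable_funB; apply: (measurableT_comp (measurable_coord j)); exact: mB.
Qed.

Lemma brownian_measurable (B : R -> Omega -> rV) t : brownian P B -> 0 <= t -> measurable_fun setT (B t).
Proof.
by move=> [B1 _] t0; apply: measurable_rV => i; exact: (brownian1_measurable (B1 i) t0).
Qed.

Lemma has_law_start_increments dT (T : measurableType dT) (X0 : Omega -> T)
    (mu : probability T R) (B : R -> Omega -> rV) n :
  has_law P X0 mu -> brownian P B ->
  independent2 P (sigma_var X0) (sigma_process `[0, +oo[ B) ->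
  has_law P (fun w => (X0 w, [tuple incr B k w | k < n]))
    (mu \x prod_power (@noise1 R d (Num.sqrt h)) n)%E.
Proof.
move=> [mX lX] bB ind.
have pR := pi_generates_measurable R.
have pG := pi_generates_prod (pi_generates_measurable T)
  (pi_generates_tuple n (pi_generates_tuple d pR)).
apply: (has_law_pi _ pG).
  apply: measurable_fun_pair => //; apply: measurable_mktuple => k.
  by apply: measurable_incr => t t0; exact: brownian_measurable.
move=> _ [A mA [_ [D DE ->] <-]].
have /choice[A' A'E] : forall k, exists A' : 'I_d -> set R,
    (forall j, measurable (A' j)) /\ D k = box A'.
  by move=> k; have [A' ? ?] := DE k; exists A'.
(* Indices from [n] on carry no constraint. *)
pose A2 k j := if insub k is Some k' then A' k' j else setT.
have mA2 k j : measurable (A2 k j).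
  by rewrite /A2; case: insubP => // k' _ _; have [] := A'E k'.
have -> : (fun w => (X0 w, [tuple incr B k w | k < n])) @^-1` (A `*` box D) =
    (X0 @^-1` A) `&` vincr_ev B n A2.
  apply/seteqP; split => w /= [Aw Dw]; split => //.
    move=> j k kn; rewrite /A2; case: insubP => [k' _ kk'|]; last by rewrite kn.
    have := Dw k'; rewrite tnth_mktuple; have [_ ->] := A'E k'.
    by move=> /(_ j); rewrite tnth_mktuple kk'.
  move=> k; have [_ ->] := A'E k; move=> j; rewrite !tnth_mktuple.
  by have := Dw j k (ltn_ord k); rewrite /A2 valK.
rewrite ind; first last.
- exact: vincr_ev_sp.
- by exists A => //; rewrite setTI.
rewrite lX// vincr_ev_prob// [RHS]prodE//; last first.
  by apply: measurable_box => k; have [mk ->] := A'E k; exact: measurable_box.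
congr (_ * _)%E; rewrite prod_power_box; last first.
  by move=> k; have [mk ->] := A'E k; exact: measurable_box.
rewrite exchange_big; apply: eq_bigr => k _; have [mk ->] := A'E k.
by rewrite prod_power_box//; apply: eq_bigr => j _; rewrite /A2 valK.
Qed.

Lemma has_law_start_increments_family dT (T : measurableType dT) (X0 : Omega -> T)
    (mu : probability T R) N (B : 'I_N -> R -> Omega -> rV) n :
  has_law P X0 mu -> (forall i, brownian P (B i)) ->
  independent_family P (fun o : option 'I_N =>
    if o is Some i then sigma_process `[0, +oo[ (B i) else sigma_var X0) ->
  has_law P (fun w => (X0 w, [tuple [tuple incr (B i) k w | i < N] | k < n]))
    (mu \x prod_power (@noise R d (Num.sqrt h) N) n)%E.
Proof.
move=> [mX lX] bB ind.
have pR := pi_generates_measurable R.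
have pG := pi_generates_prod (pi_generates_measurable T)
  (pi_generates_tuple n (pi_generates_tuple N (pi_generates_tuple d pR))).
apply: (has_law_pi _ pG).
  apply: measurable_fun_pair => //; apply: measurable_mktuple => k.
  apply: measurable_mktuple => i.
  by apply: measurable_incr => t t0; exact: brownian_measurable.
move=> _ [A mA [_ [D DE ->] <-]].
have /choice[A' A'E] : forall k, exists A' : 'I_N -> 'I_d -> set R,
    (forall i j, measurable (A' i j)) /\ D k = box (fun i => box (A' i)).
  move=> k; have [C CE ->] := DE k.
  have /choice[A' A'E] : forall i, exists A' : 'I_d -> set R,
      (forall j, measurable (A' j)) /\ C i = box A'.
    by move=> i; have [A' ? ?] := CE i; exists A'.
  exists A'; split; first by move=> i; have [] := A'E i.
  by congr box; apply/funext => i; have [] := A'E i.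
pose A2 i k j := if insub k is Some k' then A' k' i j else setT.
have mA2 i k j : measurable (A2 i k j).
  by rewrite /A2; case: insubP => // k' _ _; have [] := A'E k'.
pose ev (o : option 'I_N) := if o is Some i then vincr_ev (B i) n (A2 i) else X0 @^-1` A.
have -> : (fun w => (X0 w, [tuple [tuple incr (B i) k w | i < N] | k < n])) @^-1` (A `*` box D) =
    \bigcap_o ev o.
  apply/seteqP; split => w /=.
    move=> [Aw Dw] [i|] _ //= j k kn; rewrite /A2; case: insubP => [k' _ kk'|]; last by rewrite kn.
    have := Dw k'; rewrite tnth_mktuple; have [_ ->] := A'E k'.
    by move=> /(_ i); rewrite tnth_mktuple => /(_ j); rewrite tnth_mktuple kk'.
  move=> H; split; first exact: (H None I).
  move=> k; have [_ ->] := A'E k; move=> i j; rewrite !tnth_mktuple.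
  by have := H (Some i) I j k (ltn_ord k); rewrite /A2 valK.
rewrite ind; last first.
  move=> [i|] /=; first exact: vincr_ev_sp.
  by exists A => //; rewrite setTI.
have mDk k : measurable (D k).
  by have [mk ->] := A'E k; apply: measurable_box => i; exact: measurable_box.
rewrite [RHS]prodE//; last exact: measurable_box.
rewrite (bigD1 None)//= lX//; congr (_ * _)%E; rewrite prod_power_box//.
transitivity (\prod_(i < N) P (vincr_ev (B i) n (A2 i)))%E.
  rewrite (reindex_omap Some id) /=; last by case.
  by apply: eq_big => [i|i _] //=; rewrite eqxx.
under eq_bigr => i _ do rewrite vincr_ev_prob//.
under eq_bigr => i _ do rewrite exchange_big.
rewrite exchange_big; apply: eq_bigr => k _; have [mk ->] := A'E k.
rewrite prod_power_box; last by move=> i; exact: measurable_box.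
apply: eq_bigr => i _; rewrite prod_power_box//.
by apply: eq_bigr => j _; rewrite /A2 valK.
Qed.

End vector.
End increments.

(** * Laws of chains driven by independent noise *)

Section markov_chain.
Context {R : realType} {d0 d1 : measure_display}.
Context {T0 : measurableType d0} {T : measurableType d1}.
Variables (s : nat -> T0 -> T -> T0) (gam : probability T R) (m0 : probability T0 R).
Hypothesis ms : forall k, measurable_fun setT (fun p : T0 * T => s k p.1 p.2).

Fixpoint lawseq (k : nat) : probability T0 R :=
  if k is k'.+1 then law (lawseq k' \x gam)%E (ms k') else m0.

Lemma lawseqS k : has_law (lawseq k \x gam)%E (fun p => s k p.1 p.2) (lawseq k.+1).
Proof. exact: has_law_law. Qed.

Lemma prob_Rint dT' (T' : measurableType dT') (mu : probability T' R) A : measurable A ->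
  mu A = (\int[mu]_x \1_A x)%:E.
Proof.
by move=> mA; rewrite (EFin_Rint _ (bmf_ind mA)) integral_indic// setIT.
Qed.

Lemma measurable_behead n : measurable_fun setT (fun Z : n.+1.-tuple T => [tuple of behead Z]).
Proof.
rewrite (_ : (fun Z => _) = (fun Z : n.+1.-tuple T => [tuple tnth Z (lift ord0 i) | i < n])).
  by apply: measurable_mktuple => i; exact: measurable_tnth.
apply/funext => Z; apply: eq_from_tnth => i; rewrite tnth_mktuple.
by rewrite tnth_behead; congr tnth; apply: val_inj; rewrite /= inordK// ltnS.
Qed.

(** The state is followed jointly with the noises still to be used. One step consumes the first of
    them and preserves the independence of the new state from the rest. *)
Lemma has_law_consume k n : has_law (lawseq k \x prod_power gam n.+1)%E
  (fun p => (s k p.1 (tnth p.2 ord0), [tuple of behead p.2]))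
  (lawseq k.+1 \x prod_power gam n)%E.
Proof.
have mX : measurable_fun setT (fun p : T0 * n.+1.-tuple T =>
    (s k p.1 (tnth p.2 ord0), [tuple of behead p.2])).
  apply: measurable_fun_pair.
    apply: (measurableT_comp (ms k)) (_ : measurable_fun setT (fun p => (p.1, tnth p.2 ord0))).
    apply: measurable_fun_pair => //.
    exact: (measurableT_comp (measurable_tnth ord0) measurable_snd).
  exact: (measurableT_comp (@measurable_behead n) measurable_snd).
apply: (has_law_pi mX (pi_generates_prod (pi_generates_measurable T0)
  (pi_generates_measurable (n.-tuple T)))).
move=> _ [A mA [D mD <-]].
pose F (q : T0 * n.-tuple T) : R := \1_A q.1 * \1_D q.2.
have bA := bmf_ind (R := R) mA; have bD := bmf_ind (R := R) mD.
have bF : bmf F.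
  by apply: bmfM; [exact: bmf_comp bA measurable_fst|exact: bmf_comp bD measurable_snd].
have FE : \1_(A `*` D) = F :> (_ -> R).
  apply/funext => q; rewrite /F !indicE -natrM mulnb; congr (_%:R : R).
  by congr nat_of_bool; apply/idP/andP; rewrite !inE.
rewrite prob_Rint; last by rewrite -[X in measurable X]setTI; apply: mX; [|exact: measurableX].
rewrite prob_Rint; last exact: measurableX.
congr EFin; rewrite FE.
transitivity (\int[(lawseq k \x prod_power gam n.+1)%E]_p
    F (s k p.1 (tnth p.2 ord0), [tuple of behead p.2])).
  by apply: eq_Rintegral => p _; rewrite -FE !indicE.
have bFX := bmf_comp bF mX.
rewrite (Rint_prod12 (lawseq k) (prod_power gam n.+1) bFX).
have bsx x : bmf (fun z => \1_A (s k x z) : R).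
  exact: (bmf_comp (X := fun z => s k x z) bA (measurableT_comp (ms k) (measurable_pair1 x))).
have E1 x : \int[prod_power gam n.+1]_Z F (s k x (tnth Z ord0), [tuple of behead Z]) =
    \int[prod_power gam n]_Z \1_D Z * \int[gam]_z \1_A (s k x z).
  have bx : bmf (fun Z : n.+1.-tuple T => F (s k x (tnth Z ord0), [tuple of behead Z])).
    exact: (bmf_comp (X := fun Z : n.+1.-tuple T => (x, Z)) bFX (measurable_pair1 x)).
  rewrite (Rint_prod_powerS gam bx) -RintZ//.
  apply: eq_Rintegral => z _.
  transitivity (\int[prod_power gam n]_Z (\1_A (s k x z) * \1_D Z)).
    apply: eq_Rintegral => Z _; rewrite /F; congr (_ * \1_D _); exact: val_inj.
  by rewrite RintZ// mulrC.
have bs : bmf (fun p : T0 * T => \1_A (s k p.1 p.2) : R) by exact: bmf_comp bA (ms k).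
under eq_Rintegral => x _ do rewrite /= E1.
rewrite RintZ; last exact: (bmf_int1 (lawseq k) gam bs).
rewrite (Rint_prod12 (lawseq k.+1) (prod_power gam n) bF).
transitivity (\int[lawseq k.+1]_x (\int[prod_power gam n]_Z \1_D Z * \1_A x)); last first.
  by apply: eq_Rintegral => x _; rewrite /F /= RintZ// mulrC.
rewrite RintZ//; congr (_ * _).
by rewrite (has_law_Rint (lawseqS k) bA) (Rint_prod12 (lawseq k) gam bs).
Qed.

Section on_space.
Context {dO : measure_display} {Omega : measurableType dO}.
Variables (P : probability Omega R) (Y : nat -> Omega -> T0) (z : nat -> Omega -> T).
Variable n : nat.
Hypothesis Z_law : has_law P (fun w => (Y 0%N w, [tuple z k w | k < n])) (m0 \x prod_power gam n)%E.
Hypothesis YS : forall k w, Y k.+1 w = s k (Y k w) (z k w).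

Lemma run_joint_law k r : (k + r = n)%N ->
  has_law P (fun w => (Y k w, [tuple z (k + i)%N w | i < r])) (lawseq k \x prod_power gam r)%E.
Proof.
elim: k r => [|k IH] r; first by rewrite add0n => ->.
rewrite addSnnS => kr; have := has_law_comp (IH _ kr) (has_law_consume k r).
congr has_law; apply/funext => w /=; congr pair.
  by rewrite YS tnth_mktuple addn0.
apply: eq_from_tnth => i; rewrite !tnth_mktuple tnth_behead tnth_mktuple.
by congr (z _ w); rewrite /= inordK ?addnS// ltnS.
Qed.

Lemma run_law k : (k <= n)%N -> has_law P (Y k) (lawseq k).
Proof.
move=> kn; have := run_joint_law (subnKC kn) => H.
apply: (has_law_comp H (Y := fst)); split => // A mA.
rewrite (_ : fst @^-1` A = A `*` setT).
  have e := prodE (lawseq k) (prod_power gam (n - k)) mA measurableT.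
  by apply: (etrans e); rewrite probability_setT mule1.
by apply/seteqP; split => -[a b] //= [].
Qed.

End on_space.
End markov_chain.

(** * The McKean-Vlasov process and its scheme *)

Lemma has_law_Rint_integrable (R : realType) d (O : measurableType d) (P : probability O R)
    d' (T : measurableType d') (X : O -> T) (mu : probability T R)
    (f : T -> R) : has_law P X mu -> measurable_fun setT f ->
  P.-integrable setT (EFin \o (fun w => f (X w))) ->
  \int[mu]_x f x = \int[P]_w f (X w).
Proof.
move=> [mX PX] mf fi; pose Y := mfun_Sub (mem_set mX).
rewrite /Rintegral; congr fine.
transitivity (\int[distribution P Y]_x (f x)%:E)%E.
  by apply: eq_measure_integral => A mA _; first [exact: PX|exact/esym/PX].
by apply: integral_distribution => //; exact/measurable_EFinP.
Qed.

Section measurable_norm.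
Context {R : realType} {d' : measure_display} {T : measurableType d'} {d : nat}.

Lemma measurable_enorm (f : T -> 'rV[R]_d) : measurable_fun setT f ->
  measurable_fun setT (fun x => enorm (f x)).
Proof.
move=> mf; apply: (measurableT_comp (f := Num.sqrt : R -> R)); last exact: measurable_sq.
by apply: continuous_measurable_fun; exact: sqrt_continuous.
Qed.

Lemma nnm_enorm (f : T -> 'rV[R]_d) : measurable_fun setT f -> nnm (fun x => enorm (f x)).
Proof. by move=> mf; split; [exact: measurable_enorm|move=> x; exact: enorm_ge0]. Qed.

End measurable_norm.

Section limits.
Context {R : realType} {dT : measure_display} {T : measurableType dT}.
Variable mu : probability T R.

(** Fatou's lemma in the form in which path estimates are obtained: a bound that holds from some
    rank depending on the sample point. Truncating by both [m] and [f] reduces it to bounded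
    convergence. *)
Lemma fatou_eventually (f : T -> R) (g : nat -> T -> R) K : nnm f -> (forall n, nnm (g n)) ->
  {ae mu, forall x, \forall n \near \oo, f x <= g n x} ->
  (forall n, (\int[mu]_x (g n x)%:E <= K%:E)%E) ->
  (\int[mu]_x (f x)%:E <= K%:E)%E.
Proof.
move=> [mf f0] ng ae gK; apply: integral_trunc => // m.
have bm : bmf (fun x => Num.min m%:R (f x)) by apply: bmf_minc.
have bg n : bmf (fun x => Num.min (Num.min m%:R (f x)) (g n x)).
  split; first by apply: measurable_minr; [exact: bmf_meas|exact: nnm_meas].
  exists m%:R => x; rewrite ger0_norm; first by rewrite !ge_min lexx.
  by rewrite !le_min f0 (nnm_ge0 (ng n)) ler0n.
have : \int[mu]_x Num.min (Num.min m%:R (f x)) (g n x) @[n --> \oo] -->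
    \int[mu]_x Num.min m%:R (f x).
  apply: (@Rint_bounded_cvg _ _ _ _ _ _ m%:R) => //.
  - by move=> n; exact: bmf_meas.
  - move=> n x; rewrite ger0_norm; first by rewrite !ge_min lexx.
    by rewrite !le_min f0 (nnm_ge0 (ng n)) ler0n.
  - apply: filterS ae => x fx; apply: cvg_near_cst; apply: filterS fx => n fg.
    by rewrite min_l// ge_min fg orbT.
move=> cv; apply: (cvgr_to_le cv); apply: nearW => n.
rewrite -lee_fin EFin_Rint//; apply: le_trans (gK n).
apply: nnI_le => //; last by move=> x; rewrite ge_min lexx orbT.
split; first exact: bmf_meas.
by move=> x; rewrite !le_min f0 (nnm_ge0 (ng n)) ler0n.
Qed.

(** Bounded second moments make the sequence uniformly integrable, which upgrades almost sure
    convergence to convergence in mean. *)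
Lemma L1_cvg_of_L2_bound (f : nat -> T -> R) K : (forall n, nnm (f n)) ->
  {ae mu, forall x, f n x @[n --> \oo] --> (0 : R)} ->
  (forall n, (\int[mu]_x (f n x ^+ 2)%:E <= K%:E)%E) ->
  forall e, 0 < e -> \forall n \near \oo, (\int[mu]_x (f n x)%:E <= e%:E)%E.
Proof.
move=> nf ae fK e e0.
have K0 : 0 <= K.
  rewrite -lee_fin; apply: le_trans (fK 0%N); apply: nnI_ge0; apply: nnm_sqr.
  exact: nnm_meas (nf 0%N).
pose eta := e / 3; have eta0 : 0 < eta by rewrite divr_gt0.
pose ka := e / 3 / (K + 1); have ka0 : 0 < ka by rewrite divr_gt0 ?ltr_wpDl.
have bg n : bmf (fun x => Num.min 1 (eta^-1 * f n x)).
  have nn : nnm (fun x => eta^-1 * f n x) by apply: nnmZ => //; rewrite invr_ge0 ltW.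
  apply: bmf_minc => //; [exact: nnm_meas|exact: nnm_ge0].
have g0 n x : 0 <= Num.min 1 (eta^-1 * f n x).
  by rewrite le_min ler01 mulr_ge0 ?invr_ge0 ?(ltW eta0)// (nnm_ge0 (nf n)).
have cv : \int[mu]_x Num.min 1 (eta^-1 * f n x) @[n --> \oo] --> \int[mu]_x (0 : R).
  apply: (@Rint_bounded_cvg _ _ _ _ _ _ 1).
  - by move=> n; exact: bmf_meas.
  - exact: bmf_cst.
  - by move=> n x; rewrite ger0_norm// ge_min lexx.
  - apply: filterS ae => x fx.
    have h2 : (fun n => eta^-1 * f n x) @ \oo --> eta^-1 * 0 by apply: cvgM => //; exact: cvg_cst.
    rewrite mulr0 in h2.
    apply: (@squeeze_cvgr _ _ _ _ (fun=> 0) (fun n => eta^-1 * f n x)) => //.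
      by apply: nearW => n; rewrite g0 ge_min lexx orbT.
    exact: cvg_cst.
rewrite Rint_cst in cv.
have eK : 0 < e / 3 * (4 * ka).
  by apply: mulr_gt0; [exact: eta0|exact: mulr_gt0].
apply: filterS (cvgr_le _ cv _ eK) => n sm.
have ka4 : 0 <= (4 * ka)^-1 by rewrite invr_ge0 mulr_ge0// ltW.
have n2 : nnm (fun x => f n x ^+ 2) by apply: nnm_sqr; exact: nnm_meas (nf n).
have nb : nnm (fun x => Num.min 1 (eta^-1 * f n x)) by split; [exact: bmf_meas|exact: g0].
have nA : nnm (fun x => ka * f n x ^+ 2) by apply: nnmZ => //; exact: ltW.
have nB : nnm (fun x => (4 * ka)^-1 * Num.min 1 (eta^-1 * f n x)) by exact: nnmZ.
(* Where [f n x] exceeds [eta] the truncation equals 1, and a <= ka a^2 + 1/(4 ka). Each of the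
   three terms will integrate to at most [e / 3]. *)
apply: (@le_trans _ _ (\int[mu]_x (eta + (ka * f n x ^+ 2 + (4 * ka)^-1 * Num.min 1 (eta^-1 * f n x)))%:E)%E).
  apply: nnI_le => //; first by apply: nnmD; [exact: nnm_cst (ltW eta0)|exact: nnmD].
  move=> x; have fx0 := nnm_ge0 (nf n) x.
  case: (leP (f n x) eta) => fe.
    by rewrite -[leLHS]addr0; apply: lerD => //; rewrite addr_ge0// mulr_ge0 ?sqr_ge0// ltW.
  have -> : Num.min 1 (eta^-1 * f n x) = 1.
    by apply/min_l; rewrite ler_pdivlMl// mulr1 ltW.
  have key : f n x <= ka * f n x ^+ 2 + (4 * ka)^-1.
    rewrite -subr_ge0 (_ : _ - _ = ka * (f n x - (2 * ka)^-1) ^+ 2).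
      by rewrite mulr_ge0 ?sqr_ge0// ltW.
    by field; rewrite lt0r_neq0.
  rewrite mulr1; have := ltW eta0; move: key; lra.
rewrite (nnID mu (nnm_cst (ltW eta0)) (nnmD nA nB)) (nnID mu nA nB) nnIcst.
rewrite (nnIZ mu (ltW ka0) n2) (nnIZ mu ka4 nb) -(EFin_Rint mu (bg n)).
apply: (@le_trans _ _ (eta%:E + (ka%:E * K%:E + ((4 * ka)^-1)%:E * (e / 3 * (4 * ka))%:E))%E).
  rewrite leeD2l//; apply: leeD.
    apply: lee_wpmul2l; first by rewrite lee_fin ltW.
    exact: (fK n).
  by apply: lee_wpmul2l; rewrite lee_fin.
rewrite -!EFinM -!EFinD lee_fin.
have -> : (4 * ka)^-1 * (e / 3 * (4 * ka)) = e / 3 by field; rewrite lt0r_neq0.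
have : ka * K <= e / 3.
  have e3 : 0 <= e / 3 by exact: ltW.
  rewrite /ka mulrAC ler_pdivrMr ?ltr_wpDl//.
  by rewrite ler_wpM2l// lerDl.
by rewrite /eta; lra.
Qed.

End limits.

Section vector_mean.
Context {R : realType} {dT : measure_display} {T : measurableType dT} {d : nat}.
Variable mu : probability T R.

Lemma dotv_vmean (F : T -> 'rV[R]_d) w :
  (forall i, mu.-integrable setT (EFin \o (fun x => F x 0 i))) ->
  dotv w (vmean mu F) = \int[mu]_x dotv w (F x).
Proof.
move=> iF; have iZ i : mu.-integrable setT (EFin \o (fun x => w 0 i * F x 0 i)).
  by apply: integrableZR => //; exact: iF.
rewrite /dotv; transitivity (\sum_i \int[mu]_x (w 0 i * F x 0 i)).
  by apply: eq_bigr => i _; rewrite mxE RintegralZl.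
elim: (index_enum _) => [|i r IH].
  rewrite big_nil (_ : (fun x => _) = fun=> 0); first by rewrite Rint_cst.
  by apply/funext => x; rewrite big_nil.
rewrite big_cons IH -RintegralD//.
  by apply: eq_Rintegral => x _; rewrite big_cons.
elim: r {IH} => [|j r IH].
  rewrite (_ : EFin \o _ = cst 0%E); first exact: integrable0.
  by apply/funext => x; rewrite /= big_nil.
rewrite (_ : EFin \o _ = EFin \o (fun x => w 0 j * F x 0 j + \sum_(i <- r) w 0 i * F x 0 i)).
  exact: integrableDR.
by apply/funext => x; rewrite /= big_cons.
Qed.

Lemma vmeanB (F G : T -> 'rV[R]_d) :
  (forall i, mu.-integrable setT (EFin \o (fun x => F x 0 i))) ->
  (forall i, mu.-integrable setT (EFin \o (fun x => G x 0 i))) ->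
  vmean mu F - vmean mu G = vmean mu (fun x => F x - G x).
Proof.
move=> iF iG; apply/rowP => i; rewrite !mxE -RintegralB//.
by apply: eq_Rintegral => x _; rewrite !mxE.
Qed.

(** Testing the mean against itself: its square is the mean of [dotv w (F x)], at most half of
    [sq w] plus half of [a], and the first half is absorbed. *)
Lemma sq_vmean_le (F : T -> 'rV[R]_d) a :
  (forall i, mu.-integrable setT (EFin \o (fun x => F x 0 i))) ->
  (forall x, sq (F x) <= a) -> sq (vmean mu F) <= a.
Proof.
move=> iF Fa; set w := vmean mu F.
have a0 : 0 <= a := le_trans (sq_ge0 _) (Fa point).
have Fi i x : `|F x 0 i| <= 1 + a.
  have : F x 0 i ^+ 2 <= a := le_trans (sq_coord _ _) (Fa x).
  rewrite -[F x 0 i ^+ 2]real_normK ?num_real//; move: `|F x 0 i| (normr_ge0 (F x 0 i)) => u u0 ua.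
  by have := sqr_ge0 (u - 2^-1); rewrite sqrrB; nra.
have bF : bmf (fun x => dotv w (F x)).
  split; last first.
    exists (\sum_i `|w 0 i| * (1 + a)) => x; apply: (le_trans (ler_norm_sum _ _ _)).
    by apply: ler_sum => i _; rewrite normrM ler_wpM2l.
  apply: measurable_sum => i; apply: measurable_funM => //.
  by have /integrableP[/measurable_EFinP] := iF i.
have : sq w <= \int[mu]_x (2^-1 * sq w + 2^-1 * a).
  rewrite {1}/sq {2}/w dotv_vmean//; apply: Rint_le => //; first exact: bmf_cst.
  move=> x; have := dotv_young w (F x) (ltr01 : 0 < 1 :> R); rewrite invr1.
  by have := Fa x; lra.
by rewrite Rint_cst; lra.
Qed.

End vector_mean.

Section selfconv_field.
Context {R : realType} {d : nat}.
Local Notation rV := 'rV[R]_d.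
Variables (gW : rV -> rV) (L lamW : R) (nu : probability rV R).
Hypothesis L0 : 0 <= L.
Hypothesis lipW : forall x y, sq (gW x - gW y) <= L * sq (x - y).
Hypothesis monW : forall x y, lamW * sq (x - y) <= dotv (gW x - gW y) (x - y).
Hypothesis iW : forall x i, nu.-integrable setT (fun y => (gW (x - y) 0 i)%:E).

Lemma lip_continuous (K : rV -> rV) :
  (forall x y, sq (K x - K y) <= L * sq (x - y)) -> continuous K.
Proof.
move=> Klip x; have FF := nbhs_filter x; apply/cvgrPdist_lt => e e0.
pose C := L * d%:R + 1; have C0 : 0 < C by rewrite ltr_wpDl// mulr_ge0.
have m0 : 0 < Num.min 1 (e ^+ 2 / C).
  by rewrite lt_min ltr01 divr_gt0//; exact: exprn_gt0.
have cid : (fun y : rV => y) @ x --> x by exact: cvg_id.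
have /cvgrPdist_lt/(_ _ m0) hn := cid.
apply: filterS hn => y xy.
rewrite -(ltr_pXn2r (n := 2))// ?nnegrE ?(ltW e0)//.
apply: (le_lt_trans (norm_sq_le _)); apply: (le_lt_trans (Klip _ _)).
apply: (@le_lt_trans _ _ (L * (d%:R * `|x - y| ^+ 2))).
  by rewrite ler_wpM2l// sq_norm_le.
move: xy; rewrite lt_min => /andP[x1 x2].
have : `|x - y| ^+ 2 <= `|x - y| by rewrite expr2 ler_piMr// ltW.
move=> h; apply: (@le_lt_trans _ _ (C * `|x - y|)).
  rewrite mulrA; apply: ler_pM => //; rewrite ?mulr_ge0// /C; lra.
by rewrite mulrC -ltr_pdivlMr.
Qed.

Lemma selfconv_field_ok : field_ok L lamW (selfconv gW nu).
Proof.
have iB x y i : nu.-integrable setT (EFin \o (fun z => (gW (x - z) - gW (y - z)) 0 i)).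
  rewrite (_ : EFin \o _ = EFin \o (fun z => gW (x - z) 0 i - gW (y - z) 0 i)).
    by apply: integrableBR => //; exact: iW.
  by apply/funext => z; rewrite /= !mxE.
have E x y : selfconv gW nu x - selfconv gW nu y = vmean nu (fun z => gW (x - z) - gW (y - z)).
  by rewrite /selfconv vmeanB => // i; exact: iW.
have Klip x y : sq (selfconv gW nu x - selfconv gW nu y) <= L * sq (x - y).
  rewrite E; apply: sq_vmean_le => // z; apply: (le_trans (lipW _ _)).
  by rewrite opprB addrA subrK.
split => //.
- apply: continuous_measurable_map; exact: lip_continuous.
- move=> x y; rewrite E dotvC dotv_vmean//.
  rewrite -[leLHS](Rint_cst _ nu); apply: Rint_le; first exact: bmf_cst.
    split.
      apply: measurable_sum => i; apply: measurable_funM => //.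
      by have /integrableP[/measurable_EFinP] := iB x y i.
    exists (sq (x - y) + L * sq (x - y)) => z.
    have := dotv_young (x - y) (gW (x - z) - gW (y - z)) (ltr01 : 0 < 1 :> R).
    have := dotv_young (- (x - y)) (gW (x - z) - gW (y - z)) (ltr01 : 0 < 1 :> R).
    have := lipW (x - z) (y - z); rewrite (_ : x - z - (y - z) = x - y); last first.
      by rewrite opprB addrA subrK.
    have := sq_ge0 (gW (x - z) - gW (y - z)).
    rewrite sqN dotvNl invr1 => h1 h2 h3 h4; have := sq_ge0 (x - y) => h5.
    by rewrite ler_norml; apply/andP; split; lra.
  move=> z; rewrite dotvC; have := monW (x - z) (y - z).
  by rewrite (_ : x - z - (y - z) = x - y)// opprB addrA subrK.
Qed.

End selfconv_field.

Section selfconv_difference.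
Context {R : realType} {d : nat} {dO : measure_display} {O : measurableType dO}.
Local Notation rV := 'rV[R]_d.
Variables (gW : rV -> rV) (l : R) (P : probability O R).
Hypotheses (l0 : 0 <= l) (cW : continuous gW).
Hypothesis lipW : forall x y, enorm (gW x - gW y) <= l * enorm (x - y).
Variables (X Y : O -> rV) (mu nu : probability rV R).
Hypotheses (hX : has_law P X mu) (hY : has_law P Y nu).
Hypothesis iX : forall x i, mu.-integrable setT (fun y => (gW (x - y) 0 i)%:E).
Hypothesis iY : forall x i, nu.-integrable setT (fun y => (gW (x - y) 0 i)%:E).

(** Both convolutions are expectations on one probability space, so the coupling of [X] and [Y]
    controls their difference uniformly in [x]. The factor [d%:R] comes from arguing coordinate by
    coordinate. *)
Lemma selfconv_diff m x : 0 <= m -> (\int[P]_w (enorm (X w - Y w))%:E <= m%:E)%E ->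
  sq (selfconv gW mu x - selfconv gW nu x) <= d%:R * (l * m) ^+ 2.
Proof.
move=> m0 hm; have [mX _] := hX; have [mY _] := hY.
have mgi i : measurable_fun setT (fun y : rV => gW (x - y) 0 i).
  have /integrableP[+ _] := iX x i; by move/measurable_EFinP.
have int (Z : O -> rV) (ka : probability rV R) i : has_law P Z ka ->
    ka.-integrable setT (fun y => (gW (x - y) 0 i)%:E) ->
    P.-integrable setT (EFin \o (fun w => gW (x - Z w) 0 i)).
  move=> hZ /integrableP[_ fin]; have [mZ _] := hZ.
  apply/integrableP; split; first by apply/measurable_EFinP; exact: (measurableT_comp (mgi i) mZ).
  apply: le_lt_trans fin; rewrite (has_law_integral hZ (f := fun y : rV => `|(gW (x - y) 0 i)%:E|%E))//.
  by apply: measurableT_comp => //; exact/measurable_EFinP.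
rewrite sqE; apply: (@le_trans _ _ (\sum_(i < d) (l * m) ^+ 2)); last first.
  by rewrite sumr_const card_ord -[X in X <= _]mulr_natl.
apply: ler_sum => i _; rewrite -real_normK ?num_real// lerXn2r ?nnegrE ?mulr_ge0//.
rewrite !mxE.
have -> : \int[mu]_y gW (x - y) 0 i = \int[P]_w gW (x - X w) 0 i.
  by apply: (has_law_Rint_integrable (f := fun y : rV => gW (x - y) 0 i) hX) => //; exact: int hX _.
have -> : \int[nu]_y gW (x - y) 0 i = \int[P]_w gW (x - Y w) 0 i.
  by apply: (has_law_Rint_integrable (f := fun y : rV => gW (x - y) 0 i) hY) => //; exact: int hY _.
have i1 := int _ _ _ hX (iX x i); have i2 := int _ _ _ hY (iY x i).
rewrite -RintegralB// -lee_fin.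
have i3 := integrableBR measurableT i1 i2.
apply: (@le_trans _ _ (\int[P]_w `|(gW (x - X w) 0 i - gW (x - Y w) 0 i)%:E|)%E).
  rewrite -abse_EFin /Rintegral fineK; last exact: (integrable_fin_num measurableT i3).
  by apply: le_abse_integral => //; have /integrableP[] := i3.
apply: (@le_trans _ _ (\int[P]_w (l * enorm (X w - Y w))%:E)%E).
  have mXY := measurable_rVB mX mY.
  apply: (@nnI_le _ _ _ P (fun w => `|gW (x - X w) 0 i - gW (x - Y w) 0 i|)).
  - split => //; apply: measurableT_comp => //.
    by have /integrableP[/measurable_EFinP] := i3.
  - by apply: nnmZ => //; exact: nnm_enorm.
  - move=> w; have -> : gW (x - X w) 0 i - gW (x - Y w) 0 i = (gW (x - X w) - gW (x - Y w)) 0 i.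
      by rewrite !mxE.
    apply: (le_trans (coord_le_enorm _ _)); apply: (le_trans (lipW _ _)).
    rewrite -[enorm (X w - Y w)]enormN (_ : x - X w - (x - Y w) = - (X w - Y w))//.
    by apply/rowP => j; rewrite !mxE; ring.
rewrite nnIZ//; last by apply: nnm_enorm; exact: measurable_rVB.
by rewrite EFinM; apply: lee_wpmul2l.
Qed.

End selfconv_difference.

Section brownian_moments.
Context {dO : measure_display} {Omega : measurableType dO} {R : realType}.
Variable P : probability Omega R.

Lemma brownian1_integral b s (f : R -> R) : brownian1 P b -> 0 < s -> nnm f ->
  (\int[P]_w (f (b s w))%:E = \int[normal_prob 0 (Num.sqrt s)]_x (f x)%:E)%E.
Proof.
move=> Bb s0 nf.
have ms := brownian1_measurable Bb (ltW s0); have m0 := brownian1_measurable Bb (lexx 0).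
have mB : measurable_fun setT (fun w => b s w - b 0 w) by exact: measurable_funB.
have hl : has_law P (fun w => b s w - b 0 w) (gauss1 (Num.sqrt s)).
  split => // A mA; rewrite (brownian1_gauss Bb (lexx 0) s0 mA).
  by rewrite subr0.
rewrite -nnI_gauss1//.
rewrite (has_law_integral hl (f := fun x : R => (f x)%:E) (nnm_EFin nf)); last first.
  by move=> x; rewrite lee_fin nnm_ge0.
apply: ge0_ae_eq_integral => //.
- by apply: (measurableT_comp (nnm_EFin nf)).
- by apply: (measurableT_comp (nnm_EFin nf)).
- by move=> w _; rewrite lee_fin nnm_ge0.
- by move=> w _; rewrite lee_fin nnm_ge0.
- by apply: filterS (brownian1_start Bb) => w -> _; rewrite subr0.
Qed.

Lemma brownian1_moment b s q : brownian1 P b -> 0 < s ->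
  (\int[P]_w (`|b s w| ^+ q)%:E <= (4 * q%:R ^+ q * (1 + s) ^+ q)%:E)%E.
Proof.
move=> Bb s0; rewrite (brownian1_integral Bb s0 (f := fun x => `|x| ^+ q)); last first.
  split; last by move=> x; rewrite exprn_ge0.
  apply: measurable_funX; apply: continuous_measurable_fun => x.
  exact: norm_continuous.
have sq0 : 0 < Num.sqrt s by rewrite sqrtr_gt0.
apply: (le_trans (normal_moment sq0 q)); rewrite lee_fin; apply: ler_wpM2l.
  by rewrite mulr_ge0// exprn_ge0.
rewrite lerXn2r ?nnegrE ?(ltW sq0) ?addr_ge0 ?(ltW s0)//.
rewrite -(ler_pXn2r (n := 2))// ?nnegrE ?(ltW sq0) ?addr_ge0 ?(ltW s0)//.
rewrite sqr_sqrtr ?(ltW s0)//; have := sqr_ge0 s; nra.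
Qed.

Section vector.
Variable d : nat.
Local Notation rV := 'rV[R]_d.

Definition sum_abs (b : rV) : R := \sum_j `|b 0 j|.

Lemma sum_abs_ge0 b : 0 <= sum_abs b. Proof. by apply: sumr_ge0 => j _. Qed.

Lemma sum_abs_pow b m : sum_abs b ^+ m <= d%:R ^+ m * (1 + \sum_j `|b 0 j| ^+ m).
Proof.
rewrite /sum_abs; case: d b => [|n] b.
  rewrite !big_ord0 addr0; case: m => [|m]; first by rewrite !expr0 mulr1.
  by rewrite !exprS !mul0r.
pose j0 := [arg max_(j > ord0) `|b 0 j|]%O.
have hj j : `|b 0 j| <= `|b 0 j0|.
  by rewrite /j0; case: arg_maxP => // i _ /(_ j isT).
apply: (@le_trans _ _ ((n.+1%:R * `|b 0 j0|) ^+ m)).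
  rewrite lerXn2r ?nnegrE ?mulr_ge0//; first by apply: sumr_ge0.
  apply: (@le_trans _ _ (\sum_(j < n.+1) `|b 0 j0|)); first by apply: ler_sum => j _.
  by rewrite sumr_const card_ord -[X in X <= _]mulr_natl.
rewrite exprMn ler_wpM2l ?exprn_ge0//.
rewrite (bigD1 j0)//= -[leLHS]add0r lerD// lerDl.
by apply: sumr_ge0 => i _; rewrite exprn_ge0.
Qed.

Lemma measurable_sum_abs (f : Omega -> rV) : measurable_fun setT f ->
  measurable_fun setT (fun w => sum_abs (f w)).
Proof.
move=> mf; apply: measurable_sum => j; apply: measurableT_comp => //.
exact: (measurableT_comp (measurable_coord j) mf).
Qed.

Lemma sum_abs_moment B T m : brownian P B -> exists2 C : R, 0 <= C &
  forall s, 0 < s -> s <= T -> (\int[P]_w (sum_abs (B s w) ^+ m)%:E <= C%:E)%E.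
Proof.
move=> [B1 _]; pose c : R := 4 * m%:R ^+ m * (1 + `|T|) ^+ m.
have c0 : 0 <= c by rewrite !mulr_ge0 ?exprn_ge0// addr_ge0.
exists (d%:R ^+ m * (1 + d%:R * c)); first by rewrite mulr_ge0 ?exprn_ge0// addr_ge0// mulr_ge0.
move=> s s0 sT; have mB j := brownian1_measurable (B1 j) (ltW s0).
have mBs : measurable_fun setT (B s) by apply: measurable_rV.
have nj j : nnm (fun w => `|B s w 0 j| ^+ m).
  split; last by move=> w; rewrite exprn_ge0.
  by apply: measurable_funX; apply: measurableT_comp.
have nS : nnm (fun w => \sum_j `|B s w 0 j| ^+ m) by exact: nnm_sum.
apply: (@le_trans _ _ (\int[P]_w (d%:R ^+ m * (1 + \sum_j `|B s w 0 j| ^+ m))%:E)%E).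
  apply: nnI_le => [||w]; last exact: sum_abs_pow.
  - split; last by move=> w; rewrite exprn_ge0// sum_abs_ge0.
    by apply: measurable_funX; exact: measurable_sum_abs.
  - by apply: nnmZ; [rewrite exprn_ge0|apply: nnmD => //; exact: nnm_cst].
rewrite nnIZ ?exprn_ge0//; last by apply: nnmD => //; exact: nnm_cst.
rewrite (nnID P (nnm_cst ler01) nS) nnIcst nnIsum// EFinM; apply: lee_wpmul2l; first by rewrite lee_fin exprn_ge0.
rewrite EFinD leeD2l//.
apply: (@le_trans _ _ (\sum_(j < d) c%:E)%E); last first.
  by rewrite sumEFin sumr_const card_ord lee_fin -[X in X <= _]mulr_natl.
apply: lee_sum => j _; apply: (le_trans (brownian1_moment m (B1 j) s0)).
rewrite lee_fin; apply: ler_wpM2l; first by rewrite mulr_ge0// exprn_ge0.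
rewrite lerXn2r ?nnegrE ?addr_ge0 ?(ltW s0)// lerD2l.
by rewrite (le_trans sT)// ler_norm.
Qed.

Lemma enorm_le_sum_abs b : enorm b <= sum_abs b.
Proof. exact: enorm_le_sum. Qed.

Lemma noise_cost_moment (V : rV -> R) l Kv p B T : brownian P B -> smooth V -> 0 <= l ->
  (forall x, enorm (grad V x) <= Kv * (1 + enorm x ^+ p)) ->
  exists2 C : R, 0 <= C & forall s, 0 < s -> s <= T ->
    (\int[P]_w (noise_cost V l (B s w) ^+ 2)%:E <= C%:E)%E.
Proof.
move=> bB sV l0 hV.
have Kv0 : 0 <= Kv.
  have := hV 0; have := enorm_ge0 (grad V 0) => h1 h2.
  have h3 : 0 < 1 + enorm (0 : rV) ^+ p by rewrite ltr_pwDl// exprn_ge0// enorm_ge0.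
  by rewrite -(pmulr_lge0 _ h3) (le_trans h1).
have [C1 C10 H1] := sum_abs_moment T (2 * p) bB.
have [C2 C20 H2] := sum_abs_moment T 2 bB.
pose a := Kv ^+ 2 * 4 ^+ p; pose c := 4 * d%:R ^+ 2 * l ^+ 2.
have a0 : 0 <= a by rewrite mulr_ge0 ?exprn_ge0.
have c0 : 0 <= c by rewrite !mulr_ge0 ?exprn_ge0.
exists (3 * Kv ^+ 2 + (3 * a * C1 + 3 * c * C2)).
  by rewrite !addr_ge0 ?mulr_ge0 ?exprn_ge0.
move=> s s0 sT; have [B1 _] := bB.
have mBs : measurable_fun setT (B s).
  by apply: measurable_rV => j; exact: (brownian1_measurable (B1 j) (ltW s0)).
have bound b : noise_cost V l b ^+ 2 <=
    3 * Kv ^+ 2 + (3 * a * sum_abs b ^+ (2 * p) + 3 * c * sum_abs b ^+ 2).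
  have S0 := sum_abs_ge0 b; have e0 := enorm_ge0 b; have eS := enorm_le_sum_abs b.
  have s2 : 0 <= Num.sqrt 2 :> R by rewrite sqrtr_ge0.
  have s22 := @sqrt2_le2 R.
  have k1 : enorm (grad V (Num.sqrt 2 *: b)) <= Kv + Kv * 2 ^+ p * sum_abs b ^+ p.
    apply: (le_trans (hV _)); rewrite mulrDr mulr1 lerD2l -mulrA ler_wpM2l//.
    rewrite -exprMn lerXn2r ?nnegrE ?enorm_ge0 ?mulr_ge0//.
    by rewrite enormZ ger0_norm//; apply: ler_pM.
  have k2 : d%:R * l * (Num.sqrt 2 * enorm b) <= d%:R * l * (2 * sum_abs b).
    by rewrite ler_wpM2l ?mulr_ge0//; apply: ler_pM.
  apply: (@le_trans _ _ ((Kv + Kv * 2 ^+ p * sum_abs b ^+ p + d%:R * l * (2 * sum_abs b)) ^+ 2)).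
    rewrite lerXn2r ?nnegrE ?noise_cost_ge0//; last by apply: lerD.
    by rewrite !addr_ge0 ?mulr_ge0 ?exprn_ge0.
  have -> : 3 * Kv ^+ 2 + (3 * a * sum_abs b ^+ (2 * p) + 3 * c * sum_abs b ^+ 2) =
    3 * (Kv ^+ 2 + (Kv * 2 ^+ p * sum_abs b ^+ p) ^+ 2 + (d%:R * l * (2 * sum_abs b)) ^+ 2).
    rewrite /a /c mulnC exprM (_ : 4 ^+ p = 2 ^+ p * 2 ^+ p :> R); last by rewrite -exprMn; congr (_ ^+ _); ring.
    by ring.
  move: (Kv * 2 ^+ p * _) (d%:R * l * _) => y z.
  by have := sqr_ge0 (Kv - y); have := sqr_ge0 (Kv - z); have := sqr_ge0 (y - z); rewrite !expr2; lra.
have nS m : nnm (fun w => sum_abs (B s w) ^+ m).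
  split; last by move=> w; rewrite exprn_ge0// sum_abs_ge0.
  by apply: measurable_funX; exact: measurable_sum_abs.
have n1 : nnm (fun w => 3 * a * sum_abs (B s w) ^+ (2 * p)) by apply: nnmZ => //; rewrite mulr_ge0.
have n2 : nnm (fun w => 3 * c * sum_abs (B s w) ^+ 2) by apply: nnmZ => //; rewrite mulr_ge0.
have n3 : nnm (fun _ : Omega => 3 * Kv ^+ 2) by apply: nnm_cst; rewrite mulr_ge0 ?exprn_ge0.
apply: (@le_trans _ _ (\int[P]_w (3 * Kv ^+ 2 + (3 * a * sum_abs (B s w) ^+ (2 * p) +
    3 * c * sum_abs (B s w) ^+ 2))%:E)%E).
  apply: nnI_le => [||w]; last exact: bound.
  - apply: nnm_sqr; apply: measurable_funD.
      apply: measurable_enorm; apply: measurable_rV => i.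
      apply: (measurableT_comp (f := fun x : rV => grad V x 0 i)).
        by apply: continuous_measurable_rV; exact: smooth_grad_continuous.
      exact: measurable_rVZ.
    by apply: measurable_funM => //; apply: measurable_funM => //; exact: measurable_enorm.
  - by apply: nnmD => //; exact: nnmD.
rewrite (nnID P n3 (nnmD n1 n2)) (nnID P n1 n2) nnIcst.
rewrite nnIZ ?mulr_ge0// (nnIZ P _ (nS 2%N)) ?mulr_ge0//.
rewrite !EFinD leeD2l// !(EFinM (3 * _)); apply: leeD; apply: lee_wpmul2l; rewrite ?lee_fin ?mulr_ge0//.
- exact: H1.
- exact: H2.
Qed.

End vector.
End brownian_moments.

Section noise_mean.
Context {R : realType} {d : nat}.
Variable s : R.
Hypothesis s0 : 0 < s.
Local Notation n1 := (@noise1 R d s).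

Lemma noise1_mean : vmean n1 (fun z => Num.sqrt 2 *: row_of z) = 0.
Proof.
have mz i : measurable_fun setT (fun z : d.-tuple R => tnth z i) by exact: measurable_tnth.
have z2 i : (\int[n1]_z (tnth z i ^+ 2)%:E < +oo)%E.
  apply: le_lt_trans (ltry (16 * d%:R * s ^+ 2)); apply: le_trans (noise1_moment s0).
  apply: nnI_le => [||z].
  - exact: nnm_sqr.
  - apply: nnm_sq; exact: measurable_row_of.
  - by have := sq_coord (row_of z) i; rewrite mxE.
apply/rowP => i; rewrite !mxE.
have ii := L2_integrable (mz i) (z2 i).
transitivity (\int[n1]_z (Num.sqrt 2 * tnth z i)).
  by apply: eq_Rintegral => z _; rewrite !mxE.
rewrite RintegralZl//.
rewrite -(has_law_Rint_integrable (f := id) (has_law_tnth (gauss1 s) i)) //=.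
have -> : \int[gauss1 s]_x x = \int[normal_prob 0 s]_x x.
  apply: (has_law_Rint_integrable (f := id) (has_law_law (normal_prob 0 s) _)) => //.
  have := integrable_normal_pow s0 1.
  by rewrite (_ : (fun x : R => (x ^+ 1)%:E) = (EFin \o id)).
by rewrite normal_mean// mulr0.
Qed.

End noise_mean.

Section chain_moment.
Context {R : realType} {d : nat}.
Local Notation rV := 'rV[R]_d.
Variables (V : rV -> R) (L lam lamW h : R).
Hypotheses (sV : smooth V) (h0 : 0 < h) (L0 : 0 <= L) (lam0 : 0 <= lam).
Hypothesis monV : forall x y,
  lam * sq (x - y) <= dotv (grad V x - grad V y) (x - y).
Let J := resolvent V h.
Hypothesis mJ : measurable_fun setT J.

(** The origin is the resolvent of [h *: grad V 0], so the new position is at most as far from it as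
    the arguments are apart; the centred noise contributes only its variance. Growth in time is
    harmless, since this serves at fixed [t] to pass to the limit in the step. *)
Lemma second_moment_next K nu nu' kb m : field_ok L lamW K -> next_law J h K nu nu' ->
  sq (K 0) <= kb -> (\int[nu]_x (sq x)%:E <= m%:E)%E ->
  (\int[nu']_x (sq x)%:E <=
   ((1 + h) * (1 + 3 * h * L) * m + h * ((1 + h) * 3 * (kb + sq (grad V 0)) + 32 * d%:R))%:E)%E.
Proof.
move=> [mK Klip _] hl hk hm; set n1 := @noise1 R d (Num.sqrt h) in hl.
have kb0 : 0 <= kb := le_trans (sq_ge0 _) hk.
have sh : 0 < Num.sqrt h by rewrite sqrtr_gt0.
pose f (z : d.-tuple R) : rV := Num.sqrt 2 *: row_of z.
have mf : measurable_fun setT f by apply: measurable_rVZ; exact: measurable_row_of.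
have f2 : (\int[n1]_z (sq (f z))%:E <= (32 * d%:R * h)%:E)%E.
  under eq_integral do rewrite /f sqZ sqr_sqrtr//.
  rewrite nnIZ//; last by apply: nnm_sq; exact: measurable_row_of.
  apply: (@le_trans _ _ (2%:E * (16 * d%:R * Num.sqrt h ^+ 2)%:E)%E).
    by apply: lee_wpmul2l; [rewrite lee_fin|exact: noise1_moment].
  by rewrite sqr_sqrtr ?(ltW h0)// -EFinM lee_fin; lra.
have f2fin : (\int[n1]_z (sq (f z))%:E < +oo)%E := le_lt_trans f2 (ltry _).
have vle : vvar n1 f <= 32 * d%:R * h.
  rewrite -lee_fin; apply: le_trans f2.
  have -> : (\int[n1]_z (sq (f z))%:E = \int[n1]_z (sq (0 + f z))%:E)%E.
    by apply: eq_integral => z _; rewrite add0r.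
  by rewrite (vvar_shift mf f2fin) lee_fin lerDr sq_ge0.
pose A x := x - h *: K x - h *: grad V 0.
pose cc := (1 + h) * (1 + 3 * h * L); pose ee := h * (1 + h) * 3 * (kb + sq (grad V 0)).
have cc0 : 0 <= cc by rewrite mulr_ge0 ?addr_ge0 ?mulr_ge0// ltW.
have ee0 : 0 <= ee.
  by rewrite !mulr_ge0 ?addr_ge0 ?sq_ge0// ltW.
have A_le x : sq (A x) <= cc * sq x + ee.
  rewrite /A (_ : _ - _ = x - h *: (K x + grad V 0)); last first.
    by move: (grad V 0) (K x) => w v; apply/rowP => j; rewrite !mxE; ring.
  apply: (le_trans (sqD_young _ _ h0)); rewrite sqN sqZ mulrA.
  have -> : (1 + h^-1) * h ^+ 2 = (1 + h) * h by field; rewrite lt0r_neq0.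
  have := sqD3_le (K x - K 0) (K 0) (grad V 0); rewrite subrK => h3.
  have := Klip x 0; rewrite subr0 => h4.
  have : (1 + h) * h * sq (K x + grad V 0) <= (1 + h) * h * (3 * (L * sq x) + 3 * kb + 3 * sq (grad V 0)).
    by rewrite ler_wpM2l ?mulr_ge0 ?addr_ge0 ?(ltW h0)//; lra.
  rewrite /cc /ee; lra.
have S_le x z : sq (step1 J h K x z) <= sq (A x + f z).
  have := resolvent_contract sV lam0 monV (x - h *: K x + Num.sqrt 2 *: row_of z) (0 + h *: grad V 0) h0.
  rewrite (resolvent_fix sV lam0 monV)// subr0 => hc.
  apply: (@le_trans _ _ ((1 + 2 * h * lam) * sq (step1 J h K x z))).
    by rewrite -[X in X <= _]mul1r ler_wpM2r ?sq_ge0// lerDl !mulr_ge0// ltW.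
  apply: (le_trans hc); rewrite le_eqVlt; apply/orP; left; apply/eqP; congr sq.
  by rewrite /A /f; move: (grad V 0) (row_of z) (K x) => w v k; apply/rowP => j; rewrite !mxE; ring.
have mS := measurable_step1 h mJ mK.
rewrite (has_law_integral hl (f := fun x : rV => (sq x)%:E)); last 2 first.
- by apply/measurable_EFinP; apply: measurable_sq.
- by move=> x; rewrite lee_fin sq_ge0.
rewrite (fubini_tonelli1 (m1 := nu) (m2 := n1) (fun p => (sq (step1 J h K p.1 p.2))%:E)); last 2 first.
- by apply/measurable_EFinP; exact: measurable_sq.
- by move=> p; rewrite lee_fin sq_ge0.
have nsq : nnm (fun x : rV => sq x) by apply: nnm_sq; exact: measurable_id.
have nc : nnm (fun x : rV => cc * sq x) by exact: nnmZ.
have e0 : 0 <= ee + 32 * d%:R * h by rewrite addr_ge0// !mulr_ge0// ltW.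
apply: (@le_trans _ _ (\int[nu]_x (cc * sq x + (ee + 32 * d%:R * h))%:E)%E).
  apply: ge0_le_integral => //.
  - by move=> x _; apply: integral_ge0 => z _; rewrite lee_fin sq_ge0.
  - by apply: (nnm_fubini n1 (f := fun p => sq (step1 J h K p.1 p.2))); exact: nnm_sq.
  - by apply: nnm_EFin; apply: nnmD => //; exact: nnm_cst.
  - move=> x _; rewrite /fubini_F /=.
    apply: (@le_trans _ _ (\int[n1]_z (sq (A x + f z))%:E)%E).
      apply: nnI_le => [||z]; last exact: S_le.
      + by apply: nnm_sq; exact: (measurableT_comp mS (measurable_pair1 x)).
      + by apply: nnm_sq; exact: measurable_rVD.
    rewrite (vvar_shift mf f2fin) (_ : vmean n1 f = 0) ?addr0; last exact: noise1_mean.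
    by rewrite lee_fin; have := A_le x; lra.
rewrite (nnID nu nc (nnm_cst e0)) nnIcst nnIZ//.
apply: (@le_trans _ _ (cc%:E * m%:E + (ee + 32 * d%:R * h)%:E)%E).
  by rewrite leeD2r//; apply: lee_wpmul2l.
by rewrite -EFinM -EFinD lee_fin /cc /ee; lra.
Qed.

End chain_moment.

Lemma ae_ex (R : realType) d (T : measurableType d) (P : probability T R) (Q : T -> Prop) :
  {ae P, forall w, Q w} -> exists w, Q w.
Proof.
move=> [A [mA PA sub]]; apply/not_existsP => H.
have AT : A = setT by apply/seteqP; split => // w _; apply: sub => /=; exact: H.
by have := @probability_setT _ _ _ P; rewrite -AT PA => /eqP; rewrite eq_sym onee_eq0.
Qed.

Lemma integrable_sumR (R : realType) d (T : measurableType d) (mu : {measure set T -> \bar R})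
    (D : set T) (I : finType) (F : I -> T -> R) : measurable D ->
  (forall i, mu.-integrable D (EFin \o F i)) ->
  mu.-integrable D (EFin \o (fun x => \sum_i F i x)).
Proof.
move=> mD iF; elim: (index_enum I) => [|i r IH].
  rewrite (_ : EFin \o _ = cst 0%E); first exact: integrable0.
  by apply/funext => x; rewrite /= big_nil.
rewrite (_ : EFin \o _ = EFin \o (fun x => F i x + \sum_(i <- r) F i x)).
  exact: integrableDR.
by apply/funext => x; rewrite /= big_cons.
Qed.

Lemma integrable_normR (R : realType) d (T : measurableType d) (mu : {measure set T -> \bar R})
    (D : set T) (f : T -> R) :
  mu.-integrable D (EFin \o f) -> mu.-integrable D (EFin \o (fun x => `|f x|)).
Proof. by move=> fi; exact: (integrable_abse fi). Qed.

Lemma sqr_sum_le (R : realType) n (a : nat -> R) :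
  (\sum_(k < n) a k) ^+ 2 <= n%:R * \sum_(k < n) a k ^+ 2.
Proof.
elim: n => [|n IH]; first by rewrite !big_ord0 expr0n mul0r.
rewrite !big_ord_recr /=; set s := \sum_(k < n) a k in IH *; set q := \sum_(k < n) _ in IH *.
rewrite -[n.+1%:R]natr1; case: n @s @q IH => [|n] s q IH.
  have -> : s = 0 by rewrite /s big_ord0.
  have -> : q = 0 by rewrite /q big_ord0.
  by rewrite !add0r mul1r.
have n0 : 0 < n.+1%:R :> R by [].
move: (n.+1%:R : R) n0 IH (a n.+1) => m m0 IH b; move: s q IH => s q IH.
have h1 : 2 * s * b <= q + m * b ^+ 2.
  have h2 : m^-1 * (s - m * b) ^+ 2 <= q - 2 * s * b + m * b ^+ 2.
    have -> : q - 2 * s * b + m * b ^+ 2 = m^-1 * (m * q - 2 * s * b * m + (m * b) ^+ 2).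
      by field; rewrite lt0r_neq0.
    rewrite ler_wpM2l ?invr_ge0 ?(ltW m0)//; move: IH; rewrite !expr2; lra.
  have : 0 <= m^-1 * (s - m * b) ^+ 2 by rewrite mulr_ge0 ?sqr_ge0// invr_ge0 ltW.
  lra.
by move: IH h1; rewrite !expr2; lra.
Qed.

Lemma coord_split (R : realType) d (a b : 'rV[R]_d) j : a 0 j = b 0 j + (a - b) 0 j.
Proof. by rewrite !mxE; ring. Qed.

Lemma coord_drift (R : realType) d (a b : 'rV[R]_d) j : b 0 j = - (- a - b) 0 j + - a 0 j.
Proof. by rewrite !mxE; ring. Qed.

Section mckean.
Context {dO : measure_display} {Omega : measurableType dO} {R : realType} {d : nat}.
Local Notation rV := 'rV[R]_d.
Variables (P : probability Omega R) (V W : rV -> R) (lamV lamW l Kv : R) (p : nat).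
Variables (u : R -> probability rV R) (B X : R -> Omega -> rV).
Hypothesis HMV : mckean_vlasov P V W u B X.
Hypotheses (sV : smooth V) (lamV0 : 0 <= lamV) (l0 : 0 <= l).
Hypothesis monV : forall x y,
  lamV * sq (x - y) <= dotv (grad V x - grad V y) (x - y).
Hypothesis cW : continuous (grad W).
Hypothesis oddW : forall x, grad W (- x) = - grad W x.
Hypothesis lipW : forall x y, enorm (grad W x - grad W y) <= l * enorm (x - y).
Hypothesis monW : forall x y,
  lamW * sq (x - y) <= dotv (grad W x - grad W y) (x - y).
Hypothesis growV : forall x, enorm (grad V x) <= Kv * (1 + enorm x ^+ p).
Variable K0 : R.
Hypothesis X0_moment : (\int[P]_w (sq (X 0 w))%:E <= K0%:E)%E.

Local Notation K s := (conv_grad W (u s)).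
Let L := l ^+ 2.
Let L0 : 0 <= L. Proof. exact: sqr_ge0. Qed.

Lemma lipW_sq x y : sq (grad W x - grad W y) <= L * sq (x - y).
Proof.
by rewrite /L -!sq_enorm -exprMn lerXn2r ?nnegrE ?mulr_ge0 ?enorm_ge0.
Qed.

Lemma K_ok s : 0 <= s -> field_ok L lamW (K s).
Proof.
move=> s0; apply: (@selfconv_field_ok _ _ (grad W) L lamW (u s)) => //; first exact: lipW_sq.
by move=> x i; exact: (mv_integrable HMV).
Qed.

Lemma K_lip s x y : 0 <= s -> enorm (K s x - K s y) <= l * enorm (x - y).
Proof. by move=> /K_ok[_ Klip _]; apply: enorm_le_sq => //; exact: Klip. Qed.

Let bB := mv_brownian HMV.
Let hX s : 0 <= s -> has_law P (X s) (u s). Proof. exact: (mv_law HMV). Qed.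
Let mX s : 0 <= s -> measurable_fun setT (X s). Proof. by move=> /hX[]. Qed.
Let mB s : 0 <= s -> measurable_fun setT (B s). Proof. exact: (brownian_measurable bB). Qed.

Definition good w := [/\ forall j, cont0 (fun s => X s w 0 j),
  forall j, cont0 (fun s => grad V (X s w) 0 j),
  forall j, cont0 (fun s => B s w 0 j),
  forall j s, 0 <= s -> lebesgue_measure.-integrable `[0, s]
    (EFin \o (fun r => mv_drift V W u X r w 0 j)) &
  forall s, 0 <= s -> X s w = X 0 w + Num.sqrt 2 *: B s w +
    \row_j \int[lebesgue_measure]_(r in `[0, s]) mv_drift V W u X r w 0 j].

Lemma ae_good : {ae P, forall w, good w}.
Proof.
have H := mv_sde HMV.
have HB : {ae P, forall w, forall j : 'I_d, {within `[0, +oo[, continuous (fun t => B t w 0 j)}}.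
  by apply: filter_forall => j; have [B1 _] := bB; exact: (brownian1_continuous (B1 j)).
have FF := ae_filter_ringOfSetsType P.
have HA := filterS2 FF (fun w => @conj _ _) (sde_continuous H) HB.
have HC := filterS2 FF (fun w => @conj _ _) (sde_integrable H) (sde_equation H).
apply: (filterS2 FF _ HA HC) => w [h1 h2] [h3 h4]; split => //.
- move=> j; apply: (cont0_within (F := fun x : rV => x 0 j) h1).
  exact: coord_continuous.
- by move=> j; apply: (cont0_within (F := fun x : rV => grad V x 0 j) h1); exact: smooth_grad_continuous.
- by move=> j; apply: (cont0_within (F := id) (h2 j)) => x; exact: cvg_id.
- by move=> j s s0; exact: h3.
Qed.

(** The McKean-Vlasov solution comes with an integrable drift along each path, not with moments
    bounded locally in time. One good path [w0] is fixed: along it the field is integrable in time,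
    and the Lipschitz property of the field transfers this to all other paths. This gives a
    deterministic integrable [g] that feeds [path_bound_eventually]. *)
Lemma sup_moment T : 0 < T -> exists2 C, 0 <= C &
  forall s, 0 <= s -> s <= T -> (\int[P]_w (sq (X s w))%:E <= C%:E)%E.
Proof.
move=> T0; have [w0 [zc zg _ zi _]] := ae_ex ae_good.
pose F0 j s := mv_drift V W u X s w0 0 j.
pose g s := \sum_j (`|F0 j s| + `|grad V (X s w0) 0 j| + l * `|X s w0 0 j|).
have g0 s : 0 <= g s by apply: sumr_ge0 => j _; rewrite !addr_ge0// mulr_ge0.
have ig s : 0 <= s -> lebesgue_measure.-integrable `[0, s] (EFin \o g).
  move=> s0; apply: integrable_sumR => // j; apply: integrableDR => //.
    apply: integrableDR => //; apply: integrable_normR; first exact: zi.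
    exact: cont0_integrable.
  by apply: integrableZR => //; apply: integrable_normR; exact: cont0_integrable.
have kg w s j : 0 <= s -> `|K s (X s w) 0 j| <= g s + l * enorm (X s w).
  move=> s0; rewrite (coord_split (K s (X s w)) (K s (X s w0))).
  apply: (le_trans (ler_normD _ _)).
  have h1 : `|(K s (X s w) - K s (X s w0)) 0 j| <= l * enorm (X s w) + \sum_j l * `|X s w0 0 j|.
    apply: (le_trans (coord_le_enorm _ _)); apply: (le_trans (K_lip _ _ s0)).
    rewrite -mulr_sumr -mulrDr ler_wpM2l//; apply: (le_trans (enormB _ _)).
    by rewrite lerD2l enorm_le_sum.
  have h2 : `|K s (X s w0) 0 j| <= \sum_j (`|F0 j s| + `|grad V (X s w0) 0 j|).
    rewrite (bigD1 j)//=; apply: (@le_trans _ _ (`|F0 j s| + `|grad V (X s w0) 0 j|)); last first.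
      by rewrite lerDl; apply: sumr_ge0 => i _; rewrite addr_ge0.
    have -> : K s (X s w0) 0 j = - F0 j s + - grad V (X s w0) 0 j.
      exact: coord_drift.
    by apply: (le_trans (ler_normD _ _)); rewrite !normrN.
  have -> : g s = \sum_j (`|F0 j s| + `|grad V (X s w0) 0 j|) + \sum_j l * `|X s w0 0 j|.
    by rewrite -big_split.
  lra.
have [C1 C10 H1] := noise_cost_moment T bB sV l0 growV.
have [C2 C20 H2] := sum_abs_moment T 2 bB.
pose IT := \int[lebesgue_measure]_(s in `[0, T]) g s.
pose E0 := expR (d%:R * l * T).
pose A := E0 ^+ 2 * (4 * (K0 + ((d%:R * IT) ^+ 2 + (T ^+ 2 * C1 + 1)))).
have K00 : 0 <= K0.
  by rewrite -lee_fin; apply: le_trans X0_moment; apply: nnI_ge0; apply: nnm_sq; exact: mX.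
have A0 : 0 <= A.
  apply: mulr_ge0; first exact: sqr_ge0.
  apply: mulr_ge0 => //; apply: addr_ge0 K00 _; apply: addr_ge0; first exact: sqr_ge0.
  by apply: addr_ge0 => //; apply: mulr_ge0 C10; exact: sqr_ge0.
exists (K0 + (2 * A + 4 * C2)); first by rewrite !addr_ge0// mulr_ge0.
move=> t; rewrite le_eqVlt => /orP[/eqP <- _|t0 tT].
  by apply: (le_trans X0_moment); rewrite lee_fin lerDl addr_ge0// mulr_ge0.
have mXt := mX (ltW t0); have mBt := mB (ltW t0).
pose S n w := mesh t n * \sum_(k < n) noise_cost V l (B (grid t n k.+1) w).
have h0 n : 0 <= mesh t n by rewrite divr_ge0// ltW.
have S0 n w : 0 <= S n w.
  by rewrite mulr_ge0//; apply: sumr_ge0 => k _; exact: noise_cost_ge0.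
have gr n k : 0 <= grid t n k by rewrite mulr_ge0.
have mc n k : measurable_fun setT (fun w => noise_cost V l (B (grid t n k) w)).
  apply: measurable_funD.
    apply: measurable_enorm; apply: measurable_rV => i.
    apply: (measurableT_comp (f := fun x : rV => grad V x 0 i)).
      by apply: continuous_measurable_rV; exact: smooth_grad_continuous.
    by apply: measurable_rVZ; exact: mB.
  by apply: measurable_funM => //; apply: measurable_funM => //; apply: measurable_enorm; exact: mB.
have nS n : nnm (fun w => S n w ^+ 2).
  by apply: nnm_sqr; apply: measurable_funM => //; apply: measurable_sum => k; exact: mc.
have S2 n : (\int[P]_w (S n w ^+ 2)%:E <= (T ^+ 2 * C1)%:E)%E.
  case: n => [|n].
    rewrite (_ : (fun w => _) = fun=> 0%:E); first by rewrite nnIcst lee_fin mulr_ge0 ?sqr_ge0.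
    by apply/funext => w; rewrite /S big_ord0 mulr0 expr0n.
  have nc k : nnm (fun w => noise_cost V l (B (grid t n.+1 k) w) ^+ 2) by exact: nnm_sqr.
  have c0 : 0 <= mesh t n.+1 ^+ 2 * n.+1%:R by rewrite mulr_ge0 ?sqr_ge0.
  apply: (@le_trans _ _ (\int[P]_w (mesh t n.+1 ^+ 2 * n.+1%:R *
      \sum_(k < n.+1) noise_cost V l (B (grid t n.+1 k.+1) w) ^+ 2)%:E)%E).
    apply: nnI_le => [||w]; [exact: nS|by apply: nnmZ => //; apply: nnm_sum => k; exact: nc|].
    rewrite /S exprMn -mulrA ler_wpM2l ?sqr_ge0//.
    exact: (sqr_sum_le n.+1 (fun k => noise_cost V l (B (grid t n.+1 k.+1) w))).
  rewrite nnIZ//; last by apply: nnm_sum => k; exact: nc.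
  rewrite nnIsum; last by move=> k; exact: nc.
  apply: (@le_trans _ _ ((mesh t n.+1 ^+ 2 * n.+1%:R)%:E * \sum_(k < n.+1) C1%:E)%E).
    apply: lee_wpmul2l; first by rewrite lee_fin.
    apply: lee_sum => k _; apply: H1.
      by rewrite mulr_gt0//; exact: mesh_gt0.
    by have /andP[_ /le_trans] := grid_itv t0 (ltn_ord k); apply.
  rewrite sumEFin sumr_const card_ord -EFinM lee_fin -[C1 *+ _]mulr_natl.
  have -> : mesh t n.+1 ^+ 2 * n.+1%:R * (n.+1%:R * C1) = (n.+1%:R * mesh t n.+1) ^+ 2 * C1 by ring.
  by rewrite meshM//; apply: ler_wpM2r => //; rewrite lerXn2r ?nnegrE ?(ltW t0) ?(ltW T0).
pose f w := sq (X t w - Num.sqrt 2 *: B t w).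
have nf : nnm f by apply: nnm_sq; apply: measurable_rVB => //; exact: measurable_rVZ.
have n1 : nnm (fun w => sq (X 0 w)) by apply: nnm_sq; exact: mX.
pose G n w := E0 ^+ 2 * (4 * (sq (X 0 w) + ((d%:R * IT) ^+ 2 + (S n w ^+ 2 + 1)))).
have nG n : nnm (G n).
  apply: nnmZ; first exact: sqr_ge0.
  apply: nnmZ => //; apply: nnmD => //; apply: nnmD; first by apply: nnm_cst; exact: sqr_ge0.
  by apply: nnmD => //; exact: nnm_cst.
(* On each good path the bound holds for fine grids with slack 1. Integrating it by Fatou's lemma
   requires only moments of the Riemann sums [S n], which are uniform in [n]. *)
have fA : (\int[P]_w (f w)%:E <= A%:E)%E.
  apply: (fatou_eventually (g := G) nf nG).
    apply: filterS ae_good => w [c1 c2 c3 c4 c5].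
    have := path_bound_eventually sV lamV0 l0 monV (x := fun s => X s w) (B := fun s => B s w)
      (k := fun s => K s (X s w)) (g := g) c1 c3 c2 c4 c5 ig (fun s _ => g0 s)
      (fun s j s0 => kg w s j s0) t0 ltr01.
    apply: filterS => n; rewrite -/(S n w) => h.
    have It : \int[lebesgue_measure]_(s in `[0, t]) g s <= IT.
      have i0 : lebesgue_measure.-integrable `[0, T] (EFin \o (fun=> 0 : R)).
        by apply: cont0_integrable => y _ e e0; exists 1 => // r _ _; rewrite subrr normr0.
      have := increment_le (f := fun=> 0) (g := g) (ltW t0) tT i0 (ig _ (ltW T0)) (fun s _ _ => g0 s).
      by rewrite (Rint_itv_cst 0 (ltW T0)) (Rint_itv_cst 0 (ltW t0)) !mul0r subrr subr_ge0.
    have It0 : 0 <= \int[lebesgue_measure]_(s in `[0, t]) g s.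
      have i0 : lebesgue_measure.-integrable `[0, t] (EFin \o (fun=> 0 : R)).
        by apply: cont0_integrable => y _ e e0; exists 1 => // r _ _; rewrite subrr normr0.
      have := increment_le (f := fun=> 0) (g := g) (lexx 0) (ltW t0) i0 (ig _ (ltW t0)) (fun s _ _ => g0 s).
      rewrite (Rint_itv_cst 0 (lexx 0)) (Rint_itv_cst 0 (ltW t0)) !mul0r subrr subr_ge0; apply: le_trans.
      by rewrite set_itv1 Rintegral_set1.
    have h2 : enorm (X t w - Num.sqrt 2 *: B t w) <= E0 * (enorm (X 0 w) + d%:R * IT + S n w + 1).
      apply: (le_trans h); apply: ler_pM.
      - exact: expR_ge0.
      - by rewrite !addr_ge0 ?enorm_ge0// mulr_ge0.
      - by rewrite ler_expR ler_wpM2l// mulr_ge0.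
      - by rewrite !lerD2r lerD2l ler_wpM2l.
    have IT0 : 0 <= IT by exact: le_trans It.
    rewrite /f -sq_enorm; apply: (@le_trans _ _ ((E0 * (enorm (X 0 w) + d%:R * IT + S n w + 1)) ^+ 2)).
      rewrite lerXn2r ?nnegrE ?enorm_ge0// mulr_ge0 ?expR_ge0//.
      by rewrite !addr_ge0 ?enorm_ge0// mulr_ge0.
    rewrite exprMn /G ler_wpM2l ?sqr_ge0// -sq_enorm.
    move: (enorm _) (d%:R * IT) (S n w) => a b c.
    have := sqr_ge0 (a - b); have := sqr_ge0 (a - c); have := sqr_ge0 (a - 1).
    have := sqr_ge0 (b - c); have := sqr_ge0 (b - 1); have := sqr_ge0 (c - 1).
    by rewrite !expr2; lra.
  move=> n; have nS1 : nnm (fun w => S n w ^+ 2 + 1) by apply: nnmD => //; exact: nnm_cst.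
  have nc : nnm (fun _ : Omega => (d%:R * IT) ^+ 2) by apply: nnm_cst; exact: sqr_ge0.
  have n2 := nnmD nc nS1; have n3 := nnmD n1 n2.
  rewrite nnIZ ?sqr_ge0//; last exact: nnmZ.
  rewrite (nnIZ P _ n3)// (nnID P n1 n2) (nnID P nc nS1) (nnID P (nS n) (nnm_cst ler01)) !nnIcst.
  rewrite /A (EFinM (E0 ^+ 2)) (EFinM 4); apply: lee_wpmul2l; first by rewrite lee_fin sqr_ge0.
  apply: lee_wpmul2l; first by rewrite lee_fin.
  by rewrite !EFinD; apply: leeD => //; apply: leeD => //; apply: leeD.
have nB : nnm (fun w => sq (B t w)) by exact: nnm_sq.
apply: (@le_trans _ _ (\int[P]_w (2 * f w + 4 * sq (B t w))%:E)%E).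
  apply: nnI_le => [||w]; [exact: nnm_sq|by apply: nnmD; exact: nnmZ|].
  have := sqD_le (X t w - Num.sqrt 2 *: B t w) (Num.sqrt 2 *: B t w).
  by rewrite subrK sqZ sqr_sqrtr// -/(f w); lra.
rewrite (nnID P (nnmZ _ nf) (nnmZ _ nB))// !nnIZ//.
apply: (@le_trans _ _ (2%:E * A%:E + 4%:E * C2%:E)%E).
  apply: leeD; apply: lee_wpmul2l; rewrite ?lee_fin//.
  apply: (le_trans _ (H2 t t0 tT)).
  apply: nnI_le => [||w]; first exact: nnm_sq.
    by apply: nnm_sqr; exact: measurable_sum_abs.
  rewrite -sq_enorm lerXn2r ?nnegrE ?enorm_ge0 ?sum_abs_ge0//.
  exact: enorm_le_sum_abs.
by rewrite -!EFinM -EFinD lee_fin lerDr.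
Qed.

Lemma good_close w r e : good w -> 0 <= r -> 0 < e -> exists2 de, 0 < de &
  forall s, 0 <= s -> `|s - r| < de -> enorm (X s w - X r w) <= e.
Proof.
move=> [cX _ _ _ _] r0 e0; pose e' := e / (d%:R + 1).
have d1 : 0 < d%:R + 1 :> R by rewrite ltr_wpDl.
have e'0 : 0 < e' by rewrite divr_gt0.
have /choice[de deP] : forall j : 'I_d, exists de, 0 < de /\
    forall s, 0 <= s -> `|s - r| < de -> `|X s w 0 j - X r w 0 j| < e'.
  by move=> j; have [de ? ?] := cX j r r0 e' e'0; exists de.
pose m := \big[Num.min/1]_j de j.
exists m.
  by apply: (big_ind (fun z => 0 < z)) => // [a b a0 b0|j _]; [rewrite lt_min a0|have [] := deP j].
move=> s s0 sr; apply: (le_trans (enorm_le_sum _)).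
apply: (@le_trans _ _ (\sum_(j < d) e')).
  apply: ler_sum => j _; apply: ltW; rewrite !mxE; have [_ +] := deP j; apply => //.
  by apply: (lt_le_trans sr); exact: bigmin_le.
rewrite sumr_const card_ord -[X in X <= _]mulr_natl /e' mulrA ler_pdivrMr// mulrC ler_wpM2l ?(ltW e0)//.
by rewrite lerDl.
Qed.

(** Paths are continuous and second moments locally bounded, so continuity in mean follows along
    sequences; a failure would produce a bad sequence. *)
Lemma X_L1_cont r m : 0 <= r -> 0 < m -> exists2 de, 0 < de &
  forall s, 0 <= s -> `|s - r| < de -> (\int[P]_w (enorm (X s w - X r w))%:E <= m%:E)%E.
Proof.
move=> r0 m0; apply: contrapT => H.
have /choice[s_ sP] : forall n : nat, exists s, [/\ 0 <= s, `|s - r| < n.+1%:R^-1 &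
    ~ (\int[P]_w (enorm (X s w - X r w))%:E <= m%:E)%E].
  move=> n; apply: contrapT => Hn; apply: H; exists n.+1%:R^-1; first by rewrite invr_gt0.
  by move=> s s0 sr; apply: contrapT => Hs; apply: Hn; exists s.
have [C C0 HC] := sup_moment (ltr_wpDl r0 ltr01 : 0 < r + 1).
have s1 n : s_ n <= r + 1.
  have [_ + _] := sP n; rewrite ltr_norml => /andP[_ h].
  have : n.+1%:R^-1 <= 1 :> R by rewrite invf_le1// ler1n.
  move: (n.+1%:R^-1) h => a h; lra.
have nf n : nnm (fun w => enorm (X (s_ n) w - X r w)).
  by apply: nnm_enorm; apply: measurable_rVB; apply: mX => //; have [] := sP n.
have ae : {ae P, forall w, enorm (X (s_ n) w - X r w) @[n --> \oo] --> (0 : R)}.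
  apply: filterS ae_good => w gw; apply/cvgr0Pnorm_le => e e0.
  have [de de0 Hde] := good_close gw r0 e0.
  have /cvgr0_norm_lt/(_ _ de0) : (fun n => n.+1%:R^-1 : R) @ \oo --> 0 by exact: cvg_harmonic.
  apply: filterS => n hn.
  have [sn0 sn1 _] := sP n; rewrite ger0_norm ?enorm_ge0//; apply: Hde => //.
  by apply: (lt_le_trans sn1); apply: ltW; move: hn; rewrite ger0_norm// invr_ge0.
have L2 n : (\int[P]_w (enorm (X (s_ n) w - X r w) ^+ 2)%:E <= (4 * C)%:E)%E.
  have [sn0 _ _] := sP n.
  have nX s : 0 <= s -> nnm (fun w => sq (X s w)) by move=> s0; apply: nnm_sq; exact: mX.
  apply: (@le_trans _ _ (\int[P]_w (2 * sq (X (s_ n) w) + 2 * sq (X r w))%:E)%E).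
    apply: nnI_le => [||w]; first by apply: nnm_sqr; exact: nnm_meas (nf n).
      by apply: nnmD; apply: nnmZ => //; exact: nX.
    by rewrite sq_enorm; exact: sqB_le.
  have i1 := HC _ sn0 (s1 n).
  have i2 : (\int[P]_w (sq (X r w))%:E <= C%:E)%E by apply: HC => //; rewrite lerDl.
  have two : 0 <= 2 :> R by [].
  rewrite (nnID P (nnmZ two (nX _ sn0)) (nnmZ two (nX _ r0))) (nnIZ P two (nX _ sn0)) (nnIZ P two (nX _ r0)).
  apply: (@le_trans _ _ (2%:E * C%:E + 2%:E * C%:E)%E).
    by apply: leeD; apply: lee_wpmul2l; rewrite ?lee_fin.
  by rewrite -!EFinM -EFinD lee_fin; lra.
have := L1_cvg_of_L2_bound nf ae L2 m0 => -[n _ /(_ n (leqnn n))] /= bad.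
by have [_ _] := sP n.
Qed.

(** Together with path continuity, this makes the drift continuous along good paths, as convergence
    of the Euler scheme requires. *)
Lemma K_cont r e : 0 <= r -> 0 < e -> exists2 de, 0 < de &
  forall s, 0 <= s -> `|s - r| < de -> forall x, sq (K s x - K r x) <= e.
Proof.
move=> r0 e0; pose m := Num.min 1 (e / (d%:R * l ^+ 2 + 1)).
have c0 : 0 < d%:R * l ^+ 2 + 1 by rewrite ltr_wpDl// mulr_ge0 ?sqr_ge0.
have m0 : 0 < m by rewrite lt_min ltr01 divr_gt0.
have [de de0 H] := X_L1_cont r0 m0; exists de => // s s0 sr x.
have := selfconv_diff l0 lipW (hX s0) (hX r0) (fun x i => mv_integrable HMV x i s0)
   (fun x i => mv_integrable HMV x i r0) x (ltW m0) (H s s0 sr).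
move=> h; apply: (le_trans h).
have m1 : m ^+ 2 <= m by rewrite expr2 ler_piMr ?(ltW m0)// ge_min lexx.
have m2 : m * (d%:R * l ^+ 2 + 1) <= e by rewrite -ler_pdivlMr// ge_min lexx orbT.
apply: (@le_trans _ _ (m * (d%:R * l ^+ 2))); last by move: m2 m0; lra.
by rewrite exprMn mulrA mulrC ler_wpM2r// mulr_ge0 ?sqr_ge0.
Qed.

Lemma good_drift_cont w j : good w -> cont0 (fun s => K s (X s w) 0 j).
Proof.
move=> gw r r0 e e0; pose e1 := e / 4; have e10 : 0 < e1 by rewrite divr_gt0.
have [d1 d10 H1] := K_cont r0 (exprn_gt0 2 e10).
have [|d2 d20 H2] := good_close (e := e1 / (l + 1)) gw r0; first by rewrite divr_gt0// ltr_wpDl.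
exists (Num.min d1 d2) => [|s s0]; first by rewrite lt_min d10.
rewrite lt_min => /andP[sr1 sr2].
have h1 : enorm (K s (X s w) - K s (X r w)) <= e1.
  apply: (le_trans (K_lip _ _ s0)).
  apply: (@le_trans _ _ (l * (e1 / (l + 1)))); first by rewrite ler_wpM2l// H2.
  by rewrite mulrA ler_pdivrMr ?ltr_wpDl// mulrC ler_wpM2l ?(ltW e10)// lerDl.
have h2 : enorm (K s (X r w) - K r (X r w)) <= e1.
  rewrite -(ler_pXn2r (n := 2))// ?nnegrE ?enorm_ge0 ?(ltW e10)// sq_enorm.
  exact: H1.
have -> : K s (X s w) 0 j - K r (X r w) 0 j =
    ((K s (X s w) - K s (X r w)) + (K s (X r w) - K r (X r w))) 0 j.
  by move: (K s (X s w)) (K s (X r w)) (K r (X r w)) => a b c; rewrite !mxE; ring.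
apply: (le_lt_trans (coord_le_enorm _ _)); apply: (le_lt_trans (enormD _ _)).
by move: h1 h2 e0; rewrite /e1; lra.
Qed.

End mckean.

Section weak_limit.
Context {R : realType} {d N : nat}.
Local Notation rV := 'rV[R]_d.
Context {dO : measure_display} {Omega : measurableType dO}.
Variable Q : probability Omega R.

Lemma ucont_limit (f : N.-tuple rV -> R) (A B : nat -> Omega -> N.-tuple rV) :
  bmf f -> ucont f -> (forall n, measurable_fun setT (A n)) ->
  (forall n, measurable_fun setT (B n)) ->
  (forall b e, 0 <= b -> 0 < e -> \forall n \near \oo,
    \int[Q]_w Num.min b (b * dist2 (A n w) (B n w)) <= e) ->
  forall e, 0 < e -> \forall n \near \oo,
    \int[Q]_w f (A n w) <= \int[Q]_w f (B n w) + e.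
Proof.
move=> bf uf mA mB H e e0; have [M M0 fM] := bmf_bound bf.
have e20 : 0 < e / 2 by rewrite divr_gt0.
have [C HC] := uf _ e20.
pose b := 2 * M + `|C|; have b0 : 0 <= b by rewrite addr_ge0// mulr_ge0// ltW.
apply: filterS (H b _ b0 e20) => n hn.
have mD : measurable_fun setT (fun w => dist2 (A n w) (B n w)).
  apply: measurable_sum => i; apply: measurable_sq; apply: measurable_rVB.
    exact: (measurableT_comp (measurable_tnth i) (mA n)).
  exact: (measurableT_comp (measurable_tnth i) (mB n)).
have bm : bmf (fun w => Num.min b (b * dist2 (A n w) (B n w))).
  apply: bmf_minc => //; first exact: measurable_funM.
  by move=> w; rewrite mulr_ge0// dist2_ge0.
have bA := bmf_comp bf (mA n); have bB := bmf_comp bf (mB n).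
have bBe : bmf (fun w => f (B n w) + e / 2) by apply: bmfD => //; exact: bmf_cst.
apply: (@le_trans _ _ (\int[Q]_w (f (B n w) + e / 2 + Num.min b (b * dist2 (A n w) (B n w))))).
  apply: Rint_le => //; first exact: bmfD.
  move=> w; rewrite /Num.min; case: ifP => _; last first.
    apply: (le_trans (HC (B n w) (A n w))); rewrite lerD2l.
    have -> : dist2 (B n w) (A n w) = dist2 (A n w) (B n w).
      by apply: eq_bigr => i _; rewrite -sqN opprB.
    apply: ler_wpM2r; first exact: dist2_ge0.
    apply: (le_trans (ler_norm C)); rewrite /b lerDr mulr_ge0//; exact: ltW.
  have := fM (A n w); have := fM (B n w); rewrite !ler_norml => /andP[h1 h2] /andP[h3 h4].
  by rewrite /b; have := normr_ge0 C; lra.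
rewrite RintD// RintD//; last exact: bmf_cst.
rewrite Rint_cst; move: hn; lra.
Qed.

Lemma min_dist2_limit (A B : nat -> Omega -> N.-tuple rV) :
  (forall n, measurable_fun setT (A n)) -> (forall n, measurable_fun setT (B n)) ->
  {ae Q, forall w, forall e, 0 < e -> \forall n \near \oo, dist2 (A n w) (B n w) <= e} ->
  forall b e, 0 <= b -> 0 < e -> \forall n \near \oo,
    \int[Q]_w Num.min b (b * dist2 (A n w) (B n w)) <= e.
Proof.
move=> mA mB ae b e b0 e0.
have mD n : measurable_fun setT (fun w => dist2 (A n w) (B n w)).
  apply: measurable_sum => i; apply: measurable_sq; apply: measurable_rVB.
    exact: (measurableT_comp (measurable_tnth i) (mA n)).
  exact: (measurableT_comp (measurable_tnth i) (mB n)).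
have D0 n w : 0 <= b * dist2 (A n w) (B n w) by rewrite mulr_ge0// dist2_ge0.
have bm n : bmf (fun w => Num.min b (b * dist2 (A n w) (B n w))).
  by apply: bmf_minc => //; exact: measurable_funM.
have ae0 : {ae Q, forall w, Num.min b (b * dist2 (A n w) (B n w)) @[n --> \oo] --> (0 : R)}.
  apply: filterS ae => w hw; apply/cvgr0Pnorm_le => eps eps0.
  have b1 : 0 < b + 1 by rewrite ltr_wpDl.
  have := hw _ (divr_gt0 eps0 b1); apply: filterS => n hn.
  rewrite ger0_norm ?le_min ?b0 ?D0//; apply: (@le_trans _ _ (b * dist2 (A n w) (B n w))).
    by rewrite ge_min lexx orbT.
  apply: (@le_trans _ _ (b * (eps / (b + 1)))); first by rewrite ler_wpM2l.
  by rewrite mulrA ler_pdivrMr// mulrC ler_wpM2l ?(ltW eps0)// lerDl.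
have cv := Rint_bounded_cvg (mu := Q) (f := fun=> 0) (B := b) (fun n => bmf_meas (bm n))
  (bmf_cst 0) _ ae0.
have {}cv : \int[Q]_w Num.min b (b * dist2 (A n w) (B n w)) @[n --> \oo] --> \int[Q]_w (0 : R).
  by apply: cv => n w; rewrite ger0_norm ?le_min ?b0 ?D0// ge_min lexx.
rewrite Rint_cst in cv; have /cvgr0Pnorm_le/(_ _ e0) := cv; apply: filterS => n.
exact: le_trans (ler_norm _).
Qed.

End weak_limit.

Lemma row_integral_ext (R : realType) d (F G : R -> 'rV[R]_d) (D : set R) : (forall r, F r = G r) ->
  \row_j \int[lebesgue_measure]_(r in D) F r 0 j =
  \row_j \int[lebesgue_measure]_(r in D) G r 0 j :> 'rV_d.
Proof. by move=> /funext ->. Qed.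

Section mckean_scheme.
Context {dO : measure_display} {Omega : measurableType dO} {R : realType} {d : nat}.
Local Notation rV := 'rV[R]_d.
Variables (P : probability Omega R) (V W : rV -> R) (lamV lamW l Kv : R) (p : nat).
Variables (u : R -> probability rV R) (B X : R -> Omega -> rV).
Hypothesis HMV : mckean_vlasov P V W u B X.
Hypotheses (sV : smooth V) (lamV0 : 0 <= lamV) (l0 : 0 <= l).
Hypothesis monV : forall x y,
  lamV * sq (x - y) <= dotv (grad V x - grad V y) (x - y).
Hypothesis cW : continuous (grad W).
Hypothesis oddW : forall x, grad W (- x) = - grad W x.
Hypothesis lipW : forall x y, enorm (grad W x - grad W y) <= l * enorm (x - y).
Hypothesis monW : forall x y,
  lamW * sq (x - y) <= dotv (grad W x - grad W y) (x - y).
Hypothesis growV : forall x, enorm (grad V x) <= Kv * (1 + enorm x ^+ p).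
Variable u0 : probability rV R.
Hypothesis hX0 : has_law P (X 0) u0.
Variable K0 : R.
Hypothesis X0_moment : (\int[P]_w (sq (X 0 w))%:E <= K0%:E)%E.
Variable t : R.
Hypothesis t0 : 0 < t.

Local Notation K s := (conv_grad W (u s)).
Local Notation J n := (resolvent V (mesh t n)).
Local Notation tk := (grid t).
Let L := l ^+ 2.
Let L0 : 0 <= L. Proof. exact: sqr_ge0. Qed.
Let lipW2 := lipW_sq l0 lipW.
Let Kok s (s0 : 0 <= s) := K_ok HMV l0 lipW monW s0.
Let bB := mv_brownian HMV.
Let hX s : 0 <= s -> has_law P (X s) (u s). Proof. exact: (mv_law HMV). Qed.
Let mX s : 0 <= s -> measurable_fun setT (X s). Proof. by move=> /hX[]. Qed.
Let h0 n : 0 < mesh t n.+1. Proof. exact: mesh_gt0. Qed.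
Let gr n k : 0 <= tk n k. Proof. by rewrite mulr_ge0// divr_ge0// ltW. Qed.

Lemma resolvent_measurable n : measurable_fun setT (J n.+1).
Proof.
apply: continuous_measurable_map; apply: (@lip_continuous _ _ 1) => // x y.
rewrite mul1r; apply: le_trans (resolvent_contract sV lamV0 monV x y (h0 n)).
by rewrite -[X in X <= _]mul1r ler_wpM2r ?sq_ge0// lerDl !mulr_ge0// ltW.
Qed.

(** The field at each grid time is that of the exact law [u], not that of the law of the chain
    itself. The chain is thus an ordinary time-inhomogeneous Markov chain, and the discrepancy is
    left to [mv_bias]. *)
Fixpoint mvY n k w : rV := if k is k'.+1
  then step1 (J n) (mesh t n) (K (tk n k')) (mvY n k' w) (incr (mesh t n) B k' w) else X 0 w.

Let mK s : 0 <= s -> measurable_fun setT (K s). Proof. by move=> /Kok[]. Qed.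

Let ms n k : measurable_fun setT (fun q : rV * d.-tuple R =>
  step1 (J n.+1) (mesh t n.+1) (K (tk n.+1 k)) q.1 q.2).
Proof. by apply: measurable_step1; [exact: resolvent_measurable|exact: mK]. Qed.

Definition mvlaw n k : probability rV R :=
  lawseq (s := fun k y z => step1 (J n.+1) (mesh t n.+1) (K (tk n.+1 k)) y z) (noise1 (Num.sqrt (mesh t n.+1))) u0 (ms n) k.

Lemma mvlaw_next n k : next_law (J n.+1) (mesh t n.+1) (K (tk n.+1 k)) (mvlaw n k) (mvlaw n k.+1).
Proof. exact: lawseqS. Qed.

Lemma mvY_law n k : (k <= n.+1)%N -> has_law P (mvY n.+1 k) (mvlaw n k).
Proof.
apply: (@run_law _ _ _ _ _ _ _ _ (ms n) _ _ P (mvY n.+1) (incr (mesh t n.+1) B)) => //.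
apply: (has_law_start_increments (h0 n) _ hX0 bB).
exact: (mv_indep HMV).
Qed.

Lemma mvY_close w : good V W u B X w -> forall e, 0 < e -> \forall n \near \oo,
  forall k, (k <= n)%N -> sq (X (tk n k) w - mvY n k w) <= e.
Proof.
move=> gw e e0; have [c1 c2 c3 c4 c5] := gw.
pose x (i : 'I_1) s := X s w; pose b (i : 'I_1) s := B s w.
pose G s (a : 1.-tuple rV) (i : 'I_1) := K s (tnth a i).
(* The limit equation is the instance of [euler] with one component, its field depending on time
   through the law. *)
have ex i s : tnth (tup x s) i = X s w by rewrite tnth_mktuple.
have H := @euler_cvg _ _ 1 V lamV L sV lamV0 L0 monV x b G (fun i j => c2 j) _ _ _ t t0 e e0.
have {H} : \forall n \near \oo, forall k, (k <= n)%N ->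
    dist2 (tup x (tk n k)) (euler V x b G t n k) <= e.
  apply: H.
  - move=> i j; have cd := good_drift_cont HMV sV lamV0 l0 monV lipW monW growV X0_moment j gw.
    by rewrite /G; under eq_fun do rewrite ex.
  - move=> i s s0; apply: (etrans (c5 s s0)); apply: (congr1 (fun r : rV => X 0 w + Num.sqrt 2 *: B s w + r)).
    apply: (row_integral_ext (F := fun r => mv_drift V W u X r w)) => r.
    by rewrite /mv_drift /G; have -> : tnth (tup x r) i = X r w by exact: ex.
  - move=> s a a' s0; rewrite /dist2 mulr_sumr; apply: ler_sum => i _.
    by have [_ + _] := Kok s0; apply.
apply: filterS => n hn k kn.
have E : euler V x b G t n k = [tuple mvY n k w | _ < 1].
  elim: k {kn} => [//|k IH]; apply: eq_from_tnth => i; rewrite /= IH !tnth_mktuple /step1 /G tnth_mktuple.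
  by congr (J n (_ + _ *: _)); apply/rowP => j; rewrite !mxE tnth_mktuple.
have := hn k kn; rewrite E /dist2 big_ord_recl big_ord0 addr0 ex tnth_mktuple.
by [].
Qed.

Lemma mvlaw_moment : exists2 C, 0 <= C & forall n k, (k <= n.+1)%N ->
  (\int[mvlaw n k]_x (sq x)%:E <= C%:E)%E.
Proof.
have [C C0 HC] := sup_moment HMV sV lamV0 l0 monV lipW monW growV X0_moment t0.
have K00 : 0 <= K0.
  by rewrite -lee_fin; apply: le_trans X0_moment; apply: nnI_ge0; apply: nnm_sq; exact: mX.
have hu s : 0 <= s -> s <= t -> (\int[u s]_x (sq x)%:E <= C%:E)%E.
  move=> s0 st; have nq : nnm (fun x : rV => sq x) by exact: nnm_sq.
  rewrite (has_law_integral (hX s0) (f := fun x => (sq x)%:E)); first exact: HC.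
    exact: nnm_EFin.
  by move=> x; rewrite lee_fin sq_ge0.
have mgW : measurable_fun setT (grad W) := continuous_measurable_map cW.
have kb s : 0 <= s -> s <= t -> sq (K s 0) <= L * C.
  move=> s0 st; pose f (y : rV) := grad W (0 - y).
  have mf : measurable_fun setT f.
    by apply: (measurableT_comp mgW); exact: measurable_rVB.
  have f2 : (\int[u s]_y (sq (f y))%:E <= (L * C)%:E)%E.
    apply: (@le_trans _ _ (\int[u s]_y (L * sq y)%:E)%E).
      apply: nnI_le => [||y]; [exact: nnm_sq|by apply: nnmZ => //; exact: nnm_sq|].
      by apply: (le_trans (gW_growth oddW lipW2 _)); rewrite sub0r sqN.
    rewrite nnIZ//; last exact: nnm_sq.
    by rewrite (EFinM L C); apply: lee_wpmul2l; [rewrite lee_fin|exact: hu].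
  rewrite -lee_fin; apply: (le_trans _ f2).
  have := vvar_shift mf (le_lt_trans f2 (ltry _)) 0.
  rewrite (_ : (\int[u s]_x (sq (0 + f x))%:E)%E = (\int[u s]_x (sq (f x))%:E)%E); last first.
    by apply: eq_integral => y _; rewrite add0r.
  move=> ->; rewrite lee_fin add0r (_ : vmean (u s) f = K s 0)// lerDl.
  exact: vvar_ge0 (le_lt_trans f2 (ltry _)).
pose A := (1 + t) * 3 * (L * C + sq (grad V 0)) + 32 * d%:R.
have A0 : 0 <= A.
  by apply: addr_ge0; [apply: mulr_ge0; [rewrite mulr_ge0// addr_ge0// ltW|rewrite addr_ge0 ?sq_ge0// mulr_ge0]|rewrite mulr_ge0].
pose c := 1 + 3 * L; have c0 : 0 <= c by rewrite addr_ge0// mulr_ge0.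
exists (expR (c * t) * (K0 + t * A)); first by rewrite mulr_ge0 ?expR_ge0// addr_ge0// mulr_ge0// ltW.
move=> n k kn; set h := mesh t n.+1.
have hh : 0 < h := h0 n.
have : (\int[mvlaw n k]_x (sq x)%:E <= (expR (c * (k%:R * h)) * (K0 + k%:R * h * A))%:E)%E.
  elim: k kn => [_|k IH kn].
    rewrite mul0r mulr0 expR0 mul1r mul0r addr0.
    rewrite (has_law_integral hX0 (f := fun x => (sq x)%:E))//.
      by apply: nnm_EFin; exact: nnm_sq.
    by move=> x; rewrite lee_fin sq_ge0.
  have /andP[_ kt] := grid_itv t0 (ltnW kn).
  have := second_moment_next sV hh L0 lamV0 monV (resolvent_measurable n) (Kok (gr n.+1 k))
    (mvlaw_next n k) (kb _ (gr n.+1 k) kt) (IH (ltnW kn)).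
  move=> H; apply: (le_trans H); rewrite lee_fin -[k.+1%:R]natr1.
  have e1 : (1 + h) * (1 + 3 * h * L) <= expR (c * h).
    have -> : c * h = h + 3 * h * L by rewrite /c; ring.
    rewrite expRD; apply: ler_pM; rewrite ?expR_ge1Dx// ?addr_ge0 ?mulr_ge0// ltW//.
  have e2 : (1 + h) * 3 * (L * C + sq (grad V 0)) + 32 * d%:R <= A.
    rewrite /A lerD2r; apply: ler_wpM2r; first by rewrite addr_ge0 ?sq_ge0// mulr_ge0.
    by apply: ler_wpM2r => //; rewrite lerD2l; exact: mesh_le.
  have -> : c * ((k%:R + 1) * h) = c * h + c * (k%:R * h) by ring.
  rewrite expRD; set E1 := expR (c * h) in e1 *; set E2 := expR (c * (k%:R * h)).
  have E11 : 1 <= E1 by rewrite -expR0 ler_expR mulr_ge0// ltW.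
  have E21 : 1 <= E2 by rewrite -expR0 ler_expR mulr_ge0// mulr_ge0// ltW.
  have -> : E1 * E2 * (K0 + (k%:R + 1) * h * A) = E1 * (E2 * (K0 + k%:R * h * A)) + E1 * E2 * (h * A) by ring.
  apply: lerD.
    apply: ler_wpM2r e1; apply: mulr_ge0; first exact: expR_ge0.
    by rewrite addr_ge0// !mulr_ge0// ltW.
  apply: (@le_trans _ _ (h * A)); first by rewrite ler_wpM2l// ltW.
  rewrite -[X in X <= _]mul1r; apply: ler_wpM2r; first by rewrite mulr_ge0// ltW.
  by rewrite -[1]mulr1; apply: ler_pM.
move=> H; apply: (le_trans H); have /andP[_ kt] := grid_itv t0 kn.
have kh : 0 <= k%:R * h by rewrite mulr_ge0// ltW.
rewrite lee_fin; apply: ler_pM; rewrite ?expR_ge0//.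
- by rewrite addr_ge0// mulr_ge0.
- by rewrite ler_expR ler_wpM2l.
- by rewrite lerD2l ler_wpM2r.
Qed.

(** Almost sure convergence is uniform over the grid, and second moments are bounded uniformly in
    [n] and [k]; the claim follows by uniform integrability. *)
Lemma mvY_L1 m : 0 < m -> \forall n \near \oo, forall k, (k <= n.+1)%N ->
  (\int[P]_w (enorm (mvY n.+1 k w - X (tk n.+1 k) w))%:E <= m%:E)%E.
Proof.
move=> m0; pose F n k w := enorm (mvY n.+1 k w - X (tk n.+1 k) w).
pose Qs n k := (\int[P]_w (F n k w)%:E <= m%:E)%E.
(* For each [n] an index violating the bound is selected if there is one, so that uniformity in [k]
   reduces to convergence along one sequence. *)
have /choice[kn knP] : forall n, exists k, (k <= n.+1)%N /\
    (Qs n k -> forall k', (k' <= n.+1)%N -> Qs n k').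
  move=> n; have [H|H] := pselect (forall k', (k' <= n.+1)%N -> Qs n k'); first by exists 0%N.
  have [k /not_implyP[kn Hk]] : exists k, ~ ((k <= n.+1)%N -> Qs n k) by exact/existsNP.
  by exists k; split; [exact: kn|move=> /Hk].
have [C C0 HC] := sup_moment HMV sV lamV0 l0 monV lipW monW growV X0_moment t0.
have [C' C'0 HC'] := mvlaw_moment.
have mY n : measurable_fun setT (mvY n.+1 (kn n)).
  by have [kk _] := knP n; have [] := mvY_law kk.
have nf n : nnm (F n (kn n)).
  by apply: nnm_enorm; apply: measurable_rVB => //; exact: mX.
have ae : {ae P, forall w, F n (kn n) w @[n --> \oo] --> (0 : R)}.
  apply: filterS (ae_good HMV sV) => w gw; apply/cvgr0Pnorm_le => e e0.
  have e2 : 0 < e ^+ 2 by rewrite exprn_gt0.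
  have [n1 _ Hn1] := mvY_close gw e2; exists n1 => // n /= nn.
  have [kk _] := knP n; have := Hn1 n.+1 (leqW nn) _ kk => hq.
  rewrite ger0_norm ?enorm_ge0// -(ler_pXn2r (n := 2))// ?nnegrE ?enorm_ge0 ?(ltW e0)//.
  by rewrite /F sq_enorm -sqN opprB.
have L2 n : (\int[P]_w (F n (kn n) w ^+ 2)%:E <= (2 * C' + 2 * C)%:E)%E.
  have [kk _] := knP n.
  have nX : nnm (fun w => sq (X (tk n.+1 (kn n)) w)) by apply: nnm_sq; exact: mX.
  have nY : nnm (fun w => sq (mvY n.+1 (kn n) w)) by exact: nnm_sq.
  have two : 0 <= 2 :> R by [].
  apply: (@le_trans _ _ (\int[P]_w (2 * sq (mvY n.+1 (kn n) w) + 2 * sq (X (tk n.+1 (kn n)) w))%:E)%E).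
    apply: nnI_le => [||w]; first by apply: nnm_sqr; exact: (proj1 (nf n)).
      by apply: nnmD; exact: nnmZ.
    by rewrite /F sq_enorm; exact: sqB_le.
  rewrite (nnID P (nnmZ two nY) (nnmZ two nX)) (nnIZ P two nX) (nnIZ P two nY).
  rewrite (EFinD (2 * C')) (EFinM 2 C') (EFinM 2 C).
  apply: leeD; apply: lee_wpmul2l; rewrite ?lee_fin//.
    have nq : nnm (fun x : rV => sq x) by exact: nnm_sq.
    rewrite -(has_law_integral (mvY_law kk) (f := fun x => (sq x)%:E)); first exact: HC'.
      exact: nnm_EFin.
    by move=> x; rewrite lee_fin sq_ge0.
  by have /andP[_ kt] := grid_itv t0 kk; apply: HC.
have := L1_cvg_of_L2_bound nf ae L2 m0; apply: filterS => n hn k kk.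
by have [_ H] := knP n; exact: H.
Qed.

(** Supplies the bias of [fluct_mean]: the chain is close in mean to the exact process, and the
    convolution is Lipschitz in that distance. *)
Lemma mv_bias e : 0 < e -> \forall n \near \oo, forall k, (k <= n.+1)%N ->
  forall x, sq (selfconv (grad W) (mvlaw n k) x - K (tk n.+1 k) x) <= e.
Proof.
move=> e0; have [C C0 HC] := mvlaw_moment.
have c0 : 0 < d%:R * l ^+ 2 + 1 by rewrite ltr_wpDl// mulr_ge0 ?sqr_ge0.
pose m := Num.min 1 (e / (d%:R * l ^+ 2 + 1)).
have m0 : 0 < m by rewrite lt_min ltr01 divr_gt0.
apply: filterS (mvY_L1 m0) => n hn k kk x.
have mgW : measurable_fun setT (grad W) := continuous_measurable_map cW.
have iY (x' : rV) (i : 'I_d) : (mvlaw n k).-integrable setT (fun y => (grad W (x' - y) 0 i)%:E).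
  have mg : measurable_fun setT (fun y : rV => grad W (x' - y)).
    by apply: (measurableT_comp mgW); exact: measurable_rVB.
  have mgi : measurable_fun setT (fun y : rV => grad W (x' - y) 0 i).
    exact: (measurableT_comp (measurable_coord i) mg).
  apply: L2_integrable => //.
  apply: (@le_lt_trans _ _ (\int[mvlaw n k]_y (L * 2 * sq x' + L * 2 * sq y)%:E)%E).
    apply: nnI_le => [||y]; first exact: nnm_sqr.
      apply: nnmD; first by apply: nnm_cst; rewrite !mulr_ge0 ?sq_ge0.
      by apply: nnmZ; [rewrite mulr_ge0|exact: nnm_sq].
    apply: (le_trans (sq_coord _ _)); apply: (le_trans (gW_growth oddW lipW2 _)).
    have -> : L * 2 * sq x' + L * 2 * sq y = L * (2 * sq x' + 2 * sq y) by ring.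
    by apply: ler_wpM2l => //; exact: sqB_le.
  have n1 : nnm (fun _ : rV => L * 2 * sq x') by apply: nnm_cst; rewrite !mulr_ge0 ?sq_ge0.
  have n2 : nnm (fun y : rV => sq y) by exact: nnm_sq.
  have c2 : 0 <= L * 2 by rewrite mulr_ge0.
  rewrite (nnID _ n1 (nnmZ c2 n2)) (nnIZ _ c2 n2) nnIcst.
  apply: (le_lt_trans (leeD2l _ (lee_wpmul2l _ (HC n k kk)))); first by rewrite lee_fin.
  by rewrite -EFinM -EFinD ltry.
have := selfconv_diff l0 lipW (mvY_law kk) (hX (gr n.+1 k)) iY
  (fun x' i => mv_integrable HMV x' i (gr n.+1 k)) x (ltW m0) (hn k kk).
move=> h; apply: (le_trans h).
have m1 : m ^+ 2 <= m by rewrite expr2 ler_piMr ?(ltW m0)// ge_min lexx.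
have m2 : m * (d%:R * l ^+ 2 + 1) <= e by rewrite -ler_pdivlMr// ge_min lexx orbT.
apply: (@le_trans _ _ (m * (d%:R * l ^+ 2))); last by move: m2 m0; lra.
by rewrite exprMn mulrA mulrC ler_wpM2r// mulr_ge0 ?sqr_ge0.
Qed.

Lemma mvlaw_cvg N (f : N.-tuple rV -> R) e : bmf f -> ucont f -> 0 < e ->
  \forall n \near \oo, \int[prod_power (mvlaw n n.+1) N]_y f y <=
    \int[prod_power (u t) N]_y f y + e.
Proof.
move=> bf uf e0; pose A n (w : N.-tuple Omega) := [tuple mvY n.+1 n.+1 (tnth w i) | i < N].
pose A' (w : N.-tuple Omega) := [tuple X t (tnth w i) | i < N].
have hA n : has_law (prod_power P N) (A n) (prod_power (mvlaw n n.+1) N).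
  by apply: has_law_map; exact: mvY_law.
have hA' : has_law (prod_power P N) A' (prod_power (u t) N).
  by apply: has_law_map; apply: hX; exact: ltW.
have [mA' _] := hA'; have mA n : measurable_fun setT (A n) by have [] := hA n.
have mY n : measurable_fun setT (mvY n.+1 n.+1) by have [] := mvY_law (leqnn n.+1).
pose s n w := sq (mvY n.+1 n.+1 w - X t w).
have mXt : measurable_fun setT (X t) by apply: mX; exact: ltW.
have ms' n : nnm (s n) by apply: nnm_sq; exact: measurable_rVB.
have := ucont_limit (Q := prod_power P N) (A := A) (B := fun=> A') bf uf mA (fun=> mA') _ e0.
move=> H; apply: filterS (H _) => [n|b e1 b0 e10].
  by rewrite (has_law_Rint (hA n) bf) (has_law_Rint hA' bf).
pose e2 := e1 / N.+1%:R; have e20 : 0 < e2 by rewrite divr_gt0.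
(* One-component tuples bring the single-particle statement under [min_dist2_limit]; the [N] copies
   are then treated by a union of truncations. *)
have aes : {ae P, forall w, forall e, 0 < e -> \forall n \near \oo,
    dist2 [tuple mvY n.+1 n.+1 w | _ < 1] [tuple X t w | _ < 1] <= e}.
  apply: filterS (ae_good HMV sV) => w gw e3 e30.
  have [n1 _ Hn1] := mvY_close gw e30; exists n1 => // n /= nn.
  have := Hn1 n.+1 (leqW nn) _ (leqnn _).
  rewrite /dist2 big_ord_recl big_ord0 addr0 !tnth_mktuple -sqN opprB.
  by rewrite /grid meshM.
have := min_dist2_limit (A := fun n w => [tuple mvY n.+1 n.+1 w | _ < 1])
  (B := fun n w => [tuple X t w | _ < 1]) _ _ aes b0 e20.
move=> H1; apply: filterS (H1 _ _) => [n|n|n].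
- have -> : (fun w => Num.min b (b * dist2 [tuple mvY n.+1 n.+1 w | _ < 1] [tuple X t w | _ < 1])) =
      (fun w => Num.min b (b * s n w)).
    by apply/funext => w; rewrite /dist2 big_ord_recl big_ord0 addr0 !tnth_mktuple.
  have bs0 w : 0 <= b * s n w by rewrite mulr_ge0// sq_ge0.
  have bs : bmf (fun w => Num.min b (b * s n w)).
    apply: bmf_minc => //; apply: measurable_funM => //; exact: (proj1 (ms' n)).
  move=> hn; rewrite -lee_fin.
  have mD : measurable_fun setT (fun w => dist2 (A n w) (A' w)).
    apply: measurable_sum => i; apply: measurable_sq; apply: measurable_rVB.
      exact: (measurableT_comp (measurable_tnth i) (mA n)).
    exact: (measurableT_comp (measurable_tnth i) mA').
  have D0 w : 0 <= b * dist2 (A n w) (A' w) by rewrite mulr_ge0// dist2_ge0.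
  have bm : bmf (fun w => Num.min b (b * dist2 (A n w) (A' w))).
    by apply: bmf_minc => //; exact: measurable_funM.
  have ni i : nnm (fun w : N.-tuple Omega => Num.min b (b * s n (tnth w i))).
    split; last by move=> w; rewrite le_min b0 bs0.
    apply: (measurableT_comp (bmf_meas bs)); exact: measurable_tnth.
  (* A truncated sum of nonnegative terms is at most the sum of the truncations, and each of these
     concerns a single copy. *)
  rewrite EFin_Rint//; apply: (@le_trans _ _ (\int[prod_power P N]_w
      (\sum_i Num.min b (b * s n (tnth w i)))%:E)%E).
    apply: nnI_le => [||w].
    - split; first exact: bmf_meas bm.
      by move=> w; rewrite le_min b0 D0.
    - exact: nnm_sum.
    have -> : b * dist2 (A n w) (A' w) = \sum_i b * s n (tnth w i).
      by rewrite mulr_sumr; apply: eq_bigr => i _; rewrite !tnth_mktuple.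
    have min0 i : 0 <= Num.min b (b * s n (tnth w i)) by rewrite le_min b0 bs0.
    have [/existsP[i bi]|/existsPn/= H2] := boolP [exists i, b <= b * s n (tnth w i)].
      rewrite ge_min; apply/orP; left; rewrite (bigD1 i)//= min_l// lerDl.
      by apply: sumr_ge0 => j _.
    rewrite ge_min; apply/orP; right; apply: ler_sum => i _; rewrite min_r//.
    by apply: ltW; rewrite ltNge; exact: H2.
  rewrite nnIsum//; apply: (@le_trans _ _ (\sum_(i < N) e2%:E)%E).
    apply: lee_sum => i _.
    have nb : nnm (fun w => Num.min b (b * s n w)).
      by split; [exact: bmf_meas bs|move=> w; rewrite le_min b0 bs0].
    rewrite -(has_law_integral (has_law_tnth P i) (f := fun w => (Num.min b (b * s n w))%:E)).
    - by rewrite -EFin_Rint.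
    - exact: nnm_EFin.
    - by move=> w; rewrite lee_fin (proj2 nb).
  rewrite sumEFin sumr_const card_ord lee_fin -[X in X <= _]mulr_natl /e2 mulrA.
  by rewrite ler_pdivrMr// mulrC ler_wpM2l ?(ltW e10)// ler_nat.
- by apply: measurable_mktuple => _; exact: mY.
- by apply: measurable_mktuple => _.
Qed.

Theorem mckean_scheme : exists nus : nat -> nat -> probability rV R, [/\
  forall n, nus n 0%N = u0,
  forall n k, next_law (J n.+1) (mesh t n.+1) (K (tk n.+1 k)) (nus n k) (nus n k.+1),
  (forall e, 0 < e -> \forall n \near \oo, forall k, (k <= n.+1)%N ->
    forall x, sq (selfconv (grad W) (nus n k) x - K (tk n.+1 k) x) <= e) &
  forall N (f : N.-tuple rV -> R) e, bmf f -> ucont f -> 0 < e ->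
    \forall n \near \oo, \int[prod_power (nus n n.+1) N]_y f y <=
      \int[prod_power (u t) N]_y f y + e].
Proof.
exists mvlaw; split; [by []|exact: mvlaw_next|exact: mv_bias|exact: mvlaw_cvg].
Qed.

End mckean_scheme.

(** * The particle system and its scheme *)

Lemma cont0_sum (R : realType) (I : finType) (F : I -> R -> R) : (forall i, cont0 (F i)) ->
  cont0 (fun s => \sum_i F i s).
Proof.
move=> cF; elim: (index_enum I) => [|i r IH].
  rewrite (_ : (fun s => _) = fun=> 0); last by apply/funext => s; rewrite big_nil.
  by move=> y y0 e e0; exists 1 => // s _ _; rewrite subrr normr0.
rewrite (_ : (fun s => _) = fun s => F i s + \sum_(j <- r) F j s); first exact: cont0D.
by apply/funext => s; rewrite big_cons.
Qed.

Lemma coord_scale_sum (R : realType) d (I : finType) (c : R) (F : I -> 'rV[R]_d) j :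
  (c *: \sum_i F i) 0 j = \sum_i c * F i 0 j.
Proof. by rewrite !mxE summxE mulr_sumr. Qed.

Section particle_scheme.
Context {dO : measure_display} {Omega : measurableType dO} {R : realType} {d N : nat}.
Local Notation rV := 'rV[R]_d.
Local Notation E := (N.-tuple rV).
Variables (P : probability Omega R) (V W : rV -> R) (lamV L : R).
Variables (B X : 'I_N -> R -> Omega -> rV).
Hypothesis HP : particle_system P V W B X.
Hypotheses (sV : smooth V) (lamV0 : 0 <= lamV) (L0 : 0 <= L).
Hypothesis monV : forall x y,
  lamV * sq (x - y) <= dotv (grad V x - grad V y) (x - y).
Hypothesis cW : continuous (grad W).
Hypothesis lipW : forall x y, sq (grad W x - grad W y) <= L * sq (x - y).
Variables (mu0 mut : probability E R) (t : R).
Hypothesis t0 : 0 < t.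
Hypothesis hmu0 : has_law P (configuration X 0) mu0.
Hypothesis hmut : has_law P (configuration X t) mut.

Local Notation J n := (resolvent V (mesh t n)).
Local Notation tk := (grid t).

Let h0 n : 0 < mesh t n.+1. Proof. exact: mesh_gt0. Qed.

Fixpoint pY n k w : E := if k is k'.+1
  then step (grad W) (J n) (mesh t n) (pY n k' w) [tuple incr (mesh t n) (B i) k' w | i < N]
  else configuration X 0 w.

Let mJ n := resolvent_measurable sV lamV0 monV t0 n.

Let ms n (k : nat) : measurable_fun setT (fun q : E * N.-tuple (d.-tuple R) =>
  step (grad W) (J n.+1) (mesh t n.+1) q.1 q.2).
Proof. by apply: measurable_step => //; exact: mJ. Qed.

Let plaw n := lawseq (s := fun k y z => step (grad W) (J n.+1) (mesh t n.+1) y z)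
  (noise (Num.sqrt (mesh t n.+1)) N) mu0 (ms n).

Let pY_law n k : (k <= n.+1)%N -> has_law P (pY n.+1 k) (plaw n k).
Proof.
apply: (@run_law _ _ _ _ _ _ _ _ (ms n) _ _ P (pY n.+1)
  (fun k w => [tuple incr (mesh t n.+1) (B i) k w | i < N])) => //.
apply: (has_law_start_increments_family (h0 n) _ hmu0 (particle_brownian HP)).
exact: (particle_indep HP).
Qed.

Let Rint_plaw n k f : bmf f -> \int[plaw n k]_x f x =
  \int[mu0]_x iter k (Top (grad W) (J n.+1) (mesh t n.+1)) f x.
Proof.
elim: k f => [//|k IH] f bf; rewrite iterSr.
have bF := bmf_comp bf (ms n k).
rewrite (has_law_Rint (lawseqS _ _ (ms n) k) bf) (Rint_prod12 _ _ bF).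
by rewrite -IH//; apply: bmf_Top => //; exact: mJ.
Qed.

Let pY_close : {ae P, forall w, forall e, 0 < e -> \forall n \near \oo,
  dist2 (configuration X t w) (pY n.+1 n.+1 w) <= e}.
Proof.
have A1 : {ae P, forall w, forall i, {within `[0, +oo[, continuous (fun s => X i s w)}}.
  by apply: filter_forall => i; exact: (sde_continuous (particle_sde HP i)).
have A2 : {ae P, forall w, forall i s, 0 <= s -> X i s w = X i 0 w + Num.sqrt 2 *: B i s w
   + \row_j \int[lebesgue_measure]_(r in `[0, s]) particle_drift V W X i r w 0 j}.
  by apply: filter_forall => i; exact: (sde_equation (particle_sde HP i)).
have FF := ae_filter_ringOfSetsType P.
apply: (filterS2 FF _ A1 A2) => w c1 c2 e e0.
pose x (i : 'I_N) s := X i s w; pose b (i : 'I_N) s := B i s w.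
pose G (s : R) (a : E) (i : 'I_N) := KN (grad W) a i.
have ex i s : tnth (tup x s) i = X i s w by rewrite tnth_mktuple.
(* The instance of [euler] with [N] components: the empirical field is constant in time and has
   constant [4 * L] by [KN_lip]. *)
have L40 : 0 <= 4 * L by rewrite mulr_ge0.
have H := @euler_cvg _ _ N V lamV (4 * L) sV lamV0 L40 monV x b G _ _ _ _ t t0 e e0.
have {H} : \forall n \near \oo, forall k, (k <= n)%N ->
    dist2 (tup x (tk n k)) (euler V x b G t n k) <= e.
  apply: H.
  - move=> i j; apply: (cont0_within (F := fun x : rV => grad V x 0 j) (c1 i)).
    exact: smooth_grad_continuous.
  - move=> i j; rewrite /G /KN.
    under eq_fun do rewrite coord_scale_sum.
    apply: cont0_sum => k.
    have cc : {within `[0, +oo[, continuous (fun s => X i s w - X k s w)}.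
      by move=> s; apply: cvgB; [exact: c1|exact: c1].
    have -> : (fun s => N%:R^-1 * grad W (tnth (tup x s) i - tnth (tup x s) k) 0 j) =
        (fun s => N%:R^-1 * grad W (X i s w - X k s w) 0 j).
      by apply/funext => s; rewrite !ex.
    apply: (cont0_within (F := fun x : rV => N%:R^-1 * grad W x 0 j) cc) => z; apply: (cvg_comp (fun x : rV => grad W x 0 j) ( *%R N%:R^-1)).
      apply: (cvg_comp (grad W) (fun v : rV => v 0 j)); [exact: cW|exact: coord_continuous].
    exact: mulrl_continuous.
  - move=> i s s0; apply: (etrans (c2 i s s0)).
    apply: (congr1 (fun r : rV => X i 0 w + Num.sqrt 2 *: B i s w + r)).
    apply: (row_integral_ext (F := fun r => particle_drift V W X i r w)) => r.
    rewrite /particle_drift /G /KN; congr (_ - _ *: _).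
    by apply: eq_bigr => k _; rewrite !ex.
  - by move=> s a a' _; exact: KN_lip.
have E1 n k : euler V x b G t n k = pY n k w.
  elim: k => [//|k IH]; apply: eq_from_tnth => i; rewrite /= IH !tnth_mktuple /G.
  by congr (J n (_ + _ *: _)); apply/rowP => j; rewrite !mxE tnth_mktuple.
move=> [n1 _ Hn]; exists n1 => // n /= nn; have := Hn n.+1 (leqW nn) _ (leqnn _).
by rewrite E1 /grid meshM.
Qed.

Theorem particle_scheme_limit f e : bmf f -> ucont f -> 0 < e -> \forall n \near \oo,
  \int[mut]_x f x <=
  \int[mu0]_x iter n.+1 (Top (grad W) (J n.+1) (mesh t n.+1)) f x + e.
Proof.
move=> bf uf e0; have [mX _] := hmut.
have mY n : measurable_fun setT (pY n.+1 n.+1) by have [] := pY_law (leqnn n.+1).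
have := ucont_limit (Q := P) (A := fun=> configuration X t) (B := fun n => pY n.+1 n.+1)
  bf uf (fun=> mX) mY (min_dist2_limit (fun=> mX) mY pY_close) e0.
apply: filterS => n; rewrite -(has_law_Rint hmut bf) -(has_law_Rint (pY_law (leqnn n.+1)) bf).
by rewrite Rint_plaw.
Qed.

End particle_scheme.

(** * Duality for the relative entropy *)

Section entropy.
Context {R : realType} {dT : measure_display} {T : measurableType dT}.
Implicit Types mu nu : probability T R.

Lemma xlnx_ge (x : R) : 0 <= x -> -1 <= x * ln x.
Proof.
rewrite le_eqVlt => /orP[/eqP <-|x0]; first by rewrite mul0r lerN10.
have := ln_sublinear (x := x^-1); rewrite lnV ?posrE// invr_gt0 => /(_ x0) h.
have : x * - ln x <= x * x^-1 by rewrite ler_wpM2l ?(ltW x0)// ltW.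
by rewrite divff ?gt_eqF//; lra.
Qed.

(* Young's inequality for the conjugate pair [x ln x - x], [exp]. *)
Lemma young_entropy (a b : R) : 0 <= a -> a * b <= a * ln a - a + expR b.
Proof.
rewrite le_eqVlt => /orP[/eqP <-|a0]; first by rewrite !mul0r subr0 add0r expR_ge0.
have e : expR b = a * expR (b - ln a).
  by rewrite expRB lnK ?posrE// mulrC divfK// gt_eqF.
have := expR_ge1Dx (b - ln a); move=> /(ler_wpM2l (ltW a0)).
by rewrite -e; lra.
Qed.

(** Replaces the derivative in [rel_entropy] by a version that is finite and nonnegative everywhere,
    equal to it almost everywhere. *)
Lemma entropy_density mu nu : mu `<< nu -> exists g : T -> R, [/\ nnm g,
  rel_entropy mu nu = (\int[nu]_x (g x * ln (g x))%:E)%E,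
  (\int[nu]_x (g x)%:E = 1)%E &
  forall h, bmf h -> nu.-integrable setT (EFin \o (fun x => h x * g x)) /\
    \int[nu]_x (h x * g x) = \int[mu]_x h x].
Proof.
move=> ac; pose f := Radon_Nikodym_SigmaFinite.f mu nu.
have fE x : (fine (f x))%:E = f x.
  by rewrite fineK//; exact: Radon_Nikodym_SigmaFinite.f_fin_num.
have f0 x : (0 <= f x)%E by exact: Radon_Nikodym_SigmaFinite.f_ge0.
have fi : nu.-integrable setT f by exact: Radon_Nikodym_SigmaFinite.f_integrable.
have mf : measurable_fun setT (fun x => fine (f x)).
  by apply/measurable_EFinP; rewrite (_ : _ \o _ = f); [exact: measurable_int fi|apply/funext].
have gi : nu.-integrable setT (EFin \o (fun x => fine (f x))).
  by rewrite (_ : _ \o _ = f)//; apply/funext.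
have ng : nnm (fun x => fine (f x)) by split => // x; exact: fine_ge0.
exists (fun x => fine (f x)); split => //.
- rewrite /rel_entropy asboolT//.
  have mr : measurable_fun setT (Radon_Nikodym (charge_of_finite_measure mu) nu).
    apply: measurable_int; apply: (Radon_Nikodym_integrable (mu := nu)).
    exact: ac.
  have mk (k : T -> R) : measurable_fun setT k -> measurable_fun setT (EFin \o (fun x => k x * ln (k x))).
    by move=> mk; apply/measurable_EFinP; apply: measurable_funM => //; exact: measurableT_comp.
  apply: ae_eq_integral => //.
  + apply: (mk (fun x => fine _)); exact: measurableT_comp.
  + exact: mk.
  + have := ae_eq_Radon_Nikodym_SigmaFinite ac measurableT.
    by apply: filterS => x /= h _; rewrite /f h.
- under eq_integral do rewrite fE.
  have E1 := @probability_setT _ _ _ mu.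
  by rewrite -(Radon_Nikodym_SigmaFinite.f_integral ac measurableT); exact: E1.
move=> h bh; have [M M0 hM] := bmf_bound bh.
have hgi : nu.-integrable setT (EFin \o (fun x => h x * fine (f x))).
  apply: (@le_integrable _ _ _ _ _ _ _ (EFin \o (fun x => M * fine (f x)))) => //.
  - by apply/measurable_EFinP; apply: measurable_funM => //; exact: bmf_meas.
  - move=> x _ /=; rewrite lee_fin !normrM ler_pM//.
    by apply: (le_trans (hM x)); exact: ler_norm.
  - exact: integrableZR.
split => //; rewrite /Rintegral; congr fine.
rewrite -(Radon_Nikodym_change_of_variables ac measurableT (bmf_integrable mu bh)).
apply: ae_eq_integral => //.
- by case/integrableP: hgi.
- apply: emeasurable_funM; first by apply/measurable_EFinP; exact: bmf_meas.
  apply: measurable_int; apply: (Radon_Nikodym_integrable (mu := nu)).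
  exact: ac.
- have := ae_eq_Radon_Nikodym_SigmaFinite ac measurableT.
  by apply: filterS => x /= hx _; rewrite /f -hx// EFinM fE.
Qed.

(** x ln x is bounded below by -1, so the shift by 1 turns the entropy into the integral of a
    nonnegative function, whether or not it is finite. *)
Lemma integral_shift1 nu (k : T -> R) : measurable_fun setT k -> (forall x, -1 <= k x) ->
  (\int[nu]_x (k x)%:E = \int[nu]_x (k x + 1)%:E - 1)%E.
Proof.
move=> mk k1; have n1 : nnm (fun x => k x + 1).
  split; first by apply: measurable_funD => //.
  by move=> x; have := k1 x; lra.
have mk' := mk; move/measurable_EFinP in mk'.
have [ki|kni] := pselect (nu.-integrable setT (EFin \o k)).
  have := integralD measurableT ki (bmf_integrable nu (bmf_cst 1)).
  have -> : (\int[nu]_x ((EFin \o k) x + (EFin \o (fun=> 1%R)) x) = \int[nu]_x (k x + 1)%:E)%E by [].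
  move=> ->; rewrite (_ : (\int[nu]_x (EFin \o (fun=> 1%R)) x)%E = 1%E) ?addeK//.
  exact: (nnIcst nu 1).
have top : (\int[nu]_x (k x + 1)%:E = +oo)%E.
  apply: contrapT => /eqP; rewrite -ltey => lt; apply: kni.
  have := integrableBR measurableT (nnI_int n1 lt) (bmf_integrable nu (bmf_cst 1)).
  by congr (nu.-integrable _ _); apply/funext => x; rewrite /= addrK.
rewrite top /= integralE.
have neg : (\int[nu]_x ((EFin \o k)^\- x) <= 1)%E.
  rewrite -(nnIcst nu 1); apply: ge0_le_integral => //.
  - exact: measurable_funeneg.
  - move=> x _; rewrite funenegE /= -EFin_max lee_fin ge_max ler01 andbT.
    by have := k1 x; lra.
have pos : (\int[nu]_x ((EFin \o k)^\+ x) = +oo)%E.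
  apply/eqP; rewrite -leye_eq -top.
  have : (\int[nu]_x (k x + 1)%:E <= \int[nu]_x ((EFin \o k)^\+ x) + 1)%E.
    rewrite -[X in (_ + X)%E](nnIcst nu 1) -ge0_integralD//; last exact: measurable_funepos.
    apply: ge0_le_integral => //.
    - by move=> x _; rewrite lee_fin (nnm_ge0 n1).
    - exact: nnm_EFin.
    - by apply: emeasurable_funD => //; exact: measurable_funepos.
    - move=> x _; rewrite funeposE /= -EFin_max -EFinD lee_fin lerD2r.
      by rewrite le_max lexx.
  rewrite top leye_eq => /eqP; case: (\int[nu]_x _)%E => //.
have nn : ((\int[nu]_x ((EFin \o k)^\- x)) != +oo)%E by rewrite -ltey (le_lt_trans neg)// ltry.
by rewrite [X in (X - _)%E]pos addye// eqe_oppLR.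
Qed.

(** The easy half of the Donsker-Varadhan formula: Young's inequality is integrated after
    normalising [f] so that its exponential has mean 1. *)
Lemma entropy_ge mu nu f : bmf f ->
  ((\int[mu]_x f x - ln (\int[nu]_x expR (f x)))%:E <= rel_entropy mu nu)%E.
Proof.
move=> bf; have [ac|nac] := pselect (mu `<< nu); last first.
  by rewrite /rel_entropy asboolF// leey.
have [g [ng -> g1 hg]] := entropy_density ac.
set c := ln _; have be := bmf_expR bf.
have bfc : bmf (fun x => f x - c) by apply: bmfB => //; exact: bmf_cst.
have mk : measurable_fun setT (fun x => g x * ln (g x)).
  by apply: measurable_funM; [exact: (proj1 ng)|apply: measurableT_comp => //; exact: (proj1 ng)].
have [igf Igf] := hg _ bfc.
have gi : nu.-integrable setT (EFin \o g) by apply: nnI_int => //; rewrite g1 ltry.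
have k1 x : -1 <= g x * ln (g x) by apply: xlnx_ge; exact: (nnm_ge0 ng).
have [ki|kni] := pselect (nu.-integrable setT (EFin \o (fun x => g x * ln (g x)))); last first.
  rewrite integral_shift1//.
  suff -> : (\int[nu]_x (g x * ln (g x) + 1)%:E = +oo)%E by rewrite addye// leey.
  apply: contrapT => /eqP; rewrite -ltey => lt; apply: kni.
  have n1 : nnm (fun x => g x * ln (g x) + 1).
    by split; [exact: measurable_funD|move=> x; have := k1 x; lra].
  have := integrableBR measurableT (nnI_int n1 lt) (bmf_integrable nu (bmf_cst 1)).
  by congr (nu.-integrable _ _); apply/funext => x; rewrite /= addrK.
have -> : (\int[nu]_x (g x * ln (g x))%:E)%E = (\int[nu]_x (g x * ln (g x)))%:E.
  by rewrite /Rintegral fineK//; exact: (integrable_fin_num measurableT ki).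
rewrite lee_fin.
have bfe : bmf (fun x => expR (f x - c)) by exact: bmf_expR.
have i2 := integrableBR measurableT ki gi.
have i3 := integrableDR measurableT i2 (bmf_integrable nu bfe).
have : \int[nu]_x ((f x - c) * g x) <= \int[nu]_x (g x * ln (g x) - g x + expR (f x - c)).
  apply: le_Rintegral => // x _; rewrite mulrC; apply: young_entropy; exact: (nnm_ge0 ng).
rewrite Igf RintB//; last exact: bmf_cst.
rewrite Rint_cst RintegralD//; last exact: (bmf_integrable nu bfe).
rewrite RintegralB//.
have -> : \int[nu]_x g x = 1 by rewrite /Rintegral g1.
have -> : \int[nu]_x expR (f x - c) = 1.
  have -> : (fun x => expR (f x - c)) = (fun x => expR (- c) * expR (f x)).
    by apply/funext => x; rewrite addrC expRD.
  rewrite RintZ// /c expRN lnK ?posrE ?Rint_expR_gt0// mulVf// gt_eqF// Rint_expR_gt0//.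
by rewrite subrK.
Qed.

(* It suffices to test the truncations of the logarithm of the density. *)
Lemma entropy_le mu nu C :
  (forall f, bmf f -> \int[mu]_x f x <= ln (\int[nu]_x expR (f x)) + C) ->
  (rel_entropy mu nu <= C%:E)%E.
Proof.
(* Tested on k times the indicator of a [nu]-null set, the hypothesis reads k mu(A) <= C for every
   integer k. *)
move=> H; have ac : mu `<< nu.
  apply/null_content_dominatesP => A mA nuA; have bA := bmf_ind (R := R) mA.
  have hk (k : nat) : k%:R * fine (mu A) <= C.
    have bk : bmf (fun x => k%:R * \1_A x : R) by exact: bmfZ.
    have IA (la : probability T R) : \int[la]_x \1_A x = fine (la A) :> R.
      by rewrite /Rintegral integral_indic// setIT.
    have := H _ bk; rewrite RintZ// IA.
    have -> : (fun x => expR (k%:R * \1_A x : R)) = (fun x => 1 + (expR k%:R - 1) * \1_A x).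
      apply/funext => x; rewrite indicE; case: (x \in A); rewrite ?mulr1 ?mulr0 ?expR0 ?addr0//.
      by ring.
    rewrite RintD//; [|exact: bmf_cst|exact: bmfZ].
    by rewrite RintZ// Rint_cst IA nuA mulr0 addr0 ln1 add0r.
  have A0 : 0 <= fine (mu A) by exact: fine_ge0.
  have fA : mu A \is a fin_num by exact: fin_num_measure.
  apply/eqP; rewrite -(fineK fA) eqe eq_le A0 andbT leNgt; apply/negP => Apos.
  have [n Hn] : exists n : nat, `|C| / fine (mu A) < n%:R.
    by exists (Num.truncn (`|C| / fine (mu A))).+1; exact: truncnS_gt.
  have := hk n; rewrite leNgt => /negP; apply.
  by apply: (le_lt_trans (ler_norm C)); rewrite -ltr_pdivrMr.
have [g [ng -> g1 hg]] := entropy_density ac; have g0 := nnm_ge0 ng.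
have mk : measurable_fun setT (fun x => g x * ln (g x)).
  by apply: measurable_funM; [exact: (proj1 ng)|apply: measurableT_comp => //; exact: (proj1 ng)].
have k1 x : -1 <= g x * ln (g x) by exact: xlnx_ge.
rewrite integral_shift1// leeBlDr//; apply/lee_addgt0Pr => e e0.
have [n0 Hn0] : exists n0 : nat, e^-1 < n0%:R.
  by exists (Num.truncn e^-1).+1; exact: truncnS_gt.
have nk : nnm (fun x => g x * ln (g x) + 1).
  by split; [exact: measurable_funD|move=> x; have := k1 x; lra].
pose m n : R := (n + n0).+1%:R; have m1 n : 1 <= m n by rewrite ler1n.
have m0 n : 0 < m n by exact: lt_le_trans (m1 n).
(* The density is truncated above at [m n] and raised by its inverse, which makes the logarithm
   bounded. The offset [n0] in [m] keeps that inverse below [e], so the mean of [q n] is at most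
   [1 + e]. *)
pose q n x := (m n)^-1 + Num.min (m n) (g x).
pose f n x := ln (q n x).
have bq n : bmf (q n) by apply: bmfD; [exact: bmf_cst|apply: bmf_minc; [exact: (proj1 ng)| |exact: ltW]].
have q0 n x : (m n)^-1 <= q n x by rewrite lerDl le_min g0 ltW.
have bf n : bmf (f n) by apply: (bmf_ln (a := (m n)^-1)) => //; rewrite invr_gt0.
have me n : (m n)^-1 <= e.
  rewrite -[e]invrK lef_pV2 ?posrE ?invr_gt0//; apply: (le_trans (ltW Hn0)).
  by rewrite ler_nat ltnW// ltnS leq_addl.
have fg n x : g x * ln (Num.min (m n) (g x)) <= f n x * g x.
  rewrite mulrC; case: (ltrP 0 (g x)) => [gp|]; last first.
    move=> gn; have -> : g x = 0 by apply/eqP; rewrite eq_le gn g0.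
    by rewrite !mulr0.
  rewrite ler_wpM2r//; rewrite ler_ln ?posrE ?lt_min ?m0//.
    by rewrite lerDr invr_ge0 ltW.
  by rewrite (lt_le_trans _ (q0 n x))// invr_gt0.
pose kn n x := f n x * g x + 1.
have fmin n x : -1 <= f n x * g x.
  apply: le_trans (fg n x); rewrite /Num.min; case: ifPn => [mg|_]; last exact: k1.
  by apply: (@le_trans _ _ 0); rewrite ?lerN10// mulr_ge0// ln_ge0.
have nkn n : nnm (kn n).
  split; last by move=> x; have := fmin n x; rewrite /kn; lra.
  by apply: measurable_funD => //; apply: measurable_funM; [exact: bmf_meas|exact: (proj1 ng)].
have ikn n : (\int[nu]_x (kn n x)%:E <= (C + 1 + e)%:E)%E.
  have [ii II] := hg _ (bf n).
  have ik : nu.-integrable setT (EFin \o kn n) by apply: integrableDR => //; exact: bmf_integrable (bmf_cst 1).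
  have -> : (\int[nu]_x (kn n x)%:E)%E = (\int[nu]_x kn n x)%:E.
    by rewrite /Rintegral fineK//; exact: (integrable_fin_num measurableT ik).
  rewrite lee_fin RintegralD//; last exact: (bmf_integrable nu (bmf_cst 1)).
  rewrite II [\int[nu]_x 1]Rint_cst; have := H _ (bf n).
  have -> : (fun x => expR (f n x)) = q n.
    by apply/funext => x; rewrite lnK// posrE (lt_le_trans _ (q0 n x))// invr_gt0.
  have : ln (\int[nu]_x q n x) <= e.
    have I1 : \int[nu]_x q n x <= 1 + e.
      have gi : nu.-integrable setT (EFin \o g) by apply: nnI_int => //; rewrite g1 ltry.
      have ie := integrableDR measurableT (bmf_integrable nu (bmf_cst e)) gi.
      apply: (@le_trans _ _ (\int[nu]_x (e + g x))).
        apply: le_Rintegral => //; first exact: bmf_integrable.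
        by move=> x _; apply: lerD => //; rewrite ge_min lexx orbT.
      rewrite RintegralD//; last exact: (bmf_integrable nu (bmf_cst e)).
      by rewrite Rint_cst [\int[nu]_x g x]/Rintegral g1 addrC.
    have I0 : 0 < \int[nu]_x q n x.
      apply: (@lt_le_trans _ _ (\int[nu]_x (m n)^-1)); first by rewrite Rint_cst invr_gt0.
      by apply: Rint_le => //; exact: bmf_cst.
    have e1 : 0 < 1 + e by rewrite addr_gt0.
    apply: (@le_trans _ _ (ln (1 + e))); first by rewrite ler_ln ?posrE.
    rewrite -[X in _ <= X]expRK ler_ln ?posrE ?expR_gt0//; exact: expR_ge1Dx.
  lra.
rewrite -!EFinD.
apply: (fatou_eventually (g := kn)) => //; apply: aeW => x.
exists (Num.truncn (g x)).+1 => // n /= nn; rewrite lerD2r; apply: le_trans (fg n x).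
rewrite min_r//; apply: (le_trans (ltW (truncnS_gt _))); rewrite ler_nat.
by apply: (leq_trans nn); rewrite leqW// leq_addr.
Qed.

End entropy.

(** * Density of uniformly continuous functions *)

Section lipschitz_indicator.
Context {R : realType} {d : nat}.
Local Notation rV := 'rV[R]_d.
Variables (A : set rV) (n : nat).

Let S (x : rV) : set R := [set \1_A y + n%:R * `|x - y| | y in setT].

(* The largest [n]-Lipschitz function below the indicator of [A]. *)
Definition lip_ind (x : rV) : R := inf (S x).

Let S_lb x : has_lbound (S x).
Proof. by exists 0 => _ [y _ <-]; rewrite addr_ge0 ?indicE// mulr_ge0. Qed.

Let S_le x y : lip_ind x <= \1_A y + n%:R * `|x - y|.
Proof. by apply: ge_inf => //; exists y. Qed.

Lemma lip_ind_le x : lip_ind x <= \1_A x.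
Proof. by have := S_le x x; rewrite subrr normr0 mulr0 addr0. Qed.

Let le_S x c : (forall y, c <= \1_A y + n%:R * `|x - y|) -> c <= lip_ind x.
Proof.
move=> h; apply: lb_le_inf; last by move=> _ [y _ <-].
by exists (\1_A x + n%:R * `|x - x|); exists x.
Qed.

Lemma lip_ind_ge0 x : 0 <= lip_ind x.
Proof. by apply: le_S => y; rewrite addr_ge0 ?indicE// mulr_ge0. Qed.

Lemma lip_ind_le1 x : lip_ind x <= 1.
Proof. by apply: (le_trans (lip_ind_le x)); rewrite indicE; case: (_ \in _). Qed.

Lemma lip_ind_lip x y : lip_ind y <= lip_ind x + n%:R * `|x - y|.
Proof.
rewrite -lerBlDr; apply: le_S => z; rewrite lerBlDr -addrA -mulrDr.
apply: (le_trans (S_le y z)); rewrite lerD2l ler_wpM2l//.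
by have := ler_distD x y z; rewrite (distrC y x) [`|x - y| + _]addrC.
Qed.

Lemma lip_ind_ge x r : ball x r `<=` A -> 1 <= n%:R * r -> 1 <= lip_ind x.
Proof.
move=> bA nr; apply: le_S => y; rewrite indicE; case: (boolP (y \in A)) => [_|yA].
  by rewrite lerDl mulr_ge0.
rewrite add0r; apply: (le_trans nr); rewrite ler_wpM2l// leNgt; apply: contra yA => xy.
by rewrite inE; apply: bA; rewrite -ball_normE.
Qed.

Lemma lip_ind_bmf : bmf lip_ind.
Proof.
split; last by exists 1 => x; rewrite ger0_norm ?lip_ind_ge0// lip_ind_le1.
apply: continuous_measurable_rV => x; have FF := nbhs_filter x; apply/cvgrPdist_lt => e e0.
have n1 : 0 < n%:R + 1 :> R by rewrite ltr_wpDl.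
have cid : (fun y : rV => y) @ x --> x by exact: cvg_id.
have /cvgrPdist_lt/(_ _ (divr_gt0 e0 n1)) := cid; apply: filterS => y xy.
have h1 := lip_ind_lip x y; have h2 := lip_ind_lip y x; rewrite distrC in h2.
apply: (@le_lt_trans _ _ (n%:R * `|x - y|)); first by rewrite ler_norml; lra.
apply: (@le_lt_trans _ _ ((n%:R + 1) * `|x - y|)); first by rewrite ler_wpM2r// lerDl.
by rewrite mulrC -ltr_pdivlMr.
Qed.

Lemma lip_ind_ucont N (i : 'I_N) : ucont (fun x : N.-tuple rV => lip_ind (tnth x i)).
Proof.
move=> e e0; exists (n%:R ^+ 2 / (4 * e)) => x y; apply: (le_trans (lip_ind_lip (tnth x i) (tnth y i))).
rewrite -addrA lerD2l; set a := `|_|.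
have a2 : a ^+ 2 <= dist2 x y.
  apply: (le_trans (norm_sq_le _)); rewrite /dist2 (bigD1 i)//= lerDl.
  by apply: sumr_ge0 => j _; exact: sq_ge0.
apply: (@le_trans _ _ (e + n%:R ^+ 2 / (4 * e) * a ^+ 2)); last first.
  by rewrite lerD2l; apply: ler_wpM2l => //; rewrite divr_ge0 ?sqr_ge0// mulr_ge0// ltW.
have -> : n%:R ^+ 2 / (4 * e) * a ^+ 2 = (n%:R * a) ^+ 2 / (4 * e) by ring.
have : 0 <= (n%:R * a - 2 * e) ^+ 2 / (4 * e).
  by rewrite divr_ge0 ?sqr_ge0// mulr_ge0// ltW.
have -> : (n%:R * a - 2 * e) ^+ 2 / (4 * e) = (n%:R * a) ^+ 2 / (4 * e) - n%:R * a + e.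
  by field; rewrite gt_eqF.
lra.
Qed.

End lipschitz_indicator.

Section density.
Context {R : realType} {d N : nat}.
Local Notation rV := 'rV[R]_d.
Local Notation E := (N.-tuple rV).
Variables (mu nu : probability E R).

Let dist (f g : E -> R) := \int[mu]_x `|f x - g x| + \int[nu]_x `|f x - g x|.

(** Approximation in mean under both laws at once, since the variational formula for the entropy
    involves the two of them. *)
Definition ucont_approx (f : E -> R) := forall e, 0 < e ->
  exists g, [/\ bmf g, ucont g & dist f g <= e].

Let bmf_abs (f : E -> R) : bmf f -> bmf (fun x => `|f x|).
Proof.
move=> [mf [B fB]]; split; first exact: measurableT_comp.
by exists B => x; rewrite normr_id.
Qed.

Let dist_le (f g h : E -> R) : bmf (fun x => `|f x - g x|) -> bmf h ->
  (forall x, `|f x - g x| <= h x) -> dist f g <= \int[mu]_x h x + \int[nu]_x h x.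
Proof. by move=> b1 b2 fg; apply: lerD; exact: Rint_le. Qed.

Lemma ucont_approx_ucont f : bmf f -> ucont f -> ucont_approx f.
Proof.
move=> bf uf e e0; exists f; split => //; rewrite /dist.
have -> : (fun x => `|f x - f x|) = fun=> 0 by apply/funext => x; rewrite subrr normr0.
by rewrite !Rint_cst addr0 ltW.
Qed.

Let approx2 (f g k : E -> R) (op : R -> R -> R) : bmf f -> bmf g ->
  (forall f' g' : E -> R, bmf f' -> bmf g' -> bmf (fun x => op (f' x) (g' x))) ->
  (forall f' g' : E -> R, ucont f' -> ucont g' -> ucont (fun x => op (f' x) (g' x))) ->
  (forall a b a' b', `|op a b - op a' b'| <= `|a - a'| + `|b - b'|) ->
  ucont_approx f -> ucont_approx g -> ucont_approx (fun x => op (f x) (g x)).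
Proof.
move=> bf bg bop uop lop af ag e e0; have e2 : 0 < e / 2 by rewrite divr_gt0.
have [f' [bf' uf' df]] := af _ e2; have [g' [bg' ug' dg]] := ag _ e2.
exists (fun x => op (f' x) (g' x)); split; [exact: bop|exact: uop|].
have b1 := bmf_abs (bmfB bf bf'); have b2 := bmf_abs (bmfB bg bg').
apply: (le_trans (dist_le _ (bmfD b1 b2) (fun x => lop _ _ _ _))).
  by apply: bmf_abs; apply: bmfB; exact: bop.
by rewrite !RintD//; move: df dg; rewrite /dist; lra.
Qed.

Lemma ucont_min (f g : E -> R) : ucont f -> ucont g -> ucont (fun x => Num.min (f x) (g x)).
Proof.
move=> uf ug e e0; have [C C0 HC] := ucont_pos uf e0; have [D D0 HD] := ucont_pos ug e0.
exists (C + D) => x y; have := HC x y; have := HD x y; have := dist2_ge0 x y.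
move: (dist2 x y) (f x) (f y) (g x) (g y) => a f1 f2 g1 g2 a0 h1 h2.
have h3 : 0 <= C * a by rewrite mulr_ge0.
have h4 : 0 <= D * a by rewrite mulr_ge0.
by rewrite ge_min /Num.min; case: ifP => _; apply/orP; [left|right]; lra.
Qed.

Lemma ucont_cst (c : R) : ucont (fun _ : E => c).
Proof. by move=> e e0; exists 0 => x y; rewrite mul0r addr0 lerDl ltW. Qed.

Lemma ucont_approxD f g : bmf f -> bmf g -> ucont_approx f -> ucont_approx g ->
  ucont_approx (fun x => f x + g x).
Proof.
move=> bf bg; apply: (approx2 (fun x => 0) (op := +%R)) => //.
- by move=> f' g'; exact: bmfD.
- by move=> f' g'; exact: ucontD.
- by move=> a b a' b'; rewrite opprD addrACA; exact: ler_normD.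
Qed.

Lemma ucont_approx_min f g : bmf f -> bmf g -> ucont_approx f -> ucont_approx g ->
  ucont_approx (fun x => Num.min (f x) (g x)).
Proof.
move=> bf bg; apply: (approx2 (fun x => 0) (op := Num.min)) => //.
- by move=> f' g'; exact: bmf_min.
- by move=> f' g'; exact: ucont_min.
- move=> a b a' b'; have [a1 a2] : a - a' <= `|a - a'| /\ a' - a <= `|a - a'|.
    by split; [exact: ler_norm|rewrite distrC; exact: ler_norm].
  have [b1 b2] : b - b' <= `|b - b'| /\ b' - b <= `|b - b'|.
    by split; [exact: ler_norm|rewrite distrC; exact: ler_norm].
  move: (normr_ge0 (a - a')) (normr_ge0 (b - b')) => p q.
  rewrite /Num.min; case: ltrP => h1; case: ltrP => h2; rewrite ler_norml; lra.
Qed.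

Lemma ucontZ (c : R) (f : E -> R) : 0 <= c -> ucont f -> ucont (fun x => c * f x).
Proof.
move=> c0 uf e e0; have c1 : 0 < c + 1 by rewrite ltr_wpDl.
have [C C0 HC] := ucont_pos uf (divr_gt0 e0 c1); exists (c * C) => x y.
have := ler_wpM2l c0 (HC x y); rewrite !mulrDr => h; apply: (le_trans h).
rewrite [c * (C * _)]mulrA lerD2r lerD2l mulrA ler_pdivrMr// mulrC.
by rewrite ler_wpM2l ?(ltW e0)// lerDl.
Qed.

Lemma ucontN (f : E -> R) : ucont f -> ucont (fun x => - f x).
Proof.
move=> uf e e0; have [C HC] := uf _ e0; exists C => x y.
have := HC y x; have -> : dist2 y x = dist2 x y by apply: eq_bigr => i _; rewrite -sqN opprB.
lra.
Qed.

Let approx1 (f : E -> R) (op : R -> R) c : bmf f -> 0 <= c ->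
  (forall f' : E -> R, bmf f' -> bmf (fun x => op (f' x))) ->
  (forall f' : E -> R, ucont f' -> ucont (fun x => op (f' x))) ->
  (forall a a', `|op a - op a'| <= c * `|a - a'|) ->
  ucont_approx f -> ucont_approx (fun x => op (f x)).
Proof.
move=> bf c0 bop uop lop af e e0; have c1 : 0 < c + 1 by rewrite ltr_wpDl.
have [f' [bf' uf' df]] := af _ (divr_gt0 e0 c1).
exists (fun x => op (f' x)); split; [exact: bop|exact: uop|].
have b1 := bmf_abs (bmfB bf bf').
apply: (le_trans (dist_le _ (bmfZ c b1) (fun x => lop _ _))).
  by apply: bmf_abs; apply: bmfB; exact: bop.
rewrite !RintZ// -mulrDr; apply: (@le_trans _ _ (c * (e / (c + 1)))); first by rewrite ler_wpM2l.
by rewrite mulrA ler_pdivrMr// mulrC ler_wpM2l ?(ltW e0)// lerDl.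
Qed.

Lemma ucont_approxZ c f : 0 <= c -> bmf f -> ucont_approx f -> ucont_approx (fun x => c * f x).
Proof.
move=> c0 bf; apply: (approx1 (op := *%R c) bf c0).
- by move=> f'; exact: bmfZ.
- by move=> f'; exact: ucontZ.
- by move=> a a'; rewrite -mulrBr normrM ger0_norm.
Qed.

Lemma ucont_approxN f : bmf f -> ucont_approx f -> ucont_approx (fun x => - f x).
Proof.
move=> bf; apply: (approx1 (op := -%R) bf ler01).
- by move=> f'; exact: bmfN.
- by move=> f'; exact: ucontN.
- by move=> a a'; rewrite -opprD normrN mul1r.
Qed.

Lemma ucont_approx_cvg (f_ : nat -> E -> R) f B : bmf f -> (forall n, bmf (f_ n)) ->
  (forall n x, `|f_ n x| <= B) -> (forall n, ucont_approx (f_ n)) ->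
  (forall x, f_ n x @[n --> \oo] --> f x) -> ucont_approx f.
Proof.
move=> bf bf_ fB af cf e e0; have e4 : 0 < e / 4 by rewrite divr_gt0.
have [M M0 fM] := bmf_bound bf.
have cv (la : probability E R) : \forall n \near \oo, \int[la]_x `|f x - f_ n x| <= e / 4.
  have ba n : bmf (fun x => `|f x - f_ n x|) by apply: bmf_abs; exact: bmfB.
  have := Rint_bounded_cvg (mu := la) (f_ := fun n x => `|f x - f_ n x|) (f := fun=> 0) (B := M + B)
    (fun n => bmf_meas (ba n)) (bmf_cst 0).
  rewrite Rint_cst => H.
  suff /cvgr0Pnorm_le/(_ _ e4) : \int[la]_x `|f x - f_ n x| @[n --> \oo] --> (0 : R).
    by apply: filterS => n; exact: le_trans (ler_norm _).
  apply: H => [n x|]; first by rewrite normr_id; apply: (le_trans (ler_normB _ _)); exact: lerD.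
  apply: aeW => x; apply/cvgr0Pnorm_le => eps eps0.
  have /cvgrPdist_le/(_ _ eps0) := cf x; apply: filterS => n.
  by rewrite normr_id.
have [n [h1 h2]] : exists n, \int[mu]_x `|f x - f_ n x| <= e / 4 /\ \int[nu]_x `|f x - f_ n x| <= e / 4.
  have [n1 _ H1] := cv mu; have [n2 _ H2] := cv nu; exists (maxn n1 n2).
  by split; [apply: H1|apply: H2]; rewrite /= ?leq_maxl ?leq_maxr.
have e2 : 0 < e / 2 by rewrite divr_gt0.
have [g [bg ug dg]] := af n _ e2; exists g; split => //.
have b1 := bmf_abs (bmfB bf (bf_ n)); have b2 := bmf_abs (bmfB (bf_ n) bg).
apply: (le_trans (dist_le (bmf_abs (bmfB bf bg)) (bmfD b1 b2) _)) => [x|].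
  exact: ler_distD.
by rewrite !RintD//; move: dg; rewrite /dist; lra.
Qed.

(** These sets will form a sigma-algebra: complements and intersections come from algebraic
    operations on approximants, countable unions from bounded convergence. It contains the boxes
    with open sides, whose one-coordinate factors are increasing limits of Lipschitz functions. *)
Let good_set A := measurable A /\ ucont_approx (\1_A).

Let good_box1 (i : 'I_N) (A : set rV) : open A -> good_set [set x : E | A (tnth x i)].
Proof.
move=> oA.
have mA : measurable A by exact: sub_sigma_algebra.
have mT : measurable [set x : E | A (tnth x i)].
  rewrite -[X in measurable X]setTI; apply: (measurable_tnth i) => //.
split => //.
have bl n : bmf (fun x : E => lip_ind A n (tnth x i)).
  exact: (bmf_comp (lip_ind_bmf A n) (measurable_tnth i)).
apply: (ucont_approx_cvg (f_ := fun n x => lip_ind A n (tnth x i)) (B := 1)) => //.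
- exact: bmf_ind.
- by move=> n x; rewrite ger0_norm ?lip_ind_ge0// lip_ind_le1.
- by move=> n; apply: ucont_approx_ucont => //; exact: lip_ind_ucont.
- move=> x; apply: cvg_near_cst.
  rewrite indicE; have [xA|xA] := boolP (x \in [set x : E | A (tnth x i)]); last first.
    near=> n; apply/eqP; rewrite eq_le lip_ind_ge0 andbT.
    apply: (le_trans (lip_ind_le A n (tnth x i))); rewrite indicE.
    suff -> : (tnth x i \in A) = false by [].
    by apply/negbTE; move: xA; rewrite !notin_setE.
  have /nbhs_ballP[r /= r0 hr] : nbhs (tnth x i) A.
    by apply: open_nbhs_nbhs; split => //; move: xA; rewrite inE.
  exists (Num.truncn r^-1).+1 => // n /= rn; apply/eqP; rewrite eq_le lip_ind_le1/=.
  apply: lip_ind_ge hr _; rewrite -ler_pdivrMr// div1r; apply: (le_trans (ltW (truncnS_gt _))).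
  by rewrite ler_nat.
Unshelve. all: by end_near. Qed.

Let good_setC A : good_set A -> good_set (~` A).
Proof.
move=> [mA aA]; split; first exact: measurableC.
have bA := bmf_ind (R := R) mA.
have -> : \1_(~` A) = (fun x => 1 + - \1_A x) :> (E -> R).
  by apply/funext => x; rewrite !indicE in_setC; case: (x \in A); rewrite ?subrr ?subr0.
apply: ucont_approxD; [exact: bmf_cst|exact: bmfN| |exact: ucont_approxN].
by apply: ucont_approx_ucont; [exact: bmf_cst|exact: ucont_cst].
Qed.

Let good_setI A B : good_set A -> good_set B -> good_set (A `&` B).
Proof.
move=> [mA aA] [mB aB]; split; first exact: measurableI.
have -> : \1_(A `&` B) = (fun x => Num.min (\1_A x) (\1_B x)) :> (E -> R).
  apply/funext => x; rewrite !indicE in_setI.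
  by case: (x \in A); case: (x \in B); rewrite /= ?minxx// /Num.min ?ltr01// ltr10.
by apply: ucont_approx_min => //; exact: bmf_ind.
Qed.

Let good_setT : good_set setT.
Proof.
split => //; rewrite indicT; apply: ucont_approx_ucont; [exact: bmf_cst|exact: ucont_cst].
Qed.

Let good_bigU (A : nat -> set E) : (forall k, good_set (A k)) -> good_set (\bigcup_k A k).
Proof.
move=> gA; have gU n : good_set (\big[setU/set0]_(k < n) A k).
  elim: n => [|n IH]; first by rewrite big_ord0 -setCT; exact: good_setC.
  rewrite big_ord_recr /= -[X in good_set X]setCK setCU.
  by apply: good_setC; apply: good_setI; exact: good_setC.
have mU : measurable (\bigcup_k A k) by apply: bigcup_measurable => k _; have [] := gA k.
split => //.
apply: (ucont_approx_cvg (f_ := fun n => \1_(\big[setU/set0]_(k < n) A k)) (B := 1)).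
- exact: bmf_ind.
- by move=> n; apply: bmf_ind; have [] := gU n.
- by move=> n x; rewrite indicE; case: (_ \in _); rewrite ?normr1 ?normr0.
- by move=> n; have [] := gU n.
- move=> x; apply: cvg_near_cst; rewrite !indicE.
  have [xA|xA] := boolP (x \in \bigcup_k A k).
    move: (xA); rewrite inE => -[k _ Ak]; exists k.+1 => // n /= kn.
    rewrite indicE; suff -> : x \in \big[setU/set0]_(k < n) A k by [].
    by rewrite inE -bigcup_mkord; exists k.
  near=> n; rewrite indicE; suff -> : (x \in \big[setU/set0]_(k < n) A k) = false by [].
  apply/negbTE; rewrite notin_setE -bigcup_mkord => -[k _ Ak].
  by move: xA; rewrite notin_setE; apply; exists k.
Unshelve. all: by end_near. Qed.

Lemma ucont_approx_indic A : measurable A -> ucont_approx (\1_A).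
Proof.
have pG : pi_generates (@open rV).
  by split; [exact: openI|exact: openT|].
have [_ _ ->] := pi_generates_tuple N pG => mA.
suff : good_set A by case.
suff sub : <<s @boxes rV N open >> `<=` good_set by exact: sub.
apply: smallest_sub.
  split; first by rewrite -setCT; exact: good_setC.
    by move=> B gB; rewrite setTD; exact: good_setC.
  exact: good_bigU.
move=> _ [B oB ->].
have H (s : seq 'I_N) : good_set [set x : E | forall i, i \in s -> B i (tnth x i)].
  elim: s => [|i s IH].
    rewrite (_ : [set x | _] = setT)//; exact/seteqP.
  rewrite (_ : [set x | _] = [set x : E | B i (tnth x i)] `&`
      [set x : E | forall i, i \in s -> B i (tnth x i)]).
    by apply: good_setI => //; exact: good_box1.
  apply/seteqP; split => x /=.
    by move=> h; split => [|j js]; apply: h; rewrite in_cons ?eqxx// js orbT.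
  by move=> [h1 h2] j; rewrite in_cons => /orP[/eqP ->|/h2].
rewrite (_ : box B = [set x : E | forall i, i \in enum 'I_N -> B i (tnth x i)])//.
apply/seteqP; split => x /=; first by move=> h i _; exact: h.
by move=> h i; apply: h; rewrite mem_enum.
Qed.

(** Binary expansion of the values: subtracting half the range where [f] exceeds it halves the
    range. After [n] indicators the rest lies between 0 and [de]. *)
Let approx_dyadic (de : R) n f : 0 < de -> bmf f ->
  (forall x, 0 <= f x <= 2 ^+ n * de) ->
  exists f', [/\ bmf f', ucont_approx f' & forall x, `|f x - f' x| <= de].
Proof.
move=> de0; elim: n f => [|n IH] f bf hf.
  exists (fun=> 0); split; [exact: bmf_cst|by apply: ucont_approx_ucont; [exact: bmf_cst|exact: ucont_cst]|].
  by move=> x; have := hf x; rewrite subr0 expr0 mul1r => /andP[f0 f1]; rewrite ger0_norm.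
pose c := 2 ^+ n * de; have c0 : 0 < c by rewrite mulr_gt0// exprn_gt0.
pose A := [set x | c < f x].
have mA : measurable A.
  rewrite -[X in measurable X]setTI; apply: measurable_fun_ltr => //; exact: bmf_meas bf.
have bA := bmf_ind (R := R) mA.
have bf1 : bmf (fun x => f x - c * \1_A x) by apply: bmfB => //; exact: bmfZ.
have [|f' [bf' af' hf']] := IH _ bf1.
  move=> x; rewrite -/c indicE; have := hf x; rewrite exprS -mulrA -/c => /andP[f0 f1].
  have [xA|xA] := boolP (x \in A); move: xA.
    by rewrite inE /A /= mulr1 => cf; rewrite subr_ge0 ltW//=; lra.
  by rewrite notin_setE /A /= mulr0 subr0 => /negP; rewrite -leNgt f0.
exists (fun x => f' x + c * \1_A x); split.
- by apply: bmfD => //; exact: bmfZ.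
- apply: ucont_approxD => //; first exact: bmfZ.
  by apply: ucont_approxZ; [exact: ltW|exact: bA|exact: ucont_approx_indic].
- by move=> x; have := hf' x; rewrite opprD addrA addrAC.
Qed.

Theorem ucont_dense f : bmf f -> ucont_approx f.
Proof.
move=> bf e e0; have [B B0 fB] := bmf_bound bf.
have e4 : 0 < e / 4 by rewrite divr_gt0.
have bfB : bmf (fun x => f x + B) by apply: bmfD => //; exact: bmf_cst.
have [n hn] : exists n : nat, 2 * B <= 2 ^+ n * (e / 4).
  exists (Num.truncn (2 * B / (e / 4))).+1; rewrite -ler_pdivrMr//.
  apply: (le_trans (ltW (truncnS_gt _))); set k := _.+1.
  by rewrite -natrX ler_nat ltnW// ltn_expl.
have [|f' [bf' af' hf']] := approx_dyadic (n := n) e4 bfB.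
  move=> x; have := fB x; rewrite ler_norml => /andP[h1 h2]; apply/andP; split; first by lra.
  by apply: le_trans hn; lra.
have af2 : ucont_approx (fun x => f' x + - B).
  apply: ucont_approxD => //; first exact: bmf_cst.
  by apply: ucont_approx_ucont; [exact: bmf_cst|exact: ucont_cst].
have e2 : 0 < e / 2 by rewrite divr_gt0.
have [g [bg ug dg]] := af2 _ e2; exists g; split => //.
have b2 : bmf (fun x => `|f' x + - B - g x|).
  by apply: bmf_abs; apply: bmfB => //; apply: bmfD => //; exact: bmf_cst.
apply: (le_trans (dist_le (bmf_abs (bmfB bf bg)) (bmfD (bmf_cst (e / 4)) b2) _)) => [x|].
  apply: (le_trans (ler_distD (f' x - B) _ _)); rewrite lerD2r.
  by have := hf' x; congr (`|_| <= _); ring.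
rewrite !RintD//; [|exact: bmf_cst|exact: bmf_cst].
by rewrite !Rint_cst; move: dg; rewrite /dist; lra.
Qed.

End density.

Section entropy_ucont.
Context {R : realType} {d N : nat}.
Local Notation E := (N.-tuple 'rV[R]_d).

Lemma entropy_le_ucont (mu nu : probability E R) C :
  (forall f : E -> R, bmf f -> ucont f -> \int[mu]_x f x <= ln (\int[nu]_x expR (f x)) + C) ->
  (rel_entropy mu nu <= C%:E)%E.
Proof.
move=> H; apply: entropy_le => f bf; have [B B0 fB] := bmf_bound bf.
have be := bmf_expR bf; set I := \int[nu]_x expR (f x).
have I0 : 0 < I by exact: Rint_expR_gt0.
(* An error in mean costs a factor 1 on the [mu] side and [expR B / I] through the logarithm on the
   [nu] side. *)
pose c := 1 + expR B / I.
have c0 : 0 < c by rewrite ltr_pwDl// divr_ge0 ?expR_ge0// ltW.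
apply/ler_addgt0Pr => e e0; have [g0 [bg0 ug0 dg0]] := ucont_dense mu nu bf (divr_gt0 e0 c0).
(* Clipping to [-B, B] brings the approximant no farther from [f] and bounds its exponential by
   [expR B]. *)
pose g x := Num.min B (- Num.min B (- g0 x)).
have bg : bmf g.
  by apply: bmf_min; [exact: bmf_cst|apply: bmfN; apply: bmf_min; [exact: bmf_cst|exact: bmfN]].
have ug : ucont g.
  apply: ucont_min; first exact: ucont_cst.
  by apply: ucontN; apply: ucont_min; [exact: ucont_cst|exact: ucontN].
have gP x : g x <= B /\ `|f x - g x| <= `|f x - g0 x|.
  have := fB x; rewrite ler_norml => /andP[h1 h2].
  have [a1 a2] : f x - g0 x <= `|f x - g0 x| /\ g0 x - f x <= `|f x - g0 x|.
    by split; [exact: ler_norm|rewrite distrC; exact: ler_norm].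
  have a3 := normr_ge0 (f x - g0 x).
  rewrite /g /Num.min; case: (ltrP B (- g0 x)) => h3; case: ltrP => h4; rewrite ler_norml; split; lra.
have babs (k : E -> R) : bmf k -> bmf (fun x => `|k x|).
  move=> [mk [K kK]]; split; first exact: measurableT_comp.
  by exists K => x; rewrite normr_id.
have bd := babs _ (bmfB bf bg0).
set dmu := \int[mu]_x `|f x - g0 x| in dg0; set dnu := \int[nu]_x `|f x - g0 x| in dg0.
have dmu0 : 0 <= dmu by apply: Rint_ge0b.
have dnu0 : 0 <= dnu by apply: Rint_ge0b.
have h1 : \int[mu]_x f x <= \int[mu]_x g x + dmu.
  rewrite -RintD//; apply: Rint_le => //; first exact: bmfD.
  by move=> x; have [_ /le_trans] := gP x => /(_ _ (lexx _)); have := ler_norm (f x - g x); lra.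
have h2 : \int[nu]_x expR (g x) <= I + expR B * dnu.
  rewrite /I /dnu -RintZ// -RintD//; last exact: bmfZ.
  apply: Rint_le; [exact: bmf_expR|by apply: bmfD => //; exact: bmfZ|move=> x].
  have [gB fg] := gP x.
  have E1 : expR (g x) - expR (f x) <= expR (g x) * (g x - f x).
    have -> : expR (f x) = expR (g x) * expR (f x - g x).
      by rewrite -expRD; congr expR; ring.
    have := ler_wpM2l (expR_ge0 (g x)) (expR_ge1Dx (f x - g x)); lra.
  have E2 : expR (g x) * (g x - f x) <= expR B * `|f x - g0 x|.
    apply: (@le_trans _ _ (expR (g x) * `|f x - g0 x|)).
      apply: ler_wpM2l; first exact: expR_ge0.
      by apply: le_trans fg; rewrite distrC; exact: ler_norm.
    by rewrite ler_wpM2r// ler_expR.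
  lra.
have h3 : ln (\int[nu]_x expR (g x)) <= ln I + expR B / I * dnu.
  have Ig : 0 < \int[nu]_x expR (g x) by exact: Rint_expR_gt0.
  apply: (@le_trans _ _ (ln (I * expR (expR B / I * dnu)))); last first.
    by rewrite lnM ?posrE ?expR_gt0// expRK.
  rewrite ler_ln ?posrE ?mulr_gt0 ?expR_gt0//; apply: (le_trans h2).
  have -> : I + expR B * dnu = I * (1 + expR B / I * dnu).
    by field; rewrite gt_eqF.
  by rewrite ler_wpM2l ?(ltW I0)// expR_ge1Dx.
have h4 := H _ bg ug.
have h5 : dmu + expR B / I * dnu <= e.
  have q0 : 0 <= expR B / I by rewrite divr_ge0 ?expR_ge0// ltW.
  apply: (@le_trans _ _ (c * (dmu + dnu))).
    rewrite /c mulrDl mul1r mulrDr -addrA lerD2l addrA lerDr.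
    by rewrite addr_ge0// mulr_ge0.
  by rewrite mulrC -ler_pdivlMr.
apply: (le_trans h1); apply: (@le_trans _ _ (ln I + expR B / I * dnu + C + dmu)).
  by rewrite lerD2r (le_trans h4)// lerD2r.
by rewrite -!addrA lerD2l addrCA lerD2l addrC.
Qed.

End entropy_ucont.

(** * The entropy bound *)

Section transport_entropy.
Context {R : realType} {d : nat}.
Variables (nu : probability 'rV[R]_d R) (k : R).
Hypotheses (k0 : 0 < k) (T2 : T2dual nu k).

(** Scaling by [r = (2 * a)^-1] turns the cost into the one of [T2dual_tensor]; the resulting
    exponential bound is inserted in [entropy_ge]. This is where an initial squared distance is
    converted into initial entropy. *)
Lemma transport_entropy N (U g : N.-tuple 'rV[R]_d -> R) a
    (mu : probability (N.-tuple 'rV[R]_d) R) e :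
  bmf U -> bmf g -> ucont g -> 0 < a -> (forall x y, U x <= g y + a * dist2 x y) ->
  rel_entropy mu (prod_power nu N) = e%:E ->
  \int[mu]_x U x <= 2 * a / k * e + \int[prod_power nu N]_x g x.
Proof.
move=> bU bg ug a0 Ug He; pose r := (2 * a)^-1.
have r0 : 0 < r by rewrite invr_gt0 mulr_gt0.
have ra : r * a = 2^-1 by rewrite /r invfM -mulrA mulVf ?mulr1// gt_eqF.
have bU' : bmf (fun x => r * U x) by exact: bmfZ.
have bg' : bmf (fun x => r * g x) by exact: bmfZ.
have h1 := T2dual_tensor k0 T2 bU' bg' (ucontZ (ltW r0) ug).
have {}h1 : \int[prod_power nu N]_x expR (k * (r * U x)) <=
    expR (k * \int[prod_power nu N]_x (r * g x)).
  apply: h1 => x y; have := ler_wpM2l (ltW r0) (Ug x y); rewrite mulrDr mulrA ra.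
  by rewrite [2^-1 * _]mulrC.
have bkU : bmf (fun x => k * (r * U x)) by exact: bmfZ.
have := entropy_ge mu (prod_power nu N) bkU; rewrite He lee_fin RintZ// RintZ//.
have h2 : ln (\int[prod_power nu N]_x expR (k * (r * U x))) <=
    k * (r * \int[prod_power nu N]_x g x).
  rewrite -[X in _ <= X]expRK ler_ln ?posrE ?expR_gt0 ?Rint_expR_gt0//.
  by rewrite -(RintZ _ _ bg).
move: (\int[mu]_x U x) (\int[prod_power nu N]_x g x) (ln _) h2 => I1 I2 l h2 h3.
have h4 : k * r * (I1 - I2) <= e by lra.
have kr : 0 < k * r by exact: mulr_gt0.
rewrite -lerBlDr; have -> : 2 * a / k = (k * r)^-1.
  by rewrite /r; field; rewrite !gt_eqF.
by rewrite mulrC ler_pdivlMr// mulrC.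
Qed.

End transport_entropy.

Section one_scale.
Context {R : realType} {d N : nat}.
Local Notation rV := 'rV[R]_d.
Local Notation E := (N.-tuple rV).
Variables (gW J : rV -> rV) (L lamV lamW h th C1 q2 k : R).
Hypotheses (h0 : 0 < h) (L0 : 0 <= L) (lamV0 : 0 <= lamV).
Hypothesis cW : continuous gW.
Hypothesis lipW : forall x y, sq (gW x - gW y) <= L * sq (x - y).
Hypothesis J_contract : forall u v,
  (1 + 2 * h * lamV) * sq (J u - J v) <= sq (u - v).
Hypothesis mJ : measurable_fun setT J.
Hypotheses (th0 : 0 <= th) (th1 : th < 1) (C10 : 0 <= C1) (q20 : 0 < q2).
Hypothesis sync : forall (x y : E) K z,
  dist2 (step gW J h x z) (bstep J h K y z) <= th * dist2 x y + C1 * h * fluct gW K y.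
Hypothesis syncN : forall (x y : E) z,
  dist2 (step gW J h x z) (step gW J h y z) <= q2 * dist2 x y.
Variables (Ks : nat -> rV -> rV) (nus : nat -> probability rV R).
Hypothesis Kok : forall n, field_ok L lamW (Ks n).
Hypothesis nus_next : forall n, next_law J h (Ks n) (nus n) (nus n.+1).
Hypotheses (k0 : 0 < k) (T2 : T2dual (nus 0%N) k).
Variables (mu0 : probability E R) (e : R).
Hypothesis Ent : rel_entropy mu0 (prod_power (nus 0%N) N) = e%:E.
Variable phi : E -> R.
Hypotheses (bphi : bmf phi) (uphi : ucont phi).

Local Notation lnU n := (fun y : E => ln (Ubar J h (field_seq Ks 0 n) (fun x => expR (phi x)) y)).

Let phi_bound : exists2 B, 0 < B & forall x, `|phi x| <= B. Proof. exact: bmf_bound. Qed.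

Let fok a n : oks L lamW (field_seq Ks a n). Proof. exact: field_seq_ok. Qed.

Let cb0 : 0 <= cb L. Proof. by rewrite mulr_ge0. Qed.

Let cal0 : 0 < cal L.
Proof. by rewrite /cal mulr_gt0// ltr_pwDl// mulr_gt0// /cA ltr_pwDl// mulr_ge0. Qed.

Let bmf_lnU n : bmf (lnU n).
Proof.
have [B B0 pB] := phi_bound.
exact: (bmf_lnUbar h0 lamV0 J_contract mJ bphi pB (@fok 0 n)).
Qed.

Let bmf_U n : bmf (Ubar J h (field_seq Ks 0 n) (fun x => expR (phi x))).
Proof.
have [B B0 pB] := phi_bound.
by have [] := Ubar_ok h0 lamV0 J_contract mJ bphi pB (@fok 0 n).
Qed.

Let expR_lnU n : (fun y => expR (lnU n y)) = Ubar J h (field_seq Ks 0 n) (fun x => expR (phi x)).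
Proof.
apply/funext => y; rewrite lnK// posrE; have [B B0 pB] := phi_bound.
have [_ + _] := Ubar_ok h0 lamV0 J_contract mJ bphi pB (@fok 0 n) => /(_ y).
exact: lt_le_trans (expR_gt0 _).
Qed.

Let Rint_U n : \int[prod_power (nus 0%N) N]_y Ubar J h (field_seq Ks 0 n) (fun x => expR (phi x)) y =
  \int[prod_power (nus n) N]_y expR (phi y).
Proof. exact: (Rint_Ubar mJ Kok nus_next 0 n (bmf_expR bphi)). Qed.

Let S2_mean B a r c : 0 < B -> r%:R * h <= 1 -> 0 <= c ->
  (forall i, (i < r)%N -> (\int[prod_power (nus (a + i)%N) N]_y
    (fluct gW (Ks (a + i)%N) y)%:E <= c%:E)%E) ->
  \int[prod_power (nus a) N]_y S2 gW J L h C1 B (field_seq Ks a r) y <= cC L C1 * c.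
Proof.
move=> B0 rh c0 hc.
have cc := cC_ge0 L0 C10.
have S := Rint_Sacc h0 L0 lamV0 cW lipW J_contract mJ Kok nus_next (a := a) (n := r) (B := B)
  (w := fun=> cC L C1 * h) (S0 := fun=> 0) (c := c) (c0 := 0) B0 _ (bmf_cst 0) _ (ucont_cst 0) hc _.
apply: (le_trans (S _ _ _)) => //; first by move=> _; rewrite mulr_ge0// ltW.
  by rewrite Rint_cst.
rewrite addr0 sumr_const card_ord -[_ *+ r]mulr_natl ler_wpM2r//.
by move: (ler_wpM2l cc rh); clear S; lra.
Qed.

(** Over a short time the meeting cost would blow up, so no meeting is attempted: [harnack_meet] is
    used with [y = x], and the resulting term [lnU r] is integrated against [mu0] by a second use of
    the entropy inequality. Hence the extra 1 in front of [e]. *)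
Lemma short_time_bound r c : r%:R * h <= 1 -> 0 <= c ->
  (forall i, (i < r)%N -> (\int[prod_power (nus i) N]_y (fluct gW (Ks i) y)%:E <= c%:E)%E) ->
  \int[mu0]_x iter r (Top gW J h) phi x <=
    (1 + 2 * (cb L + 1) / k) * e + ln (\int[prod_power (nus r) N]_y expR (phi y)) + cC L C1 * c.
Proof.
move=> rh c0 hc; have [B B0 pB] := phi_bound.
have ok := @fok 0 r; have sz := size_field_seq Ks 0 r.
have [bi _] := iter_Top_ok h cW mJ bphi pB r.
have [bS S0 uS] := S2_ok (N := N) h0 L0 lamV0 cW lipW J_contract mJ C10 B0 ok.
set S := S2 _ _ _ _ _ _ _ in bS S0 uS.
pose U x := iter r (Top gW J h) phi x - lnU r x.
have bU : bmf U by exact: bmfB.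
have cb1 : 0 < cb L + 1 by rewrite ltr_wpDl.
have US x y : U x <= S y + (cb L + 1) * dist2 x y.
  have := harnack_meet h0 L0 lamV0 cW lipW J_contract mJ (ltW th1) C10 sync bphi B0 pB
    (x := x) (y := x) y ok; rewrite sz => /(_ rh (fun=> erefl)).
  rewrite dist2xx mulr0 addr0 /U => H.
  have D := dist2_ge0 x y.
  have : cb L * (r%:R * h) * dist2 x y <= cb L * dist2 x y.
    by rewrite ler_wpM2r// -[X in _ <= X]mulr1 ler_wpM2l.
  by rewrite -/S in H; lra.
have h1 := transport_entropy k0 T2 bU bS uS cb1 US Ent.
have h2 := @S2_mean B 0 r c B0 rh c0 hc.
have h3 := entropy_ge mu0 (prod_power (nus 0%N) N) (bmf_lnU r).
rewrite Ent expR_lnU Rint_U lee_fin in h3.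
move: h1; rewrite RintB//; rewrite -/S in h2; lra.
Qed.

(** [r] steps of meeting, lasting between 1/2 and 1, preceded by [j] synchronous ones. The weights
    [th ^+ i] sum to at most [1 / (1 - th)], which keeps the accumulated fluctuations bounded in
    time. *)
Lemma long_time_bound j r c : r%:R * h <= 1 -> 1 <= 2 * (r%:R * h) -> 0 <= c ->
  (forall i, (i < j + r)%N -> (\int[prod_power (nus i) N]_y (fluct gW (Ks i) y)%:E <= c%:E)%E) ->
  \int[mu0]_x iter (j + r) (Top gW J h) phi x <=
    2 * (cal L * q2 ^+ j) / k * e + ln (\int[prod_power (nus (j + r)%N) N]_y expR (phi y)) +
    (cal L * C1 * h / (1 - th) + cC L C1) * c.
Proof.
move=> rh rh2 c0 hc; have [B B0 pB] := phi_bound.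
have ok1 := @fok 0 j; have ok2 := @fok j r.
have sz1 := size_field_seq Ks 0 j; have sz2 := size_field_seq Ks j r.
have [bi _] := iter_Top_ok h cW mJ bphi pB (j + r).
have [bS2 S20 uS2] := S2_ok (N := N) h0 L0 lamV0 cW lipW J_contract mJ C10 B0 ok2.
have [bS S0 uS] := S1_ok (N := N) h0 L0 lamV0 cW lipW J_contract mJ th0 C10 B0 ok1 ok2.
set S := S1 _ _ _ _ _ _ _ _ _ in bS S0 uS.
have catE : field_seq Ks 0 j ++ field_seq Ks j r = field_seq Ks 0 (j + r) by rewrite field_seq_cat.
have ul : ucont (lnU (j + r)).
  exact: (ucont_lnUbar h0 lamV0 J_contract mJ bphi pB (@fok 0 (j + r)%N) uphi).
have bg : bmf (fun y => lnU (j + r) y + S y) by exact: bmfD.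
have ug : ucont (fun y => lnU (j + r) y + S y) by exact: ucontD.
have a0 : 0 < cal L * q2 ^+ j by rewrite mulr_gt0// exprn_gt0.
have US x y : iter (j + r) (Top gW J h) phi x <= lnU (j + r) y + S y + cal L * q2 ^+ j * dist2 x y.
  have := harnack h0 L0 lamV0 cW lipW J_contract mJ th0 (ltW th1) C10 (ltW q20) sync syncN
    bphi B0 pB x y y ok1 ok2; rewrite sz2 => /(_ rh rh2).
  by rewrite catE size_field_seq sz1 dist2xx mulr0 addr0 -/S; lra.
have h1 := transport_entropy k0 T2 bi bg ug a0 US Ent.
have h2 := ln_jensen (prod_power (nus 0%N) N) (bmf_lnU (j + r)).
rewrite expR_lnU Rint_U in h2.
have h3 : \int[prod_power (nus 0%N) N]_y S y <= (cal L * C1 * h / (1 - th) + cC L C1) * c.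
  have hc2 i : (i < r)%N -> (\int[prod_power (nus (j + i)%N) N]_y
      (fluct gW (Ks (j + i)%N) y)%:E <= c%:E)%E.
    by move=> ir; apply: hc; rewrite ltn_add2l.
  have c10 : 0 <= cal L * C1 * h by rewrite mulr_ge0 ?(ltW h0)// mulr_ge0// ltW.
  have HS := Rint_Sacc h0 L0 lamV0 cW lipW J_contract mJ Kok nus_next (a := 0%N) (n := j) (B := B)
    (w := fun i => cal L * C1 * h * th ^+ i) B0 _ bS2 S20 uS2 (c := c) _ (S2_mean B0 rh c0 hc2).
  apply: (le_trans (HS _ _)).
  - by move=> i; rewrite mulr_ge0// exprn_ge0.
  - by move=> i ij; apply: hc; exact: ltn_addr.
  have G : \sum_(i < j) th ^+ i <= 1 / (1 - th).
    rewrite ler_pdivlMr ?subr_gt0// mulrC.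
    have -> : (1 - th) * \sum_(i < j) th ^+ i = 1 - th ^+ j.
      by rewrite -[1 in RHS](expr1n _ j) subrXX; congr (_ * _);
        apply: eq_bigr => i _; rewrite expr1n mul1r.
    by rewrite lerBlDr lerDl exprn_ge0.
  rewrite -mulr_sumr [X in _ <= X]mulrDl lerD2r ler_wpM2r//.
  have := ler_wpM2l c10 G; lra.
move: h1; rewrite RintD//; lra.
Qed.

End one_scale.

Section scale.
Context {R : realType} {d : nat}.
Local Notation rV := 'rV[R]_d.
Variables (gW J : rV -> rV) (L lamV lamW h : R).
Hypotheses (h0 : 0 < h) (h1 : h <= 1) (L0 : 0 <= L) (lamV0 : 0 <= lamV).
Hypothesis oddW : forall x, gW (- x) = - gW x.
Hypothesis lipW : forall x y, sq (gW x - gW y) <= L * sq (x - y).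
Hypothesis monW : forall x y, lamW * sq (x - y) <= dotv (gW x - gW y) (x - y).
Hypothesis J_contract : forall u v,
  (1 + 2 * h * lamV) * sq (J u - J v) <= sq (u - v).

Local Notation lamM := (Num.min lamW 0).
Local Notation kap := (lamV + lamM).
Hypothesis kap0 : 0 < kap.
Hypothesis h_small : h * (4 * L + kap * - lamM + 2 * kap * L + kap * lamV) <= kap.

Let lamM0 : lamM <= 0. Proof. by rewrite ge_min lexx orbT. Qed.

Let rho1 : 1 <= 1 + 2 * h * lamV. Proof. by rewrite lerDl !mulr_ge0// ltW. Qed.

Let rho0 : 0 < 1 + 2 * h * lamV. Proof. exact: lt_le_trans rho1. Qed.

(** To first order the step gains [2 * kap * h]. Young's inequality spends a quarter of this and a
    quarter is kept as the rate of [th]; the remaining half absorbs the second-order terms, which is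
    the content of [h_small]. *)
Lemma scale_contract : (1 + kap * h / 2) * (1 - 2 * h * lamM + 4 * h ^+ 2 * L) <=
  (1 - kap * h / 2) * (1 + 2 * h * lamV).
Proof.
move: h_small lamM0 kap0 (lexx kap); set m := lamM; set k := lamV + m.
move=> hs m0 k0 _; have ek : lamV = k - m by rewrite /k; ring.
have f1 : 0 <= h * (k - h * (4 * L + k * - m + 2 * k * L + k * lamV)).
  by rewrite mulr_ge0 ?(ltW h0)// subr_ge0.
have f2 : 0 <= h ^+ 2 * (1 - h) * (2 * k * L).
  by rewrite mulr_ge0// ?mulr_ge0 ?sqr_ge0 ?subr_ge0// ltW.
rewrite -subr_ge0; apply: (le_trans (addr_ge0 f1 f2)).
rewrite le_eqVlt; apply/orP; left; apply/eqP; by rewrite ek; field.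
Qed.

Lemma scale_twocopy : 1 - 2 * h * lamW + h ^+ 2 * L <= (1 - kap * h / 2) * (1 + 2 * h * lamV).
Proof.
apply: le_trans scale_contract.
have mW : lamM <= lamW by rewrite ge_min lexx.
have hm : 2 * h * lamM <= 2 * h * lamW by rewrite ler_wpM2l// mulr_ge0// ltW.
have hM : h * lamM <= 0 by rewrite mulr_ge0_le0// ltW.
have hL : 0 <= h ^+ 2 * L by rewrite mulr_ge0// sqr_ge0.
have kh : 0 <= kap * h / 2 by rewrite divr_ge0// mulr_ge0// ltW.
have X0 : 0 <= 1 - 2 * h * lamM + 4 * h ^+ 2 * L by lra.
apply: (@le_trans _ _ (1 - 2 * h * lamM + 4 * h ^+ 2 * L)); first lra.
by rewrite -[X in X <= _]mul1r ler_wpM2r// lerDl.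
Qed.

(** Young's weight is [kap * h / 2]; its inverse times [h ^+ 2] is of order [h], which produces
    [C1 = 1 + 2 / kap]. *)
Lemma scale_sync N (x y : N.-tuple rV) K z :
  dist2 (step gW J h x z) (bstep J h K y z) <=
  (1 - kap * h / 2) * dist2 x y + (1 + 2 / kap) * h * fluct gW K y.
Proof.
have e0 : 0 < kap * h / 2 by rewrite divr_gt0// mulr_gt0.
have := step_bstep_sync h0 L0 oddW lipW monW J_contract x y K z e0.
have D := dist2_ge0 x y; have F := fluct_ge0 gW K y.
have := ler_wpM2r D scale_contract => c1 c2.
have c3 : (1 + (kap * h / 2)^-1) * h ^+ 2 <= (1 + 2 / kap) * h.
  have -> : (1 + (kap * h / 2)^-1) * h ^+ 2 = h * h + 2 / kap * h.
    by field; rewrite !gt_eqF.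
  by rewrite [X in _ <= X]mulrDl lerD2r ler_wpM2r// ltW.
rewrite -(ler_pM2l rho0); apply: (le_trans c2).
have c4 : (1 + (kap * h / 2)^-1) * h ^+ 2 * fluct gW K y <= (1 + 2 / kap) * h * fluct gW K y.
  exact: ler_wpM2r.
have F2 : 0 <= (1 + 2 / kap) * h * fluct gW K y.
  by rewrite !mulr_ge0 ?addr_ge0 ?divr_ge0// ltW.
have c5 : (1 + 2 / kap) * h * fluct gW K y <= (1 + 2 * h * lamV) * ((1 + 2 / kap) * h * fluct gW K y).
  by rewrite -[X in X <= _]mul1r ler_wpM2r.
apply: (@le_trans _ _ ((1 - kap * h / 2) * (1 + 2 * h * lamV) * dist2 x y +
    (1 + 2 * h * lamV) * ((1 + 2 / kap) * h * fluct gW K y))).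
  by apply: lerD => //; exact: le_trans c4 c5.
by rewrite le_eqVlt; apply/orP; left; apply/eqP; ring.
Qed.

(** Two particle systems have no fluctuation to absorb, so the full rate [2 * kap] remains, up to a
    second-order term whose sum over the steps is of order [t * h]. *)
Lemma scale_syncN N (x y : N.-tuple rV) z :
  dist2 (step gW J h x z) (step gW J h y z) <=
  expR (- 2 * kap * h + (4 * L + 4 * lamV * kap) * h ^+ 2) * dist2 x y.
Proof.
have D := dist2_ge0 x y.
have c1 := step_sync h0 L0 oddW lipW monW J_contract x y z.
rewrite -(ler_pM2l rho0); apply: (le_trans c1); rewrite [X in _ <= X]mulrA; apply: ler_wpM2r => //.
apply: (@le_trans _ _ ((1 + 2 * h * lamV) * (1 + (- 2 * kap * h + (4 * L + 4 * lamV * kap) * h ^+ 2)))).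
  have f : 0 <= 2 * h ^+ 3 * (4 * L + 4 * lamV * kap) * lamV.
    rewrite mulr_ge0// mulr_ge0//; first by rewrite mulr_ge0// exprn_ge0// ltW.
    by apply: addr_ge0; rewrite mulr_ge0 ?mulr_ge0// ltW.
  rewrite -subr_ge0; apply: (le_trans f).
  by rewrite le_eqVlt; apply/orP; left; apply/eqP; ring.
by rewrite ler_wpM2l ?(ltW rho0)// expR_ge1Dx.
Qed.

End scale.

Lemma mesh_small (R : realType) (t c e : R) : 0 < t -> 0 < e ->
  \forall n \near \oo, mesh t n.+1 * c <= e.
Proof.
move=> t0 e0; exists (Num.truncn (t * `|c| / e)).+1 => // n /= hn.
rewrite /mesh mulrAC ler_pdivrMr//; apply: (@le_trans _ _ (t * `|c|)).
  by rewrite ler_wpM2l ?(ltW t0)// ler_norm.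
rewrite [X in _ <= X]mulrC -ler_pdivrMr//; apply: (le_trans (ltW (truncnS_gt _))).
by rewrite ler_nat ltnW.
Qed.

Lemma twocopy_le (R : realType) d (nu : probability 'rV[R]_d R) K :
  (\int[nu]_x (sq x)%:E <= K%:E)%E -> (twocopy nu <= (4 * K)%:E)%E.
Proof.
move=> hK; have nq : nnm (fun x : 'rV[R]_d => sq x) by exact: nnm_sq.
have two : 0 <= 2 :> R by [].
have K0 : 0 <= K by rewrite -lee_fin; apply: (le_trans _ hK); exact: nnI_ge0.
have inner (x : 'rV[R]_d) : (\int[nu]_y (sq (x - y))%:E <= (2 * sq x + 2 * K)%:E)%E.
  have nc : nnm (fun _ : 'rV[R]_d => 2 * sq x) by apply: nnm_cst; rewrite mulr_ge0// sq_ge0.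
  apply: (@le_trans _ _ (\int[nu]_y (2 * sq x + 2 * sq y)%:E)%E).
    apply: nnI_le => [||y]; last exact: sqB_le.
    - by apply: nnm_sq; exact: measurable_rVB.
    - by apply: nnmD => //; exact: nnmZ.
  rewrite (nnID nu nc (nnmZ two nq)) nnIcst (nnIZ nu two nq) (EFinD (2 * sq x)); apply: leeD2l.
  by rewrite (EFinM 2 K); apply: lee_wpmul2l.
have nK : nnm (fun _ : 'rV[R]_d => 2 * K) by apply: nnm_cst; rewrite mulr_ge0.
apply: (@le_trans _ _ (\int[nu]_x (2 * sq x + 2 * K)%:E)%E).
  apply: ge0_le_integral => //.
  - by move=> x _; apply: integral_ge0 => y _; rewrite lee_fin sq_ge0.
  - by apply: (nnm_inner nu (f := fun p : 'rV[R]_d * 'rV[R]_d => sq (p.1 - p.2))); apply: nnm_sqB2.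
  - by apply: nnm_EFin; apply: nnmD => //; exact: nnmZ.
rewrite (nnID nu (nnmZ two nq) nK) nnIcst (nnIZ nu two nq).
apply: (@le_trans _ _ (2%:E * K%:E + (2 * K)%:E)%E); first by apply: leeD2r; exact: lee_wpmul2l.
by rewrite -EFinM -EFinD lee_fin; lra.
Qed.

Section flow_bound.
Context {R : realType} {d : nat}.
Local Notation rV := 'rV[R]_d.
Variables (V W : rV -> R) (lamV lamW l Kv : R) (p : nat) (u0 : probability rV R) (k K0 : R).
Hypotheses (sV : smooth V) (lamV0 : 0 <= lamV) (l0 : 0 <= l).
Hypothesis monV : forall x y,
  lamV * sq (x - y) <= dotv (grad V x - grad V y) (x - y).
Hypothesis cW : continuous (grad W).
Hypothesis oddW : forall x, grad W (- x) = - grad W x.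
Hypothesis lipW : forall x y, enorm (grad W x - grad W y) <= l * enorm (x - y).
Hypothesis monW : forall x y,
  lamW * sq (x - y) <= dotv (grad W x - grad W y) (x - y).
Hypothesis growV : forall x, enorm (grad V x) <= Kv * (1 + enorm x ^+ p).
Hypotheses (k0 : 0 < k) (T2 : T2dual u0 k).
Hypothesis u0_moment : (\int[u0]_x (sq x)%:E <= K0%:E)%E.
Local Notation kap := (lamV + Num.min lamW 0).
Hypothesis kap0 : 0 < kap.

Local Notation L := (l ^+ 2).
Let L0 : 0 <= L. Proof. exact: sqr_ge0. Qed.
Let lipW2 := lipW_sq l0 lipW.

(** [4 * K0] bounds the initial [twocopy], and [128 * d%:R / kap] is the fixed point of the
    recursion D -> th D + 64 d h. The final 2 is [2 * b * N] for a bias [b] of 1/N. *)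
Definition fluct_bound : R := 4 * L * (4 * K0 + 128 * d%:R / kap) + 2.
(** With [1 - th = kap * h / 2], the geometric series of the synchronous phase becomes the first
    summand; the second is the weight of the meeting phase. *)
Definition chaos_const : R :=
  (2 * cal L * (1 + 2 / kap) / kap + cC L (1 + 2 / kap)) * fluct_bound.
(** First summand, for long times: [2 * kap] repays the last unit of time, without contraction, and
    1 the second-order errors. Second summand, for times below 1: its exponential compensates the
    decay factor. *)
Definition decay_const : R :=
  2 * cal L / k * expR (2 * kap + 1) + (1 + 2 * (cb L + 1) / k) * expR (2 * kap).

Let K00 : 0 <= K0.
Proof. by rewrite -lee_fin; apply: (le_trans _ u0_moment); apply: nnI_ge0; exact: nnm_sq. Qed.

Let cb0 : 0 <= cb L. Proof. by rewrite mulr_ge0. Qed.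

Let cal0 : 0 < cal L.
Proof. by rewrite /cal mulr_gt0// ltr_pwDl// mulr_gt0// /cA ltr_pwDl// mulr_ge0. Qed.

Let D0 : 0 <= 4 * K0 + 128 * d%:R / kap.
Proof.
by apply: addr_ge0; [rewrite mulr_ge0|apply: divr_ge0; [rewrite mulr_ge0|exact: ltW]].
Qed.

Let cF0 : 0 <= fluct_bound.
Proof.
by apply: addr_ge0 => //; apply: mulr_ge0 => //; rewrite mulr_ge0.
Qed.

Let C10 : 0 <= 1 + 2 / kap. Proof. by apply: addr_ge0 => //; apply: divr_ge0 => //; exact: ltW. Qed.

Lemma chaos_const_ge0 : 0 <= chaos_const.
Proof.
rewrite /chaos_const mulr_ge0//; apply: addr_ge0; last exact: (cC_ge0 L0 C10).
by rewrite divr_ge0 ?(ltW kap0)// mulr_ge0// mulr_ge0// ltW.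
Qed.

Lemma decay_const_ge1 : 1 <= decay_const.
Proof.
have h1 : 0 <= 2 * cal L / k * expR (2 * kap + 1).
  apply: mulr_ge0 (expR_ge0 _); apply: divr_ge0 (ltW k0).
  by rewrite mulr_ge0// ltW.
have h2 : 1 <= expR (2 * kap) by rewrite -expR0 ler_expR mulr_ge0// ltW.
have h3 : 1 <= 1 + 2 * (cb L + 1) / k.
  by rewrite lerDl divr_ge0 ?(ltW k0)// mulr_ge0// addr_ge0.
have h4 : 1 * 1 <= (1 + 2 * (cb L + 1) / k) * expR (2 * kap) by apply: ler_pM.
by rewrite /decay_const; lra.
Qed.

Variables (u : R -> probability rV R) (N : nat).
Local Notation E := (N.-tuple rV).
Variables (mu0 mut : probability E R) (t e : R).
Hypotheses (N0 : (0 < N)%N) (t0 : 0 < t).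
Hypothesis Ent : rel_entropy mu0 (prod_power u0 N) = e%:E.

Hypothesis HM : exists (dO : measure_display) (Omega : measurableType dO)
    (P : probability Omega R) (B X : R -> Omega -> rV),
    mckean_vlasov P V W u B X /\ has_law P (X 0) u0.
Hypothesis HPs : exists (dO : measure_display) (Omega : measurableType dO)
    (P : probability Omega R) (B X : 'I_N -> R -> Omega -> rV),
    [/\ particle_system P V W B X, has_law P (configuration X 0) mu0 &
        has_law P (configuration X t) mut].

Let e0 : 0 <= e.
Proof.
have := entropy_ge mu0 (prod_power u0 N) (bmf_cst 0); rewrite Ent lee_fin Rint_cst.
by rewrite (_ : (fun=> expR 0) = fun=> 1) ?Rint_cst ?ln1 ?subrr//; apply/funext => x; rewrite expR0.
Qed.

(** With [t], [N] and [f] fixed, the step is taken so small that every smallness condition holds at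
    once; the constants depend on none of these, and the slack [e1] is arbitrary. *)
Lemma flow_bound f : bmf f -> ucont f -> \int[mut]_x f x <=
  ln (\int[prod_power (u t) N]_x expR (f x)) + (decay_const * expR (- 2 * kap * t) * e + chaos_const).
Proof.
move=> bf uf; have [dO [Om [P [B [X [HMV hX0]]]]]] := HM.
have [dO' [Om' [P' [B' [X' [HP hmu0 hmut]]]]]] := HPs.
have X0m : (\int[P]_w (sq (X 0 w))%:E <= K0%:E)%E.
  rewrite -(has_law_integral hX0 (f := fun x => (sq x)%:E)) //.
    by apply: nnm_EFin; exact: nnm_sq.
  by move=> x; rewrite lee_fin sq_ge0.
have [nus [nus0 nusS nusb nusc]] := mckean_scheme HMV sV lamV0 l0 monV cW oddW lipW monW growV hX0 X0m t0.
pose I := \int[prod_power (u t) N]_x expR (f x).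
have I0 : 0 < I by apply: Rint_expR_gt0.
have bef := bmf_expR bf; have uef := ucont_expR bf uf.
apply/ler_addgt0Pr => e1 e10; have e2 : 0 < e1 / 2 by rewrite divr_gt0.
have N1 := particle_scheme_limit HP sV lamV0 L0 monV cW lipW2 t0 hmu0 hmut bf uf e2.
have N2 := nusc N _ _ bef uef (mulr_gt0 I0 e2).
(* The bias is required to be at most 1/N, so that its total over the particles is at most 2. *)
have iN : 0 < N%:R^-1 :> R by rewrite invr_gt0 ltr0n.
have N3 := nusb _ iN.
have half : 0 < 2^-1 :> R by rewrite invr_gt0.
have N4 := mesh_small 1 t0 half.
have N5 := mesh_small (4 * L + kap * - Num.min lamW 0 + 2 * kap * L + kap * lamV) t0 kap0.
have N6 := mesh_small kap t0 ltr01.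
have N7 := mesh_small ((4 * L + 4 * lamV * kap) * t) t0 ltr01.
near \oo => n.
have h1 : \int[mut]_x f x <= \int[mu0]_x iter n.+1 (Top (grad W) (resolvent V (mesh t n.+1)) (mesh t n.+1)) f x + e1 / 2.
  by near: n; exact: N1.
have h2 : \int[prod_power (nus n n.+1) N]_x expR (f x) <= I + I * (e1 / 2).
  by near: n; exact: N2.
have h3 : forall i, (i <= n.+1)%N -> forall x,
    sq (selfconv (grad W) (nus n i) x - conv_grad W (u (grid t n.+1 i)) x) <= N%:R^-1.
  by near: n; exact: N3.
have h4 : mesh t n.+1 * 1 <= 2^-1 by near: n; exact: N4.
have h5 : mesh t n.+1 * (4 * L + kap * - Num.min lamW 0 + 2 * kap * L + kap * lamV) <= kap.
  by near: n; exact: N5.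
have h6 : mesh t n.+1 * kap <= 1 by near: n; exact: N6.
have h7 : mesh t n.+1 * ((4 * L + 4 * lamV * kap) * t) <= 1 by near: n; exact: N7.
have hh : 0 < mesh t n.+1 by exact: mesh_gt0.
have hM := meshM t (ltn0Sn n).
have mJ := resolvent_measurable sV lamV0 monV t0 n.
have J_contract a b := resolvent_contract sV lamV0 monV a b hh.
have gr i : 0 <= grid t n.+1 i by rewrite mulr_ge0// ltW.
have nS := nusS n; have n0E := nus0 n.
move: h1 h2 h3 h4 h5 h6 h7 hh hM mJ J_contract nS.
set h := mesh t n.+1; set J := resolvent V h.
move=> h1 h2 h3 h4 h5 h6 h7 hh hM mJ J_contract nS.
rewrite mulr1 in h4.
have hle1 : h <= 1 by lra.
pose Ks i := conv_grad W (u (grid t n.+1 i)).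
have Kok i : field_ok L lamW (Ks i) by exact: (K_ok HMV l0 lipW monW (gr i)).
have mK i : measurable_fun setT (Ks i) by have [] := Kok i.
pose th := 1 - kap * h / 2.
have th0 : 0 <= th by rewrite /th; lra.
have th1 : th < 1 by rewrite /th gtrBl divr_gt0// mulr_gt0.
pose D := 4 * K0 + 128 * d%:R / kap.
(* [D] is preserved by the recursion, hence bounds the variance at all steps, uniformly in time. *)
have twoc i : (twocopy (nus n i) <= D%:E)%E.
  elim: i => [|i IH].
    rewrite n0E; apply: (le_trans (twocopy_le u0_moment)).
    by rewrite lee_fin /D lerDl divr_ge0 ?mulr_ge0// ltW.
  have := twocopy_next hh lamV0 J_contract mJ (Kok i) (nS i)
    (scale_twocopy hh hle1 L0 kap0 h5) th0 IH.
  move=> H; apply: (le_trans H); rewrite lee_fin -/th.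
  have : 64 * d%:R * h <= kap * h / 2 * D.
    rewrite /D mulrDr -[X in X <= _]add0r; apply: lerD.
      apply: mulr_ge0; last by rewrite mulr_ge0.
      by apply: divr_ge0 => //; apply: mulr_ge0; exact: ltW.
    by rewrite le_eqVlt; apply/orP; left; apply/eqP; field; rewrite gt_eqF.
  by rewrite /th; lra.
have Fl i : (i < n.+1)%N -> (\int[prod_power (nus n i) N]_y (fluct (grad W) (Ks i) y)%:E <= fluct_bound%:E)%E.
  move=> ii; have := fluct_mean L0 cW oddW lipW2 (twoc i) N (mK i) (h3 i (ltnW ii)).
  move=> H; apply: (le_trans H); rewrite lee_fin /fluct_bound -/D divfK//.
  by rewrite pnatr_eq0 -lt0n.
have sync (x y : E) K z := scale_sync hh hle1 L0 lamV0 oddW lipW2 monW J_contract kap0 h5 x y K z.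
have syncN (x y : E) z := scale_syncN hh L0 lamV0 oddW lipW2 monW J_contract kap0 x y z.
have Ent' : rel_entropy mu0 (prod_power (nus n 0%N) N) = e%:E by rewrite n0E.
have T2' : T2dual (nus n 0%N) k by rewrite n0E.
have lnI : ln (\int[prod_power (nus n n.+1) N]_x expR (f x)) <= ln I + e1 / 2.
  apply: (@le_trans _ _ (ln (I * expR (e1 / 2)))); last by rewrite lnM ?posrE ?expR_gt0// expRK.
  rewrite ler_ln ?posrE ?mulr_gt0 ?expR_gt0 ?Rint_expR_gt0//; apply: (le_trans h2).
  by rewrite -[X in X + _]mulr1 -mulrDr ler_wpM2l ?(ltW I0)// expR_ge1Dx.
have calk : 0 <= 2 * cal L / k by apply: divr_ge0 (ltW k0); rewrite mulr_ge0// ltW.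
have cbk : 0 <= 1 + 2 * (cb L + 1) / k.
  by apply: addr_ge0 => //; apply: divr_ge0 (ltW k0); rewrite mulr_ge0// addr_ge0.
suff main : \int[mu0]_x iter n.+1 (Top (grad W) J h) f x <=
    ln (\int[prod_power (nus n n.+1) N]_x expR (f x)) +
    (decay_const * expR (- 2 * kap * t) * e + chaos_const).
  by rewrite -/I; move: h1 lnI main; set c1 := decay_const * _ * _; lra.
have [t1|t1] := ltrP t 1.
  have rh : n.+1%:R * h <= 1 by rewrite hM ltW.
  have H := short_time_bound hh L0 lamV0 cW lipW2 J_contract mJ th1 C10 sync Kok nS k0 T2' Ent' bf rh cF0 Fl.
  apply: (le_trans H); rewrite [X in X + _]addrC -addrA lerD2l.
  have a1 : (1 + 2 * (cb L + 1) / k) * e <= decay_const * expR (- 2 * kap * t) * e.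
    apply: ler_wpM2r => //; rewrite /decay_const [X in _ <= X]mulrDl -[X in X <= _]add0r; apply: lerD.
      by rewrite mulr_ge0 ?expR_ge0// mulr_ge0 ?expR_ge0.
    rewrite -[X in _ <= X]mulrA -expRD -[X in X <= _]mulr1; apply: ler_wpM2l => //.
    rewrite -[X in X <= _]expR0 ler_expR.
    have -> : 2 * kap + - 2 * kap * t = 2 * kap * (1 - t) by ring.
    by rewrite mulr_ge0 ?subr_ge0 ?(ltW t1)// mulr_ge0// ltW.
  have a2 : cC L (1 + 2 / kap) * fluct_bound <= chaos_const.
    rewrite /chaos_const; apply: ler_wpM2r => //; rewrite lerDr.
    by rewrite divr_ge0 ?(ltW kap0)// mulr_ge0// mulr_ge0// ltW.
  by apply: lerD.
(* The number of steps in the last unit of time. Since [h] is at most 1/2, these steps last between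
   1/2 and 1. *)
pose r := Num.truncn h^-1.
have hi : 0 <= h^-1 by rewrite invr_ge0 ltW.
have rh : r%:R * h <= 1.
  by rewrite -ler_pdivlMr// div1r; have /andP[] := truncn_itv hi.
have rh2 : 1 <= 2 * (r%:R * h).
  have := truncnS_gt h^-1; rewrite -/r -[r.+1%:R]natr1 -(ltr_pM2r hh) mulVf ?gt_eqF//; lra.
have rn : (r <= n.+1)%N.
  have : r%:R * h <= n.+1%:R * h by rewrite hM; exact: le_trans rh t1.
  by rewrite (ler_pM2r hh) ler_nat.
pose j := (n.+1 - r)%N; have jr : (j + r)%N = n.+1 by exact: subnK.
have H := long_time_bound hh L0 lamV0 cW lipW2 J_contract mJ th0 th1 C10 (expR_gt0 _) sync syncN
  Kok nS k0 T2' Ent' bf uf (j := j) rh rh2 cF0.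
rewrite jr in H; apply: (le_trans (H Fl)); rewrite [X in X + _]addrC -addrA lerD2l.
apply: lerD; last first.
  rewrite /chaos_const; apply: ler_wpM2r => //; rewrite lerD2r le_eqVlt; apply/orP; left; apply/eqP.
  have -> : 1 - th = kap * h / 2 by rewrite /th; ring.
  by field; rewrite !gt_eqF.
apply: ler_wpM2r => //; rewrite /decay_const [X in _ <= X]mulrDl -[X in X <= _]addr0; apply: lerD; last first.
  by rewrite !mulr_ge0 ?expR_ge0.
have -> : 2 * (cal L * expR (- 2 * kap * h + (4 * L + 4 * lamV * kap) * h ^+ 2) ^+ j) / k =
  2 * cal L / k * expR (- 2 * kap * h + (4 * L + 4 * lamV * kap) * h ^+ 2) ^+ j by ring.
rewrite -[X in _ <= X]mulrA; apply: ler_wpM2l => //.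
rewrite -expRM_natl -expRD ler_expR.
have jh : j%:R * h = t - r%:R * h by rewrite /j natrB// mulrBl hM.
have -> : j%:R * (- 2 * kap * h + (4 * L + 4 * lamV * kap) * h ^+ 2) =
  - 2 * kap * (j%:R * h) + h * ((4 * L + 4 * lamV * kap) * (j%:R * h)) by ring.
have C20 : 0 <= 4 * L + 4 * lamV * kap.
  by apply: addr_ge0; rewrite mulr_ge0 ?mulr_ge0// ltW.
have jt : j%:R * h <= t by rewrite jh gerBl mulr_ge0// ltW.
have b1 : h * ((4 * L + 4 * lamV * kap) * (j%:R * h)) <= 1.
  by apply: (le_trans _ h7); rewrite ler_wpM2l ?(ltW hh)// ler_wpM2l.
have b2 : kap * (r%:R * h) <= kap * 1 by rewrite ler_wpM2l// ltW.
by rewrite jh mulrBr; move: b1 b2; rewrite jh; lra.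
Unshelve. all: by end_near. Qed.

End flow_bound.

Lemma log_sobolev_mono (R : realType) d (mu : probability 'rV[R]_d R) c c' : c <= c' ->
  log_sobolev mu c -> log_sobolev mu c'.
Proof.
move=> cc H f sf f0 i1 i2; apply: (le_trans (H f sf f0 i1 i2)).
apply: lee_wpmul2r; last by rewrite lee_fin.
apply: integral_ge0 => x _; rewrite lee_fin; apply: divr_ge0; first exact: sqr_ge0.
exact: ltW (f0 x).
Qed.

Lemma lipschitz_enorm (R : realType) d (f : 'rV[R]_d -> 'rV[R]_d) : lipschitz f ->
  exists2 l, 0 <= l & forall x y, enorm (f x - f y) <= l * enorm (x - y).
Proof.
move=> lf; have [K K0 HK] := pinfty_ex_gt0 lf.
have l0 : 0 <= d.+1%:R * K by rewrite mulr_ge0// ltW.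
exists (d.+1%:R * K) => // x y; apply: enorm_le_sq => //.
have h1 : `|f x - f y| <= K * `|x - y| := HK (x, y) (conj I I).
have h2 : `|f x - f y| ^+ 2 <= K ^+ 2 * sq (x - y).
  apply: (@le_trans _ _ ((K * `|x - y|) ^+ 2)).
    by rewrite lerXn2r ?nnegrE// mulr_ge0// ltW.
  by rewrite exprMn ler_wpM2l ?sqr_ge0// norm_sq_le.
apply: (le_trans (sq_norm_le _)); apply: (@le_trans _ _ (d%:R * (K ^+ 2 * sq (x - y)))).
  by rewrite ler_wpM2l.
rewrite [(_ * K) ^+ 2]exprMn -[X in _ <= X]mulrA; apply: ler_wpM2r.
  by apply: mulr_ge0; [exact: sqr_ge0|exact: sq_ge0].
by rewrite -natrX ler_nat; apply: (@leq_trans d.+1) => //; rewrite -[X in (X <= _)%N]muln1 expnS leq_mul2l expn_gt0.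
Qed.

Unset Implicit Arguments.

Theorem theorem8 (R : realType) (d : nat) (V W : 'rV[R]_d -> R)
    (lamV lamW M : R) (m : nat) (c0 : R)
    (u0 : probability 'rV[R]_d R)
    (uN0 : forall N : nat, probability (N.-tuple 'rV[R]_d) R)
    (H : potential_assumptions V W lamV lamW M m)
    (gradW_lipschitz : lipschitz (grad W))
    (u0_LSI : log_sobolev u0 c0) :
  exists2 Cinit : R, 0 < Cinit &
    forall (u : R -> probability 'rV[R]_d R)
      (uN : forall N : nat, R -> probability (N.-tuple 'rV[R]_d) R),
      mckean_vlasov_flow V W u0 u ->
      (forall N : nat, (1 <= N)%N -> particle_flow V W (uN0 N) (uN N)) ->
      forall (t : R) (N : nat), 0 <= t -> (1 <= N)%N ->
        ((N%:R^-1)%:E * rel_entropy (uN N t) (prod_power (u t) N)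
         <= (Cinit / N%:R)%:E *
            ((expR (- gamma c0 lamV lamW * t))%:E
               * rel_entropy (uN0 N) (prod_power u0 N) + 1))%E.
Proof.
have sV := V_smooth H; have oddW := gradW_odd H; have lV0 := lamV_gt0 H.
have [Kv [p growV]] := gradV_polynomial_growth H.
have monV x y : lamV * sq (x - y) <= dotv (grad V x - grad V y) (x - y).
  by rewrite -sq_enorm; exact: (gradV_monotone H).
have monW x y : lamW * sq (x - y) <= dotv (grad W x - grad W y) (x - y).
  by rewrite -sq_enorm; exact: (gradW_monotone H).
have [l l0 lipW] := lipschitz_enorm gradW_lipschitz.
have cW : continuous (grad W).
  by apply: (lip_continuous (sqr_ge0 l)); exact: lipW_sq.
(* A logarithmic Sobolev inequality persists for larger constants; the maximum with 1 makes the
   constant positive. *)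
pose c := Num.max c0 1; have cpos : 0 < c by rewrite lt_max ltr01 orbT.
pose k := (2 * c)^-1; have k0 : 0 < k by rewrite invr_gt0 mulr_gt0.
have T2 : T2dual u0 k.
  by apply: lsi_T2dual => //; apply: log_sobolev_mono u0_LSI; rewrite le_max lexx.
have [K0 hK0] := T2dual_moment k0 T2.
pose kap := lamV + Num.min lamW 0.
have kap0 : 0 < kap by rewrite /kap /Num.min; have := lamVW_gt0 H; case: (ltrP lamW 0); lra.
(* [kap] coincides with [beta] if [lamW] is nonnegative, and exceeds it by [- lamW] otherwise. *)
have gk : gamma c0 lamV lamW <= 2 * kap.
  rewrite /gamma ge_min; apply/orP; left; rewrite ler_wpM2l// /beta /kap /Num.min.
  by case: (ltrP lamW 0); lra.
have dc1 := decay_const_ge1 l k0 kap0.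
have cc0 := chaos_const_ge0 l hK0 kap0.
set dc := decay_const _ _ _ _ in dc1; set cc := chaos_const _ _ _ _ in cc0.
exists (dc + cc); first by lra.
move=> u uN HM HPs t N t0 N1.
have N0 : 0 < N%:R :> R by rewrite ltr0n.
set ent0 := rel_entropy (uN0 N) _.
have ent0_ge0 : (0 <= ent0)%E.
  have := entropy_ge (uN0 N) (prod_power u0 N) (bmf_cst 0); rewrite Rint_cst.
  rewrite (_ : (fun=> expR 0) = fun=> 1) ?Rint_cst ?ln1 ?subrr//.
  by apply/funext => x; rewrite expR0.
have Cpos : 0 < (dc + cc) / N%:R by rewrite divr_gt0//; lra.
(* If the initial entropy is infinite, so is the right-hand side. *)
case: {2 3}ent0 (erefl ent0) ent0_ge0 => [e| |]// Ee e0; last first.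
  rewrite [in X in (_ <= X)%E]Ee gt0_muley ?lte_fin ?expR_gt0// addye// gt0_muley ?lte_fin//.
  exact: leey.
have main : (rel_entropy (uN N t) (prod_power (u t) N) <=
    (dc * expR (- 2 * kap * t) * e + cc)%:E)%E.
  (* [flow_bound] needs a positive time. At time 0 both laws are the initial ones, so the
     variational inequality for the initial entropy suffices, [dc] being at least 1. *)
  apply: entropy_le_ucont => f bf uf; move: t0; rewrite le_eqVlt => /orP[/eqP t0|t0]; last first.
    apply: (flow_bound sV (ltW lV0) l0 monV cW oddW lipW monW growV k0 T2 hK0 kap0 N1 t0 Ee HM) => //.
    have [dO [Om [P [B [X [h1 h2 h3]]]]]] := HPs N N1.
    by exists dO, Om, P, B, X; split => //; apply: h3; exact: ltW.
  have [dO [Om [P [B [X [_ h2 h3]]]]]] := HPs N N1.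
  have [dO' [Om' [P' [B' [X' [h4 h5]]]]]] := HM.
  rewrite -t0 (has_law_Rint (h3 0 (lexx 0)) bf) -(has_law_Rint h2 bf).
  have bef := bmf_expR bf; have h6 := mv_law h4 (lexx 0).
  rewrite (has_law_Rint (has_law_map N h6) bef) -(has_law_Rint (has_law_map N h5) bef).
  have := entropy_ge (uN0 N) (prod_power u0 N) bf; rewrite -/ent0 Ee lee_fin mulr0 expR0 mulr1.
  have : 1 * e <= dc * e by rewrite ler_wpM2r.
  by lra.
rewrite [in X in (_ <= X)%E]Ee.
apply: (@le_trans _ _ ((N%:R^-1)%:E * (dc * expR (- 2 * kap * t) * e + cc)%:E)%E).
  by apply: lee_wpmul2l => //; rewrite lee_fin invr_ge0 ltW.
have -> : (((dc + cc) / N%:R)%:E * ((expR (- gamma c0 lamV lamW * t))%:E * e%:E + 1) =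
  ((dc + cc) / N%:R * (expR (- gamma c0 lamV lamW * t) * e + 1))%:E)%E by [].
rewrite -EFinM lee_fin [X in _ <= X]mulrAC [X in X <= _]mulrC.
apply: ler_wpM2r; first by rewrite invr_ge0 ltW.
rewrite lee_fin in e0.
have ge : expR (- 2 * kap * t) <= expR (- gamma c0 lamV lamW * t).
  by rewrite ler_expR ler_wpM2r//; lra.
have g0 := expR_ge0 (- gamma c0 lamV lamW * t).
have h1 : dc * expR (- 2 * kap * t) * e <= dc * (expR (- gamma c0 lamV lamW * t) * e).
  by rewrite mulrA ler_wpM2r// ler_wpM2l//; lra.
have h2 : 0 <= cc * (expR (- gamma c0 lamV lamW * t) * e) by rewrite mulr_ge0// mulr_ge0.
by lra.
Qed.
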